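(* Let $W$ be a Weyl group acting as a reflection group on $V=\mathbb{R}^\ell$, let $\Phi\subseteq V^*$ be a (reduced) root system for $W$ with positive system $\Phi^+$, let $k\in\mathbb{Z}_{>0}$, and let $\mathcal{I}\subseteq\Phi^+$ be an ideal. Then the extended Shi arrangement $\mathrm{Shi}^k$, the ideal-Shi arrangement $\mathrm{Shi}^k_{\mathcal{I}}$ and the extended Catalan arrangement $\mathrm{Cat}^k$ are accurate.
   Context: Let $\Delta\subseteq\Phi^+$ be the simple roots. The partial order on $\Phi^+$ is $\beta\le\gamma$ iff $\gamma-\beta\in\sum_{\alpha\in\Delta}\mathbb{Z}_{\ge0}\alpha$; an ideal of $\Phi^+$ is a lower order ideal. Embed $V$ in $V'=\mathbb{R}^{\ell+1}$, let $z\in(V')^*$ be the $(\ell+1)$st coordinate, so $V=\ker z=:H_z$, and view roots as linear forms on $V'$ independent of the last coordinate. For $\alpha\in\Phi^+$, $j\in\mathbb{Z}$ put $H_\alpha^j=\ker(\alpha-jz)\subset V'$. Define the following arrangements in $V'$: $\mathrm{Shi}^k=\{H_\alpha^j\mid\alpha\in\Phi^+,\,-k+1\le j\le k\}\cup\{H_z\}$, $\mathrm{Shi}^k_{\mathcal{I}}=\mathrm{Shi}^k\cup\{H_\beta^{-k}\mid\beta\in\mathcal{I}\}$, $\mathrm{Cat}^k=\mathrm{Shi}^k_{\Phi^+}$. For an arrangement $\mathscr{A}$ (finite set of linear hyperplanes) in $U\cong\mathbb{K}^m$ ($\mathbb{K}=\mathbb{R}$ or $\mathbb{C}$) and an intersection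 $X$ of hyperplanes from $\mathscr{A}$ (the empty intersection is $U$), the restriction is $\mathscr{A}^X=\{H\cap X\mid H\in\mathscr{A},H\not\supseteq X\}$, an arrangement in $X$. Let $S=\mathrm{Sym}(U^* )\cong\mathbb{K}[x_1,\dots,x_m]$ and $H=\ker\alpha_H$. $D(\mathscr{A})=\{\theta\in\mathrm{Der}_{\mathbb{K}}(S)\mid\theta(\alpha_H)\in\alpha_HS\text{ for all }H\in\mathscr{A}\}$. $\theta=\sum f_i\,\partial/\partial x_i$ is homogeneous of degree $p$ if all $f_i$ are homogeneous of degree $p$ (or zero). $\mathscr{A}$ is free if $D(\mathscr{A})$ is a free $S$-module; its exponents are the degrees of a homogeneous basis of $D(\mathscr{A})$. Accurate: $\mathscr{A}$ is free with exponents $e_1\le e_2\le\dots\le e_m$, and for every $1\le d\le m$ there is an intersection $X$ of hyperplanes from $\mathscr{A}$ with $\dim X=d$ such that $\mathscr{A}^X$ is free with exponents $e_1\le\dots\le e_d$. *)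

(* Defs.v *)
From HB Require Import structures.
From mathcomp Require Import all_boot all_order all_algebra.
From mathcomp Require Import finmap.
From mathcomp Require Import mpoly.
From mathcomp Require Import reals zify.

Set Implicit Arguments.
Unset Strict Implicit.
Unset Printing Implicit Defensive.

Import Order.TTheory GRing.Theory Num.Theory.
Local Open Scope fset_scope.
Local Open Scope ring_scope.

Section Arrangements.
Variable K : fieldType.

(* symalg U is Sym(U^* ), written in the coordinates of U in the basis
   vbasis {:U}; the notions below do not depend on this choice. The row (f_i)
   in der U stands for the derivation \sum_i f_i d/dx_i of symalg U. *)
Local Notation symalg U := {mpoly K[\dim {:U}]}.
Local Notation der U := 'rV[{mpoly K[\dim {:U}]}]_(\dim {:U}).

Definition form_poly (U : vectType K) (a : 'Hom(U, K^o)) : symalg U :=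
  \sum_(i < \dim {:U}) (a (vbasis {:U})`_i : K) *: 'X_i.

Definition der_apply (U : vectType K) (theta : der U) (p : symalg U) :
  symalg U := \sum_(i < \dim {:U}) theta 0 i * mderiv i p.

Definition der_homog (U : vectType K) (p : nat) (theta : der U) : Prop :=
  forall i, theta 0 i \is p.-homog.

(* An arrangement in U is a term A : {fset {vspace U}} whose elements all have
   codimension 1. The form alpha_H is unique up to a nonzero scalar, so
   quantifying over all forms with kernel H amounts to choosing one. *)
Definition is_arrangement (U : vectType K) (A : {fset {vspace U}}) : Prop :=
  forall H, H \in A -> (\dim H).+1 = \dim {:U}.

Definition logder (U : vectType K) (A : {fset {vspace U}}) (theta : der U) :
    Prop :=
  forall (H : {vspace U}) (a : 'Hom(U, K^o)), H \in A -> lker a = H ->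
    exists g : symalg U, der_apply theta (form_poly a) = form_poly a * g.

Definition logder_basis (U : vectType K) (A : {fset {vspace U}}) (n : nat)
    (B : 'I_n -> der U) : Prop :=
  [/\ forall i, logder A (B i),
      forall theta, logder A theta ->
        exists c : 'I_n -> symalg U, theta = \sum_(i < n) c i *: B i
    & forall c : 'I_n -> symalg U,
        \sum_(i < n) c i *: B i = 0 -> forall i, c i = 0].

Definition free_with_exponents (U : vectType K) (A : {fset {vspace U}})
    (e : seq nat) : Prop :=
  exists2 B : 'I_(size e) -> der U,
    logder_basis A B & forall i : 'I_(size e), der_homog (nth 0%N e i) (B i).

Definition intersection (U : vectType K) (A : {fset {vspace U}})
    (X : {vspace U}) : Prop :=
  exists2 B : {fset {vspace U}}, B `<=` A & X = (\bigcap_(H <- B) H)%VS.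

(* Restrictions live in X seen as a vector space of its own; the preimage of H
   under the inclusion of X in U is H :&: X. *)
Definition restriction (U : vectType K) (A : {fset {vspace U}})
    (X : {vspace U}) : {fset {vspace (subvs_of X)}} :=
  [fset (linfun (vsval : subvs_of X -> U) @^-1: H)%VS
     | H in A & ~~ (X <= H)%VS].

Definition accurate (U : vectType K) (A : {fset {vspace U}}) : Prop :=
  exists e : seq nat,
    [/\ size e = \dim {:U}, sorted leq e, free_with_exponents A e
      & forall d, (1 <= d <= \dim {:U})%N ->
          exists X : {vspace U},
            [/\ intersection A X, \dim X = d
              & free_with_exponents (restriction A X) (take d e)]].

Lemma dim_lker_form (U : vectType K) (a : 'Hom(U, K^o)) :
  a != 0 -> (\dim (lker a)).+1 = \dim {:U}.
Proof.
move=> a0; have := limg_ker_dim a fullv; rewrite capfv => <-.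
suff -> : \dim (limg a) = 1%N by rewrite addn1.
apply/eqP; rewrite eqn_leq; apply/andP; split.
  by apply: leq_trans (dimvS (subvf _)) _; rewrite dimvf.
rewrite lt0n dimv_eq0; apply: contra a0 => /eqP h.
apply/eqP/lfunP => u; rewrite lfunE /=.
by apply/eqP; rewrite -memv0 -h memv_img ?memvf.
Qed.

Lemma mem_restriction (U : vectType K) (X H : {vspace U})
    (u : subvs_of X) :
  (u \in (linfun (vsval : subvs_of X -> U) @^-1: H)%VS) = (vsval u \in H).
Proof. by rewrite -memv_preim lfunE. Qed.

Lemma restriction_arrangement (U : vectType K)
    (A : {fset {vspace U}}) (X : {vspace U}) :
  is_arrangement A -> is_arrangement (restriction A X).
Proof.
move=> hA Y /imfsetP[H /= /andP[HA XH] ->].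
set f := linfun _.
have fE u : f u = vsval u by rewrite lfunE.
have kf : lker f == 0%VS.
  by apply/lker0P => u v; rewrite !fE; apply: val_inj.
have im : limg f = X.
  apply/eqP; rewrite eqEsubv; apply/andP; split.
    by apply/subvP => v /memv_imgP[u _ ->]; rewrite fE subvsP.
  apply/subvP => v vX; apply/memv_imgP; exists (vsproj X v); first exact: memvf.
  by rewrite fE vsprojK.
rewrite -lpreim_cap_limg im dimvf /= -/(dimv X).
have -> : \dim (f @^-1: (H :&: X)) = \dim (H :&: X).
  rewrite -[in RHS](lpreimK (f := f) (W := (H :&: X)%VS)) ?im ?capvSr //.
  by rewrite limg_dim_eq // (eqP kf) capv0.
have hS : (H + X)%VS = fullv.
  have HS : (H <= H + X)%VS by exact: addvSl.
  apply/eqP; rewrite -(dimv_leqif_eq (subvf _)).2 eqn_leq dimvS ?subvf //=.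
  rewrite -(hA _ HA) ltn_neqAle (dimvS HS) andbT (dimv_leqif_eq HS).2.
  apply: contra XH => /eqP ->; exact: addvSr.
have := dimv_sum_cap H X; rewrite hS -(hA _ HA) addSn -addnS.
by move/addnI => ->.
Qed.

End Arrangements.

Section RootSystems.
Variables (R : realType) (l : nat).

Local Notation V := 'rV[R]_l.
Local Notation V' := 'rV[R]_(l + 1).
Implicit Types (Phi P I : {fset 'Hom(V, R^o)}) (a b : 'Hom(V, R^o)) (c v : V).

Definition coroot Phi a c : Prop :=
  (a c : R) = 2 /\ {in Phi, forall b, b - (b c : R) *: a \in Phi}.

Definition reduced_root_system Phi : Prop :=
  [/\ <<Phi>>%VS = fullv,
      0 \notin Phi,
      {in Phi, forall a, exists2 c, coroot Phi a c
                           & {in Phi, forall b, (b c : R) \is a Num.int}}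
    & {in Phi, forall a (t : R), t *: a \in Phi -> t = 1 \/ t = -1}].

Definition reflection a c : 'End(V) := linfun (fun v => v - (a v : R) *: c).

(* Reflections are involutions, so the monoid they generate is a group. *)
Inductive weyl_group Phi : 'End(V) -> Prop :=
| weyl_group1 : weyl_group Phi \1%VF
| weyl_groupM a c w : a \in Phi -> coroot Phi a c -> weyl_group Phi w ->
    weyl_group Phi (reflection a c \o w)%VF.

(* The positive roots are those positive on a Weyl chamber, given by one of
   its points v. *)
Definition positive_system Phi P : Prop :=
  exists2 v : V, {in Phi, forall a, (a v : R) != 0}
    & P = [fset a in Phi | 0 < (a v : R)].

Definition simple_roots P : {fset 'Hom(V, R^o)} :=
  [fset a in P | a \notin [fset b + c | b in P, c in P]].

Definition root_le P (b g : 'Hom(V, R^o)) : Prop :=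
  exists n : 'Hom(V, R^o) -> nat, g - b = \sum_(a <- simple_roots P) a *+ n a.

Definition root_ideal P I : Prop :=
  I `<=` P /\ {in I & P, forall b g, root_le P g b -> g \in I}.

(* V' = V x R, the roots being pulled back along the projection to V. *)
Definition zform : 'Hom(V', R^o) :=
  linfun (fun v : V' => v 0 (rshift l 0) : R^o).

Definition lift_form a : 'Hom(V', R^o) := (a \o linfun (@lsubmx R 1 l 1))%VF.

Definition Hz : {vspace V'} := lker zform.

Definition Hyp a (j : int) : {vspace V'} :=
  lker (lift_form a - (j%:~R : R) *: zform).

(* j = k - i with 0 <= i < 2k runs through -k+1 <= j <= k. *)
Definition Shi (k : nat) P : {fset {vspace V'}} :=
  [fset Hyp a j | a in P, j in [seq k%:Z - i%:Z | i <- iota 0 k.*2]]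
  `|` [fset Hz].

Definition idealShi (k : nat) P I : {fset {vspace V'}} :=
  Shi k P `|` [fset Hyp b (- k%:Z) | b in I].

Definition Cat (k : nat) P : {fset {vspace V'}} := idealShi k P P.

Lemma zformE (v : V') : (zform v : R) = v 0 (rshift l 0).
Proof.
have zl : linear (fun v : V' => v 0 (rshift l 0) : R^o).
  by move=> x u w; rewrite !mxE.
pose zL := GRing.isLinear.Build _ _ _ _ _ zl.
pose Z : {linear V' -> R^o} :=
  HB.pack (fun v : V' => v 0 (rshift l 0) : R^o) zL.
by rewrite /zform (lfunE Z).
Qed.

Lemma mem_Hyp a (j : int) (v : V') :
  (v \in Hyp a j) = ((a (lsubmx v) : R) == j%:~R * v 0 (rshift l 0)).
Proof.
rewrite memv_ker add_lfunE opp_lfunE scale_lfunE comp_lfunE lfunE.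
by rewrite zformE subr_eq0.
Qed.

Lemma mem_Shi (k : nat) P (H : {vspace V'}) :
  H \in Shi k P <->
  (exists a (j : int),
     [/\ a \in P, - k%:Z + 1 <= j, j <= k%:Z & H = Hyp a j]) \/ H = Hz.
Proof.
rewrite in_fsetU in_fset1; split.
  case/orP=> [/imfset2P[/= a aP [j /= /mapP[i]]]|/eqP ->]; last by right.
  rewrite mem_iota => /andP[_ ik] -> ->; left; exists a, (k%:Z - i%:Z); split => //;
   by move: ik; rewrite -addnn; lia.
case=> [[a [j [aP j1 j2 ->]]]|->]; last by rewrite eqxx orbT.
apply/orP; left; apply/imfset2P; exists a => //; exists j => //=.
apply/mapP; exists `|k%:Z - j|%N; last by lia.
by rewrite mem_iota -addnn; lia.
Qed.

Lemma idealShi_arrangement (k : nat) P I :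
  0 \notin P -> I `<=` P -> is_arrangement (idealShi k P I).
Proof.
move=> P0 IP.
have hz : (\dim Hz).+1 = \dim {: V'}.
  apply: dim_lker_form; apply/eqP => z0.
  have := zformE (row_mx 0 (const_mx 1)).
  rewrite z0 lfunE row_mxEr mxE => /esym/eqP.
  by rewrite oner_eq0.
have hyp a j : a \in P -> (\dim (Hyp a j)).+1 = \dim {: V'}.
  move=> aP; apply: dim_lker_form; apply: contra P0 => /eqP f0.
  suff <- : a = 0 by [].
  apply/lfunP => v; rewrite [RHS]lfunE /=.
  have : row_mx v 0 \in Hyp a j by rewrite /Hyp f0 memv_ker lfunE.
  by rewrite mem_Hyp row_mxKl row_mxEr mxE mulr0 => /eqP.
move=> H; rewrite in_fsetU => /orP[/mem_Shi[[a [j [aP _ _ ->]]]|->]|] //.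
  exact: hyp.
by case/imfsetP => b /= /(fsubsetP IP) bP ->; apply: hyp.
Qed.

End RootSystems.

(* Submission.v *)
(* Derivations killing z are written as vectors of polynomials, the i-th entry
   being the value at the i-th simple root.  Let the system be irreducible with
   Coxeter number h and exponents e_i.  The key estimate is that theta(a)
   restricted to a hyperplane a = j z is divisible by a polynomial of large,
   explicitly known degree, coming from the rank two subsystems through a; hence
   adding one hyperplane costs few dimensions in each degree.

   Start from a basis of degrees (k-1) h + e_i for Cat^(k-1).  A dimension count
   using the duality e_i + e_(l+1-i) = h gives for every simple root a_i a
   derivation eta_i of degree k h - 1 for Shi^k without a_i = k z.  The products
   (a_i - k z) eta_i are a basis for Shi^k: modulo z they are independent because
   Dunkl operators show that the derivations theta with a^(2k) | theta(a) for all
   roots a start in degree k h, where they form a copy of the reflection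
   representation.  The duality follows from evaluating a basis for Cat^0 at an
   eigenvector of a Coxeter element.

   The hyperplanes b = - k z are then added by increasing height of b.  At each
   height the residues at the new hyperplanes are constant multiples of fixed
   polynomials, so linear algebra raises the degree of exactly as many basis
   elements of top degree as there are new roots.  The i-th element of the basis
   for Shi^k vanishes on a_i = k z, and at each height the raised elements can be
   chosen so that, for every t, t elements of largest degree vanish on a flat of
   codimension t.  By Saito's criterion the other elements restrict to a basis
   for the restriction to this flat. *)
Require Import Defs.
From HB Require Import structures.
From mathcomp Require Import all_boot all_order all_algebra.
From mathcomp Require Import finmap.
From mathcomp Require Import reals boolp zify ring lra.

Set Implicit Arguments.
Unset Strict Implicit.
Unset Printing Implicit Defensive.

Import Order.TTheory GRing.Theory Num.Theory.
Local Open Scope ring_scope.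

(** Affine roots [(g, j)], standing for [g - j z], are ordered by the number [g(xi) - M j] with [M]
    large. On the affine roots through a flat of codimension two not inside [z = 0], this is again
    the functional of a positive system. So one estimate serves for adding the hyperplanes
    [b = - k z] by increasing height and for adding [b = (k + 1) z] by decreasing height.

    Irreducibility enters only where an operator must be scalar or an invariant subspace trivial:
    the Coxeter number, the positivity of the Perron vector, the Dunkl argument. In a reducible
    system the degrees of the components interleave, so the largest degrees of the whole distribute
    over the components in numbers not known beforehand. Hence the ladder has to offer, for every
    [t] separately, a basis in which [t] elements of largest degree vanish on a flat of codimension
    [t]; these bases may vary with [t], only their degrees agree.

    The hyperplane [z = 0] is left aside to the end, where the Euler derivation is adjoined; that
    derivation survives in every restriction. *)

Module Rayleigh.
From mathcomp Require Import boolp classical_sets topology normedtype derive.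
Import numFieldNormedType.Exports.
Local Open Scope classical_set_scope.

(** * Maximum of a quotient of quadratic forms *)

Section R.
Variables (R : realType) (l : nat).

Lemma continuous_bigsum (T : topologicalType) (I : Type) (r : seq I) (f : I -> T -> R) :
  (forall i, continuous (f i)) -> continuous (fun x => \sum_(i <- r) f i x).
Proof.
move=> h; elim: r => [|i r IH] x.
  by rewrite (_ : (fun _ => _) = fun=> 0); [exact: cvg_cst | apply/funext => y; rewrite big_nil].
rewrite (_ : (fun _ => _) = (fun y => f i y + \sum_(j <- r) f j y)); last by apply/funext => y; rewrite big_cons.
by apply: cvgD; [exact: h | exact: IH].
Qed.

Lemma quad_continuous (A : 'M[R]_l.+1) : continuous (fun x : 'rV[R]_l.+1 => (x *m A *m x^T) 0 0).
Proof.
have -> : (fun x : 'rV[R]_l.+1 => (x *m A *m x^T) 0 0) = (fun x => \sum_i \sum_j A i j * x 0 i * x 0 j).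
  apply/funext => x; rewrite mxE; under eq_bigr do rewrite mxE mulr_suml.
  rewrite exchange_big; apply: eq_bigr => i _; apply: eq_bigr => j _ /=.
  by rewrite !mxE; ring.
apply: continuous_bigsum => i; apply: continuous_bigsum => j x.
apply: (@continuousM _ _ (fun y : 'rV[R]_l.+1 => A i j * y 0 i) (fun y => y 0 j)); last exact: coord_continuous.
apply: (@continuousM _ _ (fun=> A i j) (fun y : 'rV[R]_l.+1 => y 0 i)); last exact: coord_continuous.
exact: cst_continuous.
Qed.

(** The quotient of the two forms is invariant under scaling, so its maximum over the compact unit
    sphere bounds it everywhere. The sphere is that of the norm carried by row vectors; any norm
    would serve. *)
Lemma rayleigh_max (A G : 'M[R]_l.+1) : (forall x : 'rV[R]_l.+1, x != 0 -> 0 < (x *m G *m x^T) 0 0) ->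
  exists v : 'rV[R]_l.+1, exists2 lam, v != 0 & (v *m A *m v^T) 0 0 = lam * (v *m G *m v^T) 0 0 /\
    forall x : 'rV[R]_l.+1, (x *m A *m x^T) 0 0 <= lam * (x *m G *m x^T) 0 0.
Proof.
move=> hG; pose q (M : 'M[R]_l.+1) (x : 'rV[R]_l.+1) := (x *m M *m x^T) 0 0.
have qZ M t x : q M (t *: x) = t ^+ 2 * q M x.
  by rewrite /q linearZ /= -scalemxAl -scalemxAl -scalemxAr scalerA mxE.
pose K : set 'rV[R]_l.+1 := [set x | `|x| = 1].
have K0 x : K x -> x != 0.
  by move=> Kx; apply/eqP => x0; move: Kx; rewrite /K /= x0 normr0 => /esym/eqP; rewrite oner_eq0.
have Kn (x : 'rV[R]_l.+1) : x != 0 -> K (`|x|^-1 *: x).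
  by move=> x0; rewrite /K /= normrZ normfV normr_id mulVf // normr_eq0.
have cK : compact K.
  apply: bounded_closed_compact.
    exists 1; split; first exact: num_real.
    by move=> M M1 x Kx; rewrite /= Kx ltW.
  rewrite (_ : K = (fun x : 'rV[R]_l.+1 => `|x|) @^-1` [set 1]); last by [].
  by apply: closed_comp; [move=> x _; apply: norm_continuous | apply: closed_eq].
have [||v vK hv] := @EVT_max_rV R l.+1 (fun x => q A x / q G x) K _ cK.
- exists (`|const_mx 1 : 'rV[R]_l.+1|^-1 *: const_mx 1); apply: Kn.
  by apply/eqP => /rowP/(_ 0); rewrite !mxE => /eqP; rewrite oner_eq0.
- apply: continuous_in_subspaceT => x; rewrite inE => Kx.
  apply: (@continuousM _ _ (q A) (fun y => (q G y)^-1)); first exact: quad_continuous.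
  by apply: continuousV; [rewrite gt_eqF // hG // K0 | exact: quad_continuous].
move: vK; rewrite inE => vK; have v0 := K0 _ vK.
exists v, (q A v / q G v) => //; split; first by rewrite divfK // gt_eqF // hG.
move=> x; case: (eqVneq x 0) => [->|x0]; first by rewrite !mul0mx mxE mulr0.
have n0 : `|x| != 0 by rewrite normr_eq0.
have := hv (`|x|^-1 *: x); rewrite inE => /(_ (Kn _ x0)); rewrite !qZ.
have -> : `|x|^-1 ^+ 2 * q A x / (`|x|^-1 ^+ 2 * q G x) = q A x / q G x.
  by rewrite -mulf_div mulfV ?mul1r // expf_neq0 // invr_eq0.
by rewrite ler_pdivrMr // hG.
Qed.

End R.
End Rayleigh.

From mathcomp Require Import mpoly.

(** * Divisibility and coprimality of polynomials *)

Section Divisibility.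
Variables (F : fieldType) (n : nat).
Local Notation S := {mpoly F[n]}.
Implicit Types (f g p q : S).

Definition mdvd f p := exists q, p = f * q.
(** Says that [g] is a non-zero-divisor modulo [f]. This one-sided coprimality passes to products in
    both arguments, so coprime divisors can be multiplied together without unique factorization. *)
Definition mcop f g := forall p, mdvd f (g * p) -> mdvd f p.

Lemma mdvd_refl f : mdvd f f.
Proof. by exists 1; rewrite mulr1. Qed.
Lemma mdvd0 f : mdvd f 0.
Proof. by exists 0; rewrite mulr0. Qed.
Lemma mdvd1 f : mdvd 1 f.
Proof. by exists f; rewrite mul1r. Qed.
Lemma mdvdD f p q : mdvd f p -> mdvd f q -> mdvd f (p + q).
Proof. by move=> [u ->] [v ->]; exists (u + v); rewrite mulrDr. Qed.
Lemma mdvdN f p : mdvd f p -> mdvd f (- p).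
Proof. by move=> [u ->]; exists (- u); rewrite mulrN. Qed.
Lemma mdvdB f p q : mdvd f p -> mdvd f q -> mdvd f (p - q).
Proof. by move=> hp /mdvdN; apply: mdvdD. Qed.
Lemma mdvdMr f p q : mdvd f p -> mdvd f (p * q).
Proof. by move=> [u ->]; exists (u * q); rewrite mulrA. Qed.
Lemma mdvdMl f p q : mdvd f q -> mdvd f (p * q).
Proof. by rewrite mulrC; apply: mdvdMr. Qed.
Lemma mdvdZ f (c : F) p : mdvd f p -> mdvd f (c *: p).
Proof. by move=> [u ->]; exists (c *: u); rewrite scalerAr. Qed.
Lemma mdvd_sum (I : Type) (r : seq I) (P : pred I) (E : I -> S) f :
  (forall i, P i -> mdvd f (E i)) -> mdvd f (\sum_(i <- r | P i) E i).
Proof.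
by move=> h; elim/big_ind: _ => //; [exact: mdvd0 | exact: mdvdD].
Qed.
Lemma mdvd_trans g f p : mdvd f g -> mdvd g p -> mdvd f p.
Proof. by move=> [u ->] [v ->]; exists (u * v); rewrite mulrA. Qed.
Lemma mdvd_mul f g p q : mdvd f p -> mdvd g q -> mdvd (f * g) (p * q).
Proof. by move=> [u ->] [v ->]; exists (u * v); rewrite mulrACA. Qed.
Lemma mdvd_expl f p m m' : (m <= m')%N -> mdvd (f ^+ m') p -> mdvd (f ^+ m) p.
Proof.
move=> le; apply: mdvd_trans; exists (f ^+ (m' - m)).
by rewrite -exprD subnKC.
Qed.
Lemma mdvd_Zl f (c : F) p : c != 0 -> mdvd f p -> mdvd (c *: f) p.
Proof.
move=> c0 [u ->]; exists (c^-1 *: u).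
by rewrite -scalerAl -scalerAr scalerA mulfV // scale1r.
Qed.
Lemma mdvd_cancel f g p : g != 0 -> mdvd (g * f) (g * p) -> mdvd f p.
Proof. by move=> g0 [u]; rewrite -mulrA => /(mulfI g0) ->; exists u. Qed.

Lemma mcop1 f : mcop f 1.
Proof. by move=> p; rewrite mul1r. Qed.
Lemma mcopMr f g h : mcop f g -> mcop f h -> mcop f (g * h).
Proof. by move=> fg fh p; rewrite -mulrA => /fg /fh. Qed.
Lemma mcopMl f f' g : f != 0 -> mcop f g -> mcop f' g -> mcop (f * f') g.
Proof.
move=> f0 fg fg' p [u e].
have [p1 ep] : mdvd f p by apply: fg; rewrite e; exists (f' * u); rewrite mulrA.
subst p; apply: mdvd_mul (mdvd_refl _) _; apply: fg'; exists u.
by apply: (mulfI f0); rewrite mulrCA e mulrA.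
Qed.
Lemma mcop_expl f g m : f != 0 -> mcop f g -> mcop (f ^+ m) g.
Proof.
move=> f0 fg; elim: m => [|m IH]; first by move=> p _; apply: mdvd1.
by rewrite exprS; apply: mcopMl.
Qed.
Lemma mcop_expr f g m : mcop f g -> mcop f (g ^+ m).
Proof.
move=> fg; elim: m => [|m IH]; first exact: mcop1.
by rewrite exprS; apply: mcopMr.
Qed.
Lemma mcop_mul f g p : mcop f g -> mdvd f p -> mdvd g p -> mdvd (f * g) p.
Proof. by move=> fg hf [u e]; subst p; move: hf => /fg[v ->]; exists v; rewrite mulrCA mulrA. Qed.

Lemma mcop_prodr (I : eqType) (r : seq I) (E : I -> S) f :
  (forall i, i \in r -> mcop f (E i)) -> mcop f (\prod_(i <- r) E i).
Proof.
elim: r => [|i r IH] h; first by rewrite big_nil; apply: mcop1.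
rewrite big_cons; apply: mcopMr; first by apply: h; rewrite mem_head.
by apply: IH => j jr; apply: h; rewrite in_cons jr orbT.
Qed.

Lemma mdvd_prod (I : eqType) (r : seq I) (E : I -> S) p :
  uniq r -> (forall i, i \in r -> mdvd (E i) p) ->
  {in r &, forall i j, i != j -> mcop (E i) (E j)} ->
  mdvd (\prod_(i <- r) E i) p.
Proof.
elim: r p => [|i r IH] p; first by rewrite big_nil => _ _ _; apply: mdvd1.
rewrite big_cons /= => /andP[ir ur] hd hc; apply: mcop_mul.
- apply: mcop_prodr => j jr; apply: hc; rewrite ?mem_head ?in_cons ?jr ?orbT //.
  by apply: contraNneq ir => ->.
- by apply: hd; rewrite mem_head.
apply: IH => // [j jr|j j' jr jr']; first by apply: hd; rewrite in_cons jr orbT.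
by apply: hc; rewrite in_cons ?jr ?jr' orbT.
Qed.

End Divisibility.

Section Substitution.
Variables (F : fieldType) (n k : nat).

Lemma mdvd_comp_sub (t t' : n.-tuple {mpoly F[k]}) g (p : {mpoly F[n]}) :
  (forall j : 'I_n, mdvd g (tnth t j - tnth t' j)) ->
  mdvd g ((p \mPo t) - (p \mPo t')).
Proof.
have telescope (a b c d : {mpoly F[k]}) :
  a * b - c * d = (a - c) * b + c * (b - d) by ring.
move=> h; rewrite !(comp_mpolyEX p) -sumrB; apply: mdvd_sum => m _.
rewrite -scalerBr; apply: mdvdZ; rewrite !comp_mpolyX.
elim/big_ind2: _ => [|x1 x2 y1 y2 e1 e2|i _].
- by rewrite subrr; apply: mdvd0.
- rewrite telescope.
  by apply: mdvdD; [apply: mdvdMr | apply: mdvdMl].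
by rewrite subrXX; apply: mdvdMr.
Qed.

End Substitution.

(** * Linear forms as prime elements *)

Section LinearForms.
Variables (F : fieldType) (n : nat).
Local Notation S := {mpoly F[n]}.
Implicit Types (a b : 'rV[F]_n) (p q : S).

Definition lf a : S := \sum_i a 0 i *: 'X_i.

Lemma lf_coef a i : (lf a)@_(U_(i)) = a 0 i.
Proof.
rewrite /lf raddf_sum /= (bigD1 i) //= mcoeffZ mcoeffX eqxx mulr1 big1 ?addr0 //.
by move=> j ji; rewrite mcoeffZ mcoeffX eq_mnm1 (negbTE ji) mulr0.
Qed.
Lemma lf_inj : injective lf.
Proof. by move=> a b e; apply/rowP => i; rewrite -!lf_coef e. Qed.
Lemma lf_is_linear : linear lf.
Proof.
move=> c a b; rewrite /lf scaler_sumr -big_split; apply: eq_bigr => i _ /=.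
by rewrite !mxE scalerDl scalerA.
Qed.
HB.instance Definition _ := GRing.isLinear.Build F 'rV[F]_n S _ lf lf_is_linear.
Lemma lf_eq0 a : (lf a == 0) = (a == 0).
Proof. by rewrite -(inj_eq lf_inj) linear0. Qed.
Lemma lf_delta i : lf (delta_mx 0 i) = 'X_i.
Proof.
rewrite /lf (bigD1 i) //= mxE !eqxx scale1r big1 ?addr0 // => j ji.
by rewrite mxE (negbTE ji) andbF scale0r.
Qed.
Lemma lf_homog a : lf a \is 1.-homog.
Proof.
by apply: rpred_sum => i _; apply: rpredZ; rewrite dhomogX /= mdeg1.
Qed.
Lemma meval_lf a (v : 'I_n -> F) : (lf a).@[v] = \sum_i a 0 i * v i.
Proof.
rewrite /lf raddf_sum; apply: eq_bigr => i _ /=.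
by rewrite mevalZ mevalXU.
Qed.
Lemma comp_lf k a (t : n.-tuple {mpoly F[k]}) :
  lf a \mPo t = \sum_i a 0 i *: tnth t i.
Proof.
rewrite /lf raddf_sum; apply: eq_bigr => i _ /=.
by rewrite comp_mpolyZ comp_mpolyXU -tnth_nth.
Qed.

(* Elimination of the variable i along the hyperplane lf a = 0. *)
Definition elim_tuple a i : n.-tuple S :=
  [tuple if j == i then 'X_i - (a 0 i)^-1 *: lf a else 'X_j | j < n].

(** The elimination is a ring morphism that changes each polynomial by a multiple of [lf a] and
    kills [lf a]. Its kernel is therefore the ideal of [lf a]; as it maps into a domain, [lf a] is
    prime. *)
Lemma lf_dvdP a i p : a 0 i != 0 -> mdvd (lf a) p <-> p \mPo elim_tuple a i = 0.
Proof.
move=> ai; split=> [[q ->]|h].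
  rewrite rmorphM /= comp_lf; set s := \sum_i _; suff -> : s = 0 by rewrite mul0r.
  rewrite /s (eq_bigr (fun j => a 0 j *: 'X_j - (j == i)%:R *: lf a)).
    rewrite sumrB -/(lf a) (bigD1 i) //= eqxx scale1r big1 ?addr0 ?subrr //.
    by move=> j ji; rewrite (negbTE ji) scale0r.
  move=> j _; rewrite tnth_mktuple; case: eqP => [->|_] /=.
    by rewrite scalerBr scalerA mulfV.
  by rewrite scale0r subr0.
have : mdvd (lf a) ((p \mPo [tuple 'X_j | j < n]) - (p \mPo elim_tuple a i)).
  apply: mdvd_comp_sub => j; rewrite !tnth_mktuple; case: eqP => [->|_].
    by rewrite opprB addrC subrK; apply/mdvdZ/mdvd_refl.
  by rewrite subrr; apply: mdvd0.
by rewrite comp_mpoly_id h subr0.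
Qed.

Lemma rV_neq0 a : a != 0 -> exists i, a 0 i != 0.
Proof. by case/rV0Pn => i; exists i. Qed.

Lemma lf_prime a p q : a != 0 -> mdvd (lf a) (p * q) ->
  mdvd (lf a) p \/ mdvd (lf a) q.
Proof.
move=> /rV_neq0[i ai] /(lf_dvdP _ ai); rewrite rmorphM /= => /eqP.
by rewrite mulf_eq0 => /orP[] /eqP /(lf_dvdP _ ai); [left | right].
Qed.
Lemma lf_cop a p : a != 0 -> ~ mdvd (lf a) p -> mcop (lf a) p.
Proof. by move=> a0 np q /(lf_prime a0)[]. Qed.
Lemma lf_dvd_lf a b : a != 0 -> mdvd (lf a) (lf b) -> exists c, b = c *: a.
Proof.
move=> /rV_neq0[i ai] /(lf_dvdP _ ai); rewrite comp_lf => h.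
exists (b 0 i / a 0 i); apply: lf_inj; rewrite linearZ /=.
rewrite (bigD1 i) //= tnth_mktuple eqxx scalerBr scalerA in h.
rewrite (eq_bigr (fun j => b 0 j *: 'X_j)) in h; last first.
  by move=> j ji; rewrite tnth_mktuple (negbTE ji).
by move/eqP: h; rewrite addrAC subr_eq0 => /eqP <-; rewrite {1}/lf (bigD1 i).
Qed.
Lemma lf_cop_lf a b : a != 0 -> (forall c, b != c *: a) -> mcop (lf a) (lf b).
Proof.
by move=> a0 h; apply: lf_cop => // /(lf_dvd_lf a0)[c e]; have := h c; rewrite e eqxx.
Qed.
Lemma lf_ndvd1 a : a != 0 -> ~ mdvd (lf a) 1.
Proof. by move=> /rV_neq0[i ai] /(lf_dvdP _ ai)/eqP; rewrite comp_mpoly1 oner_eq0. Qed.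

End LinearForms.

(** * Homogeneous polynomials *)

Section Homogeneous.
Variables (F : fieldType) (n : nat).
Local Notation S := {mpoly F[n]}.
Implicit Types (f g p q : S).

Lemma pihomogM d e f q : f \is d.-homog ->
  pihomog mdeg (d + e) (f * q) = f * pihomog mdeg e q.
Proof.
move=> hf; pose k := msize q; have hk : (mmeasure mdeg q <= k)%N by [].
rewrite {1}(pihomog_partitionE hk) {2}(pihomog_partitionE hk) mulr_sumr !raddf_sum mulr_sumr /=.
apply: eq_bigr => i _; have hi := pihomogP mdeg i q.
have hM : f * pihomog mdeg i q \is (d + i).-homog by apply: dhomogM.
case: (eqVneq (i : nat) e) => [ie|ie].
  by rewrite -ie (pihomog_dE hM) (pihomog_dE hi).
rewrite (pihomog_ne0 _ hi) // mulr0 (pihomog_ne0 _ hM) //.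
by rewrite eqn_add2l.
Qed.

(** Any quotient may be replaced by its component of degree [e], since multiplication by [f] shifts
    degrees by [d]. *)
Lemma homog_quot d e f p : f \is d.-homog -> p \is (d + e).-homog ->
  mdvd f p -> exists2 q, p = f * q & q \is e.-homog.
Proof.
move=> hf hp [q e1]; exists (pihomog mdeg e q); last exact: pihomogP.
by rewrite -(pihomogM e q hf) -e1 pihomog_dE.
Qed.
Lemma homog_quot_eq d e f p q : f != 0 -> f \is d.-homog -> f * q \is (d + e).-homog ->
  q \is e.-homog.
Proof.
move=> f0 hf hp; have [q' /(mulfI f0) ->] // := homog_quot hf hp (ex_intro _ q erefl).
Qed.
Lemma homog_dvd_small d e f p : f \is d.-homog -> p \is e.-homog -> (e < d)%N ->
  mdvd f p -> p = 0.
Proof.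
move=> hf hp ed [q e1]; rewrite -(pihomog_dE hp) e1.
pose k := msize q; have hk : (mmeasure mdeg q <= k)%N by [].
rewrite (pihomog_partitionE hk) mulr_sumr !raddf_sum big1 //= => i _.
have hM : f * pihomog mdeg i q \is (d + i).-homog by apply: dhomogM (pihomogP _ _ _).
by apply: (pihomog_ne0 _ hM); lia.
Qed.
Lemma homog0C p : p \is 0.-homog -> exists c, p = c%:MP.
Proof.
move=> /dhomogP h; exists p@_0%MM; apply/mpolyP => m; rewrite mcoeffC.
case: eqP => [->|/eqP m0]; rewrite ?mulr1 // mulr0.
apply: memN_msupp_eq0; apply: contra m0 => /h /eqP.
by rewrite /= mdeg_eq0.
Qed.
Lemma homog_prod (I : Type) (r : seq I) (E : I -> S) (d : I -> nat) :
  (forall i, E i \is (d i).-homog) ->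
  \prod_(i <- r) E i \is (\sum_(i <- r) d i).-homog.
Proof.
move=> h; elim: r => [|i r IH]; first by rewrite !big_nil dhomog1.
by rewrite !big_cons; apply: dhomogM.
Qed.
Lemma homog_mderiv d i p : p \is d.+1.-homog -> mderiv i p \is d.-homog.
Proof.
move=> /dhomogP h; apply/dhomogP => m; rewrite mcoeff_msupp mcoeff_mderiv => h0.
have : (m + U_(i))%MM \in msupp p by rewrite mcoeff_msupp; apply: contraNneq h0 => ->; rewrite mul0rn.
by move/h => /=; rewrite mdegD mdeg1 addn1 => -[].
Qed.
Lemma homog_mderiv0 i p : p \is 0.-homog -> mderiv i p = 0.
Proof. by move=> /homog0C[c ->]; rewrite mderivC. Qed.
Lemma euler_mpoly d p : p \is d.-homog -> \sum_i 'X_i * mderiv i p = d%:R *: p.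
Proof.
move=> /dhomogP h.
have hX (m : 'X_{1..n}) : \sum_i 'X_i * mderiv i 'X_[F, m] = (mdeg m)%:R *: 'X_[m].
  rewrite mdegE natr_sum scaler_suml; apply: eq_bigr => i _.
  rewrite mderivX -scalerAr; case: (posnP (m i)) => [->|mi].
    by rewrite !scale0r.
  by rewrite -mpolyXD addmC submK // lep1mP -lt0n.
rewrite [in RHS](mpolyE p) scaler_sumr.
transitivity (\sum_i \sum_(m <- msupp p) p@_m *: ('X_i * mderiv i 'X_[F, m])).
  apply: eq_bigr => i _; rewrite {1}(mpolyE p) raddf_sum mulr_sumr /=.
  by apply: eq_bigr => m _; rewrite mderivZ -scalerAr.
rewrite exchange_big /= !big_seq; apply: eq_bigr => m mp.
by rewrite -scaler_sumr hX scalerA (h _ mp) scalerA mulrC.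
Qed.

End Homogeneous.

Lemma homog_comp (F : fieldType) n k d e (t : n.-tuple {mpoly F[k]}) (p : {mpoly F[n]}) :
  p \is d.-homog -> (forall i, tnth t i \is e.-homog) -> p \mPo t \is (d * e).-homog.
Proof.
move=> /dhomogP h ht; rewrite comp_mpolyEX big_seq; apply: rpred_sum => m mp.
have -> : d = (\sum_i m i)%N by rewrite -mdegE -(h _ mp).
apply: rpredZ; rewrite comp_mpolyX big_distrl.
have hi (i : 'I_n) : tnth t i ^+ m i \is (m i * e).-homog.
  by rewrite mulnC; apply: dhomogMn.
exact: (homog_prod (index_enum 'I_n) hi).
Qed.

(** * Inner products, Cartan numbers and reflections *)

Section InnerProduct.
Variables (R : realType) (l : nat).
Local Notation V := 'rV[R]_l.
Implicit Types (G : 'M[R]_l) (a b u v x : V).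

Definition dot G u v : R := (u *m G *m v^T) 0 0.

Definition inner_product G :=
  G^T = G /\ forall u, u != 0 -> 0 < dot G u u.

Lemma dotDl G u v w : dot G (u + v) w = dot G u w + dot G v w.
Proof. by rewrite /dot !mulmxDl mxE. Qed.
Lemma dotZl G t u v : dot G (t *: u) v = t * dot G u v.
Proof. by rewrite /dot -!scalemxAl mxE. Qed.
Lemma dot0l G v : dot G 0 v = 0.
Proof. by rewrite /dot !mul0mx mxE. Qed.
Lemma dotNl G u v : dot G (- u) v = - dot G u v.
Proof. by rewrite -scaleN1r dotZl mulN1r. Qed.
Lemma dotBl G u v w : dot G (u - v) w = dot G u w - dot G v w.
Proof. by rewrite dotDl dotNl. Qed.
Lemma dotC G u v : G^T = G -> dot G u v = dot G v u.
Proof.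
move=> h; rewrite /dot -[u *m G *m v^T]trmxK mxE trmx_mul trmxK trmx_mul h.
by rewrite mulmxA.
Qed.
Lemma dot_suml G (I : Type) (r : seq I) (P : pred I) (E : I -> V) v :
  dot G (\sum_(i <- r | P i) E i) v = \sum_(i <- r | P i) dot G (E i) v.
Proof.
by elim/big_rec2: _ => [|i x y _ <-]; rewrite ?dot0l // dotDl.
Qed.

Variables (G : 'M[R]_l) (hG : inner_product G).
Local Notation "u '*d' v" := (dot G u v) (at level 40).

Lemma dotcomm u v : u *d v = v *d u.
Proof. by apply: dotC; case: hG. Qed.
Lemma dotDr u v w : u *d (v + w) = u *d v + u *d w.
Proof. by rewrite !(dotcomm u) dotDl. Qed.
Lemma dotZr t u v : u *d (t *: v) = t * (u *d v).
Proof. by rewrite !(dotcomm u) dotZl. Qed.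
Lemma dotNr u v : u *d (- v) = - (u *d v).
Proof. by rewrite !(dotcomm u) dotNl. Qed.
Lemma dotBr u v w : u *d (v - w) = u *d v - u *d w.
Proof. by rewrite dotDr dotNr. Qed.
Lemma dot_sumr (I : Type) (r : seq I) (P : pred I) (E : I -> V) v :
  v *d (\sum_(i <- r | P i) E i) = \sum_(i <- r | P i) v *d (E i).
Proof. by rewrite dotcomm dot_suml; apply: eq_bigr => i _; rewrite dotcomm. Qed.
Lemma dot_gt0 u : u != 0 -> 0 < u *d u.
Proof. by case: hG => _; apply. Qed.
Lemma dot_ge0 u : 0 <= u *d u.
Proof. by case: (eqVneq u 0) => [->|/dot_gt0/ltW //]; rewrite dot0l. Qed.
Lemma dot_eq0 u : (u *d u == 0) = (u == 0).
Proof.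
case: (eqVneq u 0) => [->|/dot_gt0]; first by rewrite dot0l eqxx.
by move/lt0r_neq0/negbTE.
Qed.

Lemma cauchy_strict u v : u != 0 -> v != 0 -> (forall t, u != t *: v) ->
  (u *d v) ^+ 2 < (u *d u) * (v *d v).
Proof.
move=> u0 v0 h; have vv := dot_gt0 v0.
have /dot_gt0 : u - (u *d v / (v *d v)) *: v != 0 by rewrite subr_eq0.
have -> : (u - (u *d v / (v *d v)) *: v) *d (u - (u *d v / (v *d v)) *: v) =
    u *d u - (u *d v) ^+ 2 / (v *d v).
  rewrite !(dotBl, dotBr, dotZl, dotZr) (dotcomm v u); field.
  by rewrite gt_eqF.
by rewrite subr_gt0 ltr_pdivrMr.
Qed.

(** The pairing of [b] with the coroot of [a]. *)
Definition cart b a : R := 2 * (b *d a) / (a *d a).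
Definition refl a v := v - cart v a *: a.

Lemma cartDl u v a : cart (u + v) a = cart u a + cart v a.
Proof. by rewrite /cart dotDl mulrDr mulrDl. Qed.
Lemma cartZl t v a : cart (t *: v) a = t * cart v a.
Proof. by rewrite /cart dotZl mulrCA !mulrA. Qed.
Lemma cartNl v a : cart (- v) a = - cart v a.
Proof. by rewrite -scaleN1r cartZl mulN1r. Qed.
Lemma cartBl u v a : cart (u - v) a = cart u a - cart v a.
Proof. by rewrite cartDl cartNl. Qed.
Lemma cart0l a : cart 0 a = 0.
Proof. by rewrite /cart dot0l mulr0 mul0r. Qed.
Lemma cart_suml (I : Type) (r : seq I) (P : pred I) (E : I -> V) a :
  cart (\sum_(i <- r | P i) E i) a = \sum_(i <- r | P i) cart (E i) a.
Proof. by elim/big_rec2: _ => [|i x y _ <-]; rewrite ?cart0l // cartDl. Qed.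
Lemma cartNr v a : cart v (- a) = - cart v a.
Proof. by rewrite /cart dotNl !dotNr opprK mulrN mulNr. Qed.
Lemma cart_self a : a != 0 -> cart a a = 2.
Proof. by move=> a0; rewrite /cart mulfK // dot_eq0. Qed.
Lemma cart_gt0 b a : a != 0 -> (0 < cart b a) = (0 < b *d a).
Proof.
by move=> a0; rewrite /cart pmulr_lgt0 ?invr_gt0 ?dot_gt0 // pmulr_rgt0.
Qed.
Lemma cart_lt0 b a : a != 0 -> (cart b a < 0) = (b *d a < 0).
Proof. by move=> a0; rewrite -oppr_gt0 -cartNl cart_gt0 // dotNl oppr_gt0. Qed.
Lemma cart_eq0 b a : a != 0 -> (cart b a == 0) = (b *d a == 0).
Proof.
move=> a0; rewrite /cart mulf_eq0 invr_eq0 dot_eq0 (negbTE a0) orbF.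
by rewrite mulf_eq0 pnatr_eq0.
Qed.
Lemma cart_eq0C b a : a != 0 -> b != 0 -> (cart b a == 0) = (cart a b == 0).
Proof. by move=> a0 b0; rewrite !cart_eq0 // dotcomm. Qed.

Lemma refl_is_linear a : linear (refl a).
Proof.
move=> t u v; rewrite /refl cartDl cartZl scalerBr scalerDl scalerA.
by rewrite opprD addrACA.
Qed.
HB.instance Definition _ a := GRing.isLinear.Build R V V _ (refl a) (refl_is_linear a).

Lemma reflB a u v : refl a (u - v) = refl a u - refl a v.
Proof. exact: linearB. Qed.
Lemma reflZ a t v : refl a (t *: v) = t *: refl a v.
Proof. exact: linearZ. Qed.
Lemma reflNr a v : refl a (- v) = - refl a v.
Proof. exact: linearN. Qed.

Lemma refl_self a : a != 0 -> refl a a = - a.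
Proof.
by move=> a0; rewrite /refl cart_self // scaler_nat mulr2n opprD addNKr.
Qed.
Lemma refl_dot a u v : a != 0 -> refl a u *d refl a v = u *d v.
Proof.
move=> a0; have aa : a *d a != 0 by rewrite dot_eq0.
rewrite /refl !dotBl !dotBr !dotZl !dotZr /cart (dotcomm a v).
by field.
Qed.
Lemma refl_inv a v : a != 0 -> refl a (refl a v) = v.
Proof.
move=> a0; rewrite /refl cartBl cartZl cart_self //.
have -> : cart v a - cart v a * 2 = - cart v a by ring.
by rewrite scaleNr opprK subrK.
Qed.
Lemma reflN a v : refl (- a) v = refl a v.
Proof. by rewrite /refl cartNr scaleNr scalerN opprK. Qed.
Lemma refl_cart a u v : a != 0 -> cart (refl a u) (refl a v) = cart u v.
Proof. by move=> a0; rewrite /cart !refl_dot. Qed.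
Lemma refl_cart2 a u v : a != 0 -> cart u (refl a v) = cart (refl a u) v.
Proof. by move=> a0; rewrite -{1}(refl_inv u a0) refl_cart. Qed.
Lemma refl_inj a : a != 0 -> injective (refl a).
Proof. by move=> a0 u v /(congr1 (refl a)); rewrite !refl_inv. Qed.
Lemma refl_refl a b v : a != 0 -> refl (refl a b) v = refl a (refl b (refl a v)).
Proof.
move=> a0; have reflE c w : refl c w = w - cart w c *: c by [].
rewrite (reflE (refl a b)) refl_cart2 //.
rewrite -{1}(refl_inv v a0) -reflZ -reflB; congr refl.
Qed.

(** Moving the terms with positive coefficient to one side writes a vector [u] as two nonnegative
    combinations of disjoint families, so [u *d u <= 0] and [u = 0]. Pairing with [xi] then kills
    the coefficients on both sides. *)
Lemma obtuse_free (s : seq V) (xi : V) (c : V -> R) : uniq s ->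
  {in s &, forall a b, a != b -> a *d b <= 0} -> {in s, forall a, 0 < a *d xi} ->
  \sum_(a <- s) c a *: a = 0 -> {in s, forall a, c a = 0}.
Proof.
move=> us ob hp h0.
pose u := \sum_(a <- s | 0 < c a) c a *: a.
have eu : u = \sum_(a <- s | ~~ (0 < c a)) (- c a) *: a.
  apply/eqP; rewrite -subr_eq0 -sumrN; move/eqP: h0.
  rewrite (bigID (fun a => 0 < c a)) /= => /eqP h; apply/eqP; rewrite -[RHS]h.
  by congr (_ + _); apply: eq_bigr => a _; rewrite scaleNr opprK.
have uu : u *d u <= 0.
  rewrite {1}/u eu dot_suml big_seq_cond; apply: sumr_le0 => a /andP[sa ca].
  rewrite dot_sumr big_seq_cond; apply: sumr_le0 => b /andP[sb cb].
  rewrite dotZl dotZr pmulr_rle0 // mulr_ge0_le0 //.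
    by rewrite oppr_ge0 leNgt.
  by apply: ob => //; apply: contraNneq cb => <-.
have u0 : u = 0 by apply/eqP; rewrite -dot_eq0 eq_le uu dot_ge0.
have le_c a : a \in s -> ~~ (0 < c a).
  move=> sa; apply/negP => ca.
  have : 0 < u *d xi.
    rewrite /u dot_suml; apply: (@lt_le_trans _ _ (c a *: a *d xi)).
      by rewrite dotZl mulr_gt0 // hp.
    rewrite (big_rem a sa) /= ca lerDl big_seq_cond.
    apply: sumr_ge0 => b /andP[/mem_rem sb cb].
    by rewrite dotZl mulr_ge0 ?ltW ?hp.
  by rewrite u0 dot0l ltxx.
move=> a sa; apply/eqP; rewrite eq_le leNgt le_c //= leNgt; apply/negP => ca.
have : 0 < u *d xi.
  rewrite eu dot_suml; apply: (@lt_le_trans _ _ ((- c a) *: a *d xi)).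
    by rewrite dotZl mulr_gt0 ?hp // oppr_gt0.
  rewrite (big_rem a sa) /= le_c // lerDl big_seq_cond.
  apply: sumr_ge0 => b /andP[/mem_rem sb cb].
  rewrite dotZl mulr_ge0 ?oppr_ge0 1?leNgt //.
  by rewrite -leNgt ltW ?hp.
by rewrite u0 dot0l ltxx.
Qed.

End InnerProduct.

Lemma count_le_in (T : eqType) (p q : pred T) (s : seq T) :
  {in s, forall y, p y -> q y} -> (count p s <= count q s)%N.
Proof.
elim: s => //= y s IH h; apply: leq_add.
  by case: (boolP (p y)) => // py; rewrite h ?mem_head.
by apply: IH => z zs; apply: h; rewrite in_cons zs orbT.
Qed.

Lemma count_lt (T : eqType) (p q : pred T) (s : seq T) x :
  {in s, forall y, p y -> q y} -> x \in s -> q x -> ~~ p x ->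
  (count p s < count q s)%N.
Proof.
move=> h xs qx px; rewrite (permP (perm_to_rem xs)) (permP (perm_to_rem xs) q) /=.
rewrite qx (negbTE px) add0n add1n ltnS; apply: count_le_in => y /mem_rem.
exact: h.
Qed.

(** * Root systems, positive and simple roots, heights *)

Section RootSystems.
Variables (R : realType) (l : nat) (G : 'M[R]_l).
Hypothesis hG : inner_product G.
Local Notation V := 'rV[R]_l.
Implicit Types (a b u v x xi : V) (Psi : seq V).
Local Notation "u '*d' v" := (dot G u v) (at level 40).
Local Notation cart := (cart G).
Local Notation refl := (refl G).

Record root_system Psi : Prop := RootSystem {
  rs_uniq : uniq Psi;
  rs_neq0 : 0 \notin Psi;
  rs_refl : {in Psi &, forall a b, refl a b \in Psi};
  rs_int : {in Psi &, forall a b, cart b a \is a Num.int};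
  rs_red : {in Psi, forall a (t : R), t *: a \in Psi -> t = 1 \/ t = -1} }.

Definition regular Psi xi := {in Psi, forall a, a *d xi != 0}.

Section Positive.
Variables (Psi : seq V) (xi : V).
Hypotheses (rsP : root_system Psi) (reg : regular Psi xi).

Definition posr := [seq a <- Psi | 0 < a *d xi].
Definition simr := [seq a <- posr | ~~ has (fun b => (b \in posr) && (a - b \in posr)) posr].

Lemma root_neq0 a : a \in Psi -> a != 0.
Proof. by apply: contraTneq => ->; case: rsP. Qed.
Lemma rootN a : a \in Psi -> - a \in Psi.
Proof. by move=> aP; rewrite -(refl_self hG (root_neq0 aP)); apply: rs_refl. Qed.
Lemma mem_posr a : (a \in posr) = (a \in Psi) && (0 < a *d xi).
Proof. by rewrite mem_filter andbC. Qed.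
Lemma pos_root a : a \in posr -> a \in Psi.
Proof. by rewrite mem_posr => /andP[]. Qed.
Lemma pos_gt0 a : a \in posr -> 0 < a *d xi.
Proof. by rewrite mem_posr => /andP[]. Qed.
Lemma pos_neq0 a : a \in posr -> a != 0.
Proof. by move/pos_root/root_neq0. Qed.
Lemma pos_uniq : uniq posr.
Proof. by rewrite filter_uniq //; case: rsP. Qed.
Lemma posN a : a \in Psi -> (- a \in posr) = (a \notin posr).
Proof.
move=> aP; rewrite !mem_posr rootN // aP /= dotNl oppr_gt0 -leNgt le_eqVlt.
by rewrite (negbTE (reg aP)).
Qed.
Lemma pos_negF a : a \in posr -> (- a \in posr) = false.
Proof. by move=> ap; rewrite posN ?ap // pos_root. Qed.
Lemma simP a : reflect (a \in posr /\ forall b, b \in posr -> a - b \notin posr)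
  (a \in simr).
Proof.
rewrite [a \in simr]mem_filter; apply: (iffP andP) => -[].
  move=> /hasPn h ap; split=> // b bp; apply/negP => abp.
  by have := h b bp; rewrite bp abp.
by move=> ap h; split=> //; apply/hasPn => b bp; rewrite bp /= h.
Qed.
Lemma sim_pos a : a \in simr -> a \in posr.
Proof. by case/simP. Qed.
Lemma sim_uniq : uniq simr.
Proof. exact: filter_uniq pos_uniq. Qed.

Lemma pos_scale a t : a \in posr -> t *: a \in posr -> t = 1.
Proof.
move=> ap tp; case: (rs_red rsP (pos_root ap) (pos_root tp)) => // e.
by move: tp; rewrite e scaleN1r pos_negF.
Qed.

Definition ncone a := exists n : V -> nat, a = \sum_(s <- simr) (n s)%:R *: s.

Lemma ncone0 : ncone 0.
Proof. by exists (fun=> 0%N); rewrite big1 // => i _; rewrite scale0r. Qed.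
Lemma nconeD a b : ncone a -> ncone b -> ncone (a + b).
Proof.
move=> [n ->] [m ->]; exists (fun s => n s + m s)%N; rewrite -big_split.
by apply: eq_bigr => s _; rewrite natrD scalerDl.
Qed.
Lemma ncone_sim a : a \in simr -> ncone a.
Proof.
move=> ap; exists (fun s => (s == a)); rewrite (bigD1_seq a) ?sim_uniq //=.
by rewrite eqxx scale1r big1 ?addr0 // => s /negbTE ->; rewrite scale0r.
Qed.

(** The values at [xi] are real numbers, but finitely many, so one can induct on the number of roots
    with a smaller value. *)
Lemma pos_ind (P : V -> Prop) :
  (forall a, a \in posr -> (forall b, b \in posr -> b *d xi < a *d xi -> P b) -> P a) ->
  forall a, a \in posr -> P a.
Proof.
move=> IH a; have [m hm] := ubnP (count (fun b => b *d xi < a *d xi) posr).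
elim: m a hm => // m IHm a hm ap; apply: IH => // b bp ba; apply: IHm => //.
rewrite ltnS in hm; apply: leq_trans hm; apply: (@count_lt _ _ _ _ b) => //.
  by move=> y _ /= /lt_trans; apply.
by rewrite ltxx.
Qed.

Lemma pos_ncone a : a \in posr -> ncone a.
Proof.
elim/pos_ind: a / => a ap IH; case: (boolP (a \in simr)) => [/ncone_sim //|ns].
have [b bp abp] : exists2 b, b \in posr & a - b \in posr.
  move: ns; rewrite mem_filter ap andbT negbK => /hasP[b _ /andP[]].
  by exists b.
have bx := pos_gt0 bp; have abx := pos_gt0 abp; rewrite dotBl subr_gt0 in abx.
rewrite -(subrK b a) addrC; apply: nconeD; apply: IH => //.
by rewrite dotBl ltrBlDr ltrDl.
Qed.

(** By strict Cauchy-Schwarz the product of the two Cartan integers is below 4. Both being positive,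
    one of them is 1, and the corresponding reflection yields the difference up to sign. *)
Lemma sub_root a b : a \in Psi -> b \in Psi -> a != b -> 0 < a *d b -> a - b \in Psi.
Proof.
move=> aP bP ab h; have [a0 b0] := (root_neq0 aP, root_neq0 bP).
have hab : a *d b = b *d a by exact: dotcomm.
have cs : (a *d b) ^+ 2 < (a *d a) * (b *d b).
  apply: cauchy_strict => // t; apply/eqP => e.
  case: (rs_red rsP bP (t := t)); rewrite -?e // => e1.
    by move: ab; rewrite e e1 scale1r eqxx.
  by move: h; rewrite e e1 scaleN1r dotNl oppr_gt0 ltNge dot_ge0.
have pa : 0 < a *d a by apply: dot_gt0.
have pb : 0 < b *d b by apply: dot_gt0.
have ca : 0 < cart a b by rewrite cart_gt0.
have cb : 0 < cart b a by rewrite cart_gt0 // -hab.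
have prod : cart a b * cart b a < 4.
  have -> : cart a b * cart b a = 4 * (a *d b) ^+ 2 / ((a *d a) * (b *d b)).
    by rewrite /Submission.cart -hab; field; rewrite !gt_eqF.
  by rewrite ltr_pdivrMr ?mulr_gt0 // ltr_pM2l.
have /intrP[m em] := rs_int rsP bP aP; have /intrP[p ep] := rs_int rsP aP bP.
rewrite em ep in ca cb prod; rewrite -intrM in prod; rewrite !ltr0z in ca cb.
have {prod} : (m * p < 4) by rewrite -(ltr_int R).
case: (eqVneq m 1) => [m1 _|m1 prod].
  have := rs_refl rsP bP aP; rewrite /Submission.refl em m1 scale1r; exact.
have p1 : p = 1 by move/eqP: m1; nia.
have := rs_refl rsP aP bP; rewrite /Submission.refl ep p1 scale1r => /rootN.
by rewrite opprB.
Qed.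

Lemma sim_obtuse a b : a \in simr -> b \in simr -> a != b -> a *d b <= 0.
Proof.
move=> as_ bs ab; rewrite leNgt; apply/negP => h.
have [ap ha] := simP _ as_; have [bp hb] := simP _ bs.
have abP : a - b \in Psi by apply: sub_root => //; apply: pos_root.
case: (boolP (a - b \in posr)) => [|nab]; first by apply/negP/ha.
by have := hb a ap; rewrite -opprB posN // negbK (negbTE nab).
Qed.

Lemma sim_free (c : V -> R) : \sum_(s <- simr) c s *: s = 0 ->
  {in simr, forall s, c s = 0}.
Proof.
move=> h; apply: (obtuse_free hG sim_uniq sim_obtuse (xi := xi) _ h) => a.
by move=> /sim_pos/pos_gt0.
Qed.

(** If the image were negative, comparing coefficients over the independent simple roots would leave
    [b] supported on [a] alone, hence equal to [a] as the system is reduced. *)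
Lemma refl_pos a b : a \in simr -> b \in posr -> b != a -> refl a b \in posr.
Proof.
move=> as_ bp ba; have ap := sim_pos as_.
have rP : refl a b \in Psi by apply: rs_refl; rewrite ?pos_root.
apply/negPn/negP; rewrite -posN // => /pos_ncone[m em].
have [n en] := pos_ncone bp.
have h0 : \sum_(s <- simr) ((n s)%:R + (m s)%:R - (s == a)%:R * cart b a) *: s = 0.
  under eq_bigr do rewrite scalerBl scalerDl.
  rewrite sumrB big_split /= -en -em /Submission.refl opprB [b + _]addrC subrK.
  rewrite (bigD1_seq a) ?sim_uniq //= eqxx mul1r big1 ?addr0 ?subrr // => s /negbTE ->.
  by rewrite mul0r scale0r.
have hn s : s \in simr -> s != a -> n s = 0%N.
  move=> ss /negbTE sa; have := sim_free h0 ss; rewrite sa mul0r subr0 -natrD.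
  by move/eqP; rewrite pnatr_eq0 addn_eq0 => /andP[/eqP].
have eb : b = (n a)%:R *: a.
  rewrite {1}en (bigD1_seq a) ?sim_uniq //= big_seq_cond big1 ?addr0 // => s /andP[ss sa].
  by rewrite hn // scale0r.
by move: ba; rewrite eb (pos_scale ap (t := (n a)%:R)) -?eb // scale1r eqxx.
Qed.

Lemma refl_pos_perm a : a \in simr ->
  perm_eq [seq refl a b | b <- rem a posr] (rem a posr).
Proof.
move=> as_; have ap := sim_pos as_; have a0 := pos_neq0 ap.
have ur := rem_uniq a pos_uniq.
have um : uniq [seq refl a b | b <- rem a posr].
  by rewrite map_inj_uniq //; apply: refl_inj.
apply: uniq_perm => //.
have sub : {subset [seq refl a b | b <- rem a posr] <= rem a posr}.
  move=> x /mapP[b]; rewrite !(mem_rem_uniq _ pos_uniq) !inE => /andP[ba bp] ->.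
  rewrite refl_pos // andbT; apply/eqP => e.
  have : a = - b by apply: (refl_inj hG a0); rewrite reflNr e refl_self.
  by move=> e'; move: (pos_negF bp); rewrite -e' ap.
by have [] := uniq_min_size um sub; rewrite ?size_map.
Qed.

(** The pairing with half the sum of the positive coroots, a linear function that equals the height
    on roots. *)
Definition htr a : R := 2^-1 * \sum_(b <- posr) cart a b.

Lemma htr_sum (I : Type) (r : seq I) (E : I -> V) (c : I -> R) :
  htr (\sum_(i <- r) c i *: E i) = \sum_(i <- r) c i * htr (E i).
Proof.
rewrite /htr; under eq_bigr do rewrite cart_suml.
rewrite exchange_big /= mulr_sumr; apply: eq_bigr => i _.
rewrite mulrCA; congr (_ * _); rewrite mulr_sumr.
by apply: eq_bigr => b _; rewrite cartZl.
Qed.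
Lemma htrD a b : htr (a + b) = htr a + htr b.
Proof.
by rewrite /htr -mulrDr -big_split; congr (_ * _); apply: eq_bigr => c _; rewrite cartDl.
Qed.

(** The reflection in [a] permutes the other positive roots and reverses the sign of [cart a b], so
    only the term [b = a] survives. *)
Lemma htr_sim a : a \in simr -> htr a = 1.
Proof.
move=> as_; have ap := sim_pos as_; have a0 := pos_neq0 ap.
rewrite /htr (perm_big _ (perm_to_rem ap)) /= big_cons cart_self //.
suff -> : \sum_(b <- rem a posr) cart a b = 0 by rewrite addr0 mulVf ?pnatr_eq0.
suff /eqP : \sum_(b <- rem a posr) cart a b + \sum_(b <- rem a posr) cart a b = 0.
  by rewrite -mulr2n mulrn_eq0 /= => /eqP.
rewrite -{1}(perm_big _ (refl_pos_perm as_)) /= big_map -big_split /=.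
by rewrite big1 // => b _; rewrite refl_cart2 // refl_self // cartNl addNr.
Qed.

Lemma exists_sim_dot b : b \in posr -> exists2 a, a \in simr & 0 < b *d a.
Proof.
move=> bp; have [n en] := pos_ncone bp.
have : 0 < b *d b by rewrite dot_gt0 // pos_neq0.
rewrite {2}en dot_sumr // => h; apply/hasP; apply/negPn/negP => /hasPn hn.
move: h; rewrite ltNge => /negP; apply; rewrite big_seq; apply: sumr_le0 => s ss.
rewrite dotZr // mulr_ge0_le0 ?ler0n // leNgt.
exact: hn.
Qed.

Lemma pos_sub_sim b : b \in posr -> b \notin simr ->
  exists2 a, a \in simr & b - a \in posr.
Proof.
move=> bp nb; have [a as_ h] := exists_sim_dot bp; exists a => //.
have ba : b != a by apply: contraNneq nb => ->.
have baP : b - a \in Psi by exact: sub_root (pos_root bp) (pos_root (sim_pos as_)) ba h.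
apply/negPn/negP; rewrite -posN // opprB => abp.
have [_ hs] := simP _ as_; have := hs _ bp.
by rewrite abp.
Qed.

Lemma pos_refl_lower b : b \in posr -> b \notin simr ->
  exists2 a, a \in simr & refl a b \in posr /\ refl a b *d xi < b *d xi.
Proof.
move=> bp nb; have [a as_ h] := exists_sim_dot bp; exists a => //.
have ba : b != a by apply: contraNneq nb => ->.
split; first exact: refl_pos.
rewrite /Submission.refl dotBl gtrBl dotZl mulr_gt0 ?pos_gt0 ?sim_pos //.
by rewrite cart_gt0 // pos_neq0 // sim_pos.
Qed.

Lemma ncone_ge0 a : ncone a -> 0 <= a *d xi.
Proof.
move=> [n ->]; rewrite dot_suml big_seq; apply: sumr_ge0 => s ss.
by rewrite dotZl mulr_ge0 ?ler0n // ltW // pos_gt0 // sim_pos.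
Qed.

(* A chain of roots climbing to a by adding simple roots, together with a second
   simple root, gives at least ht(a) roots below a. *)
Lemma lower_roots a : a \in posr -> a \notin simr ->
  exists L : seq V, [/\ uniq L, {in L, forall b, b \in posr},
    {in L, forall b, b != a /\ ncone (a - b)} & htr a <= (size L)%:R].
Proof.
elim/pos_ind: a / => a ap IH na; have [s ss asp] := pos_sub_sim ap na.
have sp := sim_pos ss; have sx := pos_gt0 sp; have s0 := pos_neq0 sp.
have lt : (a - s) *d xi < a *d xi by rewrite dotBl gtrBl.
have ne : a - s != a by rewrite -subr_eq0 addrAC subrr sub0r oppr_eq0.
have cs : ncone (a - (a - s)) by rewrite opprB addrC subrK; apply: ncone_sim.
have hta : htr a = htr (a - s) + 1 by rewrite -(htr_sim ss) -htrD subrK.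
case: (boolP (a - s \in simr)) => [ass|nass].
  exists [:: a - s; s]; split.
  - rewrite /= inE andbT; apply/eqP => e; have e2 : a = 2 *: s.
      by rewrite -(subrK s a) e scaler_nat.
    have := pos_scale sp (t := 2); rewrite -e2 => /(_ ap) /eqP.
    by rewrite -subr_eq0 (_ : 2 - 1 = 1) ?oner_eq0 //; ring.
  - by move=> b; rewrite !inE => /orP[] /eqP ->.
  - move=> b; rewrite !inE => /orP[] /eqP ->; split=> //; last exact: ncone_sim.
    by apply: contraNneq na => <-.
  by rewrite hta (htr_sim ass).
have [L [uL pL hL sL]] := IH _ asp lt nass.
exists (a - s :: L); split.
- by rewrite /= uL andbT; apply/negP => /hL[]; rewrite eqxx.
- by move=> b; rewrite inE => /orP[/eqP ->|/pL].
- move=> b; rewrite inE => /orP[/eqP ->|bL]; first by [].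
  have [_ hb] := hL b bL; split; last first.
    have -> : a - b = (a - (a - s)) + (a - s - b) by rewrite addrA subrK.
    exact: nconeD.
  apply/eqP => e; have := ncone_ge0 hb; rewrite e addrAC subrr sub0r dotNl oppr_ge0.
  by rewrite leNgt sx.
by rewrite hta /= -natr1 lerD2r.
Qed.

End Positive.
End RootSystems.

Lemma sum_subset (T : eqType) (R : realDomainType) (s t : seq T) (w : T -> R) :
  uniq s -> uniq t -> {subset s <= t} -> {in t, forall x, 0 <= w x} ->
  \sum_(x <- s) w x <= \sum_(x <- t) w x.
Proof.
move=> us ut st w0; rewrite [leRHS](bigID (mem s)) /= -[in leRHS]big_filter.
have hp : perm_eq [seq i <- t | i \in s] s.
  apply: uniq_perm; rewrite ?filter_uniq // => x; rewrite mem_filter andb_idr //.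
  exact: st.
rewrite (perm_big _ hp) /= lerDl big_seq_cond.
by apply: sumr_ge0 => x /andP[/w0].
Qed.

(** * Counting roots below a root in rank two subsystems *)

Section LocalCount.
Variables (R : realType) (l : nat) (G : 'M[R]_l).
Hypothesis hG : inner_product G.
Local Notation V := 'rV[R]_l.
Local Notation "u '*d' v" := (dot G u v) (at level 40).
Local Notation cart := (cart G).
Local Notation refl := (refl G).

Variables (Phi : seq V) (xi : V) (M h : R).
Hypotheses (rsP : root_system G Phi) (reg : regular G Phi xi).
Hypothesis hM : {in Phi, forall a, `|a *d xi| < M}.

Variables (al : V) (p : R).
Hypotheses (alP : al \in Phi) (p_int : p \is a Num.int).
(** An affine root [(b, j)] is measured by [b *d xi - M * j]. By [hM] and regularity this number is
    nonzero for integral [j], so it divides affine roots into positive and negative ones;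
    [(al, - p)] is taken positive. *)
Hypothesis al_gt0 : 0 < al *d xi + M * p.
Local Notation fa b := (b.1 *d xi - M * b.2).

Let al0 : al != 0 := root_neq0 rsP alP.

(* The affine roots are the pairs (g, j), standing for the forms g - j z; the
   component of (g, j) orthogonal to (al, -p), up to a scalar, determines the
   codimension two flat in which the two hyperplanes meet. *)
Definition aperp (b : V * R) : V * R :=
  (b.1 - (cart b.1 al / 2) *: al, b.2 + cart b.1 al / 2 * p).
Definition pivot (v : V) : R := if [pick i | v 0 i != 0] is Some i then v 0 i else 0.
(** Dividing by a coordinate that is selected from the support alone gives a normal form for
    proportionality. Two affine roots not parallel to [al] have the same class when they cut
    [(al, - p)] in the same flat. *)
Definition aclass (b : V * R) : V * R :=
  ((pivot (aperp b).1)^-1 *: (aperp b).1, (pivot (aperp b).1)^-1 * (aperp b).2).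

Lemma pivotZ t v : t != 0 -> pivot (t *: v) = t * pivot v.
Proof.
move=> t0; rewrite /pivot (eq_pick (Q := fun i => v 0 i != 0)).
  by case: pickP => [i _|]; rewrite ?mxE ?mulr0.
by move=> i; rewrite mxE mulf_eq0 (negbTE t0).
Qed.
Lemma pivot_neq0 v : v != 0 -> pivot v != 0.
Proof.
move=> /rV0Pn[i vi]; rewrite /pivot; case: pickP => [//|] /(_ i).
by rewrite vi.
Qed.

Lemma aclassP b b1 : (aperp b).1 != 0 -> (aperp b1).1 != 0 ->
  aclass b = aclass b1 -> exists u v : R, [/\ u != 0,
    b.1 = u *: b1.1 + v *: al & b.2 = u * b1.2 - v * p].
Proof.
move=> n0 n1 [e1 e2]; have p0 := pivot_neq0 n0; have p1 := pivot_neq0 n1.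
set r := pivot (aperp b).1 in e1 e2 p0; set s := pivot (aperp b1).1 in e1 e2 p1.
have ev : b.1 - (cart b.1 al / 2) *: al =
    (r / s) *: (b1.1 - (cart b1.1 al / 2) *: al).
  by rewrite -(scalerA r s^-1) -e1 scalerA mulfV // scale1r.
have ej : b.2 + cart b.1 al / 2 * p = (r / s) * (b1.2 + cart b1.1 al / 2 * p).
  by rewrite -(mulrA r s^-1) -e2 mulrA mulfV // mul1r.
exists (r / s), (cart b.1 al / 2 - r / s * (cart b1.1 al / 2)).
split; first by rewrite mulf_neq0 ?invr_eq0.
- rewrite -[LHS](subrK ((cart b.1 al / 2) *: al)) ev scalerBr scalerBl scalerA.
  by rewrite -!addrA; congr (_ + _); rewrite addrC.
- by rewrite -[LHS](addrK (cart b.1 al / 2 * p)) ej; ring.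
Qed.

Lemma aclass_span b b1 u v : u != 0 ->
  b.1 = u *: b1.1 + v *: al -> b.2 = u * b1.2 - v * p -> aclass b = aclass b1.
Proof.
move=> u0 e1 e2.
have c : cart b.1 al = u * cart b1.1 al + 2 * v.
  by rewrite e1 cartDl !cartZl cart_self // [v * 2]mulrC.
have k1 : (aperp b).1 = u *: (aperp b1).1.
  rewrite /aperp /= c e1 scalerBr scalerA mulrDl scalerDl mulrA.
  rewrite [2 * v]mulrC mulfK ?pnatr_eq0 // opprD addrACA subrr addr0.
  by congr (_ - _ *: _); rewrite /Submission.cart; field; rewrite dot_eq0.
have k2 : (aperp b).2 = u * (aperp b1).2.
  by rewrite /aperp /= c e2; field.
rewrite /aclass k1 k2 pivotZ // invfM scalerA mulrA.
by rewrite mulrAC mulVf // mul1r.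
Qed.

Lemma aperp_neq0 g j : g \in Phi -> g != al -> g != - al -> (aperp (g, j)).1 != 0.
Proof.
move=> gP g1 g2; rewrite /aperp /= subr_eq0; apply/eqP => e.
case: (rs_red rsP alP (t := cart g al / 2)); rewrite -?e // => e1.
  by move: g1; rewrite e e1 scale1r eqxx.
by move: g2; rewrite e e1 scaleN1r eqxx.
Qed.

Section Flat.
Variable (b1 : V * R).
Hypotheses (b1P : b1.1 \in Phi) (b1int : b1.2 \is a Num.int).
Hypotheses (b1n : b1.1 != al) (b1n' : b1.1 != - al).

(** A two by two Gram system, whose determinant [D] is nonzero by strict Cauchy-Schwarz. *)
Lemma flat_point : exists y : V, al *d y = - p /\ b1.1 *d y = b1.2.
Proof.
have cs : (b1.1 *d al) ^+ 2 < (b1.1 *d b1.1) * (al *d al).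
  apply: cauchy_strict => //; first exact: (root_neq0 rsP b1P).
  move=> t; apply/eqP => e; case: (rs_red rsP alP (t := t)); rewrite -?e // => e1.
    by move: b1n; rewrite e e1 scale1r eqxx.
  by move: b1n'; rewrite e e1 scaleN1r eqxx.
have ec : al *d b1.1 = b1.1 *d al by apply: dotcomm.
pose D := (b1.1 *d b1.1) * (al *d al) - (b1.1 *d al) ^+ 2.
have D0 : D != 0 by rewrite subr_eq0 gt_eqF.
exists (((- p * (b1.1 *d b1.1) - b1.2 * (b1.1 *d al)) / D) *: al +
        ((b1.2 * (al *d al) + p * (b1.1 *d al)) / D) *: b1.1).
by rewrite !dotDr // !dotZr // ec; split; rewrite /D; field.
Qed.

Variables (A Inv : seq (V * R)).
Hypotheses (uA : uniq A) (uInv : uniq Inv).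
Hypothesis Adown : forall g j (s : seq (V * R)), g \in Phi -> g != al -> g != - al ->
  j \is a Num.int -> 0 < g *d xi - M * j ->
  {in s, forall b, [/\ b.1 \in Phi, b.2 \is a Num.int & 0 < fa b]} ->
  al - g = \sum_(b <- s) b.1 -> - p - j = \sum_(b <- s) b.2 -> (g, j) \in A.
(** The reflection in [(al, - p)] lowers the measure of [b] by [cart b.1 al] times the measure of
    [(al, - p)]. The last condition thus says that [b] is positive and becomes negative: [Inv] lists
    inversions of this reflection. *)
Hypothesis invP : {in Inv, forall b, [/\ b.1 \in Phi, b.2 \is a Num.int, b.1 != al,
  b.1 != - al & 0 < fa b < cart b.1 al * (al *d xi + M * p)]}.

(** Let [y] be a point of the common flat. The roots lifting to affine roots through [y] form a
    system of rank two, with positive system given by the measure. In the height of [al] there, the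
    roots that stay positive under the reflection cancel in pairs, so the inverted ones contribute
    twice the height minus 1. For a non-simple [al], [lower_roots] finds at least as many roots
    below [al] as its height, and [Adown] puts all of them into [A]. *)
Lemma local_count :
  \sum_(b <- Inv | aclass b == aclass b1) cart al b.1 <=
  2 * ((count (fun b => aclass b == aclass b1) A).-1)%:R.
Proof.
have [y [y1 y2]] := flat_point.
(* The roots [g] whose lift [(g, g *d y)] is an affine root through [y]; on these lifts the measure
   is [g *d xi']. *)
pose Psi := [seq g <- Phi | (g <= col_mx al b1.1)%MS && (g *d y \is a Num.int)].
pose xi' := xi - M *: y.
have xi'E g : g *d xi' = g *d xi - M * (g *d y) by rewrite dotBr // dotZr.
have inPsi g : (g \in Psi) = [&& (g <= col_mx al b1.1)%MS, g *d y \is a Num.int & g \in Phi].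
  by rewrite mem_filter andbA.
have psi_rs : root_system G Psi.
  split.
  - by rewrite filter_uniq // (rs_uniq rsP).
  - by rewrite inPsi (negbTE (rs_neq0 rsP)) !andbF.
  - move=> a b; rewrite !inPsi => /and3P[a1 a2 a3] /and3P[c1 c2 c3].
    rewrite rs_refl // andbT /Submission.refl; apply/andP; split.
      by rewrite addmx_sub // -scaleNr scalemx_sub.
    by rewrite dotBl dotZl rpredB // rpredM //; apply: (rs_int rsP).
  - by move=> a b; rewrite !inPsi => /and3P[_ _ a3] /and3P[_ _ c3]; apply: (rs_int rsP).
  - by move=> a; rewrite inPsi => /and3P[_ _ a3] t; rewrite inPsi => /and3P[_ _]; apply: (rs_red rsP).
have psi_reg : regular G Psi xi'.
  move=> g; rewrite inPsi => /and3P[_ /intrP[k ek] gP]; rewrite xi'E ek subr_eq0.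
  have := hM gP; case: (eqVneq k 0) => [->|k0]; first by rewrite mulr0 reg.
  move=> hlt; apply: contraTneq hlt => ->; rewrite -leNgt normrM.
  have M0 : 0 <= M by apply: le_trans (ltW (hM gP)).
  rewrite (ger0_norm M0) ler_peMr // -intr_norm -[1]/(1%:~R) ler_int.
  by move: k0; lia.
have al_psi : al \in Psi.
  by rewrite inPsi alP andbT y1 rpredN p_int andbT (submx_trans _ (submx_refl _)) // -addsmxE addsmxSl.
have al_pos : al \in posr G Psi xi'.
  by rewrite mem_posr al_psi xi'E y1 mulrN opprK.
have psi_class g : g \in Psi -> g != al -> g != - al -> aclass (g, g *d y) = aclass b1.
  rewrite inPsi => /and3P[/submxP[D eD] _ gP] g1 g2.
  have e1 : g = D 0 (rshift 1 0) *: b1.1 + D 0 (lshift 1 0) *: al.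
    rewrite eD -[D]hsubmxK mul_row_col addrC row_mxEl row_mxEr.
    by rewrite [rsubmx D]mx11_scalar [lsubmx D]mx11_scalar !mul_scalar_mx !mxE.
  apply: (@aclass_span _ _ (D 0 (rshift 1 0)) (D 0 (lshift 1 0))) => //=.
    apply/eqP => u0; have := aperp_neq0 0 gP g1 g2; rewrite /aperp /= {1 2}e1 u0 scale0r add0r.
    by rewrite cartZl cart_self // mulfK ?pnatr_eq0 // subrr eqxx.
  by rewrite {1}e1 dotDl !dotZl y1 y2 mulrN.
have n1 : (aperp b1).1 != 0.
  by rewrite (surjective_pairing b1); apply: aperp_neq0.
have class_psi b : b.1 \in Phi -> b.2 \is a Num.int -> b.1 != al -> b.1 != - al ->
    aclass b = aclass b1 -> b.1 \in Psi /\ b.2 = b.1 *d y.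
  case: b => g j /= gP jint g1 g2 /aclassP[||u [v [_ /= e1 e2]]]; try exact: aperp_neq0.
  have ej : j = g *d y by rewrite e1 dotDl !dotZl y1 y2 e2 mulrN.
  split=> //; rewrite inPsi gP -ej jint !andbT e1 -addsmxE.
  by apply: addmx_sub; apply: scalemx_sub; [apply: addsmxSr | apply: addsmxSl].
pose pos := posr G Psi xi'; pose T0 := rem al pos.
have upos : uniq pos by apply: pos_uniq.
have inT0 g : (g \in T0) = (g != al) && (g \in pos) by rewrite (mem_rem_uniq _ upos) inE.
have T0n g : g \in T0 -> g != - al.
  rewrite inT0 => /andP[_ gp]; apply: contraTneq gp => ->.
  by rewrite (pos_negF hG psi_rs psi_reg al_pos).
have inv_inj : {in [seq b <- Inv | aclass b == aclass b1] &, injective fst}.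
  move=> b b'; rewrite !mem_filter => /andP[/eqP cb /invP[? ? ? ? _]] /andP[/eqP cb' /invP[? ? ? ? _]] e.
  have [_ e1] : b.1 \in Psi /\ b.2 = b.1 *d y by apply: class_psi.
  have [_ e2] : b'.1 \in Psi /\ b'.2 = b'.1 *d y by apply: class_psi.
  by move: e e1 e2; clear; case: b b' => [g j] [g' j'] /= -> -> ->.
have invT : {subset [seq b.1 | b <- Inv & aclass b == aclass b1] <=
    [seq g <- T0 | refl al g \notin pos]}.
  move=> g /mapP[b]; rewrite mem_filter => /andP[/eqP cb /invP[bP bint b_1 b_2 /andP[f0 f1]]] ->.
  have [bpsi ej] := class_psi b bP bint b_1 b_2 cb.
  rewrite mem_filter inT0 b_1 /= !mem_posr bpsi (xi'E b.1) -ej f0 /= andbT negb_and -leNgt.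
  apply/orP; right; rewrite /Submission.refl dotBl dotZl !xi'E -ej y1 mulrN opprK subr_le0.
  exact: ltW.
have sumT0 : \sum_(g <- T0) cart al g = 2 * (htr G Psi xi' al - 1).
  rewrite /htr -/pos (perm_big _ (perm_to_rem al_pos)) /= big_cons cart_self //.
  by rewrite -/T0; field.
(* The reflection permutes these roots and reverses the sign of [cart al g]. *)
have sumT1 : \sum_(g <- T0 | refl al g \in pos) cart al g = 0.
  suff /eqP : \sum_(g <- T0 | refl al g \in pos) cart al g +
      \sum_(g <- T0 | refl al g \in pos) cart al g = 0.
    by rewrite -mulr2n mulrn_eq0 /= => /eqP.
  rewrite -big_filter; set T := filter _ _.
  have uT : uniq T by rewrite filter_uniq // rem_uniq.
  have hp : perm_eq [seq refl al g | g <- T] T.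
    have um : uniq [seq refl al g | g <- T] by rewrite map_inj_uniq //; apply: refl_inj.
    apply: uniq_perm => //.
    suff sub : {subset [seq refl al g | g <- T] <= T}.
      by have [] := uniq_min_size um sub; rewrite ?size_map.
    move=> x /mapP[g]; rewrite mem_filter inT0 => /and3P[rg ga gp] ->.
    rewrite mem_filter refl_inv // gp inT0 rg andbT /=; apply/eqP => e.
    have e' : g = - al by rewrite -(refl_inv hG g al0) e refl_self.
    by move: gp; rewrite e' (pos_negF hG psi_rs psi_reg al_pos).
  rewrite -{1}(perm_big _ hp) /= big_map -big_split /= big1 // => g _.
  by rewrite refl_cart2 // refl_self // cartNl addNr.
have le1 : \sum_(b <- Inv | aclass b == aclass b1) cart al b.1 <=
    2 * (htr G Psi xi' al - 1).
  rewrite -sumT0 (bigID (fun g => refl al g \in pos)) /= sumT1 add0r.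
  rewrite -big_filter -[leRHS]big_filter -(big_map fst xpredT (fun g => cart al g)).
  apply: sum_subset; rewrite ?map_inj_in_uniq ?filter_uniq ?rem_uniq //.
  move=> g; rewrite mem_filter inT0 => /and3P[ng ga gp].
  have g0 : g != 0 := pos_neq0 psi_rs gp.
  rewrite ltW // cart_gt0 // dotcomm // -cart_gt0 //.
  move: ng; rewrite mem_posr (rs_refl psi_rs al_psi (pos_root gp)) /= -leNgt /Submission.refl dotBl dotZl subr_le0 => hle.
  have := lt_le_trans (pos_gt0 gp) hle; rewrite pmulr_lgt0 //.
  exact: (pos_gt0 al_pos).
apply: (le_trans le1); rewrite ler_pM2l ?ltr0n //.
set C := count _ A.
case: (boolP (al \in simr G Psi xi')) => [/(htr_sim hG psi_rs psi_reg) ->|ns].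
  by rewrite subrr ler0n.
have [L [uL pL hL sL]] := lower_roots hG psi_rs psi_reg al_pos ns.
suff szL : (size L <= C)%N.
  rewrite lerBlDr; apply: (le_trans sL); rewrite -(natrD _ _ 1) ler_nat.
  by case: C szL => [|C] /=; rewrite ?addn1 // => /leq_trans; apply.
rewrite /C -size_filter -(size_map (fun g => (g, g *d y)) L); apply: uniq_leq_size.
  by rewrite map_inj_uniq // => g g' [].
move=> b /mapP[g gL ->]; have gp := pL _ gL; have [gal [n en]] := hL _ gL.
have gPsi := pos_root gp; have gn : g != - al by apply: T0n; rewrite inT0 gal.
rewrite mem_filter psi_class // eqxx /=.
have := gPsi; rewrite inPsi => /and3P[_ gint gP].
(* A decomposition of [al - g] into simple roots of [Psi], listed with multiplicity and lifted
   through [y], as [Adown] requires. *)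
pose S := flatten [seq nseq (n s) (s, s *d y) | s <- simr G Psi xi'].
have sumS (W : nmodType) (f : V * R -> W) :
    \sum_(b <- S) f b = \sum_(s <- simr G Psi xi') f (s, s *d y) *+ n s.
  rewrite /S big_flatten big_map; apply: eq_bigr => s _.
  by rewrite big_nseq iter_addr addr0.
apply: (Adown (s := S)) => //.
- by have := pos_gt0 gp; rewrite xi'E.
- move=> c /flattenP[_ /mapP[s ss ->]] /nseqP[-> _] /=.
  have sp := pos_root (sim_pos ss); have := pos_gt0 (sim_pos ss); rewrite xi'E => s0.
  by move: sp; rewrite inPsi => /and3P[_ ? ?].
- by rewrite sumS en; apply: eq_bigr => s _; rewrite scaler_nat.
- rewrite sumS -y1 -dotBl en dot_suml; apply: eq_bigr => s _ /=.
  by rewrite dotZl mulr_natl.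
Qed.

End Flat.
End LocalCount.

(** * The count summed over all flats of codimension two *)

Section GlobalCount.
Variables (R : realType) (l : nat) (G : 'M[R]_l).
Hypothesis hG : inner_product G.
Local Notation V := 'rV[R]_l.
Local Notation "u '*d' v" := (dot G u v) (at level 40).
Local Notation cart := (cart G).
Local Notation refl := (refl G).

Variables (Phi : seq V) (xi : V) (M h : R).
Hypotheses (rsP : root_system G Phi) (reg : regular G Phi xi).
Hypothesis hM : {in Phi, forall a, `|a *d xi| < M}.
Variables (al : V) (p : nat).
Hypotheses (alP : al \in Phi) (al_gt0 : 0 < al *d xi + M * p%:R).
Hypothesis hcox : \sum_(b <- posr G Phi xi) cart b al * cart al b = 2 * h.
Local Notation fa b := (b.1 *d xi - M * b.2).
Local Notation aclass := (aclass G al p%:R).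

Variables (A : seq (V * R)).
Hypotheses (uA : uniq A).
Hypothesis Adown : forall g j (s : seq (V * R)), g \in Phi -> g != al -> g != - al ->
  j \is a Num.int -> 0 < g *d xi - M * j ->
  {in s, forall b, [/\ b.1 \in Phi, b.2 \is a Num.int & 0 < fa b]} ->
  al - g = \sum_(b <- s) b.1 -> - p%:R - j = \sum_(b <- s) b.2 -> (g, j) \in A.

Let al0 : al != 0 := root_neq0 rsP alP.
Let neg (g : V) : nat := (g *d xi < 0)%R.
Let inv_roots := [seq g <- Phi | (g != al) && (0 < cart g al)].
(** Concerns the affine roots [g + (i + neg g) z], where the shift by [neg g] ensures positivity for
    all [i]. The reflection in [(al, - p)] makes such a root negative as long as [i + neg g] is at
    most [p * cart g al], or strictly less when [refl al g] is positive. *)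
Let ninv g : nat :=
  (Num.truncn (cart g al) * p + 1 - neg g - (0 < refl al g *d xi)%R)%N.
Let Inv := [seq (g, - (i + neg g)%:R : R) | g <- inv_roots, i <- iota 0 (ninv g)].

Let inv_rootsP g : g \in inv_roots -> [/\ g \in Phi, g != al, g != - al & 0 < cart g al].
Proof.
rewrite mem_filter => /andP[/andP[g1 c] gP]; split=> //.
by apply: contraTneq c => ->; rewrite cartNl (cart_self hG) // oppr_gt0 -leNgt ler0n.
Qed.

Let truncK g : g \in inv_roots -> (Num.truncn (cart g al))%:R = cart g al.
Proof.
move=> /inv_rootsP[gP _ _ c]; have := rs_int rsP alP gP.
by rewrite intrE => /orP[/natrP[m ->]|/natrP[m e]]; [rewrite natrK|
  move: c; rewrite -[cart g al]opprK e oppr_gt0 ltrn0].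
Qed.

Let invP : {in Inv, forall b, [/\ b.1 \in Phi, b.2 \is a Num.int, b.1 != al,
  b.1 != - al & 0 < fa b < cart b.1 al * (al *d xi + M * p%:R)]}.
Proof.
move=> b /allpairsPdep[g [i [gi]]]; rewrite mem_iota add0n => /= hi -> /=.
have [gP g1 g2 c] := inv_rootsP gi; split=> //.
  by rewrite rpredN rpred_nat.
have rP := rs_refl rsP alP gP.
have := hM gP; rewrite ltr_norml => /andP[m1 m2].
have := hM rP; rewrite ltr_norml => /andP[m3 m4].
have M0 : 0 < M by exact: le_lt_trans (normr_ge0 _) (hM alP).
rewrite mulrN opprK; apply/andP; split.
  rewrite natrD mulrDr; have Mi : 0 <= M * i%:R.
  by apply: mulr_ge0; [exact: ltW | exact: ler0n].
  have := reg gP; rewrite /neg; case: (ltgtP (g *d xi) 0) => //= s0 _.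
    by rewrite mulr1; lra.
  by rewrite mulr0; lra.
have er : g *d xi = refl al g *d xi + cart g al * (al *d xi).
  by rewrite /Submission.refl dotBl dotZl subrK.
rewrite {1}er mulrDr -addrA [X in X < _]addrC -addrA ltrD2l.
rewrite mulrCA -(truncK gi) -natrM.
move: hi; rewrite /ninv; move: (_ * p)%N (neg g) => m s.
have := reg rP; case: (ltgtP (refl al g *d xi) 0) => // s0 _ hi.
  have hi' : (i + s <= m)%N by move: hi; clear; rewrite /=; lia.
  apply: (@lt_le_trans _ _ (M * (i + s)%:R)); first by rewrite -ltrBrDl subrr.
  by rewrite ler_pM2l // ler_nat.
have hi' : (i + s + 1 <= m)%N by move: hi; clear; rewrite /=; lia.
apply: (@lt_le_trans _ _ (M * (i + s + 1)%:R)).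
  by rewrite !natrD !mulrDr mulr1 ltrD2l.
by rewrite ler_pM2l // ler_nat.
Qed.

Let inv_uniq : uniq Inv.
Proof.
apply: allpairs_uniq_dep; first by rewrite filter_uniq // (rs_uniq rsP).
  by move=> g _; apply: iota_uniq.
move=> [g i] [g' i'] _ _ /= [<- /oppr_inj/eqP]; rewrite eqr_nat eqn_add2r.
by move/eqP => ->.
Qed.

Let sum_pm (F : V -> R) : \sum_(g <- Phi | 0 < cart g al) F g =
  \sum_(g <- posr G Phi xi | 0 < cart g al) F g +
  \sum_(g <- posr G Phi xi | cart g al < 0) F (- g).
Proof.
rewrite (bigID (fun g => g \in posr G Phi xi)) /=; congr (_ + _).
  rewrite /posr big_filter_cond big_seq_cond [RHS]big_seq_cond.
  by apply: eq_bigl => g; rewrite mem_posr; case: (g \in Phi) => //=; rewrite andbC.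
have hp : perm_eq [seq - g | g <- posr G Phi xi] [seq g <- Phi | g \notin posr G Phi xi].
  apply: uniq_perm.
  - by rewrite map_inj_uniq; [apply: pos_uniq | apply: oppr_inj].
  - by rewrite filter_uniq // (rs_uniq rsP).
  move=> g; rewrite mem_filter; apply/mapP/andP => [[c cp ->]|[g1 gP]].
    have cP := pos_root cp; by rewrite (posN hG rsP reg cP) cp (rootN hG rsP cP).
  exists (- g); last by rewrite opprK.
  by rewrite (posN hG rsP reg gP).
transitivity (\sum_(g <- [seq g <- Phi | g \notin posr G Phi xi] | 0 < cart g al) F g).
  by rewrite big_filter_cond; apply: eq_bigl => g; rewrite andbC.
rewrite -(perm_big _ hp) /= big_map; apply: eq_bigl => g.
by rewrite cartNl oppr_gt0.
Qed.

Let w g := cart al g * (cart g al * p%:R + 1 - (neg g)%:R - ((0 < refl al g *d xi)%R)%:R).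

(** The involution sending [g] to [- refl al g] preserves [inv_roots] and the weight, and exchanges
    the two corrections, so both may be taken equal to [neg g]. Passing to positive roots, the first
    term becomes [p] times the Coxeter sum and the rest the height. The [- 2] and the sign come from
    the omitted root [g = al]. *)
Let sum_w : \sum_(g <- inv_roots) w g =
  2 * (p%:R * (h - 2) + htr G Phi xi al - (if al *d xi < 0 then -1 else 1)).
Proof.
have e1 : \sum_(g <- inv_roots) cart al g * ((0 < refl al g *d xi)%R)%:R =
    \sum_(g <- inv_roots) cart al g * (neg g)%:R.
  have ui : uniq inv_roots by rewrite filter_uniq // (rs_uniq rsP).
  have um : uniq [seq - refl al g | g <- inv_roots].
    by rewrite map_inj_uniq // => x y /oppr_inj/(refl_inj hG al0).
  have hp : perm_eq [seq - refl al g | g <- inv_roots] inv_roots.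
    apply: uniq_perm => //.
    suff sub : {subset [seq - refl al g | g <- inv_roots] <= inv_roots}.
      by have [] := uniq_min_size um sub; rewrite ?size_map.
    move=> x /mapP[g /inv_rootsP[gP g1 g2 c]] ->.
    have cr : cart (- refl al g) al = cart g al.
      by rewrite cartNl -(refl_cart2 hG) // (refl_self hG) // (cartNr hG) opprK.
    rewrite /inv_roots mem_filter cr c andbT (rootN hG rsP (rs_refl rsP alP gP)) andbT.
    apply/eqP => e; move: g1; rewrite -(refl_inv hG g al0).
    by rewrite -[refl al g]opprK e reflNr (refl_self hG) // opprK eqxx.
  rewrite -[RHS](perm_big _ hp) big_map; apply: eq_bigr => g _.
  rewrite /neg dotNl oppr_lt0 (cartNr hG) (refl_cart2 hG) // (refl_self hG) //.
  by rewrite cartNl opprK.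
pose F g := cart al g * (cart g al * p%:R + 1 - 2 * (neg g)%:R).
have e2 : \sum_(g <- inv_roots) w g = \sum_(g <- inv_roots) F g.
  transitivity (\sum_(g <- inv_roots) cart al g * (cart g al * p%:R + 1) -
     \sum_(g <- inv_roots) cart al g * (neg g)%:R -
     \sum_(g <- inv_roots) cart al g * ((0 < refl al g *d xi)%R)%:R).
    by rewrite -!sumrB; apply: eq_bigr => g _; rewrite /w; ring.
  by rewrite e1 -!sumrB; apply: eq_bigr => g _; rewrite /F; ring.
have e3 : \sum_(g <- Phi | 0 < cart g al) F g = F al + \sum_(g <- inv_roots) F g.
  rewrite (big_rem al) //= (cart_self hG) // ltr0n; congr (_ + _).
  rewrite rem_filter ?(rs_uniq rsP) // big_filter_cond [RHS]big_filter.
  by [].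
have e4 : \sum_(g <- Phi | 0 < cart g al) F g = 2 * h * p%:R + 2 * htr G Phi xi al.
  have split3 (E : V -> R) : (forall g, g \in posr G Phi xi -> cart g al = 0 -> E g = 0) ->
      \sum_(g <- posr G Phi xi) E g = \sum_(g <- posr G Phi xi | 0 < cart g al) E g +
        \sum_(g <- posr G Phi xi | cart g al < 0) E g.
    move=> h0; rewrite (bigID (fun g => 0 < cart g al)) /=; congr (_ + _).
    rewrite (bigID (fun g => cart g al < 0)) /= [X in _ + X]big1_seq ?addr0.
      by apply: eq_bigl => g; case: ltgtP.
    by move=> g /andP[/andP[c1 c2] gp]; apply: h0 => //; move: c1 c2; case: ltgtP.
  rewrite sum_pm -hcox /htr mulrA mulfV ?pnatr_eq0 // mul1r mulr_suml -big_split /=.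
  rewrite split3.
    congr (_ + _); rewrite [LHS]big_seq_cond [RHS]big_seq_cond; apply: eq_bigr => g /andP[/pos_gt0 gp _].
      by rewrite /F /neg ltNge ltW //=; ring.
    by rewrite /F /neg dotNl oppr_lt0 gp cartNl (cartNr hG) /=; ring.
  move=> g gp e; rewrite e mul0r mul0r add0r; apply/eqP.
  by rewrite (cart_eq0C hG) ?(pos_neq0 rsP gp) // e.
rewrite e2; have := e3; rewrite e4 /F (cart_self hG) // /neg => e5.
apply: (@addrI _ (2 * (2 * p%:R + 1 - 2 * ((al *d xi < 0)%R)%:R))).
by rewrite -e5; case: ifP => _ /=; ring.
Qed.

(** The inversions are grouped by class and the local bound is used in each. A class met by [Inv] is
    met by [A] as well, since the weights are positive. *)
Lemma global_count :
  p%:R * (h - 2) + htr G Phi xi al - (if al *d xi < 0 then -1 else 1) <=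
  (\sum_(c <- undup [seq aclass b | b <- A]) (count (fun b => aclass b == c) A).-1)%:R.
Proof.
rewrite -(@ler_pM2l _ 2) ?ltr0n // -sum_w.
have pint : (p%:R : R) \is a Num.int by [].
have loc b : b \in Inv -> \sum_(b' <- Inv | aclass b' == aclass b) cart al b'.1 <=
   2 * ((count (fun b' => aclass b' == aclass b) A).-1)%:R.
  move=> bI; have [q1 q2 q3 q4 _] := invP bI.
  exact: (local_count hG rsP reg hM alP pint al_gt0 q1 q2 q3 q4 uA inv_uniq Adown invP).
have pos b : b \in Inv -> 0 < cart al b.1.
  move=> /allpairsPdep[g [i [/inv_rootsP[gP _ _ c] _ ->]]] /=.
  have g0 := root_neq0 rsP gP.
  by rewrite (cart_gt0 hG) // (dotcomm hG) -(cart_gt0 hG).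
have cls b : b \in Inv -> aclass b \in [seq aclass b | b <- A].
  move=> bI; apply: contraT => nb; have := loc b bI.
  have -> : count (fun b' => aclass b' == aclass b) A = 0%N.
    apply/eqP; rewrite -leqn0 leqNgt -has_count; apply: contra nb => /hasP[b' b'A /eqP <-].
    exact: map_f.
  rewrite mulr0 leNgt => /negP[]; rewrite -big_filter (big_rem b) ?mem_filter ?eqxx //=.
  apply: ltr_wpDr; last exact: pos.
  rewrite big_seq; apply: sumr_ge0 => b' /mem_rem; rewrite mem_filter => /andP[_ /pos/ltW]; exact.
apply: (@le_trans _ _ (\sum_(b <- Inv) cart al b.1)).
  rewrite /Inv big_allpairs_dep /= big_seq [leRHS]big_seq; apply: ler_sum => g gi.
  rewrite big_const_seq count_predT size_iota iter_addr addr0 -mulr_natr.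
  have [gP _ _ c] := inv_rootsP gi; have g0 := root_neq0 rsP gP.
  rewrite /w ler_wpM2l //; first by rewrite ltW // (cart_gt0 hG) // (dotcomm hG) -(cart_gt0 hG).
  rewrite -(truncK gi) -natrM -(natrD _ _ 1) lerBlDr lerBlDr -!natrD ler_nat /ninv; clear; lia.
have -> : \sum_(b <- Inv) cart al b.1 =
    \sum_(c <- undup [seq aclass b | b <- A]) \sum_(b <- Inv | aclass b == c) cart al b.1.
  rewrite (exchange_big_dep xpredT) //= big_seq [RHS]big_seq; apply: eq_bigr => b bI.
  rewrite (eq_bigl (pred1 (aclass b))); last by move=> c; rewrite /= eq_sym.
  by rewrite -big_filter filter_pred1_uniq ?undup_uniq ?mem_undup ?cls // big_seq1.
rewrite natr_sum mulr_sumr big_seq [leRHS]big_seq; apply: ler_sum => c _.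
case: (boolP (has (fun b => aclass b == c) Inv)) => [/hasP[b bI /eqP <-]|/hasPn hn].
  exact: loc.
by rewrite big_seq_cond big1 ?mulr_ge0 // => b /andP[/hn /negbTE ->].
Qed.

End GlobalCount.

(** * Reduction modulo a linear form *)

Section Reduction.
Variables (F : fieldType) (n : nat).
Implicit Types (a c : 'rV[F]_n) (p q : {mpoly F[n]}).

Lemma lf_mod a i p : a 0 i != 0 -> mdvd (lf a) (p - (p \mPo elim_tuple a i)).
Proof.
move=> ai; have : mdvd (lf a) ((p \mPo [tuple 'X_j | j < n]) - (p \mPo elim_tuple a i)).
  apply: mdvd_comp_sub => j; rewrite !tnth_mktuple.
  case: eqP => [->|_]; last by rewrite subrr; apply: mdvd0.
  by rewrite subKr; apply/mdvdZ/mdvd_refl.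
by rewrite comp_mpoly_id.
Qed.

Lemma comp_elim_id a i p : a 0 i != 0 ->
  (p \mPo elim_tuple a i) \mPo elim_tuple a i = p \mPo elim_tuple a i.
Proof.
by move=> ai; apply/esym/subr0_eq; rewrite -comp_mpolyB; apply/lf_dvdP/lf_mod.
Qed.

Lemma comp_elim_lf a i c : lf c \mPo elim_tuple a i = lf (c - (c 0 i / a 0 i) *: a).
Proof.
rewrite comp_lf (eq_bigr (fun j => c 0 j *: 'X_j -
   (if j == i then (c 0 i / a 0 i) *: lf a else 0))).
  by rewrite sumrB linearB linearZ /=; congr (_ - _); rewrite -big_mkcond /= big_pred1_eq.
move=> j _; rewrite tnth_mktuple; case: eqP => [->|_]; last by rewrite subr0.
by rewrite scalerBr scalerA.
Qed.

Lemma comp_elim_self a i : a 0 i != 0 -> lf a \mPo elim_tuple a i = 0.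
Proof. by move=> ai; apply/(lf_dvdP _ ai)/mdvd_refl. Qed.

Lemma mcop_elim a i c c' : a 0 i != 0 ->
  (forall t s, c' != t *: c + s *: a) -> (forall s, c != s *: a) ->
  mcop (lf c \mPo elim_tuple a i) (lf c' \mPo elim_tuple a i).
Proof.
move=> ai h h0; rewrite !comp_elim_lf; apply: lf_cop_lf.
  by rewrite subr_eq0.
move=> t; apply/eqP => e; have /eqP[] := h t (c' 0 i / a 0 i - t * (c 0 i / a 0 i)).
rewrite -[LHS](subrK ((c' 0 i / a 0 i) *: a)) e scalerBr scalerA scalerBl.
by rewrite -addrA; congr (_ + _); rewrite addrC.
Qed.

End Reduction.

(** * The divisor of theta(a) on a hyperplane *)

Section Divisor.
Variables (R : realType) (l n : nat) (G : 'M[R]_l).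
Hypothesis hG : inner_product G.
Local Notation V := 'rV[R]_l.
Local Notation S := {mpoly R[n]}.
Local Notation "u '*d' v" := (dot G u v) (at level 40).
Local Notation cart := (cart G).

Variables (E : 'M[R]_(l, n)) (zeta : 'rV[R]_n).
Hypothesis Einj : forall v t, v *m E = t *: zeta -> v = 0 /\ t = 0.

Definition aff (b : V * R) : 'rV[R]_n := b.1 *m E - b.2 *: zeta.
Definition dap (th : 'rV[S]_l) (a : V) : S := \sum_i a 0 i *: th 0 i.
Definition logd (A : seq (V * R)) th := {in A, forall b, mdvd (lf (aff b)) (dap th b.1)}.

Lemma aff_comb (b c d : V * R) t s : aff b = t *: aff c + s *: aff d ->
  b.1 = t *: c.1 + s *: d.1 /\ b.2 = t * c.2 + s * d.2.
Proof.
move=> e; have [|e1 e2] := @Einj (b.1 - t *: c.1 - s *: d.1) (b.2 - t * c.2 - s * d.2).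
  rewrite !mulmxBl -!scalemxAl !scalerBl; move: e; rewrite /aff !scalerBr !scalerA => e.
  apply/eqP; rewrite -subr_eq0; move/eqP: e; rewrite -subr_eq0; congr (_ == 0).
  by apply/rowP => i; rewrite !mxE; ring.
by split; [move/eqP: e1 | move/eqP: e2]; rewrite -addrA -opprD subr_eq0 => /eqP.
Qed.
Lemma aff_prop (b c : V * R) t : aff b = t *: aff c -> b.1 = t *: c.1 /\ b.2 = t * c.2.
Proof.
move=> e; have [|e1 e2] := @aff_comb b c c t 0; first by rewrite scale0r addr0.
by rewrite e1 e2 scale0r mul0r !addr0.
Qed.
Lemma aff_eq0 b : b.1 != 0 -> aff b != 0.
Proof.
move=> b0; apply/eqP => e; have [|e1 _] := @aff_prop b b 0; first by rewrite scale0r.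
by move: b0; rewrite e1 scale0r eqxx.
Qed.
Lemma dapD th a b : dap th (a + b) = dap th a + dap th b.
Proof. by rewrite /dap -big_split; apply: eq_bigr => i _; rewrite mxE scalerDl. Qed.
Lemma dapZ th t a : dap th (t *: a) = t *: dap th a.
Proof. by rewrite /dap scaler_sumr; apply: eq_bigr => i _; rewrite mxE scalerA. Qed.
Lemma dapN th a : dap th (- a) = - dap th a.
Proof. by rewrite -scaleN1r dapZ scaleN1r. Qed.

Variables (Phi : seq V) (xi : V) (M h : R).
Hypotheses (rsP : root_system G Phi) (reg : regular G Phi xi).
Hypothesis hM : {in Phi, forall a, `|a *d xi| < M}.
Variables (al : V) (p : nat).
Hypotheses (alP : al \in Phi) (al_gt0 : 0 < al *d xi + M * p%:R).
Hypothesis hcox : \sum_(b <- posr G Phi xi) cart b al * cart al b = 2 * h.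
Local Notation fa b := (b.1 *d xi - M * b.2).
Local Notation aclass := (aclass G al p%:R).

Variables (A : seq (V * R)).
Hypotheses (uA : uniq A).
Hypothesis AP : {in A, forall b, [/\ b.1 \in Phi, 0 < fa b & b != (al, - p%:R)]}.
Hypothesis Adown : forall g j (s : seq (V * R)), g \in Phi -> g != al -> g != - al ->
  j \is a Num.int -> 0 < g *d xi - M * j ->
  {in s, forall b, [/\ b.1 \in Phi, b.2 \is a Num.int & 0 < fa b]} ->
  al - g = \sum_(b <- s) b.1 -> - p%:R - j = \sum_(b <- s) b.2 -> (g, j) \in A.

Let al0 : al != 0 := root_neq0 rsP alP.
Let a : V * R := (al, - p%:R).
Let par (b : V * R) := (b.1 == al) || (b.1 == - al).

Let A_cop : {in A &, forall b c, b != c -> mcop (lf (aff b)) (lf (aff c))}.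
Proof.
move=> b c /AP[bP fb _] /AP[cP fc _] bc; apply: lf_cop_lf.
  by rewrite aff_eq0 // (root_neq0 rsP).
move=> t; apply/eqP => /aff_prop[e1 e2].
case: (rs_red rsP bP (t := t)) => [|t1|t1]; first by rewrite -e1.
  move: bc; rewrite [b]surjective_pairing [c]surjective_pairing e1 e2 t1.
  by rewrite scale1r mul1r eqxx.
move: fc; rewrite e1 e2 t1 dotZl mulrCA -mulrBr mulN1r oppr_gt0.
by move/lt_trans/(_ fb); rewrite ltxx.
Qed.

Let cls := undup [seq aclass b | b <- [seq b <- A | ~~ par b]].
Let mlt c := count (fun b => aclass b == c) [seq b <- A | ~~ par b].
(** Hyperplanes parallel to [a] meet it inside [z = 0], which explains the power of [zeta]. Every
    other flat, represented by the form [aff c], counts one less than the number of members of [A]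
    through it. *)
Let B : S := lf zeta ^+ count par A * \prod_(c <- cls) lf (aff c) ^+ (mlt c).-1.

Let aperp0 b : b \in A -> ~~ par b -> (aperp G al p%:R b).1 != 0.
Proof.
move=> /AP[bP _ _]; rewrite negb_or => /andP[b1 b2].
have := aperp_neq0 rsP p%:R alP b.2 bP b1 b2; by rewrite /aperp.
Qed.

Let clsP c : c \in cls -> exists b, [/\ b \in A, ~~ par b & c = aclass b].
Proof.
by rewrite mem_undup => /mapP[b]; rewrite mem_filter => /andP[b1 b2] ->; exists b.
Qed.

Let cls_perp c : c \in cls -> [/\ c.1 != 0, pivot c.1 = 1 & c.1 *d al = 0].
Proof.
move=> /clsP[b [bA bp ->]]; have n0 := aperp0 bA bp; have p0 := pivot_neq0 n0.
split; rewrite /aclass /=.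
- by rewrite scaler_eq0 invr_eq0 negb_or p0.
- by rewrite pivotZ ?invr_eq0 // mulVf.
rewrite dotZl dotBl dotZl /Submission.cart mulrAC mulrC; apply/eqP; rewrite mulf_eq0; apply/orP; left.
by rewrite subr_eq0; apply/eqP; field; rewrite dot_eq0.
Qed.

Lemma aff_aclass b : (aperp G al p%:R b).1 != 0 ->
  aff b = pivot (aperp G al p%:R b).1 *: aff (aclass b) + (cart b.1 al / 2) *: aff a.
Proof.
move=> n0; have p0 := pivot_neq0 n0; rewrite /aff /aclass /=.
set u := pivot _ in p0 *.
rewrite -scalemxAl scalerBr !scalerA mulrA mulfV // scale1r mul1r.
by apply/rowP => i; rewrite mulmxBl -scalemxAl !mxE; ring.
Qed.

Let cls_comb c t s : c \in cls -> aff c != t *: zeta + s *: aff a.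
Proof.
move=> cc; apply/eqP => e; have [|e1 _] := @aff_comb c (0, - t) a 1 s.
  have -> : aff (0, - t) = t *: zeta by rewrite /aff /= mul0mx sub0r scaleNr opprK.
  by rewrite scale1r.
have [c0 _ /eqP] := cls_perp cc; rewrite e1 scaler0 add0r dotZl mulf_eq0 dot_eq0 // (negbTE al0) orbF.
by move=> /eqP s0; move: c0; rewrite e1 s0 scaler0 scale0r addr0 eqxx.
Qed.

(** Modulo [aff a], the form of a root of class [c] is a multiple of [aff c], and that of a parallel
    root a multiple of [zeta]. Divisibility along a whole pencil then forces all but one of the
    factors [aff c] into theta(al), and [global_count] bounds the resulting degree from below. *)
Lemma divisor_mod : exists (Q : S) (d : nat), [/\ Q \is d.-homog,
  mcop (lf (aff a)) Q,
  p%:R * (h - 2) + htr G Phi xi al - (if al *d xi < 0 then -1 else 1) +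
     (count par A)%:R <= d%:R
  & forall th, logd A th -> exists q, mdvd (lf (aff a)) (dap th al - Q * q)].
Proof.
exists B, (count par A + \sum_(c <- cls) (mlt c).-1)%N.
have ha : aff a != 0 by apply: aff_eq0.
have [i ai] := rV_neq0 ha.
have z0 s : zeta != s *: aff a.
  apply/eqP => e; have [|e1 e2] := @aff_prop (0, -1) a s.
    by rewrite -e /aff /= mul0mx sub0r scaleN1r opprK.
  move/esym/eqP: e1; rewrite /= scaler_eq0 (negbTE al0) orbF => /eqP s0.
  by move/eqP: e2; rewrite s0 mul0r /= oppr_eq0 oner_eq0.
split.
- apply: dhomogM; first by rewrite -[X in X.-homog]mul1n; apply: dhomogMn (lf_homog _).
  by apply: homog_prod => c; rewrite -[X in X.-homog]mul1n; apply: dhomogMn (lf_homog _).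
- apply: mcopMr; first by apply/mcop_expr/lf_cop_lf.
  apply: mcop_prodr => c cc; apply/mcop_expr/lf_cop_lf => // t.
  by have := cls_comb 0 t cc; rewrite scale0r add0r.
- rewrite natrD addrC lerD2l.
  apply: (global_count hG rsP reg hM alP al_gt0 hcox (A := [seq b <- A | ~~ par b])).
    by rewrite filter_uniq.
  move=> g j s gP g1 g2 jint g0 hs e1 e2; rewrite mem_filter /par negb_or /= g1 g2 /=.
  exact: (Adown gP g1 g2 jint g0 hs e1 e2).
move=> th hth; pose sg q := q \mPo elim_tuple (aff a) i.
have sgM q r : sg (q * r) = sg q * sg r by rewrite /sg rmorphM.
have sgB q r : sg (q - r) = sg q - sg r by rewrite /sg rmorphB.
have sgX q m : sg (q ^+ m) = sg q ^+ m by rewrite /sg rmorphXn.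
have sgP (I : Type) (r : seq I) (Q : pred I) (f : I -> S) :
  sg (\prod_(j <- r | Q j) f j) = \prod_(j <- r | Q j) sg (f j) by rewrite /sg rmorph_prod.
(* Eliminating a variable turns the congruence modulo [aff a] into plain divisibility, which can be
   checked factor by factor. *)
suff [q eq] : mdvd (sg B) (sg (dap th al)).
  exists q; apply/(lf_dvdP _ ai); rewrite comp_mpolyB -/(sg _) -/(sg _) sgM.
  rewrite -[X in X - _](comp_elim_id _ ai) -/(sg _) -/(sg _) eq sgM.
  by rewrite /(sg _) comp_elim_id // subrr.
have sgd f q : mdvd f q -> mdvd (sg f) (sg q) by case=> r ->; rewrite sgM; exists (sg r).
have sgn0 c : (forall s, c != s *: aff a) -> sg (lf c) != 0.
  by move=> hc; rewrite /sg comp_elim_lf lf_eq0 subr_eq0.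
have prodA (P : pred (V * R)) q : (forall b, b \in A -> P b -> mdvd (lf (aff b)) q) ->
    mdvd (\prod_(b <- A | P b) lf (aff b)) q.
  move=> hq; rewrite -big_filter; apply: mdvd_prod; first by rewrite filter_uniq.
    by move=> b; rewrite mem_filter => /andP[? ?]; apply: hq.
  by move=> b c; rewrite !mem_filter => /andP[_ bA] /andP[_ cA]; apply: A_cop.
rewrite /B sgM sgX sgP; apply: mcop_mul.
- apply: mcop_expl; first exact: sgn0.
  apply: mcop_prodr => c cc; rewrite sgX; apply/mcop_expr/mcop_elim => // t s.
  exact: cls_comb.
(* Every parallel form divides theta(al), and reduces to a multiple of [zeta]. *)
- have /sgd : mdvd (\prod_(b <- A | par b) lf (aff b)) (dap th al).
    apply: prodA => b bA pb; have := hth _ bA; case/orP: pb => /eqP ->; first by [].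
    by rewrite dapN => /mdvdN; rewrite opprK.
  rewrite sgP; apply: mdvd_trans.
  have -> : sg (lf zeta) ^+ count par A = \prod_(b <- A | par b) sg (lf zeta).
    by rewrite big_const_seq iter_mulr_1.
  elim/big_ind2: _ => [|x1 x2 y1 y2 h1 h2|b]; first exact: mdvd_refl.
    exact: mdvd_mul.
  move=> pb; have [t et] : exists t, b.1 = t *: al.
    by case/orP: pb => /eqP ->; [exists 1; rewrite scale1r | exists (-1); rewrite scaleN1r].
  have -> : aff b = t *: aff a - (b.2 + t * p%:R) *: zeta.
    by rewrite /aff et /=; apply/rowP => j; rewrite -scalemxAl !mxE; ring.
  rewrite linearB !linearZ /= /sg scalerN comp_mpolyB !comp_mpolyZ comp_elim_self //.
  by rewrite scaler0 sub0r; apply/mdvdN/mdvdZ/mdvd_refl.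
apply: mdvd_prod; first exact: undup_uniq.
  move=> c cc; rewrite sgX.
  pose L := [seq b <- A | ~~ par b & aclass b == c].
  have szL : mlt c = size L by rewrite /mlt count_filter -size_filter; congr size; apply: eq_filter => b; rewrite /= andbC.
  have LP b : b \in L -> [/\ b \in A, ~~ par b & aclass b = c].
    by rewrite mem_filter => /andP[/andP[pb /eqP cb] bA].
  have sgL b : b \in L -> exists2 t, t != 0 & sg (lf (aff b)) = t *: sg (lf (aff c)).
    move=> /LP[bA pb cb]; have n0 := aperp0 bA pb.
    exists (pivot (aperp G al p%:R b).1); first exact: pivot_neq0.
    rewrite (aff_aclass n0) cb linearD !linearZ /= /sg comp_mpolyD !comp_mpolyZ.
    by rewrite comp_elim_self // scaler0 addr0.
  case EL: L => [|b1 L1]; first by rewrite szL EL expr0; apply: mdvd1.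
  have b1L : b1 \in L by rewrite EL mem_head.
  have [b1A pb1 cb1] := LP _ b1L.
  (* The combination can be rewritten with any [b] of the class in place of [b1], so all forms of
     the class divide it. Modulo [aff a] it is theta(al) times a single [aff c]. *)
  have pencil : mdvd (\prod_(b <- L) lf (aff b))
      (lf (aff b1) * dap th al - lf (aff a) * dap th b1.1).
    rewrite /L big_filter; apply: prodA => b bA /andP[pb /eqP cb].
    have [|||u [v [u0 e1 e2]]] := @aclassP _ _ G al p%:R b b1; try exact: aperp0.
      by rewrite cb cb1.
    have ef : lf (aff b1) = u^-1 *: (lf (aff b) - v *: lf (aff a)).
      have -> : aff b1 = u^-1 *: (aff b - v *: aff a).
        apply: (scalerI u0); rewrite scalerA mulfV // scale1r /aff e1 e2 /=.
        by apply/rowP => j; rewrite mulmxDl -!scalemxAl !mxE; ring.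
      by rewrite linearZ /= linearB /= linearZ.
    have -> : lf (aff b1) * dap th al - lf (aff a) * dap th b1.1 =
        lf (aff b) * (u^-1 *: dap th al) - (u^-1 *: lf (aff a)) * dap th b.1.
      rewrite ef e1 dapD !dapZ -!mul_mpolyC.
      have hu : (u^-1)%:MP_[n] * u%:MP_[n] = 1 by rewrite -mpolyCM mulVf.
      by rewrite -[lf (aff a) * dap th b1.1 in LHS]mul1r -hu; ring.
    by apply: mdvdB; [apply/mdvdMr/mdvd_refl | apply/mdvdMl/hth].
  have [t t0 et] := sgL _ b1L.
  have := sgd _ _ pencil; rewrite sgB !sgM.
  rewrite (comp_elim_self ai : sg (lf (aff a)) = 0) mul0r subr0 sgP et -scalerAl.
  move=> hp; have sc0 : sg (lf (aff c)) != 0.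
    by apply: sgn0 => s; have := cls_comb 0 s cc; rewrite scale0r add0r.
  apply: (mdvd_cancel sc0); rewrite -exprS szL EL /=.
  have := mdvdZ t^-1 hp; rewrite scalerA mulVf // scale1r; apply: mdvd_trans.
  have -> : sg (lf (aff c)) ^+ (size L1).+1 = \prod_(b <- L) sg (lf (aff c)).
    by rewrite big_const_seq iter_mulr_1 count_predT EL.
  rewrite big_seq [X in mdvd _ X]big_seq.
  elim/big_ind2: _ => [|x1 x2 y1 y2 h1 h2|b /sgL[s _ ->]]; first exact: mdvd_refl.
    exact: mdvd_mul.
  exact/mdvdZ/mdvd_refl.
move=> c c' cc cc' nc; rewrite !sgX; apply/mcop_expr/mcop_expl.
  by apply: sgn0 => s; have := cls_comb 0 s cc; rewrite scale0r add0r.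
apply: mcop_elim => //.
  move=> t s; apply/eqP => /aff_comb[/= e1 e2].
  have [c0 pc oc] := cls_perp cc; have [c0' pc' oc'] := cls_perp cc'.
  have s0 : s = 0.
    move: oc'; rewrite e1 dotDl !dotZl oc mulr0 add0r => /eqP.
    by rewrite mulf_eq0 dot_eq0 // (negbTE al0) orbF => /eqP.
  rewrite s0 scale0r mul0r !addr0 in e1 e2.
  have t1 : t = 1.
    have t0 : t != 0 by apply: contraNneq c0' => t0; rewrite e1 t0 scale0r.
    by move: pc'; rewrite e1 pivotZ // pc mulr1.
  move: nc; rewrite [c]surjective_pairing [c']surjective_pairing e1 e2 t1.
  by rewrite scale1r mul1r eqxx.
by move=> s; have := cls_comb 0 s cc; rewrite scale0r add0r.
Qed.
End Divisor.

Lemma span_size (R : fieldType) (V : lmodType R) (s B : seq V) : uniq s ->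
  (forall c : V -> R, \sum_(a <- s) c a *: a = 0 -> {in s, forall a, c a = 0}) ->
  {in s, forall a, exists t : V -> R, a = \sum_(b <- B) t b *: b} ->
  (size s <= size B)%N.
Proof.
move=> us fs sB; rewrite leqNgt; apply/negP => lt.
have [C hC] : exists C : 'M[R]_(size s, size B), forall i : 'I_(size s),
    s`_i = \sum_(j < size B) C i j *: B`_j.
  have /fin_all_exists[t ht] (i : 'I_(size s)) : exists t : V -> R, s`_i = \sum_(b <- B) t b *: b.
    by apply: sB; apply: mem_nth.
  exists (\matrix_(i, j) t i B`_j) => i; rewrite ht (big_nth 0) big_mkord.
  by apply: eq_bigr => j _; rewrite mxE.
have : kermx C != 0.
  rewrite -mxrank_eq0 mxrank_ker subn_eq0 -ltnNge.
  by apply: leq_ltn_trans lt; apply: rank_leq_col.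
case/rowV0Pn => v /sub_kermxP vC v0.
pose c (a : V) : R := if insub (index a s) is Some i then v 0 i else 0.
have cE (i : 'I_(size s)) : c s`_i = v 0 i.
  rewrite /c index_uniq // ?ltn_ord //; case: insubP => [j _ e|]; last by rewrite ltn_ord.
  by congr (v 0 _); apply: val_inj.
have : \sum_(a <- s) c a *: a = 0.
  rewrite (big_nth 0) big_mkord.
  rewrite (eq_bigr (fun i : 'I_(size s) => \sum_(j < size B) (v 0 i * C i j) *: B`_j)).
    rewrite exchange_big big1 //= => j _; rewrite -scaler_suml.
    by move/rowP: vC => /(_ j); rewrite !mxE => ->; rewrite scale0r.
  by move=> i _; rewrite cE hC scaler_sumr; apply: eq_bigr => j _; rewrite scalerA.
move/fs => h; move/eqP: v0; apply; apply/rowP => i; rewrite mxE -cE; apply: h.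
exact: mem_nth.
Qed.

(** * Dynkin forests and roots of equal height *)

Section Forest.
Variables (R : realType) (l : nat) (G : 'M[R]_l).
Hypothesis hG : inner_product G.
Local Notation V := 'rV[R]_l.
Local Notation "u '*d' v" := (dot G u v) (at level 40).
Local Notation cart := (cart G).
Local Notation refl := (refl G).
Variables (Phi : seq V) (xi : V).
Hypotheses (rsP : root_system G Phi) (reg : regular G Phi xi).
Local Notation pos := (posr G Phi xi).
Local Notation sim := (simr G Phi xi).

(** The sum [u] of the normalized roots has positive square. An adjacent pair has a product of
    Cartan integers at least 1, hence contributes at most [- 1/2] in each order. So there are fewer
    than [2 * size s] ordered adjacent pairs: fewer edges than vertices. *)
Lemma forest (s : seq V) : uniq s -> {subset s <= sim} -> s != [::] ->
  (\sum_(a <- s) count (fun b => (b != a) && (a *d b != 0)%R) s < 2 * size s)%N.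
Proof.
move=> us sS s0; pose nr (a : V) := Num.sqrt (a *d a).
have sp a : a \in s -> a \in pos by move=> /sS/sim_pos.
have sn a : a \in s -> a != 0 by move=> /sp/(pos_neq0 rsP).
have n0 a : a \in s -> 0 < nr a by move=> /sn h; rewrite sqrtr_gt0 dot_gt0.
have nn a : nr a ^+ 2 = a *d a by rewrite sqr_sqrtr // dot_ge0.
pose u := \sum_(a <- s) (nr a)^-1 *: a.
have u0 : 0 < u *d u.
  apply: (dot_gt0 hG); suff : 0 < u *d xi by apply: contraTneq => ->; rewrite dot0l ltxx.
  rewrite dot_suml; case: s s0 sp n0 {us sS sn u} => // a s _ sp n0.
  rewrite big_cons; apply: ltr_wpDr; last first.
    rewrite dotZl mulr_gt0 ?invr_gt0 ?n0 ?mem_head //.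
    by apply: (@pos_gt0 _ _ G Phi); apply: sp; rewrite mem_head.
  rewrite big_seq; apply: sumr_ge0 => b bs; rewrite dotZl ltW // mulr_gt0 ?invr_gt0 ?n0 ?in_cons ?bs ?orbT //.
  by apply: (@pos_gt0 _ _ G Phi); apply: sp; rewrite in_cons bs orbT.
have key a b : a \in s -> b \in s -> b != a ->
    (nr a)^-1 * ((nr b)^-1 * (a *d b)) <= - 2^-1 * ((a *d b != 0)%R : nat)%:R.
  move=> as_ bs ba; have [a0 b0] := (n0 _ as_, n0 _ bs).
  case: (eqVneq (a *d b) 0) => [->|ab0]; first by rewrite !mulr0.
  have le0 : a *d b <= 0 by apply: (sim_obtuse hG rsP reg); rewrite ?sS // eq_sym.
  have lt0 : a *d b < 0 by rewrite lt_neqAle ab0.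
  rewrite mulr1 mulrA -invfM.
  have aP := pos_root (sp _ as_); have bP := pos_root (sp _ bs).
  have i1 := rs_int rsP aP bP; have i2 := rs_int rsP bP aP.
  have cc : 1 <= cart a b * cart b a.
    have /intrP[m em] : cart a b * cart b a \is a Num.int by apply: rpredM.
    have : 0 < cart a b * cart b a.
      by rewrite nmulr_rgt0 (cart_lt0 hG) ?sn // (dotcomm hG).
    by rewrite em ltr0z ler1z gtz0_ge1.
  have e1 : cart a b * cart b a = 4 * (a *d b) ^+ 2 / (nr a * nr b) ^+ 2.
    by rewrite exprMn !nn /Submission.cart (dotcomm hG b a); field; rewrite !dot_eq0 // !sn.
  have nab : 0 < nr a * nr b by rewrite mulr_gt0.
  have : nr a * nr b <= 2 * - (a *d b).
    rewrite -(@ler_pXn2r _ 2) ?nnegrE ?(ltW nab) //; last by lra.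
    move: cc; rewrite e1 ler_pdivlMr ?exprn_gt0 // mul1r => /le_trans; apply.
    by rewrite exprMn sqrrN -natrX.
  by move=> hh; rewrite mulrC ler_pdivrMr //; lra.
have hu : u *d u <= \sum_(a <- s) (1 - 2^-1 * (count (fun b => (b != a) && (a *d b != 0)%R) s)%:R).
  rewrite dot_suml big_seq [leRHS]big_seq; apply: ler_sum => a as_.
  rewrite dotZl (dot_sumr hG) (bigD1_seq a) //= (dotZr hG) mulrDr; apply: lerD.
    by rewrite -nn expr2 mulKf ?mulVf // gt_eqF // n0.
  rewrite mulr_sumr -sum1_count natr_sum mulr_sumr -sumrN big_mkcondr /=.
  rewrite big_seq_cond [leRHS]big_seq_cond; apply: ler_sum => b /andP[bs ba].
  rewrite (dotZr hG); apply: (le_trans (key a b as_ bs ba)).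
  by case: ifP => _; rewrite ?mulr1 ?mulr0.
have := lt_le_trans u0 hu; rewrite sumrB -mulr_sumr -natr_sum big_const_seq count_predT iter_addr addr0.
rewrite subr_gt0 -ltr_pdivlMl ?invr_gt0 ?ltr0n // invrK -natrM ltr_nat.
by [].
Qed.

Lemma forest_leaf (s : seq V) : uniq s -> {subset s <= sim} -> s != [::] ->
  exists2 a, a \in s & (count (fun b => (b != a) && (a *d b != 0)%R) s <= 1)%N.
Proof.
move=> us sS s0; have := forest us sS s0; apply: contraPP => h; apply/negP; rewrite -leqNgt.
have -> : (2 * size s = \sum_(a <- s) 2)%N by rewrite big_const_seq count_predT iter_addn addn0.
rewrite big_seq [leqRHS]big_seq; apply: leq_sum => a as_.
by rewrite ltnNge; apply/negP => le; apply: h; exists a.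
Qed.

(** Remove a leaf, colour the rest, and give the leaf the colour opposite to that of its only
    neighbour. *)
Lemma bipartite : exists D : pred V,
  {in sim &, forall a b, a != b -> a *d b != 0 -> D a != D b}.
Proof.
suff : forall (m : nat) (s : seq V), size s = m -> uniq s -> {subset s <= sim} ->
    exists D : pred V, {in s &, forall a b, a != b -> a *d b != 0 -> D a != D b}.
  by move=> h; have [||D hD] := h _ sim erefl; [exact: (sim_uniq xi rsP)|by []|exists D].
elim=> [|m IH] s sz us sS; first by exists xpredT; case: s sz {us sS}.
have s0 : s != [::] by case: s sz {us sS}.
have [a as_ ca] := forest_leaf us sS s0.
have [|||D hD] := IH (rem a s); rewrite ?size_rem ?sz ?rem_uniq //.
  by move=> x /mem_rem/sS.
pose D' b := if b == a then ~~ has (fun c => [&& c != a, a *d c != 0 & D c]) s else D b.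
have key b : b \in s -> b != a -> a *d b != 0 -> D b = has (fun c => [&& c != a, a *d c != 0 & D c]) s.
  move=> bs ba ab; apply/idP/hasP => [Db|[c cs /and3P[ca' ac Dc]]].
    by exists b => //; rewrite ba ab Db.
  suff -> : b = c by [].
  apply/eqP; apply: contraTT ca => bc; rewrite -ltnNge.
  rewrite -size_filter; set f := filter _ _.
  have /(uniq_leq_size _) : {subset [:: b; c] <= f}.
    by move=> x; rewrite !inE => /orP[]/eqP->; rewrite mem_filter ?ba ?ab ?ca' ?ac ?bs ?cs.
  by apply; rewrite /= inE bc.
exists D' => b c bs cs bc dbc; rewrite /D'.
case: (eqVneq b a) bc dbc => [->|ba]; case: (eqVneq c a) => [->|ca'] bc dbc.
- by [].
- by rewrite (key c) //; case: has.
- by rewrite (key b) //; [case: has | rewrite (dotcomm hG)].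
by apply: hD; rewrite ?(mem_rem_uniq _ us) ?inE ?ba ?ca'.
Qed.

(** A positive inner product would make the difference of two of them a root vanishing at [xi],
    against regularity; so the family is obtuse. *)
Lemma same_height_free (B : seq V) (t : R) (c : V -> R) : uniq B ->
  {in B, forall b, b \in pos /\ b *d xi = t} ->
  \sum_(b <- B) c b *: b = 0 -> {in B, forall b, c b = 0}.
Proof.
move=> uB hB; apply: (obtuse_free hG (xi := xi)) => //.
  move=> a b aB bB ab; rewrite leNgt; apply/negP => h.
  have [/pos_root aP ea] := hB _ aB; have [/pos_root bP eb] := hB _ bB.
  have := reg (sub_root hG rsP aP bP ab h).
  by rewrite dotBl ea eb subrr eqxx.
by move=> a /hB[/pos_gt0].
Qed.

End Forest.

(** * Lower roots avoid the span of roots of equal height *)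

Section LowerRoots.
Variables (R : realType) (l : nat) (G : 'M[R]_l).
Hypothesis hG : inner_product G.
Local Notation V := 'rV[R]_l.
Local Notation "u '*d' v" := (dot G u v) (at level 40).
Local Notation cart := (cart G).
Local Notation refl := (refl G).
Variables (Phi : seq V) (xi : V).
Hypotheses (rsP : root_system G Phi) (reg : regular G Phi xi).
Local Notation pos := (posr G Phi xi).

Lemma sub_system (Q : V -> Prop) :
  (forall a b, a \in Phi -> b \in Phi -> Q a -> Q b -> Q (refl a b)) ->
  root_system G [seq g <- Phi | `[< Q g >]].
Proof.
move=> hQ; split.
- by rewrite filter_uniq // (rs_uniq rsP).
- by rewrite mem_filter (negbTE (rs_neq0 rsP)) andbF.
- move=> a b; rewrite !mem_filter => /andP[/asboolP qa aP] /andP[/asboolP qb bP].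
  by rewrite (rs_refl rsP aP bP) andbT; apply/asboolP/hQ.
- by move=> a b; rewrite !mem_filter => /andP[_ aP] /andP[_ bP]; apply: (rs_int rsP).
- by move=> a; rewrite mem_filter => /andP[_ aP] t; rewrite mem_filter => /andP[_]; apply: (rs_red rsP).
Qed.

Lemma sub_regular (Q : V -> Prop) : regular G [seq g <- Phi | `[< Q g >]] xi.
Proof. by move=> g; rewrite mem_filter => /andP[_ /reg]. Qed.

Variables (B : seq V) (t : R).
Hypotheses (uB : uniq B) (t_gt0 : 0 < t).
Hypothesis hB : {in B, forall b, b \in pos /\ b *d xi = t}.

Let dotB (c : V -> R) : (\sum_(b <- B) c b *: b) *d xi = t * \sum_(b <- B) c b.
Proof.
rewrite dot_suml mulr_sumr big_seq [RHS]big_seq; apply: eq_bigr => b /hB[_ e].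
by rewrite dotZl e mulrC.
Qed.

Let pos_sub (Q : V -> Prop) g : (g \in posr G [seq g <- Phi | `[< Q g >]] xi) =
  `[< Q g >] && (g \in pos).
Proof. by rewrite !mem_posr mem_filter andbA. Qed.

(** In the system of roots that are integral combinations of [B], positive roots have value at least
    [t], so [B] consists of simple roots and the half sum of positive coroots takes the value
    [\sum c] at [g]. Twice this is an integer because the Cartan numbers of [g] are, and [\sum c]
    lies strictly between 0 and 1. The root [g] itself need not be an integral combination. *)
Let lower_half g (c : V -> R) : g \in pos -> g *d xi < t ->
  g = \sum_(b <- B) c b *: b -> 2 * (g *d xi) = t.
Proof.
move=> gp gt eg; pose Q v := exists z : V -> int, v = \sum_(b <- B) (z b)%:~R *: b.
pose Psi := [seq g <- Phi | `[< Q g >]].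
have rs2 : root_system G Psi.
  apply: sub_system => a b aP bP [za ea] [zb eb].
  have /intrP[m em] := rs_int rsP aP bP.
  exists (fun x => zb x - m * za x); rewrite /Submission.refl em {1}eb {1}ea scaler_sumr -sumrB.
  by apply: eq_bigr => x _; rewrite scalerA -scalerBl intrB intrM.
have rg2 : regular G Psi xi by apply: sub_regular.
have BQ b : b \in B -> Q b.
  move=> bB; exists (fun x => (x == b)%:R); rewrite (bigD1_seq b) //= eqxx scale1r.
  by rewrite big1 ?addr0 // => x /negbTE ->; rewrite scale0r.
have BP b : b \in B -> b \in posr G Psi xi.
  by move=> bB; rewrite pos_sub (hB bB).1 andbT; apply/asboolP/BQ.
have hQ x : x \in posr G Psi xi -> t <= x *d xi.
  move=> xp; have := pos_gt0 xp; move: xp; rewrite pos_sub => /andP[/asboolP[z ->] _].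
  rewrite dotB -rmorph_sum /= pmulr_rgt0 // -{1}[t]mulr1 ler_pM2l //.
  by rewrite ltr0z ler1z gtz0_ge1.
have Bsim b : b \in B -> b \in simr G Psi xi.
  move=> bB; apply/simP; split; first exact: BP.
  move=> x xp; apply/negP => yp; have := hQ _ yp; rewrite dotBl (hB bB).2.
  move=> h2; have := lt_le_trans t_gt0 (hQ _ xp); rewrite ltNge => /negP; apply.
  by move: h2; rewrite lerBrDl gerDr.
have hh : htr G Psi xi g = \sum_(b <- B) c b.
  rewrite {1}eg htr_sum big_seq [RHS]big_seq; apply: eq_bigr => b /Bsim bs.
  by rewrite (htr_sim hG rs2 rg2) // mulr1.
have /intrP[m em] : 2 * htr G Psi xi g \is a Num.int.
  rewrite /htr mulrA mulfV ?pnatr_eq0 // mul1r big_seq rpred_sum // => x.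
  by rewrite pos_sub => /andP[_ /pos_root xP]; apply: (rs_int rsP xP (pos_root gp)).
have et : g *d xi = t * (m%:~R / 2) by rewrite {1}eg dotB -hh -em [2 * _]mulrC mulfK ?pnatr_eq0.
have := pos_gt0 gp; rewrite {1}et pmulr_rgt0 // => m0.
have m1 : (m < 2)%R.
  by move: gt; rewrite et -{2}[t]mulr1 ltr_pM2l // => m2; rewrite -(@ltr_int R); lra.
have {m0} m0 : (0 < m)%R by rewrite -(@ltr_int R); lra.
have e1 : m = 1 by move: m0 m1; clear; lia.
by rewrite et e1; field.
Qed.

(** In the system of roots in the real span of [B], every lower root has value [t / 2], hence is
    simple. A member of [B] is either simple or a sum of two adjacent lower simple roots. By the
    forest property there are fewer such sums than lower simple roots, as there is at least one of
    the latter; so [B] has fewer elements than there are simple roots, although it spans them. *)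
Lemma lower_not_span g (c : V -> R) : g \in pos -> g *d xi < t ->
  g <> \sum_(b <- B) c b *: b.
Proof.
move=> gp gt eg; pose Q v := exists c : V -> R, v = \sum_(b <- B) c b *: b.
pose Psi := [seq g <- Phi | `[< Q g >]].
have rs1 : root_system G Psi.
  apply: sub_system => a b aP bP [za ea] [zb eb].
  rewrite /Submission.refl; move: (cart b a) => k.
  exists (fun x => zb x - k * za x); rewrite {1}eb {1}ea scaler_sumr -sumrB.
  by apply: eq_bigr => x _; rewrite scalerA -scalerBl.
have rg1 : regular G Psi xi by apply: sub_regular.
pose D := simr G Psi xi; pose low (a : V) := a *d xi < t.
have uD : uniq D by apply: sim_uniq rs1.
have half x : x \in posr G Psi xi -> low x -> 2 * (x *d xi) = t.
  by rewrite pos_sub => /andP[/asboolP[c' e] xp] lx; apply: (lower_half xp lx e).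
have low_sim x : x \in posr G Psi xi -> low x -> x \in D.
  move=> xp lx; apply/simP; split=> // y yp; apply/negP => zp.
  have y0 := pos_gt0 yp; have z0 := pos_gt0 zp; have hx := half _ xp lx; move: z0; rewrite dotBl => z0.
  have ly : low y by rewrite /low; move: lx; rewrite /low; lra.
  by have hy := half _ yp ly; lra.
have gPsi : g \in posr G Psi xi by rewrite pos_sub gp andbT; apply/asboolP; exists c.
pose D0 := [seq a <- D | low a]; pose D1 := [seq a <- D | ~~ low a].
have D00 : D0 != [::].
  have : g \in D0 by rewrite mem_filter low_sim // andbT.
  by case: D0.
have szD : (size D0 + size D1 = size D)%N by rewrite /D0 /D1 -size_cat; apply: perm_size; rewrite perm_filterC.
have DB : (size D <= size B)%N.
  apply: span_size => //.
    by move=> d; apply: (sim_free hG rs1 rg1).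
  by move=> a /sim_pos; rewrite pos_sub => /andP[/asboolP].
(* Ordered pairs, so that each edge occurs twice. *)
pose edges := [seq (a, b) | a <- D0, b <- [seq b <- D0 | (b != a) && (a *d b != 0)]].
have uE : uniq edges.
  apply: allpairs_uniq_dep; first by apply: filter_uniq.
    by move=> a _; do 2!apply: filter_uniq.
  by move=> [a b] [a' b'] _ _ /= [-> ->].
have szE : (size edges < 2 * size D0)%N.
  have sD : {subset D0 <= simr G Psi xi} by move=> a; rewrite mem_filter => /andP[].
  have := forest hG rs1 rg1 (filter_uniq _ uD) sD D00; apply: leq_ltn_trans.
  rewrite size_allpairs_dep sumnE big_map; apply: leq_sum => a _.
  by rewrite size_filter.
have mE a b : ((a, b) \in edges) = [&& a \in D0, b \in D0, b != a & a *d b != 0].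
  apply/allpairsPdep/idP => [[x [y [xD]]]|/and4P[aD bD ba ab]].
    by rewrite mem_filter => /andP[/andP[yx xy] yD] [-> ->]; rewrite xD yD yx.
  by exists a, b; rewrite mem_filter ba ab bD.
have Bcase b : b \in B -> b \notin D1 ->
    (2 <= count (fun e => (e.1 + e.2)%R == b) edges)%N.
  move=> bB nb; have [bp eb] := hB bB.
  have bPsi : b \in posr G Psi xi.
    rewrite pos_sub bp andbT; apply/asboolP; exists (fun x => (x == b)%:R).
    rewrite (bigD1_seq b) //= eqxx scale1r big1 ?addr0 // => x /negbTE ->.
    by rewrite scale0r.
  have bD : b \notin simr G Psi xi by move: nb; rewrite mem_filter /low eb ltxx.
  have [a aD sp] := pos_sub_sim hG rs1 rg1 bPsi bD.
  have ap := sim_pos aD; have a0 := pos_gt0 ap; have s0 := pos_gt0 sp.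
  move: (s0); rewrite dotBl eb => s0'.
  have la : low a by rewrite /low; lra.
  have ls : low (b - a) by rewrite /low dotBl eb; lra.
  have aD0 : a \in D0 by rewrite mem_filter la.
  have sD0 : b - a \in D0 by rewrite mem_filter ls; apply: low_sim.
  have ns : b - a != a.
    apply/eqP => e; have eb2 : b = (2 : R) *: a by rewrite scaler_nat mulr2n -{1}e subrK.
    have := pos_scale hG rs1 rg1 ap (t := 2); rewrite -eb2 => /(_ bPsi) e2.
    by have := ler1n R 1; rewrite -{1}e2 => /eqP; lra.
  (* If the summands were orthogonal, the reflection would give the root [b - a - a], whose value at
     [xi] is zero. *)
  have sa0 : a *d (b - a) != 0.
    apply/eqP => e; have rP := rs_refl rs1 (pos_root ap) (pos_root bPsi).
    have er : refl a b = b - a - a.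
      rewrite /Submission.refl; have -> : b = (b - a) + a by rewrite subrK.
      rewrite cartDl (cart_self hG) ?(pos_neq0 rs1 ap) // /Submission.cart (dotcomm hG (b - a)) e.
      by rewrite mulr0 mul0r add0r scaler_nat mulr2n opprD addrA.
    have := rg1 _ rP; rewrite er !dotBl eb; have := half _ ap la => h1 /eqP h2.
    by apply: h2; lra.
  rewrite -size_filter; set f := filter _ _.
  have /(uniq_leq_size _) : {subset [:: (a, b - a); (b - a, a)] <= f}.
    move=> x; rewrite !inE => /orP[]/eqP->; rewrite mem_filter /= mE aD0 sD0 /=.
      by rewrite addrC subrK eqxx ns sa0.
    by rewrite subrK eqxx eq_sym ns (dotcomm hG) sa0.
  by apply; rewrite /= inE xpair_eqE (eq_sym a) (negbTE ns).
suff : (2 * size B < 2 * size B)%N by rewrite ltnn.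
have {1}-> : size B = (count (mem D1) B + count (predC (mem D1)) B)%N by rewrite count_predC.
have c1 : (count (mem D1) B <= size D1)%N.
  rewrite -size_filter; apply: uniq_leq_size; first by rewrite filter_uniq.
  by move=> x; rewrite mem_filter => /andP[].
have c2 : (2 * count (predC (mem D1)) B <= size edges)%N.
  have -> : (2 * count (predC (mem D1)) B = \sum_(b <- B | b \notin D1) 2)%N.
    by rewrite big_const_seq iter_addn addn0 mulnC.
  apply: (@leq_trans (\sum_(b <- B | b \notin D1) \sum_(e <- edges) ((e.1 + e.2)%R == b))).
    rewrite big_seq_cond [leqRHS]big_seq_cond; apply: leq_sum => b /andP[bB nb].
    by apply: leq_trans (Bcase b bB nb) _; rewrite -sum1_count big_mkcond; apply: leq_sum => e _; case: eqP.
  rewrite exchange_big /= -[leqRHS]sum1_size; apply: leq_sum => e _.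
  rewrite -big_mkcondr /= sum1_count.
  apply: (@leq_trans (count_mem (e.1 + e.2) B)); last by rewrite count_uniq_mem // leq_b1.
  by apply: sub_count => b /= /andP[_]; rewrite eq_sym.
have := leq_ltn_trans _ szE; move: DB szD c1 c2 szE; clear; lia.
Qed.

End LowerRoots.

(** * Saito's criterion *)

Section Saito.
Variables (R : realType) (l n : nat).
Local Notation V := 'rV[R]_l.
Local Notation S := {mpoly R[n]}.
Implicit Types (th : 'rV[S]_l) (Th : 'M[S]_l) (Fs : seq (V * S)).

Lemma dap_mulmx q (c : 'M[S]_(q, l)) Th a i :
  dap (row i (c *m Th)) a = \sum_j c i j * dap (row j Th) a.
Proof.
rewrite /dap; under eq_bigr do rewrite !mxE scaler_sumr.
rewrite exchange_big; apply: eq_bigr => j _ /=; rewrite mulr_sumr.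
by apply: eq_bigr => t _; rewrite !mxE scalerAr.
Qed.

Lemma dap_col th a : dap th a = (th *m (map_mx (@mpolyC n R) a)^T) 0 0.
Proof. by rewrite mxE; apply: eq_bigr => i _; rewrite !mxE -mul_mpolyC mulrC. Qed.

Lemma dap_add th th' a : dap (th + th') a = dap th a + dap th' a.
Proof. by rewrite /dap -big_split; apply: eq_bigr => i _; rewrite mxE scalerDr. Qed.
Lemma dap_scale (p : S) th a : dap (p *: th) a = p * dap th a.
Proof. by rewrite /dap mulr_sumr; apply: eq_bigr => i _; rewrite mxE scalerAr. Qed.
Lemma dap_homog th a d : (forall i, th 0 i \is d.-homog) -> dap th a \is d.-homog.
Proof. by move=> h; apply: rpred_sum => i _; apply/rpredZ/h. Qed.

(** Each form comes with the polynomial that has to divide its value. Powers of linear forms are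
    possible, which covers multiarrangements. *)
Definition lsub Fs th := {in Fs, forall c, mdvd c.2 (dap th c.1)}.

(** The adjugate applied to the column of values at [a] gives the determinant times the coordinates
    of [a], one of which is a nonzero constant. *)
Lemma det_dvd Th (a : V) f : a != 0 -> (forall i, mdvd f (dap (row i Th) a)) ->
  mdvd f (\det Th).
Proof.
move=> /rV_neq0[i0 ai] h.
have e : \adj Th *m (Th *m (map_mx (@mpolyC n R) a)^T) = \det Th *: (map_mx (@mpolyC n R) a)^T.
  by rewrite mulmxA mul_adj_mx mul_scalar_mx.
have [q eq] : mdvd f (\det Th * (a 0 i0)%:MP).
  move/matrixP: e => /(_ i0 0); rewrite [RHS]mxE [X in _ = _ * X]mxE [X in _ = _ * X]mxE => <-.
  rewrite mxE; apply: mdvd_sum => j _; apply: mdvdMl; have := h j.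
  rewrite dap_col; congr (mdvd f _); rewrite !mxE; apply: eq_bigr => t _.
  by rewrite !mxE.
exists ((a 0 i0)^-1 *: q); rewrite -scalerAr -eq mulrC mul_mpolyC scalerA mulVf //.
by rewrite scale1r.
Qed.

Definition fcop Fs := [/\ uniq Fs, {in Fs, forall c, c.1 != 0} &
  {in Fs &, forall c d, c != d -> mcop c.2 d.2}].

Lemma det_dvd_prod Fs Th : fcop Fs -> (forall i, lsub Fs (row i Th)) ->
  mdvd (\prod_(c <- Fs) c.2) (\det Th).
Proof.
case=> uF nF cF h; apply: mdvd_prod => //.
by move=> c cF'; apply: (det_dvd (nF c cF')) => i; apply: h.
Qed.

Lemma det_homog Th (e : 'I_l -> nat) : (forall i j, Th i j \is (e i).-homog) ->
  \det Th \is (\sum_i e i).-homog.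
Proof.
move=> h; apply: rpred_sum => s _; rewrite rpredMsign.
exact: homog_prod.
Qed.

Lemma saito_det Fs Th (e : 'I_l -> nat) D : fcop Fs -> (forall i, lsub Fs (row i Th)) ->
  (forall i j, Th i j \is (e i).-homog) -> \prod_(c <- Fs) c.2 \is D.-homog ->
  \sum_i e i = D -> exists u, \det Th = u *: \prod_(c <- Fs) c.2.
Proof.
move=> cF hT hh hP eD; have hd := det_dvd_prod cF hT.
have hdet : \det Th \is (D + 0).-homog by rewrite addn0 -eD det_homog.
have [q -> /homog0C[u ->]] := homog_quot hP hdet hd.
by exists u; rewrite mulrC mul_mpolyC.
Qed.

(** By Cramer's rule the coefficients are determinants with one row replaced by [th], over the
    determinant of [Th]. The replaced determinants still have all the required divisors. *)
Lemma saito Fs Th u th : fcop Fs -> (forall i, lsub Fs (row i Th)) -> u != 0 ->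
  \prod_(c <- Fs) c.2 != 0 -> \det Th = u *: \prod_(c <- Fs) c.2 ->
  lsub Fs th -> exists c : 'rV[S]_l, th = c *m Th.
Proof.
move=> cF hT u0 P0 eD hth; set P := \prod_(c <- Fs) c.2 in P0 eD *.
have hq i : exists q, (th *m \adj Th) 0 i = P * q.
  pose Ti : 'M[S]_l := \matrix_(i', j) if i' == i then th 0 j else Th i' j.
  suff -> : (th *m \adj Th) 0 i = \det Ti.
    apply: (det_dvd_prod cF) => j x xF; case: (eqVneq j i) => [ji|ji].
      have -> : row j Ti = th by apply/rowP => t; rewrite !mxE ji eqxx.
      exact: hth.
    have -> : row j Ti = row j Th by apply/rowP => t; rewrite !mxE (negbTE ji).
    exact: hT.
  rewrite (expand_det_row _ i) mxE; apply: eq_bigr => j _; rewrite !mxE eqxx.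
  congr (_ * (_ * \det _)); apply/matrixP => a b; rewrite !mxE.
  by rewrite eq_sym (negbTE (neq_lift _ _)).
have /fin_all_exists[q eq] := hq.
exists (\row_i (u^-1 *: q i)).
have e1 : th *m \adj Th = P *: \row_i q i by apply/rowP => i; rewrite eq !mxE.
have e2 : \det Th *: th = P *: ((\row_i q i) *m Th).
  by rewrite scalemxAl -e1 -mulmxA mul_adj_mx mul_mx_scalar.
apply/rowP => i; apply: (mulfI P0); apply: (scalerI u0).
move/rowP: e2 => /(_ i); rewrite !mxE eD -scalerAl => ->.
rewrite scalerAr; congr (_ * _); rewrite scaler_sumr; apply: eq_bigr => j _.
by rewrite !mxE -scalerAl scalerA mulfV // scale1r.
Qed.

End Saito.

(** * Adding several hyperplanes at once *)

Section MultipleAddition.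
Variables (R : realType) (l n : nat).
Local Notation V := 'rV[R]_l.
Local Notation S := {mpoly R[n]}.
Variables (E : 'M[R]_(l, n)) (zeta : 'rV[R]_n).
Local Notation aff := (aff E zeta).
Local Notation logd := (logd E zeta).

(** For pairwise coprime forms this amounts to being a basis: the determinant is divisible by the
    product of the forms and has the same degree, so it only has to be nonzero. *)
Definition sbasis (A : seq (V * R)) (Th : 'M[S]_l) (e : 'I_l -> nat) := [/\
  forall i, logd A (row i Th), forall i j, Th i j \is (e i).-homog,
  \det Th != 0 & \sum_i e i = size A].

Variables (A bs : seq (V * R)) (Th : 'M[S]_l) (e : 'I_l -> nat) (d : nat).
Local Notation q := (size bs).
Local Notation b_ j := (tnth (in_tuple bs) j).
Variables (B : 'I_q -> S) (c : 'M[R]_(l, q)).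
Hypotheses (sbA : sbasis A Th e) (rc : \rank c = q).
Hypothesis hB : forall i j, mdvd (lf (aff (b_ j))) (dap (row i Th) (b_ j).1 - c i j *: B j).
Hypothesis hc : forall i j, c i j != 0 -> e i = d.
Hypothesis bs0 : {in bs, forall b, aff b != 0}.

(** Constant row operations make row [f j] the only one with a nonzero residue at the [j]-th new
    hyperplane; then row [f j] is multiplied by the new form. Only rows of degree [d] are combined,
    so degrees stay homogeneous. The last clause records that a new row is built from the old row
    and, in degree [d], the rows [f j]; it transports vanishing on a flat. *)
Lemma mat_step : exists (Th' : 'M[S]_l) (f : 'I_q -> 'I_l), [/\ injective f,
  forall j, e (f j) = d,
  sbasis (A ++ bs) Th' (fun i => (e i + (i \in codom f))%N),
  forall j, exists th, row (f j) Th' = lf (aff (b_ j)) *: th &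
  forall (W : 'rV[S]_l -> Prop), W 0 -> (forall x y, W x -> W y -> W (x + y)) ->
     (forall p x, W x -> W (p *: x)) -> forall i, W (row i Th) ->
     (e i = d -> forall j, W (row (f j) Th)) -> W (row i Th')].
Proof.
case: sbA => hA hh hdet hsum.
have [f fi ucQ] : exists2 f : 'I_q -> 'I_l, injective f & rowsub f c \in unitmx.
  have fc : row_full c by rewrite /row_full rc.
  exists (fullrankfun fc); first exact: fullrankfun_inj.
  exact: fullrowsub_unit.
set cQ := rowsub f c in ucQ.
pose Fm : 'M[R]_(q, l) := rowsub f 1%:M.
have FmE i j : Fm i j = (f i == j)%:R by rewrite !mxE.
have FF : Fm *m Fm^T = 1%:M.
  apply/matrixP => i j; rewrite mxE (bigD1 (f i)) //= big1 ?addr0.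
    by rewrite [Fm^T _ _]mxE !FmE eqxx mul1r (inj_eq fi) eq_sym mxE.
  by move=> t ti; rewrite FmE eq_sym (negbTE ti) mul0r.
have Fc : Fm *m c = cQ by rewrite /Fm mul_rowsub_mx mul1mx.
pose U := invmx cQ *m Fm.
have Uc : U *m c = 1%:M by rewrite -mulmxA Fc mulVmx.
(* [U] is a left inverse of [c] that only involves the chosen rows, so [P] carries [c] to the
   indicator matrix [Fm^T] of these rows. *)
pose P := 1%:M - (c - Fm^T) *m U.
have Pc : P *m c = Fm^T by rewrite mulmxBl mul1mx -mulmxA Uc mulmx1 subKr.
have uP : P \in unitmx.
  rewrite -row_free_unit -kermx_eq0; apply/rowV0P => y /sub_kermxP yP.
  have y1 : y *m Fm^T = 0 by rewrite -Pc mulmxA yP mul0mx.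
  have y2 : y = y *m c *m U.
    apply/eqP; rewrite -subr_eq0; apply/eqP; rewrite -[RHS]yP /P mulmxBr mulmx1.
    by rewrite !mulmxA mulmxBr y1 subr0 .
  have : y *m c *m invmx cQ = 0 by rewrite -[LHS]mulmx1 -FF mulmxA -(mulmxA _ (invmx cQ)) -/U -y2.
  move/(congr1 (mulmx^~ cQ)); rewrite mulmxKV // mul0mx => yc.
  by rewrite y2 yc mul0mx.
have ef j : e (f j) = d.
  have [t ct] : exists t, c (f j) t != 0.
    case: (pickP (fun t => c (f j) t != 0)) => [t ct|h0]; first by exists t.
    have r0 : row j cQ = 0 by apply/rowP => t; rewrite !mxE; apply/eqP; rewrite -[_ == _]negbK h0.
    have := congr1 (row j) (mulmxV ucQ); rewrite row_mul r0 mul0mx => /rowP/(_ j).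
    by rewrite !mxE eqxx => /eqP; rewrite eq_sym oner_eq0.
  exact: hc ct.
have UE j i' : U j i' != 0 -> i' \in codom f.
  apply: contraR => ni; rewrite mxE big1 // => t _; rewrite FmE.
  case: eqP => [e1|_]; last by rewrite mulr0.
  by case/negP: ni; rewrite -e1 codom_f.
have Poff i i' : i != i' -> P i i' != 0 -> e i = d /\ i' \in codom f.
  move=> ii; rewrite !mxE (negbTE ii) add0r oppr_eq0 => h.
  have [j] : exists j, (c - Fm^T) i j * U j i' != 0.
    case: (pickP (fun j => (c - Fm^T) i j * U j i' != 0)) => [j hj|h0]; first by exists j.
    by move: h; rewrite big1 ?eqxx // => j _; apply/eqP; rewrite -[_ == _]negbK h0.
  rewrite mulf_eq0 negb_or => /andP[h1 /UE h2]; split=> //.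
  case: (eqVneq (c i j) 0) => [c0|]; last exact: hc.
  move: h1; rewrite 2!mxE c0 sub0r oppr_eq0 mxE FmE; case: (eqVneq (f j) i) => [<- _|_]; first exact: ef.
  by rewrite eqxx.
have Prow j : row (f j) P = row j U.
  rewrite /P linearB /= row1 row_mul linearB /=.
  have -> : row (f j) Fm^T = delta_mx 0 j.
    by apply/rowP => t; rewrite !mxE (inj_eq fi) eq_sym.
  have -> : row (f j) c = row j cQ by apply/rowP => t; rewrite !mxE.
  rewrite mulmxBl -rowE.
  have -> : row j cQ *m U = row j Fm by rewrite -row_mul mulmxA mulmxV // mul1mx.
  by rewrite (_ : row j Fm = delta_mx 0 (f j)) ?subKr //; apply/rowP => t; rewrite !mxE eq_sym.
have PfE j i' : P (f j) i' != 0 -> i' \in codom f.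
  have /rowP/(_ i') := Prow j; rewrite [LHS]mxE [RHS]mxE => ->; exact: UE.
pose g (i : 'I_l) : S := if [pick j | f j == i] is Some j then lf (aff (b_ j)) else 1.
have gf j : g (f j) = lf (aff (b_ j)).
  by rewrite /g; case: pickP => [j' /eqP/fi ->//|/(_ j)]; rewrite eqxx.
have gn i : i \notin codom f -> g i = 1.
  move=> ni; rewrite /g; case: pickP => // j /eqP e1; case/negP: ni.
  by rewrite -e1 codom_f.
have g0 i : g i != 0.
  by rewrite /g; case: pickP => [j _|_]; rewrite ?oner_neq0 // lf_eq0 bs0 // mem_tnth.
pose PS := map_mx (@mpolyC n R) P.
pose Th' := diag_mx (\row_i g i) *m (PS *m Th).
have row' i : row i Th' = g i *: row i (PS *m Th).
  by apply/rowP => j; rewrite [LHS]mxE /Th' mul_diag_mx !mxE.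
have rowP' i : row i (PS *m Th) = \sum_i' (P i i')%:MP *: row i' Th.
  by apply/rowP => j; rewrite summxE !mxE; apply: eq_bigr => t _; rewrite !mxE.
exists Th', f; split=> //.
- split.
  + move=> i b; rewrite mem_cat row' dap_scale => /orP[bA|bb].
      by apply: mdvdMl; rewrite dap_mulmx; apply: mdvd_sum => t _; apply/mdvdMl/hA.
    have [j ej] : exists j, b = b_ j by apply/tnthP.
    rewrite ej; case: (eqVneq i (f j)) => [->|ij].
      by rewrite gf; apply/mdvdMr/mdvd_refl.
    apply: mdvdMl; rewrite dap_mulmx.
    (* The subtracted terms add up to the entry of [P *m c], which is zero away from the row
       [f j]. *)
    have -> : \sum_t PS i t * dap (row t Th) (b_ j).1 =
        \sum_t PS i t * (dap (row t Th) (b_ j).1 - c t j *: B j).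
      rewrite -[LHS]subr0; under [RHS]eq_bigr do rewrite mulrBr.
      rewrite sumrB; congr (_ - _); symmetry.
      transitivity (((P *m c) i j) *: B j).
        rewrite mxE scaler_suml; apply: eq_bigr => t _.
        by rewrite !mxE mul_mpolyC scalerA.
      by rewrite Pc mxE FmE eq_sym (negbTE ij) scale0r.
    by apply: mdvd_sum => t _; apply/mdvdMl/hB.
  + move=> i j; have -> : Th' i j = g i * (PS *m Th) i j by rewrite /Th' mul_diag_mx [LHS]mxE [X in X * _]mxE.
    rewrite addnC; apply: dhomogM.
      case: (boolP (i \in codom f)) => [/codomP[t ->]|ni]; first by rewrite gf lf_homog.
      by rewrite gn // dhomog1.
    rewrite mxE; apply: rpred_sum => t _; rewrite mxE mul_mpolyC.
    case: (eqVneq i t) => [->|it]; first exact: rpredZ.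
    case: (eqVneq (P i t) 0) => [->|Pit]; first by rewrite scale0r rpred0.
    have [ei /codomP[s es]] := Poff _ _ it Pit.
    by apply: rpredZ; rewrite ei -(ef s) -es.
  + rewrite !det_mulmx det_diag !mulf_neq0 //.
      by apply/prodf_neq0 => i _; rewrite mxE.
    rewrite det_map_mx mpolyC_eq0 -unitfE.
    by move: uP; rewrite unitmxE.
  + rewrite big_split /= hsum size_cat; congr (_ + _)%N.
    rewrite -big_mkcond /= sum1_card card_codom // card_ord.
    by [].
- by move=> j; exists (row (f j) (PS *m Th)); rewrite row' gf.
move=> W W0 WD WZ i Wi Wf; rewrite row' rowP'; apply: (WZ).
elim/big_ind: _ => // i' _; case: (eqVneq (P i i') 0) => [->|Pi]; first by rewrite scale0r.
apply: (WZ); case: (eqVneq i i') => [<- //|ii].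
by have [ei /codomP[j ->]] := Poff _ _ ii Pi; apply: Wf.
Qed.

End MultipleAddition.

(** * Affine arrangements and degrees of their divisors *)

Section AffineRoots.
Variables (R : realType) (l n : nat) (G : 'M[R]_l).
Hypothesis hG : inner_product G.
Local Notation V := 'rV[R]_l.
Local Notation S := {mpoly R[n]}.
Local Notation "u '*d' v" := (dot G u v) (at level 40).
Local Notation cart := (cart G).
Variables (E : 'M[R]_(l, n)) (zeta : 'rV[R]_n).
Hypothesis Einj : forall v t, v *m E = t *: zeta -> v = 0 /\ t = 0.
Local Notation aff := (aff E zeta).
Local Notation logd := (logd E zeta).

Variables (Phi : seq V) (xi : V).
Hypotheses (rsP : root_system G Phi) (reg : regular G Phi xi).
Hypothesis sim1 : {in simr G Phi xi, forall a, a *d xi = 1}.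
Local Notation pos := (posr G Phi xi).

Definition ht (a : V) : nat := Num.truncn (a *d xi).

Lemma htE a : a \in pos -> a *d xi = (ht a)%:R.
Proof.
move=> ap; have [m ->] := pos_ncone rsP ap; rewrite /ht.
have -> : (\sum_(s <- simr G Phi xi) (m s)%:R *: s) *d xi = (\sum_(s <- simr G Phi xi) m s)%:R.
  rewrite dot_suml natr_sum big_seq [RHS]big_seq; apply: eq_bigr => s /sim1 e.
  by rewrite dotZl e mulr1.
by rewrite natrK.
Qed.
Lemma ht_gt0 a : a \in pos -> (0 < ht a)%N.
Proof. by move=> ap; rewrite -(ltr0n R) -(htE ap) (pos_gt0 ap). Qed.
Lemma htrE a : a \in Phi -> htr G Phi xi a = a *d xi.
Proof.
have key b : b \in pos -> htr G Phi xi b = b *d xi.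
  move=> bp; have [m ->] := pos_ncone rsP bp.
  rewrite dot_suml htr_sum big_seq [RHS]big_seq; apply: eq_bigr => s ss.
  by rewrite (htr_sim hG rsP reg ss) dotZl sim1.
move=> aP; case: (boolP (a \in pos)) => [/key //|na].
have ap : - a \in pos by rewrite (posN hG rsP reg aP).
have := key _ ap; rewrite dotNl /htr; under eq_bigr do rewrite cartNl.
by rewrite sumrN mulrN => /oppr_inj.
Qed.

(* The hyperplanes b = j z with - (u b) < j <= w b, for b positive. *)
Definition arr (u w : V -> nat) : seq (V * R) :=
  [seq (b, - i%:R) | b <- pos, i <- iota 0 (u b)] ++
  [seq (- b, - i%:R) | b <- pos, i <- iota 1 (w b)].

Lemma mem_arr u w c : reflect
  ((c.1 \in pos /\ exists2 i, (i < u c.1)%N & c.2 = - i%:R) \/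
   (- c.1 \in pos /\ exists2 i, (0 < i <= w (- c.1))%N & c.2 = - i%:R))
  (c \in arr u w).
Proof.
rewrite mem_cat; apply: (iffP orP) => [[]|[]].
- move=> /allpairsPdep[b [i [bp]]]; rewrite mem_iota => /= hi ->; left.
  by split=> //; exists i.
- move=> /allpairsPdep[b [i [bp]]]; rewrite mem_iota => /= hi ->; right.
  by rewrite /= opprK; split=> //; exists i => //; move: hi; rewrite add1n ltnS.
- move=> [cp [i hi ei]]; left; apply/allpairsPdep; exists c.1, i.
  by rewrite mem_iota /= cp hi -ei -surjective_pairing.
move=> [cp [i hi ei]]; right; apply/allpairsPdep; exists (- c.1), i.
by rewrite mem_iota opprK cp add1n ltnS hi -ei -surjective_pairing.
Qed.

Lemma arr_uniq u w : uniq (arr u w).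
Proof.
have up := pos_uniq xi rsP.
rewrite cat_uniq; apply/and3P; split.
- apply: allpairs_uniq_dep => //; first by move=> b _; apply: iota_uniq.
  by move=> [b i] [b' i'] _ _ /= [<- /oppr_inj/eqP]; rewrite eqr_nat => /eqP ->.
- apply/hasPn => c /allpairsPdep[b [i [bp _ ->]]]; apply/negP => /allpairsPdep[b' [i' [bp' _ [eb _]]]].
  by move: bp'; rewrite -eb (pos_negF hG rsP reg bp).
- apply: allpairs_uniq_dep => //; first by move=> b _; apply: iota_uniq.
  by move=> [b i] [b' i'] _ _ /= [/oppr_inj <- /oppr_inj/eqP]; rewrite eqr_nat => /eqP ->.
Qed.

Lemma size_arr u w : size (arr u w) = (\sum_(b <- pos) (u b + w b))%N.
Proof.
rewrite size_cat !size_allpairs_dep !sumnE !big_map -big_split /=.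
by apply: eq_bigr => b _; rewrite !size_iota.
Qed.

Lemma count_par u w al : al \in pos ->
  (u al + w al <= count (fun b => (b.1 == al) || (b.1 == - al)) (arr u w))%N.
Proof.
move=> ap; rewrite -size_filter.
pose L := [seq (al, - i%:R : R) | i <- iota 0 (u al)] ++ [seq (- al, - i%:R : R) | i <- iota 1 (w al)].
have <- : size L = (u al + w al)%N by rewrite size_cat !size_map !size_iota.
apply: uniq_leq_size.
  rewrite cat_uniq !map_inj_uniq ?iota_uniq /=; last first.
  - by move=> i j [/oppr_inj/eqP]; rewrite eqr_nat => /eqP.
  - by move=> i j [/oppr_inj/eqP]; rewrite eqr_nat => /eqP.
  rewrite andbT; apply/hasPn => c /mapP[i _ ->]; apply/negP => /mapP[j _ [e _]].
  by have := pos_negF hG rsP reg ap; rewrite e ap.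
move=> c; rewrite mem_filter mem_cat => /orP[] /mapP[i]; rewrite mem_iota => hi ->.
  by rewrite eqxx /=; apply/mem_arr; left; split=> //=; exists i.
rewrite eqxx orbT /=; apply/mem_arr; right; rewrite /= opprK; split=> //; exists i => //.
Qed.

(** The factor 2 makes [M] dominate even the difference of two root values, so that multiples of [z]
    are compared before heights. *)
Definition bound : R := 2 * \sum_(a <- Phi) `|a *d xi| + 1.
Local Notation M := bound.
Local Notation fa b := (b.1 *d xi - M * b.2).

Lemma bound_lt a : a \in Phi -> 2 * `|a *d xi| < M.
Proof.
move=> aP; rewrite /bound (big_rem a) //= mulrDr -addrA ltrDl.
by rewrite ltr_wpDl // mulr_ge0 // sumr_ge0.
Qed.
Let M0 : 0 < M.
Proof. by rewrite /bound ltr_wpDl // mulr_ge0 // sumr_ge0. Qed.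

Let Mn i : 0 <= M * i%:R.
Proof. by apply: mulr_ge0; [apply: ltW | apply: ler0n]. Qed.

Lemma bound_gt a : a \in Phi -> `|a *d xi| < M.
Proof. by move=> /bound_lt; apply: le_lt_trans; rewrite mulr_natl mulr2n lerDl. Qed.

Lemma pos_aff g j : g \in Phi -> j \is a Num.int -> 0 < g *d xi - M * j ->
  exists2 i : nat, j = - i%:R & (g \in pos) || (0 < i)%N.
Proof.
move=> gP /intrP[m ->] h; have := bound_gt gP; rewrite ltr_norml => /andP[g1 g2].
have m0 : (m <= 0)%R.
  rewrite leNgt; apply/negP => m1; have : (1 : R) <= m%:~R by rewrite ler1z -gtz0_ge1.
  move=> m2; have : M * 1 <= M * m%:~R by rewrite ler_pM2l.
  by rewrite mulr1; lra.
exists `|m|%N; first by rewrite -[m]opprK; case: m m0 {h} => // -[|m] _ //=; rewrite ?oppr0 // NegzE opprK abszN absz_nat mulrNz.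
rewrite absz_gt0 mem_posr gP /=; case: (eqVneq m 0) h => [->|_ _]; last by rewrite orbT.
by rewrite mulr0 subr0 => ->.
Qed.

Lemma arr_pos u w c : c \in arr u w -> c.1 \in Phi /\ 0 < fa c.
Proof.
move=> /mem_arr[[cp [i _ ->]]|[cp [i /andP[i0 _] ->]]].
  split; first exact: pos_root cp.
  by rewrite mulrN opprK ltr_wpDr // (pos_gt0 cp).
have cP : c.1 \in Phi by rewrite -[c.1]opprK (rootN hG rsP) // (pos_root cp).
split=> //; rewrite mulrN opprK; have := bound_gt cP; rewrite ltr_norml => /andP[g1 g2].
have : M * 1 <= M * i%:R by rewrite ler_pM2l // ler1n.
by rewrite mulr1; lra.
Qed.

(* Both divisors come from the same estimate: the roots below (al, -p) in the
   order given by the heights and M are those of the arrangement. *)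
Lemma lower_bound al p g j (s : seq (V * R)) : al \in Phi -> g \in Phi -> g != al ->
  j \is a Num.int -> 0 < g *d xi - M * j ->
  {in s, forall b, [/\ b.1 \in Phi, b.2 \is a Num.int & 0 < fa b]} ->
  al - g = \sum_(b <- s) b.1 -> - p%:R - j = \sum_(b <- s) b.2 ->
  exists i : nat, [/\ j = - i%:R, (g \in pos) || (0 < i)%N, (i <= p)%N,
    i = p -> g *d xi < al *d xi &
    i = p -> exists2 s', {subset s' <= pos} & al - g = \sum_(b <- s') b].
Proof.
move=> alP gP ga jint g0 hs e1 e2; have [i ei hi] := pos_aff gP jint g0.
have s0 : s != [::].
  by apply/eqP => e; move: e1; rewrite e big_nil => /eqP; rewrite subr_eq0 eq_sym (negbTE ga).
have lt : 0 < (al *d xi + M * p%:R) - (g *d xi - M * j).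
  have -> : (al *d xi + M * p%:R) - (g *d xi - M * j) = \sum_(b <- s) fa b.
    by rewrite sumrB -mulr_sumr -e2 -dot_suml -e1 dotBl; ring.
  case: s s0 hs {e1 e2} => // b s _ hs; rewrite big_cons; apply: ltr_wpDr.
    by rewrite big_seq; apply: sumr_ge0 => c cs; have [|_ _ /ltW] := hs c; rewrite ?in_cons ?cs ?orbT.
  by have [|_ _] := hs b; rewrite ?mem_head.
have := bound_lt gP; have := bound_lt alP; rewrite ei in lt => b1 b2.
have [a1 a2] : - `|al *d xi| <= al *d xi /\ al *d xi <= `|al *d xi| by rewrite ler_norm lerNl -normrN ler_norm.
have [c1 c2] : - `|g *d xi| <= g *d xi /\ g *d xi <= `|g *d xi| by rewrite ler_norm lerNl -normrN ler_norm.
exists i; split=> //.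
- rewrite leqNgt; apply/negP => pi.
  have : M * (p%:R + 1) <= M * i%:R by rewrite ler_pM2l // natr1 ler_nat.
  by rewrite mulrDr mulr1; move: lt; rewrite mulrN opprK; lra.
- by move=> ip; move: lt; rewrite ip mulrN opprK; lra.
move=> ip; have z2 : \sum_(b <- s) b.2 = 0 by rewrite -e2 ei ip opprK addrC subrr.
have le0 b : b \in s -> b.2 <= 0.
  by move=> /hs[bP bint fb]; have [m -> _] := pos_aff bP bint fb; rewrite oppr_le0.
have all0 b : b \in s -> b.2 = 0.
  move=> bs; apply/eqP; rewrite eq_le le0 //=.
  move: z2; rewrite (big_rem b) //= => /eqP; rewrite addr_eq0 => /eqP ->.
  by rewrite oppr_ge0 big_seq; apply: sumr_le0 => c /mem_rem/le0.
exists [seq b.1 | b <- s]; last by rewrite big_map.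
move=> x /mapP[b bs ->]; have [bP _] := hs b bs.
by rewrite (all0 b bs) mulr0 subr0 mem_posr bP.
Qed.

Variable h : R.
Hypothesis hcox : {in Phi, forall a, \sum_(b <- pos) cart b a * cart a b = 2 * h}.

(** The flats outside [z = 0] give [k (h - 2) + ht al - 1], and the [2 k] hyperplanes parallel to
    the new one supply the rest. The closure of [J] under lower roots makes the arrangement closed
    downwards in the order of affine roots. *)
Lemma divisor_up k (J : pred V) al : al \in pos -> al \notin J ->
  (forall g s, g \in pos -> {subset s <= pos} -> g != al -> al - g = \sum_(b <- s) b -> g \in J) ->
  exists (Q : S) (d : nat), [/\ Q \is d.-homog, mcop (lf (aff (al, - k%:R))) Q,
    k%:R * h + (ht al)%:R - 1 <= d%:R
  & forall th, logd (arr (fun b => (k + (b \in J))%N) (fun=> k)) th ->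
    exists q, mdvd (lf (aff (al, - k%:R))) (dap th al - Q * q)].
Proof.
move=> ap aJ hJ; have alP := pos_root ap; set A := arr _ _.
have fa0 : 0 < al *d xi + M * k%:R by rewrite ltr_wpDr // (pos_gt0 ap).
have [||Q [d [h1 h2 h3 h4]]] := divisor_mod hG Einj rsP reg bound_gt alP fa0 (hcox alP)
   (arr_uniq (fun b => (k + (b \in J))%N) (fun=> k)).
- move=> b bA; have [bP fb] := arr_pos bA; split=> //; apply: contraTneq bA => ->.
  apply/mem_arr; rewrite /= (negbTE aJ) addn0 (pos_negF hG rsP reg ap) => -[[_ [i hi]]|[]//].
  by move/oppr_inj/eqP; rewrite eqr_nat => /eqP e; rewrite e ltnn in hi.
- move=> g j s gP g1 g2 jint g0 hs e1 e2.
  have [i [ei hi ip _ hp]] := lower_bound alP gP g1 jint g0 hs e1 e2.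
  apply/mem_arr; case: (boolP (g \in pos)) hi => [gp _|gn /= i0].
    left; split=> //; exists i => //=; case: (ltngtP i k) ip => // [ik _|ik _].
      by rewrite (leq_trans ik) // leq_addr.
    have [s' sp es] := hp ik.
    by rewrite (hJ g s') // ik addn1.
  by right; rewrite /= (posN hG rsP reg gP) gn; split=> //; exists i; rewrite // i0.
exists Q, d; split=> //; apply: le_trans h3.
have := count_par (fun b => (k + (b \in J))%N) (fun=> k) ap; rewrite (negbTE aJ) addn0 -/A.
have f0 : (al *d xi < 0) = false by apply/negbTE; rewrite -leNgt (ltW (pos_gt0 ap)).
by rewrite -(ler_nat R) natrD (htrE alP) f0 (htE ap) => hc; lra.
Qed.

(** The new hyperplane [al = (k + 1) z] is the affine root [(- al, - (k + 1))], of height [- ht al];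
    with [2 k + 1] parallel hyperplanes the estimate becomes [(k + 1) h - ht al]. After the change
    of sign the higher roots are the lower ones, hence they have to be present already. *)
Lemma divisor_down k (J : pred V) al : al \in pos -> al \notin J ->
  (forall g, g \in pos -> al *d xi < g *d xi -> g \in J) ->
  exists (Q : S) (d : nat), [/\ Q \is d.-homog, mcop (lf (aff (al, k.+1%:R))) Q,
    k.+1%:R * h - (ht al)%:R <= d%:R
  & forall th, logd (arr (fun=> k.+1) (fun b => (k + (b \in J))%N)) th ->
    exists q, mdvd (lf (aff (al, k.+1%:R))) (dap th al - Q * q)].
Proof.
move=> ap aJ hJ; have alP := pos_root ap; set A := arr _ _.
have nP : - al \in Phi by apply: (rootN hG rsP).
have fa0 : 0 < (- al) *d xi + M * k.+1%:R.
  have := bound_gt nP; rewrite ltr_norml => /andP[g1 g2].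
  have : M * 1 <= M * k.+1%:R by rewrite ler_pM2l // ler1n.
  by rewrite mulr1; lra.
have [||Q [d [h1 h2 h3 h4]]] := divisor_mod hG Einj rsP reg bound_gt nP fa0 (hcox nP)
   (arr_uniq (fun=> k.+1) (fun b => (k + (b \in J))%N)).
- move=> b bA; have [bP fb] := arr_pos bA; split=> //; apply: contraTneq bA => ->.
  apply/mem_arr; rewrite /= opprK (negbTE aJ) addn0 (pos_negF hG rsP reg ap) => -[[]//|[_ [i hi]]].
  by move/oppr_inj/eqP; rewrite eqr_nat => /eqP e; rewrite -e ltnn andbF in hi.
- move=> g j s gP g1 g2 jint g0 hs e1 e2.
  have [i [ei hi ip hlt _]] := lower_bound nP gP g1 jint g0 hs e1 e2.
  apply/mem_arr; case: (boolP (g \in pos)) hi => [gp _|gn /= i0].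
    left; split=> //; exists i => //=; rewrite ltn_neqAle ip andbT; apply/eqP => ik.
    by have := hlt ik; rewrite dotNl; have := pos_gt0 gp; have := pos_gt0 ap; lra.
  have np : - g \in pos by rewrite (posN hG rsP reg gP) gn.
  right; split=> //; exists i => //; rewrite /= i0 /=.
  case: (ltngtP i k.+1) ip => // [ik _|ik _]; first by rewrite (leq_trans _ (leq_addr _ _)).
  by rewrite (hJ _ np) ?ik ?addn1 //; have := hlt ik; rewrite !dotNl; lra.
have ea : aff (- al, - k.+1%:R) = - aff (al, k.+1%:R).
  by rewrite /aff /= mulNmx scaleNr opprB opprK addrC.
exists Q, d; split=> //.
- move=> p hp; have [|r ->] := h2 p; last first.
    by rewrite ea linearN /= mulNr; apply/mdvdN/mdvdMr/mdvd_refl.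
  by rewrite ea linearN /=; case: hp => r ->; exists (- r); rewrite mulrNN.
- apply: le_trans h3.
  have := count_par (fun=> k.+1) (fun b => (k + (b \in J))%N) ap; rewrite (negbTE aJ) addn0 -/A.
  rewrite -(ler_nat R) natrD (htrE nP) dotNl (htE ap) oppr_lt0 ltr0n ht_gt0 //.
  set C := (X in _ -> _ <= _ + X); have -> : C = (count (fun b => (b.1 == al) || (b.1 == - al)) A)%:R.
    by congr (_%:R); apply: eq_count => b; rewrite opprK orbC.
  by rewrite -natr1 => hc; lra.
move=> th /h4[q]; rewrite ea linearN /= dapN => hq; exists (- q).
case: hq => r er; exists r; apply: oppr_inj; rewrite mulrN opprK opprD er mulNr.
by [].
Qed.
End AffineRoots.

(** A point is moved by a large multiple [t] of a direction in the kernel of [M] on which the new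
    form is nonzero; [t] exceeds every ratio at which another form could vanish. *)
Lemma avoid (R : realFieldType) n q (M : 'M[R]_(q, n)) (L : seq 'rV[R]_n) :
  (forall a, a \in L -> ~~ (a <= M)%MS) ->
  exists x : 'cV[R]_n, M *m x = 0 /\ {in L, forall a, (a *m x) 0 0 != 0}.
Proof.
elim: L => [|a L IH] hL; first by exists 0; rewrite mulmx0.
have [|x [Mx hx]] := IH; first by move=> b bL; apply: hL; rewrite in_cons bL orbT.
case: (eqVneq ((a *m x) 0 0) 0) => [ax|ax]; last first.
  by exists x; split=> // b; rewrite in_cons => /orP[/eqP ->|/hx].
have := hL a (mem_head _ _); rewrite submxE => /eqP nz.
have [j yj] : exists j, (a *m cokermx M) 0 j != 0.
  by apply/rV0Pn/eqP.
pose y := col j (cokermx M).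
have My : M *m y = 0 by rewrite /y colE mulmxA mulmx_coker mul0mx.
have ay : (a *m y) 0 0 != 0 by rewrite /y colE mulmxA -colE mxE.
pose t := 1 + \sum_(b <- L) `|(b *m x) 0 0 / (b *m y) 0 0|.
have t0 : 0 < t by rewrite ltr_wpDr ?ltr01 // sumr_ge0.
have E b : (b *m (x + t *: y)) 0 0 = (b *m x) 0 0 + t * (b *m y) 0 0.
  by rewrite mulmxDr -scalemxAr !mxE.
exists (x + t *: y); rewrite mulmxDr -scalemxAr Mx My scaler0 addr0; split=> // b.
rewrite E in_cons => /orP[/eqP ->|bL]; first by rewrite ax add0r mulf_neq0 // gt_eqF.
case: (eqVneq ((b *m y) 0 0) 0) => [->|by0]; first by rewrite mulr0 addr0 hx.
rewrite addr_eq0; apply/eqP => e.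
have : `|(b *m x) 0 0 / (b *m y) 0 0| < t.
  rewrite /t (big_rem b) //= addrCA ltrDl ltr_wpDr ?ltr01 // sumr_ge0 //.
by rewrite e mulNr mulfK // normrN gtr0_norm // ltxx.
Qed.

Lemma fun_of_ord (T : eqType) (R : Type) (x0 : T) (r0 : R) (s : seq T) (d : 'I_(size s) -> R) :
  uniq s -> exists t : T -> R, forall j : 'I_(size s), t (nth x0 s j) = d j.
Proof.
move=> us; exists (fun a => if insub (index a s) is Some i then d i else r0) => i.
rewrite index_uniq // ?ltn_ord //; case: insubP => [j _ e|]; last by rewrite ltn_ord.
by congr d; apply: val_inj.
Qed.

Section ModHomog.
Variables (R : realType) (n : nat).
Local Notation S := {mpoly R[n]}.
(** Eliminating a variable preserves degrees and turns the congruence into an equation, for which a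
    homogeneous quotient exists. *)
Lemma mod_homog (a : 'rV[R]_n) (Q p : S) D e : a != 0 -> Q \is D.-homog ->
  p \is e.-homog -> (exists q, mdvd (lf a) (p - Q * q)) ->
  ((e < D)%N -> mdvd (lf a) p) /\ (forall x, e = (D + x)%N ->
     exists2 q, q \is x.-homog & mdvd (lf a) (p - Q * q)).
Proof.
move=> a0 hQ hp [q hq]; have [i ai] := rV_neq0 a0.
pose sg (f : S) := f \mPo elim_tuple a i.
have th j : tnth (elim_tuple a i) j \is 1.-homog.
  rewrite tnth_mktuple; case: eqP => _; last by rewrite -lf_delta lf_homog.
  by apply: rpredB; [rewrite -lf_delta lf_homog | apply/rpredZ/lf_homog].
have sh f d : f \is d.-homog -> sg f \is d.-homog.
  by move=> hf; rewrite -[d]muln1; apply: homog_comp.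
have es : sg p = sg Q * sg q.
  move/(lf_dvdP _ ai): hq; rewrite comp_mpolyB rmorphM /= => /eqP.
  by rewrite subr_eq0 => /eqP.
have dv : mdvd (sg Q) (sg p) by exists (sg q).
split=> [lt|x ex].
  by apply/(lf_dvdP _ ai)/(homog_dvd_small (sh _ _ hQ) (sh _ _ hp) lt).
have hp' := sh _ _ hp; rewrite ex in hp'.
have [r er hr] := homog_quot (sh _ _ hQ) hp' dv.
exists r => //; apply/(lf_dvdP _ ai); rewrite comp_mpolyB rmorphM /= -/(sg p) -/(sg Q).
by rewrite -[sg p](comp_elim_id _ ai) -/(sg p) er rmorphM /= /sg comp_elim_id // subrr.
Qed.
End ModHomog.

(** * The ladder of height levels *)

Section Ladder.
Variables (R : realType) (l n : nat) (G : 'M[R]_l).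
Hypothesis hG : inner_product G.
Local Notation V := 'rV[R]_l.
Local Notation S := {mpoly R[n]}.
Local Notation "u '*d' v" := (dot G u v) (at level 40).
Local Notation cart := (cart G).
Variables (E : 'M[R]_(l, n)) (zeta : 'rV[R]_n).
Hypothesis Einj : forall v t, v *m E = t *: zeta -> v = 0 /\ t = 0.
Local Notation aff := (aff E zeta).
Local Notation logd := (logd E zeta).
Local Notation sbasis := (sbasis E zeta).
Variables (Phi : seq V) (xi : V).
Hypotheses (rsP : root_system G Phi) (reg : regular G Phi xi).
Hypothesis sim1 : {in simr G Phi xi, forall a, a *d xi = 1}.
Local Notation pos := (posr G Phi xi).
Local Notation ht := (ht G xi).
Local Notation arr := (arr G Phi xi).
Variable h : R.
Hypothesis hcox : {in Phi, forall a, \sum_(b <- pos) cart b a * cart a b = 2 * h}.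
Variables (k kh : nat) (J : seq V).
Hypothesis kh_eq : kh%:R = k%:R * h.
Hypotheses (uJ : uniq J) (Jpos : {subset J <= pos}).
Hypothesis Jlow : forall b g s, b \in J -> g \in pos -> {subset s <= pos} ->
  b - g = \sum_(x <- s) x -> g \in J.

Definition level p := arr (fun b => (k + ((b \in J) && (ht b <= p)))%N) (fun=> k).
(** The excesses of the degrees over [kh] form the partition conjugate to the numbers of roots of
    [J] of each height, up to height [p]. *)
Definition cnt p (e : 'I_l -> nat) := (forall i, (kh <= e i <= kh + p)%N) /\
  forall r, (0 < r <= p)%N -> #|[set i | (kh + r <= e i)%N]| = count (fun b => ht b == r) J.

Lemma fcop_arr u w : fcop [seq (b.1, lf (aff b)) | b <- arr u w].
Proof.
have inj : injective (fun b : V * R => (b.1, lf (aff b))).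
  move=> b c [_ /lf_inj e]; have [|e1 e2] := aff_prop Einj (b := b) (c := c) (t := 1).
    by rewrite scale1r.
  by rewrite [b]surjective_pairing [c]surjective_pairing e1 e2 scale1r mul1r.
split; first by rewrite map_inj_uniq // arr_uniq.
  move=> c /mapP[b bA ->] /=; have [bP _] := arr_pos hG rsP bA.
  exact: (root_neq0 rsP bP).
move=> c d /mapP[b bA ->] /mapP[b' bA' ->] /= ne.
have [bP fb] := arr_pos hG rsP bA; have [bP' fb'] := arr_pos hG rsP bA'.
apply: lf_cop_lf; first by apply: (aff_eq0 Einj); apply: (root_neq0 rsP bP).
move=> t; apply/eqP => /(aff_prop Einj)[e1 e2].
case: (rs_red rsP bP (t := t)) => [|t1|t1]; first by rewrite -e1.
  move: ne; rewrite [b]surjective_pairing [b']surjective_pairing e1 e2 t1.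
  by rewrite scale1r mul1r eqxx.
move: fb'; rewrite e1 e2 t1 dotZl mulrCA -mulrBr mulN1r oppr_gt0.
by move/lt_trans/(_ fb); rewrite ltxx.
Qed.

Lemma logd_lsub A th : logd A th <-> lsub [seq (b.1, lf (aff b)) | b <- A] th.
Proof.
split=> [hA c /mapP[b bA ->]|hA b bA]; first exact: hA.
exact: (hA (b.1, lf (aff b)) (map_f _ bA)).
Qed.

Lemma sbasis_span u w Th e th : sbasis (arr u w) Th e -> logd (arr u w) th ->
  exists c : 'rV[S]_l, th = c *m Th.
Proof.
case=> hT hh hd hs /logd_lsub hth; have fc := fcop_arr u w.
have hT' i : lsub [seq (b.1, lf (aff b)) | b <- arr u w] (row i Th) by apply/logd_lsub/hT.
have hP : \prod_(c <- [seq (b.1, lf (aff b)) | b <- arr u w]) c.2 \is (size (arr u w)).-homog.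
  rewrite big_map -[size _]sum1_size; apply: homog_prod => b; exact: lf_homog.
have [v ev] := saito_det fc hT' hh hP hs.
have [v0 P0] : v != 0 /\ \prod_(c <- [seq (b.1, lf (aff b)) | b <- arr u w]) c.2 != 0.
  by apply/andP; rewrite -negb_or -scaler_eq0 -ev.
exact: saito fc hT' v0 P0 ev hth.
Qed.

Section Step.
Variable p : nat.
Let B := [seq b <- J | ht b == p.+1].
Let bs : seq (V * R) := [seq (b, - k%:R) | b <- B].
Local Notation q := (size bs).
Let szq : q = size B. Proof. by rewrite size_map. Qed.

Let BP b : b \in B -> [/\ b \in pos, b \in J & b *d xi = p.+1%:R].
Proof.
rewrite mem_filter => /andP[/eqP hb bJ]; have bp := Jpos bJ.
by rewrite (htE rsP sim1 bp) hb.
Qed.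

Let bsE (j : 'I_q) : tnth (in_tuple bs) j = (B`_j, - k%:R).
Proof. by rewrite (tnth_nth (0, 0)) (nth_map 0) // -szq ltn_ord. Qed.
Let BjP (j : 'I_q) : B`_j \in B.
Proof. by apply: mem_nth; rewrite -szq. Qed.
Let uB : uniq B. Proof. exact: filter_uniq. Qed.

Let sumB (d : 'I_q -> R) : exists t : V -> R,
  [/\ \sum_j d j *: B`_j = \sum_(b <- B) t b *: b, \sum_j d j = \sum_(b <- B) t b &
    forall j : 'I_q, d j = t B`_j].
Proof.
have [t ht] := fun_of_ord 0 0 (fun j : 'I_(size B) => d (cast_ord (esym szq) j)) uB.
have e j : d j = t B`_j.
  have := ht (cast_ord szq j); rewrite /= => ->; congr d; exact: val_inj.
exists t; split=> //; rewrite [RHS](big_nth 0) big_mkord -szq; apply: eq_bigr => j _; by rewrite e.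
Qed.

(** So the common flat of the new hyperplanes lies in no old one. An old form in their span would be
    [\sum t_b (b + k z)]. If its root is positive, [lower_not_span] gives height at least [p + 1]
    and [\sum t_b >= 1], so a multiple of [z] at least [k], present only for lower roots. If its
    root is negative, the multiple of [z] has the wrong sign. *)
Let not_span c : c \in level p -> ~~ (aff c <= \matrix_(j < q) aff (B`_j, - k%:R))%MS.
Proof.
move=> cA; apply/negP => /submxP[D eD].
have [t [e1 e2 _]] := sumB (fun j => D 0 j).
have [ec1 ec2] : c.1 = \sum_(b <- B) t b *: b /\ c.2 = - (k%:R * \sum_(b <- B) t b).
  have [|x y] := aff_prop Einj (b := c) (c := (\sum_(b <- B) t b *: b, - (k%:R * \sum_(b <- B) t b))) (t := 1).
    rewrite scale1r eD -e1 -e2 [in RHS]/Submission.aff /= mulmx_suml scaleNr opprK mulmx_sum_row.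
    rewrite mulr_sumr scaler_suml -big_split /=; apply: eq_bigr => j _.
    by rewrite rowK /Submission.aff /= scaleNr opprK scalerDr scalerA -scalemxAl [_ * k%:R]mulrC.
  by rewrite x y scale1r mul1r.
have hB : {in B, forall b, b \in pos /\ b *d xi = p.+1%:R} by move=> b /BP[].
have hc : c.1 *d xi = p.+1%:R * \sum_(b <- B) t b.
  rewrite ec1 dot_suml mulr_sumr big_seq [RHS]big_seq; apply: eq_bigr => b /BP[_ _ e].
  by rewrite dotZl e mulrC.
have p0 : (0 : R) < p.+1%:R by rewrite ltr0n.
case/mem_arr: cA => -[cp [i hi ei]].
  have lep : p.+1%:R <= c.1 *d xi.
    by rewrite leNgt; apply/negP => lt; apply: (lower_not_span hG rsP reg uB p0 hB cp lt ec1).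
  have t1 : 1 <= \sum_(b <- B) t b by move: lep; rewrite hc -{1}[p.+1%:R]mulr1 ler_pM2l.
  have nJ : (ht c.1 <= p)%N = false.
    by apply/negbTE; rewrite -ltnNge -(ler_nat R) -(htE rsP sim1 cp).
  move: hi; rewrite nJ andbF addn0 => ik.
  move: ei; rewrite ec2 => /oppr_inj ei.
  have : k%:R <= i%:R :> R by rewrite -ei -{1}[k%:R]mulr1 ler_wpM2l.
  by rewrite ler_nat leqNgt ik.
have c0 := pos_gt0 cp; rewrite dotNl oppr_gt0 hc pmulr_rlt0 // in c0.
move: ei; rewrite ec2 => /oppr_inj ei; case/andP: hi => i0 _.
have : (0 : R) < k%:R * \sum_(b <- B) t b by rewrite ei ltr0n.
by rewrite ltNge mulr_ge0_le0 // ltW.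
Qed.

(** The divisor at a root of height [p + 1] has degree at least [kh + p], the largest degree that
    occurs. So the residues are constant multiples of it and vanish in smaller degrees; as their
    matrix has full rank, [mat_step] applies. *)
Lemma ladder_step Th e : sbasis (level p) Th e -> cnt p e ->
  exists (Th' : 'M[S]_l) (f : 'I_q -> 'I_l), [/\ injective f,
    forall j, e (f j) = (kh + p)%N,
    sbasis (level p.+1) Th' (fun i => (e i + (i \in codom f))%N) /\
    cnt p.+1 (fun i => (e i + (i \in codom f))%N),
    forall j, exists th, row (f j) Th' = lf (aff (B`_j, - k%:R)) *: th &
    forall (W : 'rV[S]_l -> Prop), W 0 -> (forall x y, W x -> W y -> W (x + y)) ->
     (forall r x, W x -> W (r *: x)) -> forall i, W (row i Th) ->
     (e i = (kh + p)%N -> forall j, W (row (f j) Th)) -> W (row i Th')].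
Proof.
move=> sb [ce1 ce2]; have [hT hh hd hs] := sb.
have /fin_all_exists2[Q hQ1 /fin_all_exists[c hc]] : forall j : 'I_q, exists2 Q : S, True &
    exists c : 'I_l -> R, forall i,
     mdvd (lf (aff (B`_j, - k%:R))) (dap (row i Th) B`_j - c i *: Q) /\
     (c i != 0 -> e i = (kh + p)%N).
  move=> j; have [bp bJ eb] := BP (BjP j).
  have hb : ht B`_j = p.+1 by apply/eqP; have := BjP j; rewrite mem_filter => /andP[].
  have nJ : B`_j \notin [pred b | (b \in J) && (ht b <= p)%N] by rewrite inE hb ltnn andbF.
  have [|Q [D [Q1 Q2 Q3 Q4]]] := divisor_up hG Einj rsP reg sim1 hcox k bp nJ.
    move=> g s gp sp gb eg; rewrite inE (Jlow bJ gp sp eg) /=.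
    have : g *d xi < B`_j *d xi.
      rewrite -subr_gt0 -dotBl eg; case: s sp eg => [|x s] sp eg.
        by move/eqP: eg; rewrite big_nil subr_eq0 eq_sym (negbTE gb).
      rewrite big_cons dotDl dot_suml; apply: ltr_wpDr.
        rewrite big_seq; apply: sumr_ge0 => y ys; apply: ltW; apply: (@pos_gt0 _ _ G Phi).
        by apply: sp; rewrite in_cons ys orbT.
      by apply: (@pos_gt0 _ _ G Phi); apply: sp; rewrite mem_head.
    by rewrite (htE rsP sim1 gp) eb ltr_nat ltnS.
  have leD : (kh + p <= D)%N.
    by rewrite -(ler_nat R) natrD kh_eq; apply: le_trans Q3; rewrite hb -natr1; lra.
  exists Q => //.
  have /fin_all_exists[c hc] : forall i : 'I_l, exists c : R,
     mdvd (lf (aff (B`_j, - k%:R))) (dap (row i Th) B`_j - c *: Q) /\ (c != 0 -> e i = (kh + p)%N).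
    move=> i; have hdap : dap (row i Th) B`_j \is (e i).-homog.
      by apply: dap_homog => t; rewrite mxE.
    have a0 : aff (B`_j, - k%:R) != 0.
      by apply: (aff_eq0 Einj); apply: (pos_neq0 rsP bp).
    have [m1 m2] := mod_homog a0 Q1 hdap (Q4 _ (hT i)).
    case: (ltnP (e i) D) => [lt|ge].
      by exists 0; rewrite scale0r subr0 eqxx; split=> //; apply: m1.
    have /andP[_ ei] := ce1 i.
    have eD : e i = (D + 0)%N by apply/eqP; rewrite addn0 eqn_leq ge (leq_trans ei leD).
    have [r /homog0C[v ->] hv] := m2 0%N eD.
    exists v; rewrite mulrC mul_mpolyC in hv; split=> // _.
    by apply/eqP; rewrite eqn_leq ei; apply: leq_trans ge.
  by exists c.
pose cm : 'M[R]_(l, q) := \matrix_(i, j) c j i.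
(* Evaluate at a point of all new hyperplanes that lies on no old one. Constant derivations dual to
   the new roots, multiplied by the product [F] of the old forms, are logarithmic. Their values at
   the new roots form a nonsingular scalar matrix, which factors through [cm]. *)
have rc : \rank cm = q.
  have BmF : row_free (\matrix_(j < q) B`_j).
    rewrite -kermx_eq0; apply/rowV0P => v /sub_kermxP; rewrite mulmx_sum_row => hv.
    have [t [e1 _ e3]] := sumB (fun j => v 0 j).
    apply/rowP => j; rewrite [RHS]mxE e3.
    have hB : {in B, forall b, b \in pos /\ b *d xi = p.+1%:R} by move=> b /BP[].
    apply: (same_height_free hG rsP reg uB hB _ (BjP j)); rewrite -e1 -[RHS]hv.
    by apply: eq_bigr => i _; rewrite rowK.
  have [W BW] := row_freeP BmF.
  have [x [Mx hx]] := @avoid _ _ _ (\matrix_(j < q) aff (B`_j, - k%:R)) [seq aff b | b <- level p]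
     ltac:(by move=> _ /mapP[b bA ->]; apply: not_span).
  pose ev (f : S) : R := f.@[fun i => x i 0].
  have evlf a : ev (lf a) = (a *m x) 0 0 by rewrite /ev meval_lf mxE.
  pose F : S := \prod_(b <- level p) lf (aff b).
  have F0 : ev F != 0.
    rewrite /ev /F rmorph_prod prodf_seq_neq0; apply/allP => b bA /=.
    by rewrite -/(ev _) evlf hx // map_f.
  pose thj (j : 'I_q) : 'rV[S]_l := F *: map_mx (@mpolyC n R) (col j W)^T.
  have dthj j b : dap (thj j) b = ((b *m W) 0 j) *: F.
    rewrite dap_scale /dap mxE scaler_suml mulr_sumr; apply: eq_bigr => t _.
    by rewrite !mxE -mul_mpolyC -mpolyCM mulrC mul_mpolyC.
  have thA j : logd (level p) (thj j).
    move=> b bA; rewrite dthj; apply: mdvdZ; rewrite /F (big_rem b) //=.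
    exact/mdvdMr/mdvd_refl.
  have /fin_all_exists[g hg] : forall j : 'I_q, exists g : 'rV[S]_l, thj j = g *m Th.
    by move=> j; apply: sbasis_span sb (thA j).
  pose Gx : 'M[R]_(q, l) := \matrix_(j, t) ev (g j 0 t).
  have key : Gx *m cm *m diag_mx (\row_j ev (Q j)) = (ev F)%:M.
    apply/matrixP => j i; rewrite mul_mx_diag [LHS]mxE [X in _ * X]mxE.
    have -> : (ev F)%:M j i = ev (dap (thj j) B`_i).
      rewrite dthj /ev mevalZ mxE -/(ev F); have /matrixP/(_ i j) := BW.
      rewrite mxE [RHS]mxE => e4; have -> : (B`_i *m W) 0 j = (i == j)%:R.
        by rewrite -e4 mxE; apply: eq_bigr => t _; rewrite mxE.
      by rewrite mulr_natl eq_sym.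
    have -> : dap (thj j) B`_i = \sum_t g j 0 t * dap (row t Th) B`_i.
      by rewrite -dap_mulmx hg; congr dap; apply/rowP => t; rewrite !mxE.
    rewrite mxE mulr_suml /ev rmorph_sum; apply: eq_bigr => t _ /=.
    rewrite !mxE rmorphM /= -mulrA; congr (_ * _).
    have [[r er] _] := hc i t; have : ev (dap (row t Th) B`_i - c i t *: Q i) = 0.
      rewrite er /ev rmorphM /= -/(ev _) evlf.
      move/matrixP: Mx => /(_ i 0); rewrite !mxE => e4.
      have -> : \sum_j0 aff (B`_i, - k%:R) 0 j0 * x j0 0 = 0.
        by rewrite -[RHS]e4; apply: eq_bigr => s _; rewrite !mxE.
      by rewrite mul0r.
    by rewrite /ev rmorphB /= mevalZ => /eqP; rewrite subr_eq0 => /eqP ->.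
  apply/eqP; rewrite eqn_leq rank_leq_col /=.
  have hr : \rank ((ev F)%:M : 'M_q) = q by rewrite -scalemx1 mxrank_scale_nz // mxrank1.
  apply: (@leq_trans (\rank ((ev F)%:M : 'M_q))); first by rewrite hr.
  by rewrite -key; apply: leq_trans (mxrankM_maxl _ _) (mxrankM_maxr _ _).
have bs0 : {in bs, forall b, aff b != 0}.
  move=> b /mapP[x xB ->]; apply: (aff_eq0 Einj); have [xp _ _] := BP xB.
  exact: (pos_neq0 rsP xp).
have [||Th' [f [f1 f2 f3 f4 f5]]] := @mat_step _ _ _ E zeta (level p) bs Th e (kh + p)%N Q cm sb rc _ _ bs0.
- by move=> i j; rewrite bsE !mxE; have [] := hc j i.
- by move=> i j; rewrite mxE; have [_] := hc j i.
exists Th', f; split=> //; last first.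
- by move=> j; have [th eth] := f4 j; exists th; rewrite eth bsE.
have memA b : b \in level p.+1 -> b \in level p ++ bs.
  move=> /mem_arr[[bp [i hi ei]]|h2]; rewrite mem_cat; last first.
    by apply/orP; left; apply/mem_arr; right.
  case: (boolP ((b.1 \in J) && (ht b.1 == p.+1) && (i == k))) => [/andP[/andP[b1 b2] /eqP ik]|nb].
    apply/orP; right; apply/mapP; exists b.1; first by rewrite mem_filter b2.
    by rewrite -ik -ei -surjective_pairing.
  apply/orP; left; apply/mem_arr; left; split=> //; exists i => //.
  move: hi nb; rewrite [(ht b.1 <= p.+1)%N]leq_eqVlt ltnS.
  case: (b.1 \in J) => //=; case: (ht b.1 == p.+1) => //=.
  rewrite addn1 addnC ltnS leq_eqVlt => /orP[->//|lt _]; exact: leq_trans lt (leq_addl _ _).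
have szA : size (level p.+1) = (size (level p) + size bs)%N.
  rewrite !size_arr szq size_filter.
  have -> : count (fun b => ht b == p.+1) J = (\sum_(b <- pos) ((b \in J) && (ht b == p.+1)))%N.
    rewrite -sum1_count -big_mkcond /= -[RHS]big_filter -[LHS]big_filter.
    have up := pos_uniq xi rsP.
    apply: perm_big; apply: uniq_perm; [exact: filter_uniq|exact: filter_uniq|] => b.
    rewrite !mem_filter; case: (boolP (b \in J)) => bJ; last by rewrite andbF.
    by have := Jpos bJ; rewrite mem_posr => /andP[-> ->]; rewrite !andbT.
  rewrite -big_split /=; apply: eq_bigr => b _.
  move: (ht b) (b \in J) => x y; clear; case: y => /=; last by rewrite !addn0.
  by case: (leqP x p); case: (eqVneq x p.+1); case: (leqP x p.+1) => /= *; lia.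
split.
  case: f3 => g1 g2 g3 g4; split=> //; last by rewrite g4 size_cat szA.
  by move=> i b /memA; apply: g1.
have cf i : i \in codom f -> e i = (kh + p)%N by case/codomP => j ->.
split.
  move=> i; have /andP[i1 i2] := ce1 i; rewrite (leq_trans i1) ?leq_addr //=.
  by case: (i \in codom f); rewrite ?addn1 ?addn0 addnS ?ltnS // leqW.
move=> r /andP[r0]; rewrite leq_eqVlt ltnS => /orP[/eqP ->|rp].
  rewrite -size_filter -/B -szq -[RHS]card_ord -(card_codom f1).
  apply: eq_card => i; rewrite !inE; case: (boolP (i \in codom f)) => hi.
    by rewrite (cf i hi) addn1 addnS leqnn.
  by apply/negbTE; rewrite addn0 -ltnNge addnS ltnS; have /andP[] := ce1 i.
rewrite -ce2 ?r0 //; apply: eq_card => i; rewrite !inE.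
case: (boolP (i \in codom f)) => hi; last by rewrite addn0.
rewrite (cf i hi) leq_add2l rp; apply: leq_trans (leq_addr _ _).
by rewrite leq_add2l.
Qed.
End Step.

(** [vn X] abstracts vanishing on the flat cut out by [X], of which only these closure properties
    matter. The trivial predicate serves when only degrees are of interest. *)
Variables (vn : seq (V * R) -> 'rV[S]_l -> Prop) (good : V * R -> Prop).
Hypotheses (vn0 : forall X, vn X 0)
  (vnD : forall X x y, vn X x -> vn X y -> vn X (x + y))
  (vnZ : forall X r x, vn X x -> vn X (r *: x))
  (vn_aff : forall X c th, c \in X -> vn X (lf (aff c) *: th))
  (vn_sub : forall X Y th, {subset X <= Y} -> vn X th -> vn Y th).
Hypothesis good_new : forall b, b \in J -> good (b, - k%:R).

Definition indep (Q : {set 'I_l}) (c : 'I_l -> V * R) := forall w : 'I_l -> R,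
  (forall i, i \notin Q -> w i = 0) -> \sum_i w i *: (c i).1 = 0 -> forall i, w i = 0.
Definition topset (Q : {set 'I_l}) (e : 'I_l -> nat) :=
  forall i j, i \in Q -> j \notin Q -> (e j <= e i)%N.

Lemma subset_between (T : finType) (Q0 T0 : {set T}) t : Q0 \subset T0 ->
  (#|Q0| <= t <= #|T0|)%N -> exists Q : {set T}, [/\ Q0 \subset Q, Q \subset T0 & #|Q| = t].
Proof.
move=> sQ /andP[t1 t2]; pose s := take (t - #|Q0|) (enum (T0 :\: Q0)).
have us : uniq s by rewrite take_uniq // enum_uniq.
have sz : size s = (t - #|Q0|)%N.
  rewrite size_takel // -cardE cardsD (setIidPr sQ); exact: leq_sub2r.
have sP x : x \in s -> x \in T0 :\: Q0 by move/mem_take; rewrite mem_enum.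
exists (Q0 :|: [set x in s]); split; first exact: subsetUl.
  by rewrite subUset sQ; apply/subsetP => x; rewrite inE => /sP; rewrite inE => /andP[].
rewrite cardsU (_ : Q0 :&: [set x in s] = set0) ?cards0 ?subn0; last first.
  apply/setP => x; rewrite !inE; apply/negbTE/andP => -[x0 /sP].
  by rewrite inE x0.
by rewrite cardsE (card_uniqP us) sz subnKC.
Qed.

(** Accuracy in codimension [t], the form in which it is carried up the ladder. *)
Definition acc p t := exists (Th : 'M[S]_l) (e : 'I_l -> nat) (Q : {set 'I_l}) (c : 'I_l -> V * R),
  [/\ sbasis (level p) Th e, cnt p e, #|Q| = t, topset Q e &
    [/\ indep Q c, forall i, i \in Q -> good (c i) &
       forall i, i \in Q -> vn [seq c i | i in Q] (row i Th)]].
(** Stronger information on the elements of top degree alone: each vanishes on a hyperplane of its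
    own, and these hyperplanes are independent. Any [t] of them give [acc p t]. *)
Definition prim p := exists (Th : 'M[S]_l) (e : 'I_l -> nat) (c : 'I_l -> V * R),
  [/\ sbasis (level p) Th e, cnt p e, indep [set i | e i == (kh + p)%N] c,
    forall i, e i = (kh + p)%N -> good (c i) &
    forall i, e i = (kh + p)%N -> vn [:: c i] (row i Th)].
(** The number of elements of degree [kh + p]; at level 0 all [l] elements have that degree. *)
Definition mtop p := if p is 0 then l else count (fun b => ht b == p) J.

Lemma cnt_top p e : cnt p e -> #|[set i | e i == (kh + p)%N]| = mtop p.
Proof.
case=> h1 h2; case: p h1 h2 => [|p] h1 h2 /=.
  rewrite -[RHS]card_ord -cardsT; congr #|pred_of_set _|; apply/setP => i; rewrite !inE.
  by have := h1 i; rewrite addn0 -eqn_leq eq_sym.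
rewrite -h2 ?leqnn //; congr #|pred_of_set _|; apply/setP => i; rewrite !inE.
by have /andP[_ i2] := h1 i; rewrite eqn_leq i2.
Qed.

Lemma indep_sub (Q Q' : {set 'I_l}) c : Q \subset Q' -> indep Q' c -> indep Q c.
Proof. by move=> sQ h' w hw; apply: h' => i ni; apply: hw; apply: contra ni; apply: (subsetP sQ). Qed.

Lemma prim_acc p t : prim p -> (t <= mtop p)%N -> acc p t.
Proof.
move=> [Th [e [c [sb ce ind gd vc]]]]; rewrite -(cnt_top ce) => lt.
have [|Q [_ sQ cQ]] := @subset_between _ set0 [set i | e i == (kh + p)%N] t (sub0set _).
  by rewrite cards0 lt.
have QT i : i \in Q -> e i = (kh + p)%N by move/(subsetP sQ); rewrite inE => /eqP.
exists Th, e, Q, c; split=> //.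
  by move=> i j /QT -> _; case: ce => /(_ j) /andP[].
split=> [|i /QT/gd //|i iQ]; first exact: indep_sub ind.
apply: (vn_sub _ (vc i (QT i iQ))) => x; rewrite inE => /eqP ->.
by apply: image_f.
Qed.

(** The raised elements are multiples of the new forms, whence [prim]. For [acc], if [t] elements
    fit into the old top degree, they are taken from [prim] so as to contain the raised ones;
    otherwise the old set [Q] already contains the whole old top degree. Either way the rows in [Q]
    are only mixed with rows in [Q], so they still vanish on the flat. *)
Lemma ladder_ind p : prim p -> (forall t, (mtop p < t <= l)%N -> acc p t) ->
  prim p.+1 /\ (forall t, (mtop p.+1 < t <= l)%N -> acc p.+1 t).
Proof.
move=> pp ap; split.
  have [Th [e [c [sb ce _ _ _]]]] := pp.
  have [Th' [f [f1 f2 [f3 f4] f5 _]]] := ladder_step sb ce.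
  set B := [seq b <- J | ht b == p.+1] in f f1 f2 f3 f4 f5 *.
  pose c' i : V * R := if [pick j | f j == i] is Some j then (B`_j, - k%:R) else (0, 0).
  have cf j : c' (f j) = (B`_j, - k%:R).
    by rewrite /c'; case: pickP => [j' /eqP/f1 -> //|/(_ j)]; rewrite eqxx.
  have eT i : (e i + (i \in codom f))%N = (kh + p.+1)%N -> i \in codom f.
    case: (i \in codom f) => // ei; have [/(_ i)/andP[_]] := ce.
    by move: ei; rewrite addn0 => ->; rewrite addnS ltnn.
  have szB : size B = size [seq (b, - k%:R : R) | b <- B] by rewrite size_map.
  have BJ j : (j < size B)%N -> B`_j \in B by apply: mem_nth.
  exists Th', (fun i => e i + (i \in codom f))%N, c'; split=> //.
  - move=> w hw; have hw' i : i \notin codom f -> w i = 0.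
      move=> ni; apply: hw; rewrite inE; apply: contra ni => /eqP; exact: eT.
    rewrite (bigID (mem (codom f))) /= [X in _ + X]big1 ?addr0; last first.
      by move=> i /hw' ->; rewrite scale0r.
    rewrite (eq_bigl (mem [set f j | j in predT])); last first.
      by move=> i; apply/codomP/imsetP => [[j ->]|[j _ ->]]; exists j.
    rewrite big_imset /=; last by move=> x y _ _; apply: f1.
    rewrite (eq_bigr (fun j => w (f j) *: B`_j)); last by move=> j _; rewrite cf.
    have [t ht'] := fun_of_ord 0 0 (fun j : 'I_(size B) => w (f (cast_ord szB j))) (filter_uniq _ uJ).
    have hB : {in B, forall b, b \in pos /\ b *d xi = p.+1%:R}.
      move=> b; rewrite mem_filter => /andP[/eqP hb /Jpos bp].
      by rewrite (htE rsP sim1 bp) hb.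
    have et j : w (f j) = t B`_j.
      have := ht' (cast_ord (esym szB) j) => /= ->; congr (w (f _)); exact: val_inj.
    move=> h0; have h1 : \sum_(b <- B) t b *: b = 0.
      by rewrite -[RHS]h0 (big_nth 0) big_mkord szB; apply: eq_bigr => j _; rewrite et.
    move=> i; case: (boolP (i \in codom f)) => [/codomP[j ->]|/hw' //].
    rewrite et; apply: (same_height_free hG rsP reg (filter_uniq _ uJ) hB h1).
    by apply: BJ; rewrite szB.
  - move=> i /eT/codomP[j ->]; rewrite cf; apply: good_new.
    by have := BJ j; rewrite szB ltn_ord => /(_ isT); rewrite mem_filter => /andP[].
  move=> i /eT/codomP[j ->]; have [th ->] := f5 j; rewrite cf.
  by apply: vn_aff; rewrite inE.
move=> t /andP[mt tl]; case: (leqP t (mtop p)) => [tm|tm].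
  have [Th [e [c [sb ce ind gd vc]]]] := pp.
  have [Th' [f [f1 f2 [f3 f4] f5 f6]]] := ladder_step sb ce.
  have fT : [set i in codom f] \subset [set i | e i == (kh + p)%N].
    by apply/subsetP => i; rewrite !inE => /codomP[j ->]; rewrite f2.
  have cf : #|[set i in codom f]| = mtop p.+1.
    by rewrite cardsE card_codom // card_ord size_map /= size_filter.
  have [|Q [Q1 Q2 cQ]] := subset_between fT (t := t).
    by rewrite cf (cnt_top ce) tm (ltnW mt).
  have QT i : i \in Q -> e i = (kh + p)%N by move/(subsetP Q2); rewrite inE => /eqP.
  have fQ j : f j \in Q by apply: (subsetP Q1); rewrite inE codom_f.
  exists Th', (fun i => e i + (i \in codom f))%N, Q, c; split=> //.
    move=> i j iQ jQ; have /negbTE -> : j \notin codom f.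
      by apply: contra jQ => /codomP[x ->].
    rewrite addn0 (QT i iQ); case: ce => /(_ j) /andP[_ ej] _.
    exact: leq_trans ej (leq_addr _ _).
  have vQ i : i \in Q -> vn [seq c i | i in Q] (row i Th).
    move=> iQ; apply: (vn_sub _ (vc i (QT i iQ))) => x; rewrite inE => /eqP ->.
    by apply: image_f.
  split=> [|i /QT/gd //|i iQ]; first exact: indep_sub ind.
  apply: (f6 (vn [seq c i | i in Q])); [exact: vn0 | exact: vnD | exact: vnZ | exact: vQ |].
  by move=> _ j; apply: vQ.
have [|Th [e [Q [c [sb ce cQ tQ [ind gd vc]]]]]] := ap t; first by rewrite tm tl.
have [Th' [f [f1 f2 [f3 f4] f5 f6]]] := ladder_step sb ce.
have TQ i : e i = (kh + p)%N -> i \in Q.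
  move=> ei; have : ~~ (Q \subset [set i | e i == (kh + p)%N]).
    by apply: contraL tm => /subset_leq_card; rewrite cQ (cnt_top ce) -leqNgt.
  case/subsetPn => x xQ; rewrite inE => nx; apply: contraNT nx => iQ.
  have := tQ _ _ xQ iQ; case: ce => /(_ x)/andP[_ ex] _; rewrite ei => le.
  by rewrite eqn_leq ex le.
exists Th', (fun i => e i + (i \in codom f))%N, Q, c; split=> //.
  move=> i j iQ jQ; have /negbTE -> : j \notin codom f.
    by apply: contra jQ => /codomP[x ->]; apply: TQ; apply: f2.
  by rewrite addn0; apply: leq_trans (tQ _ _ iQ jQ) (leq_addr _ _).
split=> // i iQ; apply: (f6 (vn [seq c i | i in Q])); [exact: vn0 | exact: vnD | exact: vnZ | exact: vc |].
by move=> _ j; apply: vc; apply: TQ; apply: f2.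
Qed.

Lemma arr_ext u u' w w' : {in pos, u =1 u'} -> {in pos, w =1 w'} -> arr u w = arr u' w'.
Proof.
move=> hu hw; rewrite /Submission.arr; congr (_ ++ _); congr flatten; apply/eq_in_map => b bp.
  by rewrite hu.
by rewrite hw.
Qed.

Definition cntJ (e : 'I_l -> nat) := (forall i, (kh <= e i)%N) /\
  forall r, (0 < r)%N -> #|[set i | (kh + r <= e i)%N]| = count (fun b => ht b == r) J.

Theorem ladder (Th0 : 'M[S]_l) (c0 : 'I_l -> V * R) :
  sbasis (arr (fun=> k) (fun=> k)) Th0 (fun=> kh) -> indep setT c0 ->
  (forall i, good (c0 i)) -> (forall i, vn [:: c0 i] (row i Th0)) ->
  forall t, (t <= l)%N ->
  exists (Th : 'M[S]_l) (e : 'I_l -> nat) (Q : {set 'I_l}) (c : 'I_l -> V * R),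
  [/\ sbasis (arr (fun b => (k + (b \in J))%N) (fun=> k)) Th e, cntJ e, #|Q| = t, topset Q e &
    [/\ indep Q c, forall i, i \in Q -> good (c i) &
       forall i, i \in Q -> vn [seq c i | i in Q] (row i Th)]].
Proof.
move=> sb0 ind0 gd0 vc0 t tl.
have p0 : prim 0.
  exists Th0, (fun=> kh), c0; split=> //.
  - rewrite /level (@arr_ext _ (fun=> k) _ (fun=> k)) // => b bp.
    by rewrite leqn0 eqn0Ngt (ht_gt0 rsP sim1 bp) andbF addn0.
  - by split=> [i|r]; rewrite ?addn0 ?leqnn // => /andP[r0]; rewrite leqNgt r0.
  by apply: indep_sub ind0; apply: subsetT.
have key p : prim p /\ (forall t, (mtop p < t <= l)%N -> acc p t).
  elim: p => [|p [IH1 IH2]]; last exact: ladder_ind.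
  by split=> // t' /andP[/= a b]; move: (leq_trans a b); rewrite ltnn.
(* At least every height, so that level [p] is the full arrangement. *)
pose p := (\sum_(b <- pos) ht b)%N.
have hp b : b \in pos -> (ht b <= p)%N by move=> bp; rewrite /p (big_rem b) //= leq_addr.
have [k1 k2] := key p.
have [Th [e [Q [c [sb [ce1 ce2] cQ tQ hQ]]]]] : acc p t.
  by case: (leqP t (mtop p)) => [|tm]; [exact: prim_acc | apply: k2; rewrite tm tl].
exists Th, e, Q, c; split=> //.
  move: sb; rewrite /level (@arr_ext _ (fun b => (k + (b \in J))%N) _ (fun=> k)) // => b bp.
  by rewrite hp // andbT.
split=> [i|r r0]; first by have /andP[] := ce1 i.
case: (leqP r p) => rp; first by apply: ce2; rewrite r0.
have -> : count (fun b => ht b == r) J = 0%N.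
  apply/eqP; rewrite -leqn0 leqNgt -has_count; apply/hasPn => b /Jpos/hp le.
  by rewrite neq_ltn (leq_ltn_trans le rp).
apply/eqP; rewrite cards_eq0; apply/eqP/setP => i; rewrite !inE; apply/negbTE.
by rewrite -ltnNge; have /andP[_ i2] := ce1 i; apply: leq_ltn_trans i2 _; rewrite ltn_add2l.
Qed.

End Ladder.

(** * Reflections acting on polynomials and derivations *)

Section Action.
Variables (R : realType) (l : nat) (G : 'M[R]_l).
Hypothesis hG : inner_product G.
Local Notation V := 'rV[R]_l.
Local Notation S := {mpoly R[l]}.
Local Notation "u '*d' v" := (dot G u v) (at level 40).
Local Notation cart := (cart G).
Local Notation refl := (refl G).

Definition sact (a : V) (p : S) : S := p \mPo [tuple lf (refl a (delta_mx 0 i)) | i < l].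
(** The conjugate of the derivation by the reflection in [a], given by its values at the
    coordinates. *)
Definition act (a : V) (th : 'rV[S]_l) : 'rV[S]_l :=
  \row_i sact a (dap th (refl a (delta_mx 0 i))).

Lemma sactB a p q : sact a (p - q) = sact a p - sact a q.
Proof. by rewrite /sact rmorphB. Qed.
Lemma sactM a p q : sact a (p * q) = sact a p * sact a q.
Proof. by rewrite /sact rmorphM. Qed.
Lemma sactX a p m : sact a (p ^+ m) = sact a p ^+ m.
Proof. by rewrite /sact rmorphXn. Qed.
Lemma sactZ a c p : sact a (c *: p) = c *: sact a p.
Proof. by rewrite /sact comp_mpolyZ. Qed.
Lemma sact0 a : sact a 0 = 0.
Proof. by rewrite /sact comp_mpoly0. Qed.
Lemma sactN a p : sact a (- p) = - sact a p.
Proof. by rewrite -sub0r sactB sact0 sub0r. Qed.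
Lemma sact_sum a (I : Type) (r : seq I) (F : I -> S) :
  sact a (\sum_(i <- r) F i) = \sum_(i <- r) sact a (F i).
Proof. by rewrite /sact rmorph_sum. Qed.
Lemma sact_lf a g : sact a (lf g) = lf (refl a g).
Proof.
rewrite /sact comp_lf {2}(row_sum_delta g) !linear_sum; apply: eq_bigr => i _.
by rewrite tnth_mktuple !linearZ.
Qed.
Lemma sact_X a i : sact a 'X_i = lf (refl a (delta_mx 0 i)).
Proof. by rewrite -lf_delta sact_lf. Qed.
Lemma mpoly_ext (T : nzRingType) (f g : S -> T) : {morph f : p q / p + q} -> {morph g : p q / p + q} ->
  {morph f : p q / p * q} -> {morph g : p q / p * q} -> (forall c, f c%:MP = g c%:MP) ->
  (forall i, f 'X_i = g 'X_i) -> forall p, f p = g p.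
Proof.
move=> fD gD fM gM fC gX p; elim/mpolyind: p => [|c m p _ _ IH].
  by rewrite -mpolyC0 fC.
rewrite fD gD IH -mul_mpolyC fM gM fC mpolyXE_id; congr (_ * _ + _).
apply: (big_ind (fun q => f q = g q)); first by rewrite -mpolyC1 fC.
  by move=> x y hx hy; rewrite fM gM hx hy.
move=> i _; elim: (m i) => [|t IHt]; first by rewrite !expr0 -mpolyC1 fC.
by rewrite !exprS fM gM gX IHt.
Qed.
Lemma sactD a p q : sact a (p + q) = sact a p + sact a q.
Proof. by rewrite /sact rmorphD. Qed.
Lemma sactC a c : sact a c%:MP = c%:MP.
Proof. by rewrite /sact comp_mpolyC. Qed.
Lemma sactK a p : a != 0 -> sact a (sact a p) = p.
Proof.
move=> a0; apply: (@mpoly_ext S (fun p => sact a (sact a p)) id) => //=.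
- by move=> x y; rewrite !sactD.
- by move=> x y; rewrite !sactM.
- by move=> c; rewrite !sactC.
by move=> i; rewrite sact_X sact_lf refl_inv // lf_delta.
Qed.
Lemma sact_conj a b p : a != 0 ->
  sact (refl a b) p = sact a (sact b (sact a p)).
Proof.
move=> a0; apply: (@mpoly_ext S (sact (refl a b)) (fun p => sact a (sact b (sact a p)))).
- by move=> x y; rewrite !sactD.
- by move=> x y; rewrite !sactD.
- by move=> x y; rewrite !sactM.
- by move=> x y; rewrite !sactM.
- by move=> c; rewrite !sactC.
by move=> i; rewrite !sact_X !sact_lf (refl_refl hG).
Qed.
Lemma sact_homog a p d : p \is d.-homog -> sact a p \is d.-homog.
Proof.
move=> hp; rewrite -[d]muln1; apply: homog_comp => // i.
by rewrite tnth_mktuple lf_homog.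
Qed.
Lemma sact_sub a p : mdvd (lf a) (p - sact a p).
Proof.
have : mdvd (lf a) ((p \mPo [tuple 'X_j | j < l]) - sact a p).
  apply: mdvd_comp_sub => j; rewrite !tnth_mktuple -lf_delta /Submission.refl linearB linearZ /=.
  by rewrite subKr; apply/mdvdZ/mdvd_refl.
by rewrite comp_mpoly_id.
Qed.
Lemma sact_dvd a f p : mdvd f p -> mdvd (sact a f) (sact a p).
Proof. by case=> q ->; rewrite sactM; exists (sact a q). Qed.

Lemma dap_sum (I : Type) (r : seq I) (c : I -> R) (v : I -> V) (th : 'rV[S]_l) :
  dap th (\sum_(i <- r) c i *: v i) = \sum_(i <- r) c i *: dap th (v i).
Proof.
elim: r => [|x r IH]; last by rewrite !big_cons dapD dapZ IH.
by rewrite !big_nil -[0](scale0r 0) dapZ scale0r.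
Qed.
Lemma dap_delta (th : 'rV[S]_l) i : dap th (delta_mx 0 i) = th 0 i.
Proof.
rewrite /dap (bigD1 i) //= big1 ?addr0 => [|j ji]; first by rewrite mxE !eqxx scale1r.
by rewrite mxE (negbTE ji) andbF scale0r.
Qed.

Lemma dap_act a th g : dap (act a th) g = sact a (dap th (refl a g)).
Proof.
rewrite {2}(row_sum_delta g) linear_sum /=.
under eq_bigr do rewrite linearZ.
rewrite dap_sum sact_sum /dap; apply: eq_bigr => i _.
by rewrite mxE sactZ.
Qed.
Lemma dap_inj (th th' : 'rV[S]_l) : (forall g, dap th g = dap th' g) -> th = th'.
Proof. by move=> h; apply/rowP => i; rewrite -!dap_delta. Qed.

Lemma actD a x y : act a (x + y) = act a x + act a y.
Proof. by apply: dap_inj => g; rewrite dap_add !dap_act dap_add sactD. Qed.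
Lemma act_conj a b th : a != 0 -> act (refl a b) th = act a (act b (act a th)).
Proof.
by move=> a0; apply: dap_inj => g; rewrite !dap_act (refl_refl hG) // -sact_conj.
Qed.
Lemma act_homog a (th : 'rV[S]_l) d : (forall j, th 0 j \is d.-homog) -> forall j, act a th 0 j \is d.-homog.
Proof. by move=> h j; rewrite mxE; apply/sact_homog/dap_homog. Qed.

(** A polynomial is congruent to its reflection modulo [lf a], and [refl a g] differs from [g] by a
    multiple of [a], where the hypothesis applies. *)
Lemma act_sub a th : mdvd (lf a) (dap th a) ->
  exists chi : 'rV[S]_l, th - act a th = lf a *: chi.
Proof.
move=> ha; have /fin_all_exists[c hc] : forall j, mdvd (lf a) ((th - act a th) 0 j).
  move=> j; rewrite -dap_delta; set g := delta_mx 0 j.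
  have -> : dap (th - act a th) g = dap th g - dap (act a th) g.
    by rewrite dap_add -scaleN1r dap_scale mulN1r.
  have eg : refl a g = g + (- cart g a) *: a by rewrite scaleNr.
  rewrite dap_act eg dapD dapZ sactD sactZ opprD addrA.
  apply: mdvdB; first exact: sact_sub.
  apply: mdvdZ; have := sact_dvd a ha; rewrite sact_lf.
  case: (eqVneq a 0) ha => [-> ha|a0 ha]; first by rewrite /Submission.refl scaler0 subr0.
  rewrite refl_self // linearN /= => -[r ->]; rewrite mulNr.
  exact/mdvdN/mdvdMr/mdvd_refl.
by exists (\row_j c j); apply/rowP => j; rewrite hc !mxE.
Qed.

End Action.

(** * Dunkl operators on derivations of high contact *)

Section Quasi.
Variables (R : realType) (l : nat) (G : 'M[R]_l).
Hypothesis hG : inner_product G.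
Local Notation V := 'rV[R]_l.
Local Notation S := {mpoly R[l]}.
Local Notation "u '*d' v" := (dot G u v) (at level 40).
Local Notation refl := (refl G).
Local Notation act := (act G).
Local Notation sact := (sact G).
Variables (Phi : seq V) (xi : V).
Hypotheses (rsP : root_system G Phi) (reg : regular G Phi xi).
Local Notation pos := (posr G Phi xi).
Hypothesis simd : forall i, delta_mx 0 i \in simr G Phi xi.
Hypothesis irr : forall P : V -> Prop,
  (forall a b, a \in Phi -> b \in Phi -> P a -> ~ P b -> a *d b = 0) ->
  (forall a, a \in Phi -> P a) \/ (forall a, a \in Phi -> ~ P a).
Variables k' : nat.
Local Notation k := k'.+1.

Definition quasi (th : 'rV[S]_l) := {in pos, forall a, mdvd (lf a ^+ (2 * k)) (dap th a)}.
Definition qhom d (th : 'rV[S]_l) := quasi th /\ forall j, th 0 j \is d.-homog.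

Lemma quasiP th a : quasi th -> a \in Phi -> mdvd (lf a ^+ (2 * k)) (dap th a).
Proof.
move=> hq aP; case: (boolP (a \in pos)) => [/hq //|na].
have := hq (- a); rewrite (posN hG rsP reg aP) na => /(_ isT).
rewrite dapN linearN /= exprNn exprM sqrrN !expr1n mul1r => /mdvdN.
by rewrite opprK.
Qed.

Lemma quasi_act a th : a \in Phi -> quasi th -> quasi (act a th).
Proof.
move=> aP hq b bp; have eb : lf b = sact a (lf (refl a b)) by rewrite sact_lf refl_inv // (root_neq0 rsP).
rewrite dap_act eb -sactX; apply/sact_dvd/quasiP => //.
exact: (rs_refl rsP aP (pos_root bp)).
Qed.

Lemma quasiD x y : quasi x -> quasi y -> quasi (x + y).
Proof. by move=> hx hy b bp; rewrite dap_add; apply: mdvdD; [apply: hx | apply: hy]. Qed.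
Lemma quasiZ p x : quasi x -> quasi (p *: x).
Proof. by move=> hx b bp; rewrite dap_scale; apply/mdvdMl/hx. Qed.
Lemma qhomD d x y : qhom d x -> qhom d y -> qhom d (x + y).
Proof.
move=> [x1 x2] [y1 y2]; split; first exact: quasiD.
by move=> j; rewrite mxE rpredD.
Qed.
Lemma qhomZ d c x : qhom d x -> qhom d (c%:MP *: x).
Proof.
move=> [x1 x2]; split; first exact: quasiZ.
by move=> j; rewrite mxE mul_mpolyC rpredZ.
Qed.
Lemma qhom_act d a x : a \in Phi -> qhom d x -> qhom d (act a x).
Proof. by move=> aP [x1 x2]; split; [apply: quasi_act | apply: act_homog]. Qed.
Lemma qhom_sub d a x : a \in Phi -> qhom d x -> qhom d (x - act a x).
Proof.
move=> aP hx; apply: qhomD => //; rewrite -scaleN1r -mpolyC1 -mpolyCN.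
exact/qhomZ/qhom_act.
Qed.

Lemma dapB th th' (a : V) : dap (th - th') a = dap th a - dap th' a :> S.
Proof. by rewrite dap_add -scaleN1r dap_scale mulN1r. Qed.

Lemma quasi_chi th : quasi th ->
  exists chi : V -> 'rV[S]_l, {in pos, forall b, th - act b th = lf b *: chi b}.
Proof.
move=> hq; have H (b : V) : exists c : 'rV[S]_l, b \in pos -> th - act b th = lf b *: c.
  case: (boolP (b \in pos)) => [bp|_]; last by exists 0.
  have [|c hc] := act_sub hG (a := b) (th := th); last by exists c.
  by apply: mdvd_trans (hq b bp); rewrite mulnS exprS; apply/mdvdMr/mdvd_refl.
have [f hf] := boolp.choice H.
by exists f.
Qed.

(** The Dunkl operator with parameter [k] for the [i]-th partial derivative; [chi b] stands for the
    quotient of [th - act b th] by [b]. *)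
Definition dunkl i (chi : V -> 'rV[S]_l) (th : 'rV[S]_l) : 'rV[S]_l :=
  map_mx (mderiv i) th - k%:R%:MP *: \sum_(b <- pos) (b 0 i)%:MP *: chi b.

Lemma dap_dunkl i chi th a : dap (dunkl i chi th) a =
  mderiv i (dap th a) - k%:R *: \sum_(b <- pos) b 0 i *: dap (chi b) a.
Proof.
rewrite dapB dap_scale mul_mpolyC; congr (_ - _ *: _).
  rewrite /dap raddf_sum; apply: eq_bigr => j _ /=.
  by rewrite mxE mderivZ.
elim: pos => [|x s IH]; last by rewrite !big_cons dap_add dap_scale mul_mpolyC IH.
by rewrite !big_nil -[0](scale0r 0) dap_scale mul0r.
Qed.

(** At a root [a], the terms with [b] other than [a] keep their divisibility as [b] is coprime to
    [a]. With theta(a) equal to [g] times the power [2 k] of [a], the derivative and the term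
    [b = a] combine, up to multiples of that power, to [k a_i] times the power [2 k - 1] of [a]
    times [g - sact a g], and the last factor is divisible by [a] again. *)
Lemma quasi_dunkl i chi th : quasi th ->
  {in pos, forall b, th - act b th = lf b *: chi b} -> quasi (dunkl i chi th).
Proof.
move=> hq hchi a ap; have aP := pos_root ap; have a0 := root_neq0 rsP aP.
set f := lf a; set m := (2 * k)%N; have em : m = (m.-1).+1 by [].
have f0 : f != 0 by rewrite lf_eq0.
have [g eg] := hq a ap; rewrite -/f -/m in eg.
rewrite dap_dunkl (big_rem a) //= scalerDr opprD addrA; apply: mdvdB; last first.
  apply: mdvdZ; rewrite big_seq; apply: mdvd_sum => b bp'.
  have up := pos_uniq xi rsP; move: bp'; rewrite (mem_rem_uniq _ up) inE => /andP[ba bp].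
  apply: mdvdZ; have cop : mcop (f ^+ m) (lf b).
    apply: mcop_expl => //; apply: lf_cop_lf => // t; apply/eqP => e.
    by move: ba; rewrite e (pos_scale hG rsP reg ap (t := t)) ?scale1r ?eqxx // -e.
  apply: cop; rewrite -dap_scale -hchi // dapB; apply: mdvdB; first exact: hq.
  exact: (quasi_act (pos_root bp) hq).
have ea : dap (chi a) a = f ^+ m.-1 * (g + sact a g).
  apply: (mulfI f0); rewrite -dap_scale -hchi // dapB dap_act refl_self // dapN eg sactN.
  have sf : sact a f = - f by rewrite /f sact_lf refl_self // linearN.
  rewrite sactM sactX sf {2}/m exprM sqrrN -exprM -/m.
  by rewrite opprK -mulrDr mulrA -exprS -em.
have ed : mderiv i f = (a 0 i)%:MP.
  rewrite /f /lf raddf_sum (bigD1 i) //= big1 ?addr0 => [|j ji].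
    by rewrite mderivZ mderivX mnm1E eqxx scale1r (_ : (U_(i) - U_(i))%MM = 0%MM) ?mpolyX0 -?mul_mpolyC ?mulr1 //; apply/mnmP => t; rewrite mnmBE subnn mnm0E.
  by rewrite mderivZ mderivX mnm1E (negbTE ji) scale0r scaler0.
have edX t : mderiv i (f ^+ t.+1) = (a 0 i * t.+1%:R) *: f ^+ t.
  elim: t => [|t IH]; first by rewrite expr1 ed expr0 mulr1 -mul_mpolyC mulr1.
  rewrite exprS mderivM IH ed mul_mpolyC -scalerAr -exprS -scalerDl.
  by congr (_ *: _); rewrite -[t.+2%:R]natr1 mulrDr mulr1 addrC.
have [r er] : mdvd f (g - sact a g) by apply: sact_sub.
rewrite ea eg mderivM em edX -em addrAC; apply: mdvdD; last exact/mdvdMr/mdvd_refl.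
have -> : (a 0 i * m%:R) *: f ^+ m.-1 * g - k%:R *: (a 0 i *: (f ^+ m.-1 * (g + sact a g))) =
    (k%:R * a 0 i) *: (f ^+ m.-1 * (g - sact a g)).
  have -> : m%:R = 2 * k%:R :> R by rewrite natrM.
  rewrite -!mul_mpolyC !mpolyCM mulrBr mulrDr.
  have -> : (2 : R)%:MP_[l] = 2 :> S by rewrite -mpolyC_nat.
  by ring.
by apply: mdvdZ; rewrite er mulrA -exprSr -em; apply/mdvdMr/mdvd_refl.
Qed.

Lemma quasi_chi_homog d (chi : V -> 'rV[S]_l) (th : 'rV[S]_l) : (forall j, th 0 j \is d.+1.-homog) ->
  {in pos, forall b, th - act b th = lf b *: chi b} ->
  forall b, b \in pos -> forall j, chi b 0 j \is d.-homog.
Proof.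
move=> hth hchi b bp j; have b0 := pos_neq0 rsP bp.
apply: (@homog_quot_eq _ _ 1 d (lf b) 0); rewrite ?lf_eq0 ?lf_homog //.
have /rowP/(_ j) := hchi b bp; rewrite [RHS]mxE => <-.
by rewrite mxE [X in _ + X]mxE add1n; apply: rpredB; [exact: hth | apply: act_homog].
Qed.

(* The Dunkl operators lower the degree, so they kill the lowest degree part of
   the module; this turns Euler's formula into an eigenvalue equation. *)
Lemma dunkl_kill d (chi : V -> 'rV[S]_l) (th : 'rV[S]_l) : (forall d' x, (d' < d)%N -> qhom d' x -> x = 0) ->
  qhom d th -> {in pos, forall b, th - act b th = lf b *: chi b} ->
  forall i j, mderiv i (th 0 j) = k%:R *: \sum_(b <- pos) b 0 i *: chi b 0 j.
Proof.
move=> hmin [hq hd] hchi i j.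
have hT := quasi_dunkl i hq hchi.
suff : dunkl i chi th = 0.
  move/rowP => /(_ j); rewrite !mxE summxE => /eqP; rewrite subr_eq0 => /eqP ->.
  by rewrite mul_mpolyC; congr (_ *: _); apply: eq_bigr => b _; rewrite mxE mul_mpolyC.
case: d hmin hd => [|d] hmin hd.
  have hchi0 b : b \in pos -> chi b = 0.
    move=> bp; apply/rowP => t; rewrite mxE; have b0 := pos_neq0 rsP bp.
    have /rowP/(_ t) := hchi b bp; rewrite [RHS]mxE [LHS]mxE [X in _ + X]mxE => e.
    have : lf b * chi b 0 t = 0.
      apply: (@homog_dvd_small _ _ 1 0 (lf b)); rewrite ?lf_homog //; last exact/mdvdMr/mdvd_refl.
      by rewrite -e; apply: rpredB; [exact: hd | apply: act_homog].
    by move/eqP; rewrite mulf_eq0 lf_eq0 (negbTE b0) => /eqP.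
  apply/rowP => t; rewrite !mxE homog_mderiv0 // big_seq big1 ?mxE ?mulr0 ?subr0 // => b bp.
  by rewrite hchi0 // scaler0.
apply: (hmin d) => //; split=> // t; rewrite mxE [X in _ + X]mxE; apply: rpredB.
  by rewrite mxE; apply: homog_mderiv.
rewrite mxE mul_mpolyC; apply: rpredZ; rewrite summxE big_seq; apply: rpred_sum => b bp.
by rewrite mxE mul_mpolyC; apply: rpredZ; apply: (quasi_chi_homog hd hchi).
Qed.

Lemma quasi_euler d th : (forall d' x, (d' < d)%N -> qhom d' x -> x = 0) -> qhom d th ->
  (d%:R : R)%:MP *: th = (k%:R : R)%:MP *: \sum_(b <- pos) (th - act b th).
Proof.
move=> hmin hth; have [chi hchi] := quasi_chi hth.1.
apply/rowP => j; rewrite mxE [RHS]mxE !mul_mpolyC -(euler_mpoly (hth.2 j)).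
under eq_bigr do rewrite (dunkl_kill hmin hth hchi) -scalerAr.
rewrite -scaler_sumr; congr (_ *: _); rewrite summxE.
under eq_bigr do rewrite mulr_sumr.
rewrite exchange_big /= big_seq [RHS]big_seq; apply: eq_bigr => b bp.
rewrite hchi // mxE /lf mulr_suml; apply: eq_bigr => i _.
by rewrite -scalerAr -scalerAl.
Qed.

Lemma orth_simple v : (forall i, v *d delta_mx 0 i = 0) -> v = 0.
Proof.
move=> h; apply/eqP; rewrite -(dot_eq0 hG); apply/eqP.
rewrite {2}(row_sum_delta v) (dot_sumr hG) big1 // => i _.
by rewrite (dotZr hG) h mulr0.
Qed.

(** Differentiate the relation: by [dunkl_kill] the derivatives of lowest elements are combinations
    of the [chi b], which satisfy the relation as well, so the derivatives of [p] are again
    relations. Induction on the degree leaves constant relations. The constant vectors killed by all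
    lowest elements are stable under reflections, so irreducibility leaves only zero. *)
Lemma quasi_ann d : (forall d' x, (d' < d)%N -> qhom d' x -> x = 0) ->
  (exists2 x, qhom d x & x != 0) -> forall p : 'rV[S]_l,
  (forall x, qhom d x -> \sum_j p 0 j * x 0 j = 0) -> p = 0.
Proof.
move=> hmin [x0 hx0 x00].
suff key e (p : 'rV[S]_l) : (forall j, p 0 j \is e.-homog) ->
    (forall x, qhom d x -> \sum_j p 0 j * x 0 j = 0) -> p = 0.
  move=> p hp; apply/rowP => j; rewrite mxE (pihomog_partitionE (leqnn (mmeasure mdeg (p 0 j)))).
  rewrite big1 // => e _.
  have /rowP/(_ j) : \row_t pihomog mdeg e (p 0 t) = 0; last by rewrite !mxE.
  apply: (key e) => [t|x hx]; first by rewrite mxE; apply: pihomogP.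
  have := congr1 (pihomog mdeg (d + e)) (hp x hx); rewrite raddf_sum raddf0 => e1.
  rewrite -[RHS]e1; apply: eq_bigr => t _; rewrite mxE mulrC [p 0 t * _]mulrC.
  by rewrite [RHS]/= pihomogM //; exact: (hx.2 t).
elim: e p => [|e IH] p hp ha; last first.
  have hder i : \row_j mderiv i (p 0 j) = 0.
    apply: IH => [j|x hx]; first by rewrite mxE; apply: homog_mderiv.
    have [chi hchi] := quasi_chi hx.1.
    have := congr1 (mderiv i) (ha x hx); rewrite raddf_sum raddf0 /=.
    under eq_bigr do rewrite mderivM.
    rewrite big_split /= => e1.
    have e2 : \sum_j p 0 j * mderiv i (x 0 j) = 0.
      under eq_bigr do rewrite (dunkl_kill hmin hx hchi) -scalerAr mulr_sumr.
      rewrite -scaler_sumr exchange_big /= big_seq big1 ?scaler0 // => b bp.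
      under eq_bigr do rewrite -scalerAr.
      rewrite -scaler_sumr; have b0 := pos_neq0 rsP bp.
      suff -> : \sum_j p 0 j * chi b 0 j = 0 by rewrite scaler0.
      have lb0 : lf b != 0 by rewrite lf_eq0.
      apply: (mulfI lb0); rewrite mulr0 mulr_sumr -[RHS](ha (x - act b x)).
        by apply: eq_bigr => j _; rewrite hchi // mxE mulrCA.
      by apply: qhom_sub => //; apply: pos_root bp.
    by move: e1; rewrite e2 addr0 => e1; rewrite -[RHS]e1; apply: eq_bigr => j _; rewrite mxE.
  apply/rowP => j; rewrite mxE; apply: (scalerI (a := e.+1%:R)); first by rewrite pnatr_eq0.
  rewrite scaler0 -(euler_mpoly (hp j)) big1 // => i _.
  by have /rowP/(_ j) := hder i; rewrite !mxE => ->; rewrite mulr0.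
have /fin_all_exists[a ea] : forall j, exists c : R, p 0 j = c%:MP by move=> j; apply: homog0C.
pose v : V := \row_j a j.
have dv x : dap x v = \sum_j p 0 j * x 0 j.
  by apply: eq_bigr => j _; rewrite mxE ea mul_mpolyC.
pose Z (u : V) := forall x, qhom d x -> dap x u = 0.
have Zv : Z v by move=> x hx; rewrite dv ha.
have Zr b u : b \in Phi -> Z u -> Z (refl b u).
  move=> bP hu x hx; have := hu _ (qhom_act bP hx); rewrite dap_act => e0.
  have b0 := root_neq0 rsP bP.
  by rewrite -[LHS](sactK hG _ b0) e0 sact0.
have Zb b u : b \in Phi -> Z u -> u *d b != 0 -> Z b.
  move=> bP hu ub x hx; have b0 := root_neq0 rsP bP.
  have := Zr b u bP hu x hx; rewrite /Submission.refl -scaleNr dapD dapZ hu // add0r => /eqP.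
  by rewrite scaler_eq0 oppr_eq0 cart_eq0 // (negbTE ub) => /eqP.
have [|all|none] := irr (P := Z).
- move=> b c bP cP hb hc; apply/eqP; rewrite -[_ == 0]negbK; apply/negP => nz.
  by apply: hc; apply: (Zb _ b).
- case/negP: x00; apply/eqP/rowP => j; rewrite mxE -dap_delta; apply: all => //.
  exact: (pos_root (sim_pos (simd j))).
have v0 : v = 0.
  apply: orth_simple => i; apply/eqP; rewrite -[_ == 0]negbK; apply/negP => nz.
  by apply: (none (delta_mx 0 i)) (Zb _ _ _ Zv nz); apply: (pos_root (sim_pos (simd i))).
apply/rowP => j; rewrite ea mxE; have /rowP/(_ j) := v0.
by rewrite !mxE => ->; rewrite mpolyC0.
Qed.

(** A nonzero minor is enlarged one row at a time. Expansion along the new row is a linear relation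
    with the cofactors as coefficients; it cannot hold identically, because one cofactor is the
    previous minor. *)
Lemma quasi_rank d : (forall p : 'rV[S]_l,
    (forall x, qhom d x -> \sum_j p 0 j * x 0 j = 0) -> p = 0) ->
  exists2 Th : 'M[S]_l, forall i, qhom d (row i Th) & \det Th != 0.
Proof.
move=> hann.
have H : forall r, (r <= l)%N -> exists (M : 'M[S]_(r, l)) (f : 'I_r -> 'I_l),
    [/\ injective f, forall i, qhom d (row i M) & \det (colsub f M) != 0].
  elim=> [|r IH] rl.
    exists 0, (fun i => widen_ord rl i); split=> [[]|[]|] //.
    by rewrite det_mx00 oner_neq0.
  have [M [f [fi hM dM]]] := IH (ltnW rl).
  have [c hc] : exists c, c \notin codom f.
    case: (pickP [pred c | c \notin codom f]) => [c hc|h]; first by exists c.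
    have : (#|'I_l| <= #|codom f|)%N.
      by apply: subset_leq_card; apply/subsetP => i _; have := h i => /= /negbFE.
    by rewrite card_codom // !card_ord leqNgt rl.
  pose f' (i : 'I_r.+1) := if unlift ord_max i is Some j then f j else c.
  have f'i : injective f'.
    move=> i j; rewrite /f'; case: unliftP => [i' ->|->]; case: unliftP => [j' ->|->] //.
    - by move/fi => ->.
    - by move=> e; move: hc; rewrite -e codom_f.
    - by move=> e; move: hc; rewrite e codom_f.
  pose M' (x : 'rV[S]_l) : 'M[S]_(r.+1, l) :=
    \matrix_(i, j) if unlift ord_max i is Some i' then M i' j else x 0 j.
  pose cof (j : 'I_r.+1) := cofactor (colsub f' (M' 0)) ord_max j.
  have detM x : \det (colsub f' (M' x)) = \sum_j x 0 (f' j) * cof j.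
    rewrite (expand_det_row _ ord_max); apply: eq_bigr => j _.
    rewrite !mxE unlift_none; congr (_ * (_ * \det _)); apply/matrixP => a b.
    by rewrite !mxE liftK.
  have [x hx dx] : exists2 x, qhom d x & \det (colsub f' (M' x)) != 0.
    apply/boolp.not_exists2P => hn.
    pose p : 'rV[S]_l := \row_t \sum_(j | f' j == t) cof j.
    have p0 : p = 0.
      apply: hann => x hx; have [//|/negP] := hn x; rewrite negbK detM => /eqP e.
      rewrite -[RHS]e (partition_big f' xpredT) //=; apply: eq_bigr => t _.
      rewrite mxE mulr_suml; apply: eq_bigr => j /eqP <-; by rewrite mulrC.
    have /rowP/(_ c) := p0; rewrite !mxE (bigD1 ord_max) /=; last by rewrite /f' unlift_none.
    rewrite big1 ?addr0; last first.
      move=> j /andP[/eqP fj nj]; case/eqP: nj; apply: f'i.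
      by rewrite fj /f' unlift_none.
    rewrite /cof /cofactor => /eqP; rewrite mulf_eq0 signr_eq0 /=.
    have -> : row' ord_max (col' ord_max (colsub f' (M' 0))) = colsub f M.
      by apply/matrixP => a b; rewrite !mxE liftK /f' liftK.
    by rewrite (negbTE dM).
  exists (M' x), f'; split=> // i.
  have -> : row i (M' x) = if unlift ord_max i is Some i' then row i' M else x.
    by apply/rowP => j; rewrite !mxE; case: unlift => [i'|]; rewrite ?mxE.
  by case: unlift => [i'|].
have [Th [f [fi hT dT]]] := H l (leqnn l).
exists Th => //; apply: contraNneq dT => d0.
have -> : colsub f Th = Th *m colsub f 1%:M by rewrite mulmx_colsub mulmx1.
by rewrite det_mulmx d0 mul0r.
Qed.

End Quasi.

(** * The part of lowest degree and its reflection representation *)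

Section SimpleBasis.
Variables (R : realType) (l : nat) (G : 'M[R]_l).
Hypothesis hG : inner_product G.
Local Notation V := 'rV[R]_l.
Local Notation S := {mpoly R[l]}.
Local Notation "u '*d' v" := (dot G u v) (at level 40).
Local Notation refl := (refl G).
Local Notation act := (act G).
Variables (Phi : seq V) (xi : V).
Hypotheses (rsP : root_system G Phi) (reg : regular G Phi xi).
Local Notation pos := (posr G Phi xi).
Hypothesis simd : forall i, delta_mx 0 i \in simr G Phi xi.
Hypothesis sims : forall a, a \in simr G Phi xi -> exists i, a = delta_mx 0 i.
Hypothesis irr : forall P : V -> Prop,
  (forall a b, a \in Phi -> b \in Phi -> P a -> ~ P b -> a *d b = 0) ->
  (forall a, a \in Phi -> P a) \/ (forall a, a \in Phi -> ~ P a).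
Variables (k' hn : nat).
Local Notation k := k'.+1.
Hypotheses (l_gt0 : (0 < l)%N) (hn_gt0 : (0 < hn)%N).
Hypothesis hN : (2 * size pos = hn * l)%N.
Local Notation qhom := (qhom G Phi xi k').
Let Fs : seq (V * S) := [seq (a, lf a ^+ (2 * k)) | a <- pos].

Let fcopF : fcop Fs.
Proof.
have up := pos_uniq xi rsP.
split; first by rewrite map_inj_uniq // => a b [].
  by move=> c /mapP[a ap ->]; apply: (pos_neq0 rsP ap).
move=> c d /mapP[a ap ->] /mapP[b bp ->] /= ne; apply/mcop_expr/mcop_expl.
  by rewrite lf_eq0 (pos_neq0 rsP ap).
apply: lf_cop_lf; first exact: (pos_neq0 rsP ap).
move=> t; apply/eqP => e; move: ne.
by rewrite e (pos_scale hG rsP reg ap (t := t)) ?scale1r ?eqxx // -e.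
Qed.

Let lsubF th : quasi G Phi xi k' th <-> lsub Fs th.
Proof.
split=> [h c /mapP[a ap ->]|h a ap]; first exact: h.
exact: (h (a, lf a ^+ (2 * k)) (map_f _ ap)).
Qed.

Let P := \prod_(c <- Fs) c.2.
Let P_homog : P \is (k * hn * l).-homog.
Proof.
have -> : (k * hn * l = \sum_(a <- pos) 2 * k)%N.
  by rewrite -big_distrl /= big_const_seq count_predT iter_addn addn0 -mulnA -hN; lia.
rewrite /P big_map; apply: homog_prod => a.
by rewrite -[X in X.-homog]mul1n; apply: dhomogMn (lf_homog _).
Qed.

Let P0 : P != 0.
Proof.
rewrite /P big_map prodf_seq_neq0; apply/allP => a ap.
by rewrite expf_neq0 // lf_eq0 (pos_neq0 rsP ap).
Qed.

(** In the lowest degree [d] with a nonzero element there are [l] elements with nonzero determinant.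
    It has degree [d * l] and is divisible by [P], whose degree is [k * hn * l]. *)
Lemma quasi_min d x : (d < k * hn)%N -> qhom d x -> x = 0.
Proof.
elim/ltn_ind: d x => d IH x dk hx; apply/eqP; rewrite -[_ == 0]negbK; apply/negP => x0.
have hmin d' y : (d' < d)%N -> qhom d' y -> y = 0.
  by move=> dd; apply: IH => //; apply: ltn_trans dk.
have hann := quasi_ann hG rsP reg simd irr hmin (ex_intro2 _ _ x hx x0).
have [Th hT dT] := quasi_rank hann.
have hdet : \det Th \is (d * l).-homog.
  have -> : (d * l = \sum_(i < l) d)%N by rewrite sum_nat_const card_ord mulnC.
  by apply: det_homog => i j; have := (hT i).2 j; rewrite mxE.
case/eqP: dT; apply: (homog_dvd_small P_homog hdet); first by rewrite ltn_pmul2r.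
by apply: (det_dvd_prod fcopF) => i; apply/lsubF; exact: (hT i).1.
Qed.

Section Basis.
Variable x0 : 'rV[S]_l.
Hypotheses (hx0 : qhom (k * hn) x0) (x00 : x0 != 0).

Lemma quasi_basis : exists (Th : 'M[S]_l) (u : R), [/\ forall i, qhom (k * hn) (row i Th),
  u != 0 & \det Th = u *: P].
Proof.
have hmin d' y : (d' < k * hn)%N -> qhom d' y -> y = 0 by exact: quasi_min.
have hann := quasi_ann hG rsP reg simd irr hmin (ex_intro2 _ _ x0 hx0 x00).
have [Th hT dT] := quasi_rank hann.
have [||||u eu] := @saito_det R l l Fs Th (fun=> (k * hn)%N) (k * hn * l) fcopF.
- by move=> i; apply/lsubF; exact: (hT i).1.
- by move=> i j; have := (hT i).2 j; rewrite mxE.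
- exact: P_homog.
- by rewrite sum_nat_const card_ord [RHS]mulnC.
exists Th, u; split=> //; apply: contraNneq dT => u0.
by rewrite eu u0 scale0r.
Qed.

Let sumC (C : 'rV[R]_l) (Th : 'M[S]_l) j :
  (map_mx (@mpolyC l R) C *m Th) 0 j = \sum_i C 0 i *: Th i j.
Proof. by rewrite mxE; apply: eq_bigr => i _; rewrite mxE mul_mpolyC. Qed.

Lemma quasi_coord Th u x : (forall i, qhom (k * hn) (row i Th)) -> u != 0 ->
  \det Th = u *: P -> qhom (k * hn) x -> exists C : 'rV[R]_l, x = map_mx (@mpolyC l R) C *m Th.
Proof.
move=> hT u0 eD hx.
have [|c ec] := saito fcopF _ u0 P0 eD (proj1 (lsubF x) hx.1).
  by move=> i; apply/lsubF; exact: (hT i).1.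
have /fin_all_exists[C hC] : forall i, exists t : R, pihomog mdeg 0 (c 0 i) = t%:MP.
  by move=> i; apply: homog0C; apply: pihomogP.
exists (\row_i C i); apply/rowP => j; rewrite sumC.
have hxj : x 0 j \is (k * hn + 0).-homog by rewrite addn0; exact: hx.2 j.
rewrite -[LHS](pihomog_dE hxj) {1}ec mxE raddf_sum /=; apply: eq_bigr => i _.
rewrite mulrC [X in X _]/= pihomogM ?hC ?mxE; last by have := (hT i).2 j; rewrite mxE.
by rewrite mulrC mul_mpolyC.
Qed.

(** Two independent elements divisible by [lf al] could be made rows of a basis. After both are
    divided, the determinant still has [lf al] with multiplicity [2 k - 1]; together this is
    [2 k + 1], one more than in [P]. *)
Lemma quasi_line al x y chi chi' : al \in pos -> qhom (k * hn) x -> qhom (k * hn) y ->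
  x = lf al *: chi -> y = lf al *: chi' -> x != 0 -> exists c : R, y = c%:MP *: x.
Proof.
move=> ap hx hy ex ey xn; have [Th [u [hT u0 eD]]] := quasi_basis.
have [C eC] := quasi_coord hT u0 eD hx; have [C' eC'] := quasi_coord hT u0 eD hy.
have /rV0Pn[i0 Ci0] : C != 0 by apply: contraNneq xn => C0; rewrite eC C0 map_mx0 mul0mx.
pose C2 := C' - (C' 0 i0 / C 0 i0) *: C.
have C2i : C2 0 i0 = 0 by rewrite !mxE divfK // subrr.
case: (eqVneq C2 0) => [C20|/rV0Pn[i1 Ci1]].
  have : C' = (C' 0 i0 / C 0 i0) *: C by apply/eqP; rewrite -subr_eq0; apply/eqP.
  move: (C' 0 i0 / C 0 i0) => c e; exists c; rewrite eC' e eC scalemxAl.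
  by congr (_ *m _); apply/rowP => t; rewrite !mxE mpolyCM.
have i10 : i1 != i0 by apply: contraNneq Ci1 => ->; rewrite C2i.
set c := C' 0 i0 / C 0 i0 in C2 C2i Ci1 *.
pose z := y + (- c)%:MP *: x; pose chi2 := chi' + (- c)%:MP *: chi.
have hz : qhom (k * hn) z by apply: qhomD => //; apply: qhomZ.
have ez : z = lf al *: chi2 by rewrite /z ex ey scalerDr !scalerA [_ * lf al]mulrC.
have eC2 : z = map_mx (@mpolyC l R) C2 *m Th.
  rewrite /z eC eC' scalemxAl -mulmxDl; congr (_ *m _); apply/rowP => t.
  rewrite [LHS]mxE [X in X + _]mxE [X in _ + X]mxE [X in _ * X]mxE -mpolyCM -mpolyCD [RHS]mxE.
  by congr (_%:MP); rewrite [RHS]mxE [X in _ = _ + X]mxE [X in _ = _ - X]mxE mulNr.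
pose Pm : 'M[R]_l := \matrix_(i, j) if i == i0 then C 0 j else if i == i1 then C2 0 j else (i == j)%:R.
have uP : Pm \in unitmx.
  rewrite -row_free_unit -kermx_eq0; apply/rowV0P => v /sub_kermxP vP.
  have sumP j : v 0 i0 * C 0 j + (v 0 i1 * C2 0 j + \sum_(i | (i != i0) && (i != i1)) v 0 i * (i == j)%:R) = 0.
    have /rowP/(_ j) := vP; rewrite [LHS]mxE [RHS]mxE => e.
    rewrite -[RHS]e [RHS](bigD1 i0) //= [Pm i0 j]mxE eqxx; congr (_ + _).
    rewrite [RHS](bigD1 i1) //= [Pm i1 j]mxE eqxx (negbTE i10); congr (_ + _).
    by apply: eq_bigr => i /andP[n0 n1]; rewrite [Pm i j]mxE (negbTE n0) (negbTE n1).
  have v0 : v 0 i0 = 0.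
    have := sumP i0; rewrite C2i mulr0 add0r big1 ?addr0.
      by move/eqP; rewrite mulf_eq0 (negbTE Ci0) orbF => /eqP.
    by move=> i /andP[/negbTE -> _]; rewrite mulr0.
  have v1 : v 0 i1 = 0.
    have := sumP i1; rewrite v0 mul0r add0r big1 ?addr0.
      by move/eqP; rewrite mulf_eq0 (negbTE Ci1) orbF => /eqP.
    by move=> i /andP[_ /negbTE ->]; rewrite mulr0.
  apply/rowP => t; rewrite mxE; case: (eqVneq t i0) => [-> //|t0].
  case: (eqVneq t i1) => [-> //|t1]; have := sumP t.
  rewrite v0 v1 !mul0r !add0r (bigD1 t) /=; last by rewrite t0 t1.
  rewrite eqxx mulr1 big1 ?addr0 // => i /andP[_ /negbTE ->].
  by rewrite mulr0.
pose Th2 := map_mx (@mpolyC l R) Pm *m Th.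
have dT2 : \det Th2 = (\det Pm * u) *: P.
  by rewrite det_mulmx det_map_mx eD -scalerAr mul_mpolyC scalerA mulrC.
have dP0 : \det Pm * u != 0 by rewrite mulf_neq0 // -unitfE; move: uP; rewrite unitmxE.
pose Th3 : 'M[S]_l := \matrix_i if i == i0 then chi else if i == i1 then chi2 else row i Th2.
pose D : 'rV[S]_l := \row_i if (i == i0) || (i == i1) then lf al else 1.
have r0 : row i0 Th2 = x.
  rewrite row_mul eC; congr (_ *m _); apply/rowP => t; by rewrite !mxE eqxx.
have r1 : row i1 Th2 = z.
  rewrite row_mul eC2; congr (_ *m _); apply/rowP => t; by rewrite !mxE eqxx (negbTE i10).
have e23 : Th2 = diag_mx D *m Th3.
  apply/row_matrixP => i.
  have -> : row i (diag_mx D *m Th3) = D 0 i *: row i Th3.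
    by apply/rowP => t; rewrite [LHS]mxE mul_diag_mx [LHS]mxE [RHS]mxE [X in _ = _ * X]mxE.
  rewrite rowK mxE.
  case: (eqVneq i i0) => [->|n0]; first by rewrite r0 /= ex.
  by case: (eqVneq i i1) => [->|n1]; rewrite /= ?r1 ?ez ?scale1r.
have f0 : lf al != 0 by rewrite lf_eq0 (pos_neq0 rsP ap).
have em : (2 * k = (2 * k).-1.+1)%N by [].
have divc w chi0 : quasi G Phi xi k' w -> w = lf al *: chi0 -> mdvd (lf al ^+ (2 * k).-1) (dap chi0 al).
  move=> hw ew; apply: (mdvd_cancel f0); rewrite -exprS -em -dap_scale -ew.
  exact: hw.
have dv3 : mdvd (lf al ^+ (2 * k).-1) (\det Th3).
  apply: (det_dvd (pos_neq0 rsP ap)) => i; rewrite rowK.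
  case: (eqVneq i i0) => [_|n0]; first exact: divc hx.1 ex.
  case: (eqVneq i i1) => [_|n1]; first exact: divc hz.1 ez.
  apply: (mdvd_expl (leq_pred _)).
  have -> : row i Th2 = row i Th; last exact: (hT i).1.
  rewrite row_mul; have -> : row i (map_mx (@mpolyC l R) Pm) = delta_mx 0 i.
    apply/rowP => t; rewrite !mxE (negbTE n0) (negbTE n1) eqxx eq_sym.
    by case: (t == i).
  by rewrite -rowE.
have : mdvd (lf al ^+ (2 * k).+1) ((\det Pm * u) *: P).
  rewrite -dT2 e23 det_mulmx det_diag (bigD1 i0) //= (bigD1 i1) //= big1 => [|i /andP[n0 n1]].
    rewrite !mxE !eqxx orbT mulr1 em exprS exprS mulrA.
    by apply: mdvd_mul dv3; apply: mdvd_refl.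
  by rewrite mxE (negbTE n0) (negbTE n1).
move/(mdvdZ (\det Pm * u)^-1); rewrite scalerA mulVf // scale1r.
rewrite /P big_map (big_rem al) //= exprSr => hd.
have {hd} : mdvd (lf al) (\prod_(b <- rem al pos) lf b ^+ (2 * k)).
  by apply: mdvd_cancel hd; rewrite expf_neq0.
have up := pos_uniq xi rsP.
have : mcop (lf al) (\prod_(b <- rem al pos) lf b ^+ (2 * k)).
  apply: mcop_prodr => b; rewrite (mem_rem_uniq _ up) inE => /andP[ba bp].
  apply/mcop_expr/lf_cop_lf; first exact: (pos_neq0 rsP ap).
  move=> t; apply/eqP => e; move: ba.
  by rewrite e (pos_scale hG rsP reg ap (t := t)) ?scale1r ?eqxx // -e.
move=> hc hd; case: (@lf_ndvd1 _ _ al (pos_neq0 rsP ap)); apply: hc.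
by rewrite mulr1.
Qed.

End Basis.

(** Let [U] be the real span of the [psi i]. The difference of [x] and its image under the [i]-th
    simple reflection is divisible by the simple root, so it lies on the line of [psi i] by
    [quasi_line]. Conjugation extends this to all reflections, and [quasi_euler] writes [x] as a
    combination of such differences. Hence [U] contains a basis, which has nonzero determinant. *)
Lemma simple_basis (psi : 'I_l -> 'rV[S]_l) : (forall i, qhom (k * hn) (psi i)) ->
  (forall i, psi i != 0) -> (forall i, exists chi, psi i = lf (delta_mx 0 i) *: chi) ->
  \det (\matrix_i psi i) != 0.
Proof.
move=> hp p0 hchi; pose i0 := Ordinal l_gt0; have [Th [u [hT u0 eD]]] := quasi_basis (hp i0) (p0 i0).
pose U x := exists C : 'rV[R]_l, x = map_mx (@mpolyC l R) C *m \matrix_i psi i.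
have UD x y : U x -> U y -> U (x + y).
  by move=> [C ->] [C' ->]; exists (C + C'); rewrite map_mxD mulmxDl.
have UZ (c : R) x : U x -> U (c%:MP *: x).
  by move=> [C ->]; exists (c *: C); rewrite scalemxAl; congr (_ *m _); apply/rowP => t; rewrite !mxE mpolyCM.
have U0 : U 0 by exists 0; rewrite map_mx0 mul0mx.
have UB x y : U x -> U y -> U (x - y).
  by move=> hx hy; rewrite -scaleN1r -mpolyC1 -mpolyCN; apply: UD => //; apply: UZ.
have Up i : U (psi i).
  by exists (delta_mx 0 i); rewrite map_delta_mx -rowE rowK.
have Us i x : qhom (k * hn) x -> U (x - act (delta_mx 0 i) x).
  move=> hx; have ip := sim_pos (simd i); have iP := pos_root ip.
  have [chi e1] := hchi i.
  have [|chi' e2] := act_sub hG (a := delta_mx 0 i) (th := x).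
    by apply: mdvd_trans (hx.1 _ ip); rewrite mulnS exprS; apply/mdvdMr/mdvd_refl.
  have hs : qhom (k * hn) (x - act (delta_mx 0 i) x) by apply: (qhom_sub hG rsP reg) iP hx.
  have [c ->] := quasi_line (hp i0) (p0 i0) ip (hp i) hs e1 e2 (p0 i).
  exact/UZ/Up.
have Ub : forall b, b \in pos -> forall x, qhom (k * hn) x -> U (x - act b x).
  move=> b; elim/pos_ind => {}b bp IH x hx.
  case: (boolP (b \in simr G Phi xi)) => [/sims[i ->]|ns]; first exact: Us.
  have [a asim [b'p b'lt]] := pos_refl_lower hG rsP reg bp ns.
  have [i ea] := sims asim; have aP := pos_root (sim_pos asim).
  have a0 := root_neq0 rsP aP.
  have Ua y : qhom (k * hn) y -> U (y - act a y) by rewrite ea; apply: Us.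
  have -> : act b x = act a (act (refl a b) (act a x)).
    by rewrite -(act_conj hG _ _ a0) (refl_inv hG).
  have h1 := qhom_act hG rsP reg aP hx; have h2 := qhom_act hG rsP reg (pos_root b'p) h1.
  have -> : x - act a (act (refl a b) (act a x)) = (x - act a x) +
     (act a x - act (refl a b) (act a x)) +
     (act (refl a b) (act a x) - act a (act (refl a b) (act a x))).
    by rewrite !addrA !subrK.
  by apply: (UD _ _ (UD _ _ (Ua _ hx) (IH _ b'p b'lt _ h1)) (Ua _ h2)).
have Uall x : qhom (k * hn) x -> U x.
  move=> hx; have hmin d' y : (d' < k * hn)%N -> qhom d' y -> y = 0 by exact: quasi_min.
  have kh0 : (0 < k * hn)%N by rewrite muln_gt0.
  have e := quasi_euler hG rsP reg hmin hx; have -> : x = ((k * hn)%:R^-1 : R)%:MP *: (((k * hn)%:R : R)%:MP *: x).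
    by rewrite scalerA -mpolyCM mulVf ?scale1r // pnatr_eq0 -lt0n.
  rewrite e; apply/UZ/UZ; rewrite big_seq; elim/big_ind: _ => // b bp; exact: Ub.
have /fin_all_exists[C hC] : forall i, exists C : 'rV[R]_l, row i Th = map_mx (@mpolyC l R) C *m \matrix_i psi i.
  by move=> i; apply: Uall.
have eT : Th = map_mx (@mpolyC l R) (\matrix_i C i) *m \matrix_i psi i.
  by apply/row_matrixP => i; rewrite row_mul hC -map_row rowK.
have : \det Th != 0.
  by rewrite eD scaler_eq0 negb_or u0.
by rewrite eT det_mulmx mulf_eq0 negb_or => /andP[].
Qed.

End SimpleBasis.

(** * Semidefinite forms and extremal eigenvalues *)

Section Eigen.
Variables (R : realType) (l : nat).

(** Along [v + t *: y] the form is a quadratic polynomial in [t] without constant term; being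
    nonnegative, it has no linear term. *)
Lemma psd_ker (M : 'M[R]_l) (v : 'rV[R]_l) : M^T = M ->
  (forall x : 'rV[R]_l, 0 <= (x *m M *m x^T) 0 0) -> (v *m M *m v^T) 0 0 = 0 -> v *m M = 0.
Proof.
move=> sM psd v0; pose q := dot M; have qC x y : q x y = q y x by apply: dotC.
suff h y : q v y = 0.
  apply/rowP => j; have := h (delta_mx 0 j).
  by rewrite /q /dot trmx_delta -colE mxE => ->; rewrite mxE.
have hq t : 0 <= 2 * t * q v y + t ^+ 2 * q y y.
  have := psd (v + t *: y); rewrite -/(dot M _ _) dotDl dotZl ![dot M _ (v + _)](dotC _ _ sM).
  by rewrite !dotDl !dotZl -/q (qC y v) [q v v]v0; lra.
have qy : 0 <= q y y by apply: psd.
apply/eqP; rewrite -[_ == 0]negbK; apply/negP => n0.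
pose s := q y y + 1; have s0 : 0 < s by rewrite ltr_wpDl.
have := hq (- (q v y / s)); rewrite sqrrN.
have -> : 2 * - (q v y / s) * q v y + (q v y / s) ^+ 2 * q y y =
   - ((q v y / s) ^+ 2 * (q y y + 2)).
  by rewrite /s; field; rewrite gt_eqF.
have : 0 < (q v y / s) ^+ 2 * (q y y + 2).
  rewrite mulr_gt0 ?ltr_wpDl // lt_neqAle sqr_ge0 andbT eq_sym expf_neq0 //.
  by rewrite mulf_neq0 // invr_eq0 gt_eqF.
lra.
Qed.

End Eigen.

(** The form [lam *: G - A] is semidefinite and vanishes at the maximizer, which therefore lies in
    its kernel. *)
Lemma rayleigh (R : realType) l (A G : 'M[R]_l) : (0 < l)%N -> A^T = A -> G^T = G ->
  (forall x : 'rV[R]_l, x != 0 -> 0 < (x *m G *m x^T) 0 0) ->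
  exists v : 'rV[R]_l, exists2 lam, v != 0 & v *m A = lam *: (v *m G) /\
    forall x : 'rV[R]_l, (x *m A *m x^T) 0 0 <= lam * (x *m G *m x^T) 0 0.
Proof.
case: l A G => // l A G _ sA sG pG; have [v [lam v0 [ev hx]]] := Rayleigh.rayleigh_max A pG.
exists v, lam => //; split=> //.
suff : v *m (lam *: G - A) = 0.
  by rewrite mulmxBr -scalemxAr => /eqP; rewrite subr_eq0 => /eqP ->.
have E x : (x *m (lam *: G - A) *m x^T) 0 0 = lam * (x *m G *m x^T) 0 0 - (x *m A *m x^T) 0 0.
  by rewrite mulmxBr mulmxBl -scalemxAr -scalemxAl !mxE.
apply: psd_ker; first by rewrite linearB linearZ /= sA sG.
  by move=> x; rewrite E subr_ge0.
by rewrite E ev subrr.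
Qed.

(** * Words in simple reflections *)

(* In a word of reflections the first letter acts last. *)
Section Words.
Variables (R : realType) (l : nat) (G : 'M[R]_l).
Hypothesis hG : inner_product G.
Local Notation V := 'rV[R]_l.
Local Notation "u '*d' v" := (dot G u v) (at level 40).
Local Notation cart := (cart G).
Local Notation refl := (refl G).
Variables (Phi : seq V) (xi : V).
Hypotheses (rsP : root_system G Phi) (reg : regular G Phi xi).
Local Notation pos := (posr G Phi xi).
Local Notation sim := (simr G Phi xi).

Definition wact (ws : seq V) (x : V) : V := foldr refl x ws.

Lemma wact_cat u w x : wact (u ++ w) x = wact u (wact w x).
Proof. by rewrite /wact foldr_cat. Qed.
Lemma wact_is_linear ws : linear (wact ws).
Proof. by elim: ws => [|w ws IH] t x y //=; rewrite IH linearP. Qed.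
HB.instance Definition _ ws := GRing.isLinear.Build R V V _ (wact ws) (wact_is_linear ws).

Lemma wact_root (ws : seq V) x : {subset ws <= Phi} -> x \in Phi -> wact ws x \in Phi.
Proof.
elim: ws => [|w ws IH] //= h xP; apply: (rs_refl rsP); first by apply: h; rewrite mem_head.
by apply: IH => // y yw; apply: h; rewrite in_cons yw orbT.
Qed.
Lemma wact_rev (ws : seq V) x : {subset ws <= Phi} -> wact (rev ws) (wact ws x) = x.
Proof.
elim: ws x => [|w ws IH] x h //=; rewrite rev_cons -cats1 wact_cat /=.
rewrite (refl_inv hG) ?IH //; first by move=> y yw; apply: h; rewrite in_cons yw orbT.
by apply: (root_neq0 rsP); apply: h; rewrite mem_head.
Qed.
Lemma wact_dot (ws : seq V) x y : {subset ws <= Phi} -> wact ws x *d wact ws y = x *d y.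
Proof.
elim: ws => [|w ws IH] //= h; rewrite (refl_dot hG).
  by apply: IH => z zw; apply: h; rewrite in_cons zw orbT.
by apply: (root_neq0 rsP); apply: h; rewrite mem_head.
Qed.
Lemma sim_root (ws : seq V) : {subset ws <= sim} -> {subset ws <= Phi}.
Proof. by move=> h x /h/sim_pos/pos_root. Qed.

Lemma wact_refl (ws : seq V) a x : {subset ws <= Phi} -> a \in Phi ->
  wact ws (refl a x) = refl (wact ws a) (wact ws x).
Proof.
move=> h aP; rewrite /Submission.refl linearB linearZ /=; congr (_ - _ *: _).
by rewrite /Submission.cart !wact_dot.
Qed.

(** [t] is the letter at which the image first becomes negative; a simple reflection makes only its
    own root negative. *)
Lemma wact_split (ws : seq V) x : {subset ws <= sim} -> x \in pos -> wact ws x \notin pos ->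
  exists u t v, ws = u ++ t :: v /\ wact v x = t.
Proof.
elim: ws => [|w ws IH] h xp; first by rewrite /= xp.
have h' : {subset ws <= sim} by move=> y yw; apply: h; rewrite in_cons yw orbT.
case: (boolP (wact ws x \in pos)) => [wp|np] /= nn.
  exists [::], w, ws; split=> //; apply/eqP; apply: contraNT nn => ne.
  by apply: (refl_pos hG rsP reg) => //; apply: h; rewrite mem_head.
by have [u [t [v [-> e]]]] := IH h' xp np; exists (w :: u), t, v.
Qed.

(* Deletion: a word preserving the positive roots and ending in s contains a
   letter cancelling s. *)
Lemma wact_trivial (ws : seq V) : {subset ws <= sim} -> {in pos, forall x, wact ws x \in pos} ->
  forall x, wact ws x = x.
Proof.
have [m] := ubnP (size ws); elim: m ws => // m IH ws.
case/lastP: ws => [|ws s] // sz h hp x.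
have ss : s \in sim by apply: h; rewrite mem_rcons mem_head.
have h' : {subset ws <= sim} by move=> y yw; apply: h; rewrite mem_rcons in_cons yw orbT.
have sp := sim_pos ss; have sP := pos_root sp; have s0 := root_neq0 rsP sP.
have es y : wact (rcons ws s) y = wact ws (refl s y) by rewrite -cats1 wact_cat.
have ns : wact ws s \notin pos.
  have := hp s sp; rewrite es (refl_self hG) // linearN /= (posN hG rsP reg) //.
  by apply: wact_root => //; apply: sim_root.
have [u [t [v [ews et]]]] := wact_split h' sp ns.
have hu : {subset u <= sim} by move=> y yu; apply: h'; rewrite ews mem_cat yu.
have hv : {subset v <= sim} by move=> y yv; apply: h'; rewrite ews mem_cat in_cons yv !orbT.
have eu y : wact (rcons ws s) y = wact (u ++ v) y.
  rewrite es ews !wact_cat /= -et -wact_refl //; last exact: sim_root.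
  by rewrite (refl_inv hG).
rewrite eu; apply: IH.
- by move: sz; rewrite size_rcons ews !size_cat /=; lia.
- by move=> y; rewrite mem_cat => /orP[/hu|/hv].
by move=> y yp; rewrite -eu hp.
Qed.

(** Each letter accounts for at most one inversion, the root that meets it as its own simple
    root. *)
Lemma wact_inversions (ws : seq V) : {subset ws <= sim} -> exists L : seq V,
  (size L <= size ws)%N /\ forall x, x \in pos -> wact ws x \notin pos -> x \in L.
Proof.
elim: ws => [|w ws IH] h; first by exists [::]; split=> // x /= ->.
have h' : {subset ws <= sim} by move=> y yw; apply: h; rewrite in_cons yw orbT.
have [L [sL hL]] := IH h'; exists (wact (rev ws) w :: L); split=> // x xp /= nx.
rewrite in_cons; case: (boolP (wact ws x \in pos)) => wp; last by rewrite hL ?orbT.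
suff <- : wact ws x = w by rewrite wact_rev ?eqxx //; apply: sim_root.
apply/eqP; apply: contraNT nx => ne.
by apply: (refl_pos hG rsP reg) => //; apply: h; rewrite mem_head.
Qed.

End Words.

(** * The Coxeter number *)

Section Casimir.
Variables (R : realType) (l : nat) (G : 'M[R]_l).
Hypothesis hG : inner_product G.
Local Notation V := 'rV[R]_l.
Local Notation "u '*d' v" := (dot G u v) (at level 40).
Local Notation cart := (cart G).
Local Notation refl := (refl G).
Variables (Phi : seq V) (xi : V).
Hypotheses (rsP : root_system G Phi) (reg : regular G Phi xi).
Local Notation pos := (posr G Phi xi).
Hypothesis simd : forall i, delta_mx 0 i \in simr G Phi xi.
Hypothesis sims : forall a, a \in simr G Phi xi -> exists i, a = delta_mx 0 i.
Hypothesis irr : forall P : V -> Prop,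
  (forall a b, a \in Phi -> b \in Phi -> P a -> ~ P b -> a *d b = 0) ->
  (forall a, a \in Phi -> P a) \/ (forall a, a \in Phi -> ~ P a).
Hypothesis l_gt0 : (0 < l)%N.

(* Symmetric forms for which the Weyl group acts by isometries are multiples of
   the inner product: the eigenspace of an extremal eigenvalue is stable. *)
Let casimir v := \sum_(b <- pos) cart v b *: b.

Lemma casimir_linear : linear casimir.
Proof.
move=> t x y; rewrite /casimir scaler_sumr -big_split; apply: eq_bigr => b _.
by rewrite cartDl cartZl scalerDl scalerA.
Qed.
HB.instance Definition _ := GRing.isLinear.Build R V V _ casimir casimir_linear.

Lemma casimir_refl a v : a \in Phi -> casimir (refl a v) = refl a (casimir v).
Proof.
move=> aP; have a0 := root_neq0 rsP aP.
have key s : s \in simr G Phi xi -> forall x, casimir (refl s x) = refl s (casimir x).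
  move=> ss x; have sp := sim_pos ss; have s0 := pos_neq0 rsP sp.
  rewrite /casimir linear_sum /= !(perm_big _ (perm_to_rem sp)) !big_cons; congr (_ + _).
    rewrite linearZ /= (refl_self hG) // -(refl_cart2 hG) // (refl_self hG) //.
    by rewrite (cartNr hG) scaleNr scalerN.
  rewrite -[LHS](perm_big _ (refl_pos_perm hG rsP reg ss)) big_map; apply: eq_bigr => b _.
  by rewrite (refl_cart hG) // linearZ.
have all b : b \in pos -> forall x, casimir (refl b x) = refl b (casimir x).
  elim/pos_ind => {}b bp IH x; case: (boolP (b \in simr G Phi xi)) => [/key //|ns].
  have [s ss [rp rlt]] := pos_refl_lower hG rsP reg bp ns.
  have s0 := pos_neq0 rsP (sim_pos ss).
  have e y : refl b y = refl s (refl (refl s b) (refl s y)).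
    by rewrite -(refl_refl hG) // (refl_inv hG).
  by rewrite !e key // IH // key.
case: (boolP (a \in pos)) => [/all //|na].
by rewrite -(reflN hG a) -(reflN hG a (casimir v)) all // (posN hG rsP reg).
Qed.

Lemma casimir_sym u v : casimir u *d v = u *d casimir v.
Proof.
rewrite /casimir dot_suml (dot_sumr hG); apply: eq_bigr => b _.
by rewrite dotZl (dotZr hG) /Submission.cart (dotcomm hG b v); ring.
Qed.

Lemma stable_eigen (lam : R) v0 : v0 != 0 -> casimir v0 = lam *: v0 ->
  forall v, casimir v = lam *: v.
Proof.
move=> n0 e0; pose Z v := casimir v = lam *: v.
have Zr b u : b \in Phi -> Z u -> Z (refl b u).
  by move=> bP hu; rewrite /Z casimir_refl // hu linearZ.
have Zb b u : b \in Phi -> Z u -> u *d b != 0 -> Z b.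
  move=> bP hu ub; have b0 := root_neq0 rsP bP.
  have c0 : cart u b != 0 by rewrite (cart_eq0 hG).
  have eb : b = (cart u b)^-1 *: (u - refl b u).
    by rewrite /Submission.refl subKr scalerA mulVf // scale1r.
  have := Zr b u bP hu; rewrite /Z => hr; rewrite eb linearZ linearB /= hu hr -scalerBr.
  by rewrite !scalerA mulrC.
have [|all|none] := irr (P := Z).
- move=> b c bP cP hb hc; apply/eqP; rewrite -[_ == 0]negbK; apply/negP => nz.
  by apply: hc; apply: (Zb _ b).
- move=> v; rewrite (row_sum_delta v) linear_sum scaler_sumr; apply: eq_bigr => i _.
  rewrite linearZ /= [casimir _]all ?(pos_root (sim_pos (simd i))) //.
  by rewrite !scalerA mulrC.
case/eqP: n0; apply/eqP; rewrite -(dot_eq0 hG); apply/eqP.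
rewrite {2}(row_sum_delta v0) (dot_sumr hG) big1 // => i _; rewrite (dotZr hG).
have iP := pos_root (sim_pos (simd i)).
case: (eqVneq (v0 *d delta_mx 0 i) 0) => [->|nz]; first by rewrite mulr0.
by case: (none _ iP); apply: Zb e0 nz.
Qed.

Lemma casimir_eq : exists h : R, forall v, casimir v = h *: v.
Proof.
pose A := lin1_mx casimir *m G.
have dA x y : (x *m A *m y^T) 0 0 = casimir x *d y.
  by rewrite /A mulmxA mul_rV_lin1.
have [|||v [lam v0 [ev _]]] := rayleigh (A := A) (G := G) l_gt0.
- apply/matrixP => i j; rewrite mxE.
  have E x y : A x y = casimir (delta_mx 0 x) *d delta_mx 0 y.
    by rewrite -dA -rowE trmx_delta -colE !mxE.
  by rewrite !E casimir_sym (dotcomm hG).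
- by case: hG.
- by case: hG => _ h x /h.
exists lam; apply: (stable_eigen v0); apply/eqP; rewrite -subr_eq0 -(dot_eq0 hG); apply/eqP.
set x := _ - _; rewrite /x dotBl dotZl -/x -dA /dot ev -scalemxAl.
by rewrite [X in X - _]mxE subrr.
Qed.

(** The operator [casimir] is a scalar [h]. Pairing [casimir a] with the coroot of [a] gives the
    first equation. The trace gives the second, as each summand has trace [cart b b = 2]. *)
Lemma coxeter_number : exists h : R,
  {in Phi, forall a, \sum_(b <- pos) cart b a * cart a b = 2 * h} /\
  (2 * size pos)%:R = h * l%:R.
Proof.
have [h hh] := casimir_eq; exists h; split=> [a aP|].
  have a0 := root_neq0 rsP aP; have aa : a *d a != 0 by rewrite dot_eq0.
  have := congr1 (fun x => 2 * (x *d a) / (a *d a)) (hh a); rewrite dotZl mulrA mulfK // => <-.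
  rewrite /casimir dot_suml mulr_sumr mulr_suml; apply: eq_bigr => b _.
  by rewrite dotZl /Submission.cart; ring.
have tr : \sum_i (casimir (delta_mx 0 i)) 0 i = h * l%:R.
  under eq_bigr do rewrite hh !mxE !eqxx mulr1.
  by rewrite big_const_ord iter_addr addr0 mulr_natr.
rewrite -tr; under eq_bigr do rewrite summxE.
rewrite exchange_big /= natrM mulr_natr -[size pos]sum1_size -sumrMnr big_seq [RHS]big_seq.
apply: eq_bigr => b bp; rewrite mulr1n -[LHS](cart_self hG (pos_neq0 rsP bp)).
rewrite {1}(row_sum_delta b) cart_suml; apply: eq_bigr => i _.
by rewrite cartZl mxE mulrC.
Qed.

End Casimir.

(** * The Perron vector and the Coxeter plane *)

Section CoxeterPlane.
Variables (R : realType) (l : nat) (G : 'M[R]_l).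
Hypothesis hG : inner_product G.
Local Notation V := 'rV[R]_l.
Local Notation "u '*d' v" := (dot G u v) (at level 40).
Local Notation cart := (cart G).
Local Notation refl := (refl G).
Variables (Phi : seq V) (xi : V).
Hypotheses (rsP : root_system G Phi) (reg : regular G Phi xi).
Local Notation pos := (posr G Phi xi).
Local Notation sim := (simr G Phi xi).
Local Notation al i := (delta_mx 0 i : V).
Hypothesis simd : forall i, al i \in sim.
Hypothesis sims : forall a, a \in sim -> exists i, a = al i.
Hypothesis irr : forall P : V -> Prop,
  (forall a b, a \in Phi -> b \in Phi -> P a -> ~ P b -> a *d b = 0) ->
  (forall a, a \in Phi -> P a) \/ (forall a, a \in Phi -> ~ P a).
Hypothesis l_gt0 : (0 < l)%N.

Let al0 i : al i != 0. Proof. exact: (pos_neq0 rsP (sim_pos (simd i))). Qed.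
Let alP i : al i \in Phi. Proof. exact: (pos_root (sim_pos (simd i))). Qed.
Let gram i j : al i *d al j = G i j.
Proof. by rewrite /dot -rowE trmx_delta -colE !mxE. Qed.

Lemma pos_coord b i : b \in pos -> 0 <= b 0 i.
Proof.
move=> /(pos_ncone rsP)[n ->]; rewrite summxE big_seq; apply: sumr_ge0 => s /sims[j ->].
by rewrite mxE mulr_ge0 // mxE ler0n.
Qed.

Section Support.
Variable Z : pred 'I_l.
Hypothesis GZ : forall j t, Z j -> ~~ Z t -> G t j = 0.
Definition supp_in (b : V) := forall j, ~~ Z j -> b 0 j = 0.
Definition supp_off (b : V) := forall j, Z j -> b 0 j = 0.

Lemma support_orth x y : supp_in x -> supp_off y -> x *d y = 0.
Proof.
have sG : G^T = G by case: hG.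
have GC i j : G i j = G j i by rewrite -{1}sG mxE.
move=> ix oy; rewrite (row_sum_delta x) dot_suml big1 // => j _.
rewrite dotZl (row_sum_delta y) (dot_sumr hG) mulr_sumr big1 // => t _.
rewrite (dotZr hG) gram; case: (boolP (Z j)) => Zj; last by rewrite (ix _ Zj) mul0r.
case: (boolP (Z t)) => Zt; first by rewrite (oy _ Zt) mul0r mulr0.
by rewrite GC (GZ Zj Zt) !mulr0.
Qed.

(** Subtract a simple root [al j] from a positive root [b]. If the remainder were supported on the
    other side, it would be orthogonal to [al j], and the reflection would produce
    [b - al j - al j], a root with coefficients of both signs. *)
Lemma root_support : forall b, b \in Phi -> supp_in b \/ supp_off b.
Proof.
have deltaZ j : Z j -> supp_in (al j).
  by move=> Zj t Zt; rewrite mxE eqxx; case: (t =P j) => // e; move: Zt; rewrite e Zj.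
have deltaO j : ~~ Z j -> supp_off (al j).
  by move=> Zj t Zt; rewrite mxE eqxx; case: (t =P j) => // e; move: Zj; rewrite -e Zt.
have split b : b \in pos -> supp_in b \/ supp_off b.
  elim/pos_ind => {}b bp IH; case: (boolP (b \in sim)) => [/sims[j ->]|ns].
    by case: (boolP (Z j)) => Zj; [left; apply: deltaZ | right; apply: deltaO].
  have [a /sims[j ->] sp] := pos_sub_sim hG rsP reg bp ns.
  have lt : (b - al j) *d xi < b *d xi by rewrite dotBl ltrBlDr ltrDl (pos_gt0 (sim_pos (simd j))).
  have bE : b = (b - al j) + al j by rewrite subrK.
  have mixed : (b - al j) *d al j = 0 -> (b - al j) 0 j = 0 -> False.
    move=> o z; have rP : b - al j - al j \in Phi.
      have -> : b - al j - al j = refl (al j) b.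
        rewrite /Submission.refl {2 3}bE cartDl (cart_self hG) // /Submission.cart o mulr0 mul0r add0r.
        by rewrite subrK scaler_nat mulr2n opprD addrA.
      exact: (rs_refl rsP (alP j) (pos_root bp)).
    have [t st] : exists t, 0 < (b - al j) 0 t.
      have /rV0Pn[t nt] := pos_neq0 rsP sp; exists t.
      by rewrite lt_neqAle eq_sym nt pos_coord.
    have tj : t != j by apply: contraTneq st => ->; rewrite z ltxx.
    have cE u : (b - al j - al j) 0 u = (b - al j) 0 u - (u == j)%:R.
      by rewrite mxE; congr (_ + _); rewrite !mxE eqxx.
    case: (boolP (b - al j - al j \in pos)) => [rp|].
      by have := pos_coord j rp; rewrite cE z eqxx sub0r oppr_ge0 ler10.
    rewrite -(posN hG rsP reg rP) => np; have := pos_coord t np.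
    by rewrite mxE cE (negbTE tj) subr0 oppr_ge0 leNgt st.
  case: (IH _ sp lt) => hb; case: (boolP (Z j)) => Zj.
  - by left=> t Zt; rewrite bE mxE hb // add0r; apply: deltaZ.
  - by case: mixed; [apply: support_orth hb (deltaO _ Zj) | apply: hb].
  - by case: mixed; [rewrite (dotcomm hG); apply: support_orth (deltaZ _ Zj) hb | apply: hb].
  by right=> t Zt; rewrite bE mxE hb // add0r; apply: deltaO.
move=> b bP; case: (boolP (b \in pos)) => [/split //|nb].
have : - b \in pos by rewrite (posN hG rsP reg).
have bE t : b 0 t = - (- b) 0 t by rewrite mxE opprK.
by case/split => hb; [left | right] => t Zt; rewrite bE hb // oppr0.
Qed.
End Support.

(** The entries of [A = D - G] are nonnegative, so replacing a maximizer by its absolute values does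
    not decrease the quotient and gives another eigenvector. A zero coordinate would split the Gram
    matrix, against irreducibility. That [G] is definite gives [lam < 1]. *)
Lemma perron : exists (p : 'I_l -> R) (lam : R), [/\ forall i, 0 < p i, 0 <= lam < 1 &
  forall i, \sum_(j | j != i) p j * G j i = - (lam * p i * G i i)].
Proof.
have sG : G^T = G by case: hG.
have GC i j : G i j = G j i by rewrite -{1}sG mxE.
have Gii i : 0 < G i i by rewrite -gram; apply: dot_gt0.
have Gij i j : i != j -> G i j <= 0.
  move=> ij; rewrite -gram; apply: (sim_obtuse hG rsP reg) => //.
  by apply: contraNneq ij => /rowP/(_ i); rewrite !mxE !eqxx /= => /eqP; case: (i == j) => //; rewrite oner_eq0.
pose D : 'M[R]_l := \matrix_(i, j) (if i == j then G i i else 0).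
pose A := D - G.
have sD : D^T = D by apply/matrixP => i j; rewrite !mxE eq_sym; case: eqP => // ->.
have sA : A^T = A by rewrite /A linearB /= sD sG.
have qD (x : V) : (x *m D *m x^T) 0 0 = \sum_i x 0 i ^+ 2 * G i i.
  rewrite mxE; apply: eq_bigr => i _; rewrite !mxE (bigD1 i) //= big1 ?addr0.
    by rewrite mxE eqxx; ring.
  by move=> j ji; rewrite mxE (negbTE ji) mulr0.
have pD (x : V) : x != 0 -> 0 < (x *m D *m x^T) 0 0.
  move=> /rV0Pn[i xi0]; rewrite qD (bigD1 i) //=; apply: ltr_wpDr.
    by apply: sumr_ge0 => j _; rewrite mulr_ge0 ?sqr_ge0 // ltW.
  by rewrite mulr_gt0 // lt_neqAle sqr_ge0 andbT eq_sym expf_neq0.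
have A0 i j : 0 <= A i j.
  rewrite !mxE; case: (eqVneq i j) => [->|ij]; first by rewrite subrr.
  by rewrite sub0r oppr_ge0 Gij.
have qA (x : V) : (x *m A *m x^T) 0 0 = \sum_i \sum_j x 0 i * A i j * x 0 j.
  rewrite mxE; under eq_bigr do rewrite !mxE mulr_suml.
  by rewrite exchange_big.
have [v [lam v0 [ev hx]]] := rayleigh l_gt0 sA sD pD.
pose p : V := \row_i `|v 0 i|.
have p0 i : 0 <= p 0 i by rewrite mxE.
have pn0 : p != 0.
  apply: contraNneq v0 => /rowP h; apply/eqP/rowP => i.
  by have := h i; rewrite !mxE => /normr0_eq0.
have ep : p *m A = lam *: (p *m D).
  have E x : (x *m (lam *: D - A) *m x^T) 0 0 = lam * (x *m D *m x^T) 0 0 - (x *m A *m x^T) 0 0.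
    by rewrite mulmxBr mulmxBl -scalemxAr -scalemxAl !mxE.
  have k0 : (v *m (lam *: D - A) *m v^T) 0 0 = 0.
    by rewrite mulmxBr -scalemxAr ev subrr mul0mx mxE.
  have : p *m (lam *: D - A) = 0.
    apply: psd_ker; first by rewrite linearB linearZ /= sA sD.
      by move=> x; rewrite E subr_ge0.
    apply/eqP; rewrite eq_le; apply/andP; split; last by rewrite E subr_ge0.
    rewrite -[leRHS]k0 !E; apply: lerB.
      by rewrite !qD; under eq_bigr do rewrite mxE real_normK ?num_real //.
    rewrite !qA; apply: ler_sum => i _; apply: ler_sum => j _.
    have pE t : p 0 t = `|v 0 t| by rewrite mxE.
    by rewrite !pE; apply: le_trans (ler_norm _) _; rewrite !normrM (ger0_norm (A0 i j)).
  by rewrite mulmxBr -scalemxAr => /eqP; rewrite subr_eq0 => /eqP ->.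
have eqi i : \sum_(j | j != i) p 0 j * G j i = - (lam * p 0 i * G i i).
  have e0 : \sum_j p 0 j * A j i = lam * \sum_j p 0 j * D j i.
    by have /rowP/(_ i) := ep; rewrite [X in X = _]mxE [X in _ = X]mxE [X in _ = _ * X]mxE.
  have eD : \sum_j p 0 j * D j i = p 0 i * G i i.
    rewrite (bigD1 i) //= big1 ?addr0; first by rewrite [D i i]mxE eqxx.
    by move=> j ji; rewrite [D _ _]mxE (negbTE ji) mulr0.
  have Aii : A i i = 0 by rewrite [A i i]mxE [D i i]mxE [(- G) i i]mxE eqxx subrr.
  move: e0; rewrite eD (bigD1 i) //= Aii mulr0 add0r mulrA => <-.
  rewrite -sumrN; apply: eq_bigr => j ji.
  by rewrite [A j i]mxE [D j i]mxE [(- G) j i]mxE (negbTE ji) sub0r mulrN opprK.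
have ppos i : 0 < p 0 i.
  rewrite lt_neqAle p0 andbT eq_sym; apply/negP => /eqP pi0.
  pose Z := [pred j | p 0 j == 0].
  have GZ j t : Z j -> ~~ Z t -> G t j = 0.
    move=> /= /eqP Zj Zt; have := eqi j; rewrite Zj mulr0 mul0r oppr0 => e.
    have tj : t != j by apply: contraNneq Zt => ->; rewrite /= Zj.
    have /eqP : p 0 t * G t j = 0.
      apply/eqP; rewrite eq_le mulr_ge0_le0 ?Gij //=.
      move: e; rewrite (bigD1 t) //= => /eqP; rewrite addr_eq0 => /eqP ->; rewrite oppr_ge0.
      by apply: sumr_le0 => u /andP[uj _]; rewrite mulr_ge0_le0 ?Gij.
    by rewrite mulf_eq0 (negbTE Zt) => /eqP.
  have orth x y : supp_in Z x -> supp_off Z y -> x *d y = 0 by apply: support_orth.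
  have splitR b : b \in Phi -> supp_in Z b \/ supp_off Z b by apply: root_support.
  have [|all|none] := irr (P := supp_in Z).
  - by move=> b c /splitR hb /splitR[] hc // ib nc; apply: orth.
  - have [t /negP Zt] : exists t, ~ Z t.
      have /rV0Pn[t nt] := pn0; exists t; apply/negP; exact: nt.
    have := all _ (alP t) t Zt; rewrite mxE !eqxx => /eqP; by rewrite oner_eq0.
  apply: (none _ (alP i)) => t Zt; rewrite mxE eqxx; case: (t =P i) => // e.
  by move: Zt; rewrite e /= pi0 eqxx.
exists (fun i => p 0 i), lam; split=> //.
have sumD : 0 < (p *m D *m p^T) 0 0 by apply: pD.
have e1 : (p *m A *m p^T) 0 0 = lam * (p *m D *m p^T) 0 0 by rewrite ep -scalemxAl mxE.
apply/andP; split.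
  rewrite -(pmulr_lge0 _ sumD) -e1 qA; apply: sumr_ge0 => i _; apply: sumr_ge0 => j _.
  by rewrite !mulr_ge0.
rewrite -(ltr_pM2r sumD) mul1r -e1 -subr_gt0.
have <- : p *d p = (p *m D *m p^T) 0 0 - (p *m A *m p^T) 0 0.
  have sub M N (x : V) : (x *m (M - N) *m x^T) 0 0 = (x *m M *m x^T) 0 0 - (x *m N *m x^T) 0 0.
    by rewrite mulmxBr mulmxBl !mxE.
  by rewrite -sub /A subKr.
exact: dot_gt0.
Qed.

Lemma wact_orth (ws : seq V) x : uniq ws -> {in ws, forall a, a != 0} ->
  {in ws &, forall a b, a != b -> a *d b = 0} ->
  wact G ws x = x - \sum_(a <- ws) cart x a *: a.
Proof.
elim: ws => [|w ws IH] /=; first by rewrite big_nil subr0.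
case/andP => nw us n0 ho; rewrite IH //; first last.
- by move=> a b aw bw; apply: ho; rewrite in_cons ?aw ?bw orbT.
- by move=> a aw; apply: n0; rewrite in_cons aw orbT.
rewrite big_cons /Submission.refl; have -> : cart (x - \sum_(a <- ws) cart x a *: a) w = cart x w.
  rewrite cartBl cart_suml big_seq big1 ?subr0 // => a aw.
  rewrite cartZl; have -> : cart a w = 0; last by rewrite mulr0.
  rewrite /Submission.cart ho ?mulr0 ?mul0r ?in_cons ?aw ?eqxx ?orbT //.
  by apply: contraNneq nw => <-.
by rewrite opprD addrA addrAC.
Qed.

(* The two halves of a bipartite Coxeter word act on the plane spanned by the
   two halves of the Perron vector as reflections. *)
Lemma coxeter_plane : exists (w1 w2 : seq V) (a b : V) (lam : R),
  [/\ {subset w1 <= sim}, {subset w2 <= sim}, (size w1 + size w2 = l)%N, 0 <= lam < 1 &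
   [/\ wact G w1 a = - a, wact G w1 b = b + (2 * lam) *: a,
       wact G w2 b = - b, wact G w2 a = a + (2 * lam) *: b &
   [/\ forall i, 0 < al i *d (a + b),
       forall x, wact G w1 (wact G w1 x) = x, forall x, wact G w2 (wact G w2 x) = x
     & forall x, wact G w1 x = wact G w2 x -> x = 0]]].
Proof.
have [p [lam [p0 hl eqi]]] := perron; have [D hD] := bipartite hG rsP reg.
have Gii i : 0 < G i i by rewrite -gram; apply: dot_gt0.
have Gii0 i : G i i != 0 by rewrite gt_eqF.
have ali : injective (fun i => al i).
  move=> i j /rowP/(_ i); rewrite !mxE !eqxx /=; case: (i =P j) => // _ /eqP.
  by rewrite oner_eq0.
pose W (c : bool) := [seq al i | i <- enum 'I_l & D (al i) == c].
have WP c x : x \in W c -> exists2 i, x = al i & D (al i) == c.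
  by move=> /mapP[i]; rewrite mem_filter => /andP[hi _] ->; exists i.
have uW c : uniq (W c) by rewrite map_inj_uniq // filter_uniq // enum_uniq.
have oW c : {in W c &, forall x y, x != y -> x *d y = 0}.
  move=> x y /WP[i -> hi] /WP[j -> hj] ne; apply/eqP; rewrite -[_ == 0]negbK; apply/negP => nz.
  by have := hD _ _ (simd i) (simd j) ne nz; rewrite (eqP hi) (eqP hj) eqxx.
have nW c : {in W c, forall x, x != 0} by move=> x /WP[i -> _].
have wE c x : wact G (W c) x = x - \sum_(i | D (al i) == c) cart x (al i) *: al i.
  rewrite wact_orth //; congr (_ - _); rewrite big_map big_filter big_enum_cond.
  by apply: eq_bigl => i.
have winv c x : wact G (W c) (wact G (W c) x) = x.
  have rW : rev (W c) = W c -> False \/ True by right.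
  have {rW} e : wact G (W c) (wact G (W c) x) = wact G (rev (W c)) (wact G (W c) x).
    rewrite [RHS]wact_orth ?rev_uniq //.
    - rewrite [LHS]wact_orth //; congr (_ - _); by rewrite (perm_big _ (permEl (perm_rev _))).
    - by move=> y; rewrite mem_rev; apply: nW.
    by move=> y z; rewrite !mem_rev; apply: oW.
  by rewrite e (wact_rev hG rsP) // => y /WP[i -> _].
pose h c := \sum_(i | D (al i) == c) p i *: al i.
have dW c i : D (al i) == c -> h c *d al i = p i * G i i.
  move=> hi; rewrite /h dot_suml (bigD1 i) //= dotZl gram big1 ?addr0 // => j /andP[hj ji].
  rewrite dotZl gram; suff -> : G j i = 0 by rewrite mulr0.
  apply/eqP; rewrite -gram -[_ == 0]negbK; apply/negP => nz.
  by have := hD _ _ (simd j) (simd i) _ nz; rewrite (inj_eq ali) (eqP hi) (eqP hj) eqxx => /(_ ji).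
have dN c i : D (al i) == ~~ c -> h c *d al i = - (lam * p i * G i i).
  move=> hi; rewrite -eqi (bigID (fun j => D (al j) == c)) /= [X in _ = _ + X]big1 ?addr0.
    rewrite /h dot_suml; apply: eq_big => [j|j _]; last by rewrite dotZl gram.
    case: (D (al j) =P c) => [e|]; rewrite ?andbF // andbT; apply/esym.
    by apply: contraTneq hi => <-; rewrite e; case: (c).
  move=> j /andP[ji hj]; suff -> : G j i = 0 by rewrite mulr0.
  apply/eqP; rewrite -gram -[_ == 0]negbK; apply/negP => nz.
  have := hD _ _ (simd j) (simd i) _ nz; rewrite (inj_eq ali) (eqP hi) => /(_ ji).
  by move: hj; case: (D _) (c) => [] [].
have w_self c : wact G (W c) (h c) = - h c.
  rewrite wE; have -> : \sum_(i | D (al i) == c) cart (h c) (al i) *: al i = 2 *: h c.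
    rewrite /h scaler_sumr; apply: eq_bigr => i hi; rewrite scalerA; congr (_ *: _).
    by rewrite /Submission.cart -/(h c) dW // gram; field.
  by rewrite scaler_nat mulr2n opprD addrA subrr sub0r.
have w_other c : wact G (W c) (h (~~ c)) = h (~~ c) + (2 * lam) *: h c.
  rewrite wE; congr (_ + _); rewrite /h scaler_sumr -sumrN; apply: eq_bigr => i hi.
  rewrite scalerA -scaleNr; congr (_ *: _).
  by rewrite /Submission.cart -/(h (~~ c)) dN ?negbK // gram; field.
exists (W true), (W false), (h true), (h false), lam; split=> //.
- by move=> x /WP[i -> _].
- by move=> x /WP[i -> _].
- rewrite !size_map !size_filter -[RHS]size_enum_ord -(count_predC (fun i => D (al i) == true)).
  by congr (_ + _)%N; apply: eq_count => i /=; case: (D _).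
split; [exact: w_self | exact: (w_other true) | exact: w_self | exact: (w_other false) |].
split=> // [i|x e].
  rewrite (dotcomm hG) dotDl; case Di: (D (al i)).
    rewrite dW ?Di // dN ?Di //; have /andP[_ l1] := hl.
    have -> : p i * G i i + - (lam * p i * G i i) = (1 - lam) * (p i * G i i) by ring.
    by rewrite mulr_gt0 ?mulr_gt0 // subr_gt0.
  rewrite dN ?Di // dW ?Di //; have /andP[_ l1] := hl.
  have -> : - (lam * p i * G i i) + p i * G i i = (1 - lam) * (p i * G i i) by ring.
  by rewrite mulr_gt0 ?mulr_gt0 // subr_gt0.
move: e; rewrite !wE => /addrI/oppr_inj e.
have c0 i : cart x (al i) = 0.
  have co c : (\sum_(j | D (al j) == c) cart x (al j) *: al j) 0 i = if D (al i) == c then cart x (al i) else 0.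
    rewrite summxE; case: ifP => hi.
      rewrite (bigD1 i) //= !mxE !eqxx mulr1 big1 ?addr0 // => j /andP[_ ji].
      by rewrite !mxE eq_sym (negbTE ji) andbF mulr0.
    rewrite big1 // => j hj; rewrite !mxE; case: (i =P j) => [ij|]; last by rewrite andbF mulr0.
    by move: hi; rewrite ij hj.
  by have := congr1 (fun y : V => y 0 i) e; rewrite /= !co; case: (D (al i)).
apply/eqP; rewrite -(dot_eq0 hG); apply/eqP; rewrite {2}(row_sum_delta x) (dot_sumr hG) big1 // => i _.
by rewrite (dotZr hG); have /eqP := c0 i; rewrite (cart_eq0 hG) // => /eqP ->; rewrite mulr0.
Qed.

End CoxeterPlane.

From mathcomp Require Import fingroup perm finmap.

(** * The Weyl arrangement and bases invariant under a word *)

Section CatZero.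
Variables (R : realType) (l : nat) (G : 'M[R]_l).
Hypothesis hG : inner_product G.
Local Notation V := 'rV[R]_l.
Local Notation S := {mpoly R[l]}.
Local Notation "u '*d' v" := (dot G u v) (at level 40).
Local Notation cart := (cart G).
Local Notation refl := (refl G).
Local Notation act := (act G).
Local Notation sact := (sact G).
Local Notation wact := (wact G).
Variables (Phi : seq V) (xi : V).
Hypotheses (rsP : root_system G Phi) (reg : regular G Phi xi).
Local Notation pos := (posr G Phi xi).
Local Notation sim := (simr G Phi xi).
Local Notation ht := (ht G xi).
Hypothesis simd : forall i, delta_mx 0 i \in sim.
Hypothesis sim1 : {in sim, forall a, a *d xi = 1}.
Variable h : R.
Hypothesis hcox : {in Phi, forall a, \sum_(b <- pos) cart b a * cart a b = 2 * h}.

Definition logc (th : 'rV[S]_l) := {in pos, forall b, mdvd (lf b) (dap th b)}.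
Let Fs := [seq (b, lf b) | b <- pos].
Let P : S := \prod_(c <- Fs) c.2.

Let P0 : P != 0.
Proof.
rewrite /P big_map; rewrite prodf_seq_neq0; apply/allP => b bp /=.
by rewrite lf_eq0 (pos_neq0 rsP bp).
Qed.
Let Phomog : P \is (size pos).-homog.
Proof. by rewrite /P big_map -[size _]sum1_size; apply: homog_prod => b; exact: lf_homog. Qed.
Let fcopF : fcop Fs.
Proof.
split.
- by rewrite map_inj_in_uniq ?(pos_uniq xi rsP) // => x y _ _ [].
- by move=> c /mapP[b bp ->] /=; apply: (pos_neq0 rsP bp).
move=> c d /mapP[b bp ->] /mapP[b' bp' ->] ne /=.
apply: lf_cop_lf; first exact: (pos_neq0 rsP bp).
move=> t; apply/eqP => e; move: ne; rewrite e.
by rewrite (pos_scale hG rsP reg bp (t := t)) ?scale1r ?eqxx // -e.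
Qed.
Let lsubF th : logc th <-> lsub Fs th.
Proof.
split=> [hh c /mapP[b bp ->]|hh b bp]; first exact: hh.
exact: (hh (b, lf b) (map_f _ bp)).
Qed.

Definition cbasis (Th : 'M[S]_l) (e : 'I_l -> nat) := [/\ forall i, logc (row i Th),
  forall i j, Th i j \is (e i).-homog, \det Th != 0 & \sum_i e i = size pos].

(** The ladder with [k = 0] starts at the empty arrangement with the identity matrix; setting
    [z = 0] in its result gives the basis. The determinant survives because none of the forms is a
    multiple of [z]. *)
Lemma cat0_basis : exists (Th : 'M[S]_l) (e : 'I_l -> nat), cbasis Th e /\
  forall r, (0 < r)%N -> #|[set i | (r <= e i)%N]| = count (fun b => ht b == r) pos.
Proof.
pose E : 'M[R]_(l, l + 1) := row_mx 1%:M 0.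
pose zeta : 'rV[R]_(l + 1) := row_mx 0 1%:M.
have Einj v t : v *m E = t *: zeta -> v = 0 /\ t = 0.
  rewrite mul_mx_row mulmx1 mulmx0 scale_row_mx scaler0 => /eq_row_mx[-> /matrixP/(_ 0 0)].
  by rewrite !mxE mulr1 => <-.
have up := pos_uniq xi rsP.
have A0 c : c \in arr G Phi xi (fun=> 0%N) (fun=> 0%N) = false.
  by apply/negP => /mem_arr[[_ [i]]|[_ [i]]] //; case: i.
have sb0 : sbasis E zeta (arr G Phi xi (fun=> 0%N) (fun=> 0%N)) (1%:M : 'M[{mpoly R[l + 1]}]_l) (fun=> 0%N).
  split=> [i c| | |].
  - by rewrite A0.
  - by move=> i j; rewrite mxE; case: (_ == _); rewrite ?dhomog1 ?dhomog0 ?rpred0.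
  - by rewrite det1 oner_eq0.
  by rewrite (size_arr G Phi xi) !big1_eq.
have [] := @ladder R l (l + 1) G hG E zeta Einj Phi xi rsP reg sim1 h hcox 0 0 pos _ up _ _
   (fun _ _ => True) (fun _ => True) _ _ _ _ _ _ 1%:M (fun i => (delta_mx 0 i, 0)) sb0 _ _ _ 0 => //.
- by rewrite mul0r.
- move=> w _ /= hw i; have := congr1 (fun x : V => x 0 i) hw; rewrite summxE mxE (bigD1 i) //= !mxE !eqxx mulr1.
  by rewrite big1 ?addr0 // => j ji; rewrite !mxE eq_sym (negbTE ji) andbF mulr0.
move=> Th [e [_ [_ [sb ce _ _ _]]]].
pose red := [tuple (match split i with inl j => 'X_j | inr _ => 0 end : S) | i < l + 1].
have redlf (b : V) : lf (aff E zeta (b, - 0%:R)) \mPo red = lf b.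
  rewrite comp_lf big_split_ord /= [X in _ + X]big1 ?addr0 => [|i _].
    apply: eq_bigr => i _; rewrite tnth_mktuple (unsplitK (inl i)); congr (_ *: _).
    by rewrite /aff /= oppr0 scale0r subr0 mul_mx_row row_mxEl mulmx1.
  by rewrite tnth_mktuple (unsplitK (inr i)) scaler0.
have memA b : b \in pos -> (b, - 0%:R) \in arr G Phi xi (fun b => 0 + (b \in pos))%N (fun=> 0%N).
  by move=> bp; apply/mem_arr; left; split=> //=; exists 0%N; rewrite // bp.
case: sb => [hl hh hd hs].
have hh' i j : (Th i j \mPo red) \is (e i).-homog.
  rewrite -[e i]muln1; apply: homog_comp; first exact: hh.
  move=> t; rewrite tnth_mktuple; case: (split t) => u; last exact: rpred0.
  by rewrite -lf_delta lf_homog.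
have dapr i (b : V) : dap (row i (map_mx (comp_mpoly red) Th)) b = dap (row i Th) b \mPo red.
  rewrite /dap rmorph_sum /=; apply: eq_bigr => j _.
  by rewrite comp_mpolyZ !mxE.
exists (map_mx (comp_mpoly red) Th), e; split; last first.
  by case: ce => _ ce r r0; rewrite -ce.
split=> [i b bp|i j||].
- rewrite dapr; have [g ->] := hl i _ (memA b bp); rewrite rmorphM /= redlf; exact: mdvdMr (mdvd_refl _).
- by rewrite mxE.
- have fc := fcop_arr hG Einj rsP reg (fun b => 0 + (b \in pos))%N (fun=> 0%N).
  have [|u eu] := saito_det fc (fun i => proj1 (logd_lsub E zeta _ _) (hl i)) hh _ hs.
    by rewrite big_map -[size _]sum1_size; apply: homog_prod => b; exact: lf_homog.
  have u0 : u != 0 by apply: contraNneq hd => u0; rewrite eu u0 scale0r.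
  rewrite det_map_mx /= eu comp_mpolyZ scaler_eq0 negb_or u0 rmorph_prod /= prodf_seq_neq0.
  apply/allP => c /mapP[b bA ->] /=; case/mem_arr: bA => [[bp [i hi e2]]|[_ [i]]]; last by case: i.
  have i0 : i = 0%N by move: hi; rewrite add0n; case: (b.1 \in pos); case: (i).
  by rewrite [b]surjective_pairing e2 i0 redlf lf_eq0 (pos_neq0 rsP bp).
rewrite hs size_arr -sum1_size big_seq [RHS]big_seq; apply: eq_bigr => b bp.
by rewrite bp.
Qed.

Definition actw (ws : seq V) (th : 'rV[S]_l) := foldr act th ws.
Definition sactw (ws : seq V) (p : S) := foldr sact p ws.

Lemma logc_act a th : a \in sim -> logc th -> logc (act a th).
Proof.
move=> sa hq b bp; have aP := pos_root (sim_pos sa); have a0 := root_neq0 rsP aP.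
have eb : lf b = sact a (lf (refl a b)) by rewrite sact_lf (refl_inv hG).
rewrite dap_act eb; apply/sact_dvd.
case: (eqVneq b a) => [->|ba]; last by apply: hq; apply: (refl_pos hG rsP reg).
by rewrite (refl_self hG) // dapN linearN /=; apply/mdvdN; have [g ->] := hq a (sim_pos sa); exists (- g); rewrite mulrNN.
Qed.

Lemma logc_sub a th : a \in sim -> logc th ->
  exists2 chi, th - act a th = lf a *: chi & logc chi.
Proof.
move=> sa hq; have ap := sim_pos sa; have a0 := pos_neq0 rsP ap.
have [|chi ec] := act_sub hG (a := a) (th := th); first exact: hq.
exists chi => // b bp; case: (eqVneq b a) => [->|ba].
  have [g eg] := hq a ap; have [r er] := sact_sub G a g; exists r.
  apply: (mulfI (x := lf a)); first by rewrite lf_eq0.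
  rewrite -dap_scale -ec dapB dap_act (refl_self hG) // dapN eg sactN sactM sact_lf (refl_self hG) //.
  have -> : lf (- a) = - lf a :> S by rewrite linearN.
  by rewrite -er; ring.
have cop : mcop (lf b) (lf a).
  apply: lf_cop_lf; first exact: (pos_neq0 rsP bp).
  move=> t; apply/eqP => e; move: ba; rewrite e.
  by rewrite (pos_scale hG rsP reg bp (t := t)) ?scale1r ?eqxx // -e.
apply: cop; rewrite -dap_scale -ec dapB; apply: mdvdB; first exact: hq.
exact: logc_act.
Qed.

Section Average.
Variables (Th : 'M[S]_l) (e : 'I_l -> nat).
Hypothesis cbT : cbasis Th e.

Lemma cbasis_det : exists2 u : R, u != 0 & \det Th = u *: P.
Proof.
case: cbT => hl hh hd hs.
have [u eu] := saito_det fcopF (fun i => proj1 (lsubF _) (hl i)) hh Phomog hs.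
by exists u => //; apply: contraNneq hd => u0; rewrite eu u0 scale0r.
Qed.

Lemma logc_span th : logc th -> exists c : 'rV[S]_l, th = c *m Th.
Proof.
have [u u0 eu] := cbasis_det; case: cbT => hl _ _ _ ht.
exact: saito fcopF (fun i => proj1 (lsubF _) (hl i)) u0 P0 eu (proj1 (lsubF _) ht).
Qed.

Let at0 (p : S) : R := p.@[fun=> 0].
(** Congruence modulo the maximal ideal of the origin times the module of logarithmic
    derivations. *)
Definition mod1 (x y : 'rV[S]_l) := exists2 p : 'rV[S]_l, forall j, at0 (p 0 j) = 0 & x - y = p *m Th.

Let at0_lf a : at0 (lf a) = 0.
Proof. by rewrite /at0 /lf rmorph_sum /= big1 // => i _; rewrite mevalZ mevalXU mulr0. Qed.
Let at0_sact a p : at0 (sact a p) = at0 p.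
Proof.
rewrite /at0 /Submission.sact comp_mpoly_meval; apply: meval_eq => i.
by rewrite tnth_mktuple; exact: at0_lf.
Qed.

Lemma mod1_refl x : mod1 x x.
Proof. by exists 0; [move=> j; rewrite mxE /at0 rmorph0 | rewrite subrr mul0mx]. Qed.
Lemma mod1_trans x y z : mod1 x y -> mod1 y z -> mod1 x z.
Proof.
move=> [p hp ep] [q hq eq]; exists (p + q); last by rewrite mulmxDl -ep -eq addrA subrK.
by move=> j; rewrite mxE /at0 rmorphD /= -/(at0 _) -/(at0 (q 0 j)) hp hq addr0.
Qed.
Lemma mod1D x y x' y' : mod1 x y -> mod1 x' y' -> mod1 (x + x') (y + y').
Proof.
move=> [p hp ep] [q hq eq]; exists (p + q); last by rewrite mulmxDl -ep -eq opprD addrACA.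
by move=> j; rewrite mxE /at0 rmorphD /= -/(at0 _) -/(at0 (q 0 j)) hp hq addr0.
Qed.
Lemma mod1Z c x y : mod1 x y -> mod1 (c *: x) (c *: y).
Proof.
move=> [p hp ep]; exists (c *: p); last by rewrite -scalerBr ep scalemxAl.
by move=> j; rewrite mxE /at0 rmorphM /= -/(at0 (p 0 j)) hp mulr0.
Qed.

Lemma act_scale a (p : S) x : act a (p *: x) = sact a p *: act a x.
Proof. by apply: dap_inj => g; rewrite dap_scale !dap_act dap_scale sactM. Qed.
Lemma act0 a : act a 0 = 0.
Proof. by rewrite -[0](scale0r (0 : 'rV[S]_l)) act_scale sact0 !scale0r. Qed.
Lemma act_sum a (I : Type) (r : seq I) (F : I -> 'rV[S]_l) :
  act a (\sum_(i <- r) F i) = \sum_(i <- r) act a (F i).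
Proof. by elim: r => [|x r IH]; rewrite ?big_nil ?act0 // !big_cons actD IH. Qed.

Lemma mod1_act a x y : a \in sim -> mod1 x y -> mod1 (act a x) (act a y).
Proof.
move=> sa [p hp ep]; case: cbT => hl _ _ _.
have /fin_all_exists[c hc] : forall j, exists c : 'rV[S]_l, act a (row j Th) = c *m Th.
  by move=> j; apply: logc_span; apply: logc_act.
exists (\sum_j sact a (p 0 j) *: c j).
  move=> i; rewrite summxE /at0 rmorph_sum /= big1 // => j _.
  by rewrite mxE rmorphM /= -/(at0 (sact a (p 0 j))) at0_sact hp mul0r.
have -> : act a x - act a y = act a (x - y).
  by apply: dap_inj => g; rewrite dapB !dap_act dapB sactB.
rewrite ep mulmx_sum_row act_sum mulmx_suml; apply: eq_bigr => j _.
by rewrite act_scale hc scalemxAl.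
Qed.

(** A simple reflection moves a logarithmic derivation by [lf a] times another one, hence trivially
    modulo the maximal ideal. *)
Lemma mod1_row a i : a \in sim -> mod1 (act a (row i Th)) (row i Th).
Proof.
move=> sa; case: cbT => hl _ _ _.
have [chi ec hchi] := logc_sub sa (hl i); have [c hc] := logc_span hchi.
exists (- lf a *: c); last by rewrite -scalemxAl -hc -opprB ec scaleNr.
by move=> j; rewrite mxE /at0 rmorphM rmorphN /= -/(at0 (lf a)) at0_lf oppr0 mul0r.
Qed.

Lemma mod1_word ws i : {subset ws <= sim} -> mod1 (actw ws (row i Th)) (row i Th).
Proof.
elim: ws => [|w ws IH] hw /=; first exact: mod1_refl.
have hw' : {subset ws <= sim} by move=> y yw; apply: hw; rewrite in_cons yw orbT.
have sw : w \in sim by apply: hw; rewrite mem_head.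
exact: mod1_trans (mod1_act sw (IH hw')) (mod1_row i sw).
Qed.

Lemma logc_word ws th : {subset ws <= sim} -> logc th -> logc (actw ws th).
Proof.
elim: ws => [|w ws IH] hw //= ht; apply: logc_act; first by apply: hw; rewrite mem_head.
by apply: IH => // y yw; apply: hw; rewrite in_cons yw orbT.
Qed.
Lemma actw_homog ws (th : 'rV[S]_l) d : (forall j, th 0 j \is d.-homog) ->
  forall j, actw ws th 0 j \is d.-homog.
Proof. by elim: ws => [|w ws IH] //= ht; apply: act_homog => //; apply: IH. Qed.

Lemma actw_cat u w th : actw (u ++ w) th = actw u (actw w th).
Proof. by rewrite /actw foldr_cat. Qed.
Lemma actw_sum ws (I : Type) (r : seq I) (F : I -> 'rV[S]_l) :
  actw ws (\sum_(i <- r) F i) = \sum_(i <- r) actw ws (F i).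
Proof. by elim: ws => [|w ws IH] //=; rewrite IH act_sum. Qed.
Lemma actw_scaleC ws (c : R) x : actw ws (c%:MP *: x) = c%:MP *: actw ws x.
Proof. by elim: ws => [|w ws IH] //=; rewrite IH act_scale sactC. Qed.
Lemma sactw_lf ws g : sactw ws (lf g) = lf (wact ws g).
Proof. by elim: ws => [|w ws IH] //=; rewrite IH sact_lf. Qed.
Lemma sactwD ws p q : sactw ws (p + q) = sactw ws p + sactw ws q.
Proof. by elim: ws => [|w ws IH] //=; rewrite IH sactD. Qed.
Lemma sactwM ws p q : sactw ws (p * q) = sactw ws p * sactw ws q.
Proof. by elim: ws => [|w ws IH] //=; rewrite IH sactM. Qed.
Lemma sactwC ws c : sactw ws c%:MP = c%:MP.
Proof. by elim: ws => [|w ws IH] //=; rewrite IH sactC. Qed.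
Lemma dap_actw (ws : seq V) th g : dap (actw ws th) g = sactw ws (dap th (wact (rev ws) g)).
Proof.
elim: ws g => [|w ws IH] g //=; rewrite dap_act IH rev_cons -cats1 wact_cat.
by [].
Qed.

Definition cpow (c : seq V) t := flatten (nseq t c).

(** A word permutes the finitely many roots, and these include the coordinate vectors. *)
Lemma wact_order (c : seq V) : {subset c <= sim} -> exists2 m, (0 < m)%N &
  forall x, wact (cpow c m) x = x.
Proof.
move=> cs; have cP := sim_root cs.
have hf (x : seq_sub Phi) : wact c (ssval x) \in Phi by apply: (wact_root rsP) => //; apply: ssvalP.
pose f (x : seq_sub Phi) : seq_sub Phi := SeqSub (hf x).
have fi : injective f.
  move=> x y exy; have /= e0 : ssval (f x) = ssval (f y) by rewrite exy.
  apply: val_inj => /=; by rewrite -(wact_rev hG rsP (ssval x) cP) e0 (wact_rev hG rsP).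
pose p := perm fi; exists #[p]%g; first exact: order_gt0.
have pE t x : ssval ((p ^+ t)%g x) = wact (cpow c t) (ssval x).
  elim: t => [|t IH]; first by rewrite expg0 perm1.
  by rewrite expgSr permM permE /= IH /cpow /= wact_cat.
move=> x; rewrite {2}(row_sum_delta x) {1}(row_sum_delta x) linear_sum; apply: eq_bigr => i _.
rewrite linearZ /=; congr (_ *: _); have iP := pos_root (sim_pos (simd i)).
by rewrite -[delta_mx 0 i]/(ssval (SeqSub iP)) -pE expg_order perm1.
Qed.

Lemma cpow_sub (c : seq V) t : {subset c <= sim} -> {subset cpow c t <= sim}.
Proof. by move=> cs x /flattenP[y /nseqP[-> _] /cs]. Qed.

Lemma actw_order (c : seq V) m : {subset c <= sim} -> (forall x, wact (cpow c m) x = x) ->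
  forall th, actw (cpow c m) th = th.
Proof.
move=> cs cm th; apply: dap_inj => g; rewrite dap_actw.
have -> : wact (rev (cpow c m)) g = g.
  by rewrite -{1}(cm g) (wact_rev hG rsP) //; apply/sim_root/cpow_sub.
apply: (@mpoly_ext _ _ S (sactw (cpow c m)) id) => //.
- by move=> x y; rewrite sactwD.
- by move=> x y; rewrite sactwM.
- by move=> t; rewrite sactwC.
by move=> i; rewrite -lf_delta sactw_lf cm.
Qed.

(** Averaging over the powers of [c] makes the rows invariant and keeps them in their classes for
    [mod1]. So the transition matrix is the identity at the origin and its determinant is
    nonzero. *)
Lemma inv_basis (c : seq V) : {subset c <= sim} -> exists2 Th', cbasis Th' e &
  forall i, actw c (row i Th') = row i Th'.
Proof.
move=> cs; have [m m0 cm] := wact_order cs; have cbT' := cbT; case: (cbT) => hl hh hd hs.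
have mR : m%:R != 0 :> R by rewrite pnatr_eq0 -lt0n.
pose y i : 'rV[S]_l := (m%:R^-1)%:MP *: \sum_(t < m) actw (cpow c t) (row i Th).
have y1 i : mod1 (y i) (row i Th).
  have -> : row i Th = (m%:R^-1)%:MP *: \sum_(t < m) row i Th.
    rewrite sumr_const card_ord -scaler_nat scalerA -[m%:R : S]mpolyC_nat -mpolyCM mulVf //.
    by rewrite mpolyC1 scale1r.
  apply: mod1Z; apply: (big_ind2 mod1); first exact: mod1_refl.
    exact: mod1D.
  by move=> t _; apply/mod1_word/cpow_sub.
have /fin_all_exists2[p hp ep] := y1.
pose Pm : 'M[S]_l := \matrix_(i, j) p i 0 j.
have ey : \matrix_i y i = (1%:M + Pm) *m Th.
  apply/row_matrixP => i; rewrite rowK mulmxDl mul1mx linearD /= row_mul.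
  have -> : row i Pm = p i by apply/rowP => j; rewrite !mxE.
  by rewrite -ep addrC subrK.
exists (\matrix_i y i).
  split=> //.
  - move=> i; rewrite rowK /y; move=> b bp; rewrite dap_scale; apply: mdvdMl.
    apply: (big_ind (fun x => mdvd (lf b) (dap x b))).
    + by rewrite -(scale0r (0 : 'rV[S]_l)) dap_scale mul0r; apply: mdvd0.
    + by move=> u v hu hv; rewrite dap_add; apply: mdvdD.
    by move=> t _; apply: logc_word bp => //; apply: cpow_sub.
  - move=> i j; rewrite mxE /y mxE mul_mpolyC; apply: rpredZ; rewrite summxE.
    apply: rpred_sum => t _; apply: actw_homog => j'; rewrite mxE; exact: hh.
  rewrite ey det_mulmx mulf_neq0 //; apply/eqP => d0.
  have := congr1 at0 d0; rewrite /at0 rmorph0 -det_map_mx.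
  have -> : map_mx (meval (fun=> 0)) (1%:M + Pm) = 1%:M.
    by rewrite map_mxD map_mx1; apply/matrixP => i j; rewrite !mxE [X in _ + X](hp i j) addr0.
  by rewrite det1 => /eqP; rewrite oner_eq0.
move=> i; rewrite rowK /y actw_scaleC; congr (_ *: _); rewrite actw_sum.
have e1 (t : 'I_m) : true -> actw c (actw (cpow c t) (row i Th)) = actw (cpow c t.+1) (row i Th).
  by move=> _; rewrite -actw_cat.
rewrite (eq_bigr _ e1); case: m m0 cm {mR y y1 p hp ep Pm ey e1} => // m _ cm.
rewrite big_ord_recr [RHS]big_ord_recl /= addrC; congr (_ + _).
by rewrite (actw_order cs cm).
Qed.

End Average.
End CatZero.

Lemma zeta_order (T : fieldType) (z : T) m : (0 < m)%N -> z ^+ m = 1 ->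
  exists d, [/\ (0 < d)%N, z ^+ d = 1 & forall x, z ^+ x = 1 -> (d %| x)%N].
Proof.
move=> m0 zm; have ex : exists d, (0 < d)%N && (z ^+ d == 1) by exists m; rewrite m0 zm eqxx.
case: (ex_minnP ex) => d /andP[d0 /eqP zd] hmin; exists d; split=> // x zx.
rewrite /dvdn; apply/eqP; case: (posnP (x %% d)) => // r0; exfalso.
have zr : z ^+ (x %% d) = 1.
  by move: zx; rewrite {1}(divn_eq x d) exprD mulnC exprM zd expr1n mul1r.
by have := hmin (x %% d)%N; rewrite r0 zr eqxx => /(_ isT); rewrite leqNgt ltn_mod d0.
Qed.

Lemma det_perm_neq0 (T : fieldType) n (K : 'M[T]_n) : \det K != 0 ->
  exists s : 'S_n, forall i, K i (s i) != 0.
Proof.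
move=> dK; case: (pickP (fun s : 'S_n => \prod_i K i (s i) != 0)) => [s hs|h0].
  by exists s => i; apply: contraNneq hs => e; rewrite (bigD1 i) //= e mul0r.
case/eqP: dK; rewrite /determinant big1 // => s _.
by move: (h0 s) => /negbFE/eqP ->; rewrite mulr0.
Qed.

Module Spectrum.
From mathcomp Require Import complex.

(** * Coxeter elements and the duality of exponents *)

Section Spectrum.
Variables (R : realType) (l : nat) (G : 'M[R]_l).
Hypothesis hG : inner_product G.
Local Notation V := 'rV[R]_l.
Local Notation S := {mpoly R[l]}.
Local Notation C := (R[i]).
Local Notation "u '*d' v" := (dot G u v) (at level 40).
Local Notation cart := (cart G).
Local Notation wact := (wact G).
Variables (Phi : seq V) (xi : V).
Hypotheses (rsP : root_system G Phi) (reg : regular G Phi xi).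
Local Notation pos := (posr G Phi xi).
Local Notation sim := (simr G Phi xi).
Local Notation ht := (ht G xi).
Hypothesis simd : forall i, delta_mx 0 i \in sim.
Hypothesis sims : forall a, a \in sim -> exists i, a = delta_mx 0 i.
Hypothesis sim1 : {in sim, forall a, a *d xi = 1}.
Hypothesis irr : forall P : V -> Prop,
  (forall a b, a \in Phi -> b \in Phi -> P a -> ~ P b -> a *d b = 0) ->
  (forall a, a \in Phi -> P a) \/ (forall a, a \in Phi -> ~ P a).
Hypothesis l_gt0 : (0 < l)%N.

Local Notation rc := (real_complex R).
Definition pev (v : 'I_l -> C) (p : S) : C := mmap rc v p.

Lemma pevD v p q : pev v (p + q) = pev v p + pev v q.
Proof. exact: rmorphD. Qed.
Lemma pevM v p q : pev v (p * q) = pev v p * pev v q.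
Proof. exact: rmorphM. Qed.
Lemma pevC v c : pev v c%:MP = rc c.
Proof. exact: mmapC. Qed.
Lemma pevX v i : pev v 'X_i = v i.
Proof. by rewrite /pev mmapX mmap1U. Qed.
Lemma pevZ v c p : pev v (c *: p) = rc c * pev v p.
Proof. by rewrite -mul_mpolyC pevM pevC. Qed.
Lemma pev_sum v (I : Type) (r : seq I) (F : I -> S) :
  pev v (\sum_(i <- r) F i) = \sum_(i <- r) pev v (F i).
Proof. exact: rmorph_sum. Qed.
Lemma pev_lf v g : pev v (lf g) = \sum_i rc (g 0 i) * v i.
Proof. by rewrite pev_sum; apply: eq_bigr => i _; rewrite pevZ pevX. Qed.
Lemma pev_scale v (z : C) d p : p \is d.-homog -> pev (fun i => z * v i) p = z ^+ d * pev v p.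
Proof.
move=> /dhomogP hp; rewrite /pev /mmap mulr_sumr; apply: eq_big_seq => m /hp dm.
rewrite mulrCA; congr (_ * _); rewrite /mmap1.
under eq_bigr do rewrite exprMn.
rewrite big_split /=; congr (_ * _); rewrite -[in RHS](dm : mdeg m = d) mdegE.
by rewrite prodrXr.
Qed.

Lemma pev_sactw v (ws : seq V) p :
  pev v (sactw G ws p) = pev (fun i => \sum_j rc (wact ws (delta_mx 0 i) 0 j) * v j) p.
Proof.
apply: (@mpoly_ext _ _ C (fun p => pev v (sactw G ws p))).
- by move=> x y; rewrite sactwD pevD.
- by move=> x y; rewrite pevD.
- by move=> x y; rewrite sactwM pevM.
- by move=> x y; rewrite pevM.
- by move=> c; rewrite sactwC !pevC.
by move=> i; rewrite -lf_delta sactw_lf lf_delta pevX pev_lf.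
Qed.

Lemma gram_unit : G \in unitmx.
Proof.
rewrite -row_free_unit -kermx_eq0; apply/rowV0P => v /sub_kermxP v0.
by apply/eqP; rewrite -(dot_eq0 hG) /dot v0 mul0mx mxE.
Qed.

(* The values at a regular eigenvector of a basis invariant under a Coxeter
   element c are eigenvectors of c in the complexified dual space, and their
   Gram matrix is invertible. *)
Lemma coxeter_pairing (c : seq V) (ev : V -> C) (z : C) Th e : {subset c <= sim} ->
  (forall g, ev g = \sum_j rc (g 0 j) * ev (delta_mx 0 j)) ->
  (forall g, ev (wact c g) = z * ev g) -> {in pos, forall b, ev b != 0} ->
  cbasis G Phi xi Th e -> (forall i, actw G c (row i Th) = row i Th) ->
  exists s : 'S_l, forall i, z ^+ (e i + e (s i)) = 1.
Proof.
move=> cs evl evc ev0 cb inv; have cP := sim_root cs; case: (cb) => _ hh _ _.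
pose v i := ev (delta_mx 0 i).
have evE g : pev v (lf g) = ev g by rewrite pev_lf -evl.
pose U : 'M[C]_l := map_mx (pev v) Th.
pose Cm : 'M[R]_l := \matrix_j wact c (delta_mx 0 j).
pose Z : 'rV[C]_l := \row_i z ^+ e i.
have uU : \det U != 0.
  rewrite (_ : U = map_mx (mmap rc v) Th) // det_map_mx.
  have [u u0 ->] := cbasis_det hG rsP reg cb.
  rewrite -[X in X != 0]/(pev v (u *: _)) pevZ mulf_neq0 ?fmorph_eq0 // big_map /pev rmorph_prod /= prodf_seq_neq0.
  by apply/allP => b bp /=; rewrite -/(pev v _) evE ev0.
have UC : U *m map_mx rc Cm^T = diag_mx Z *m U.
  apply/matrixP => i j; rewrite mul_diag_mx !mxE.
  have hd : dap (row i Th) (wact c (delta_mx 0 j)) = sactw G c (dap (row i Th) (delta_mx 0 j)).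
    by rewrite -{1}inv dap_actw (wact_rev hG rsP).
  have := congr1 (pev v) hd; rewrite pev_sactw dap_delta.
  rewrite (_ : (fun i0 => _) = (fun i0 => z * v i0)); last first.
    by apply: boolp.funext => i0; rewrite -evl evc.
  rewrite mxE (pev_scale _ _ (hh i j)) => <-; rewrite /dap pev_sum.
  by apply: eq_bigr => t _; rewrite pevZ !mxE mulrC.
clearbody U.
have CG : Cm *m G *m Cm^T = G.
  apply/matrixP => i j; have -> : (Cm *m G *m Cm^T) i j = row i Cm *d row j Cm.
    by rewrite /dot -row_mul [LHS]mxE [RHS]mxE; apply: eq_bigr => t _; rewrite !mxE.
  rewrite !rowK (wact_dot hG rsP) //.
  by rewrite /dot -rowE trmx_delta -colE !mxE.
have uG := gram_unit; pose H := invmx G.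
have HC : Cm^T *m H *m Cm = H.
  have e1 : Cm *m (G *m Cm^T *m H) = 1%:M by rewrite !mulmxA CG mulmxV.
  have := mulmx1C e1; rewrite -!mulmxA => e2.
  by rewrite -[LHS]mul1mx -[1%:M](mulVmx uG) -!mulmxA e2 mulmx1.
pose K := U *m map_mx rc H *m U^T.
have ZK : diag_mx Z *m K *m diag_mx Z = K.
  have -> : diag_mx Z *m K *m diag_mx Z = (diag_mx Z *m U) *m map_mx rc H *m (diag_mx Z *m U)^T.
    by rewrite trmx_mul tr_diag_mx !mulmxA.
  rewrite -UC trmx_mul (map_trmx rc Cm^T) trmxK /K -[in RHS]HC !map_mxM /= !mulmxA.
  by reflexivity.
have dK : \det K != 0.
  rewrite !det_mulmx det_tr !mulf_neq0 // det_map_mx fmorph_eq0.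
  by have : H \in unitmx; [rewrite unitmx_inv | rewrite unitmxE unitfE].
have [s hs] := det_perm_neq0 dK; exists s => i.
clearbody K; have /matrixP/(_ i (s i)) := ZK; rewrite mul_mx_diag mul_diag_mx !mxE => e1.
by apply: (mulIf (hs i)); rewrite mul1r -[RHS]e1 exprD; ring.
Qed.

Variable h : R.
Hypothesis hcox : {in Phi, forall a, \sum_(b <- pos) cart b a * cart a b = 2 * h}.
Hypothesis hN : (2 * size pos)%:R = h * l%:R.

(** Let [d] be the order of the eigenvalue [z] of a Coxeter element on its plane. By
    [coxeter_pairing], [d] divides each [e i + e (s i)], which is positive; summing, [d * l] is at
    most [2 * size pos]. Conversely the [d]-th power of the element is trivial, and every orbit of
    roots contains one of at most [l] inversions, so there are at most [d * l] roots. Hence all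
    inequalities are equalities, and [d] is the Coxeter number. *)
Theorem exponent_duality : exists (hn : nat) (e : 'I_l -> nat) (s : 'S_l), [/\ h = hn%:R, (0 < hn)%N,
  forall r, (0 < r)%N -> #|[set i | (r <= e i)%N]| = count (fun b => ht b == r) pos,
  (\sum_i e i)%N = size pos & forall i, (0 < e i)%N /\ (e i + e (s i) = hn)%N].
Proof.
have [w1 [w2 [a [b [lam [s1 s2 sl /andP[lam0 lam1] [a1 b1 b2 a2 [reg2 i1 i2 fx]]]]]]]] :=
  coxeter_plane hG rsP reg simd sims irr l_gt0.
pose c := w1 ++ w2.
have cs : {subset c <= sim} by move=> x; rewrite mem_cat => /orP[/s1|/s2].
have cpS t : {subset cpow c t <= sim} by exact: (@cpow_sub R l G Phi xi c t cs).
have cpP t : {subset cpow c t <= Phi} by exact: (sim_root (cpS t)).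
have [Th0 [e [cb0 ce]]] := cat0_basis hG rsP reg sim1 hcox.
have [Th cb inv] := inv_basis hG rsP reg simd cb0 cs.
(* A number of modulus 1 with real part [lam]. The two halves of the word act on the plane as
   reflections, and their product has eigenvalue [mu * mu], which is [z] below. *)
pose mu : C := (lam +i* Num.sqrt (1 - lam ^+ 2))%C.
have sq0 : 0 < 1 - lam ^+ 2 by rewrite subr_gt0 expr_lt1.
have sq : Num.sqrt (1 - lam ^+ 2) ^+ 2 = 1 - lam ^+ 2 by rewrite sqr_sqrtr ?ltW.
have s0 : Num.sqrt (1 - lam ^+ 2) != 0 by rewrite gt_eqF // sqrtr_gt0.
have mu2 : mu * mu = rc (2 * lam) * mu - 1.
  rewrite /mu; apply/eqP; rewrite eq_complex /=; apply/andP; split; apply/eqP; rewrite ?mulr0 ?mul0r; move: sq; rewrite !expr2 => sq; nra.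
(* Evaluation at an eigenvector in the complexified plane. It determines [g *d a] and [g *d b],
   hence the sign of [g *d (a + b)], which distinguishes positive from negative roots. *)
pose ev g : C := rc (g *d a) + mu * rc (g *d b).
have ev_re g : complex.Re (ev g) = g *d a + lam * (g *d b) by rewrite /ev /= mulr0 subr0.
have ev_im g : complex.Im (ev g) = Num.sqrt (1 - lam ^+ 2) * (g *d b) by rewrite /ev /= mulr0 add0r add0r.
have ev_inj g g' : ev g = ev g' -> g *d (a + b) = g' *d (a + b).
  move=> eg; have e1 := ev_im g; have e2 := ev_im g'; move: (ev_re g) (ev_re g'); rewrite eg in e1 *.
  move: e1; rewrite e2 => /(mulfI s0) e1 ->; rewrite !(dotDr hG) e1 => /addIr ->.
  by [].
have evl g : ev g = \sum_j rc (g 0 j) * ev (delta_mx 0 j).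
  rewrite /ev {1 2}(row_sum_delta g) !dot_suml !rmorph_sum mulr_sumr -big_split.
  by apply: eq_bigr => j _ /=; rewrite !dotZl !rmorphM /=; ring.
pose z : C := rc (2 * lam) * mu - 1.
have d1 x y : wact w1 x *d y = x *d wact w1 y.
  by rewrite -{1}(i1 y) (wact_dot hG rsP _ _ (sim_root s1)).
have d2 x y : wact w2 x *d y = x *d wact w2 y.
  by rewrite -{1}(i2 y) (wact_dot hG rsP _ _ (sim_root s2)).
have evc g : ev (wact c g) = z * ev g.
  rewrite /ev /c wact_cat !d1 !d2 a1 b1 linearN linearD linearZ /= a2 b2.
  rewrite !(dotDr hG) !(dotNr hG) !(dotZr hG) !(dotDr hG) !(dotZr hG) !rmorphD !rmorphN !rmorphM /= /z.
  rewrite !rmorphD !rmorphM /=.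
  have : mu * mu = rc 2 * rc lam * mu - 1 by rewrite mu2 rmorphM.
  set A := rc (g *d a); set B := rc (g *d b); set t := rc 2; set L := rc lam => E.
  have -> : (t * L * mu - 1) * (A + mu * B) = (t * L * mu - 1) * A + (t * L * (mu * mu) - mu) * B by ring.
  by rewrite E; ring.
have rpos x : x \in pos -> 0 < x *d (a + b).
  move=> xp; have /rV0Pn[j0 nj] := pos_neq0 rsP xp.
  rewrite (row_sum_delta x) dot_suml (bigD1 j0) //= ltr_pwDl //.
    by rewrite dotZl mulr_gt0 // lt_neqAle eq_sym nj (pos_coord rsP sims).
  by apply: sumr_ge0 => j _; rewrite dotZl mulr_ge0 ?(pos_coord rsP sims) ?ltW.
have ev0 : {in pos, forall x, ev x != 0}.
  move=> x xp; apply/eqP => e0; have := rpos x xp.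
  rewrite (ev_inj x 0) ?dot0l ?ltxx // e0.
  by rewrite /ev !dot0l rmorph0 mulr0 addr0.
have [s hs] := coxeter_pairing cs evl evc ev0 cb inv.
have wcS t x : wact (cpow c t.+1) x = wact c (wact (cpow c t) x) by rewrite /cpow /= wact_cat.
have evt t g : ev (wact (cpow c t) g) = z ^+ t * ev g.
  by elim: t => [|t IH]; rewrite ?mul1r // wcS evc IH exprS mulrA.
have [m m0 cm] := wact_order hG rsP simd cs.
pose j0 := Ordinal l_gt0.
have zm : z ^+ m = 1.
  have n0 := ev0 _ (sim_pos (simd j0)); apply: (mulIf n0).
  by rewrite mul1r -evt cm.
have [d [d0 zd dmin]] := zeta_order m0 zm.
(* The power does not change [ev], so it preserves positive roots and is trivial by deletion. *)
have cd x : wact (cpow c d) x = x.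
  apply: (wact_trivial hG rsP reg); first exact: cpow_sub.
  move=> y yp; have yR : wact (cpow c d) y \in Phi.
    by apply: (wact_root rsP (cpP d)); apply: pos_root yp.
  have : 0 < wact (cpow c d) y *d (a + b).
    by rewrite (ev_inj _ y) ?rpos // evt zd mul1r.
  case: (boolP (_ \in pos)) => // np; rewrite -[X in X *d _]opprK dotNl oppr_gt0 ltNge ltW //.
  by apply: rpos; rewrite (posN hG rsP reg).
have [L [sL hL]] := wact_inversions hG rsP reg cs.
have cfix y : wact c y = y -> y = 0.
  by move=> e1; apply: fx; rewrite -[in RHS](i1 (wact w2 y)) -/(wact _ _) -(wact_cat G w1 w2) -/c e1.
have cpA t u x : wact (cpow c (t + u)) x = wact (cpow c t) (wact (cpow c u) x).
  by elim: t => [|t IH] //; rewrite addSn !wcS IH.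
(* The sum over an orbit is fixed by [c], hence zero. So an orbit cannot keep one sign, and
   somewhere a positive root turns negative. *)
have orbit x : x \in Phi -> exists2 t, (t < d)%N & wact (cpow c t) x \in L.
  move=> xP; have oR t : wact (cpow c t) x \in Phi.
    by apply: (wact_root rsP (cpP t)).
  have per t : wact (cpow c (t + d)) x = wact (cpow c t) x by rewrite cpA cd.
  have sum0 : \sum_(t < d) wact (cpow c t) x = 0.
    apply: cfix; rewrite linear_sum /=; case: (d) d0 cd => // d' _ cd'.
    rewrite big_ord_recr [RHS]big_ord_recl /= addrC; congr (_ + _); last first.
      by apply: eq_bigr => t _; rewrite /bump /= add1n wcS.
    by rewrite -wcS cd'.
  have sgn (sg : R) : (forall t, 0 < sg * (wact (cpow c t) x *d xi)) -> False.
    move=> hp; have := congr1 (fun y => sg * (y *d xi)) sum0; rewrite dot0l mulr0 dot_suml mulr_sumr => e0.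
    have : 0 < \sum_(t < d) sg * (wact (cpow c t) x *d xi).
      rewrite (bigD1 (Ordinal d0)) //=; apply: ltr_wpDr; last exact: (hp 0%N).
      by apply: sumr_ge0 => t _; apply: ltW.
    by rewrite e0 ltxx.
  case: (pickP (fun t : 'I_d => (wact (cpow c t) x \in pos) && (wact (cpow c t.+1) x \notin pos))) => [t /andP[tp tn]|hno].
    by exists t => //; apply: hL; rewrite // -wcS.
  exfalso; have step t : wact (cpow c t) x \in pos -> wact (cpow c t.+1) x \in pos.
    have perm q : wact (cpow c (t %% d + q * d)) x = wact (cpow c (t %% d)) x.
      by elim: q => [|q IH]; rewrite ?addn0 // mulSn addnCA addnC per.
    have e1 : wact (cpow c t) x = wact (cpow c (t %% d)) x by rewrite {1}(divn_eq t d) addnC perm.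
    have := hno (Ordinal (ltn_pmod t d0)); rewrite /= !wcS -e1 => + tp.
    by rewrite tp /= => /negbFE.
  have up t u : wact (cpow c t) x \in pos -> wact (cpow c (u + t)) x \in pos.
    by elim: u => [|u IH] // tp; rewrite addSn; apply/step/IH.
  case: (boolP [exists t : 'I_d, wact (cpow c t) x \in pos]) => [/existsP[t tp]|/existsPn np].
    apply: (sgn 1) => u; rewrite mul1r; apply: pos_gt0.
    have per2 q : wact (cpow c (u + q * d)) x = wact (cpow c u) x.
      by elim: q => [|q IH]; rewrite ?addn0 // mulSn addnCA addnC per.
    rewrite -(per2 t); have -> : (u + t * d = (u + t * d - t) + t)%N.
      by rewrite subnK // (leq_trans _ (leq_addl _ _)) // leq_pmulr.
    exact: up.
  apply: (sgn (-1)) => u; rewrite mulN1r -dotNl.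
  suff : - wact (cpow c u) x \in pos by apply: pos_gt0.
  rewrite (posN hG rsP reg) //.
  have per2 q : wact (cpow c (u %% d + q * d)) x = wact (cpow c (u %% d)) x.
    by elim: q => [|q IH]; rewrite ?addn0 // mulSn addnCA addnC per.
  by rewrite {1}(divn_eq u d) addnC per2; exact: (np (Ordinal (ltn_pmod u d0))).
have N2 : (2 * size pos <= d * l)%N.
  pose Rt := pos ++ [seq - x | x <- pos].
  have uR : uniq Rt.
    rewrite cat_uniq (pos_uniq xi rsP) map_inj_uniq ?(pos_uniq xi rsP) //; last exact: oppr_inj.
    rewrite andbT; apply/hasPn => y /mapP[x xp ->]; by rewrite (pos_negF hG rsP reg xp).
  pose T := [seq wact (cpow c t) y | t <- iota 0 d.+1, y <- L].
  have -> : (2 * size pos = size Rt)%N by rewrite /Rt size_cat size_map addnn mul2n.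
  pose T' := [seq wact (cpow c (d - t)) y | t <- iota 0 d, y <- L].
  have sub : {subset Rt <= T'}.
    move=> x xR; have xP : x \in Phi.
      move: xR; rewrite mem_cat => /orP[/pos_root //|/mapP[y yp ->]].
      by apply: (rootN hG rsP); apply: pos_root yp.
    have [t td tL] := orbit x xP; apply/allpairsP; exists (t, wact (cpow c t) x).
    by rewrite /= mem_iota td; split=> //; rewrite -cpA subnK ?cd // ltnW.
  apply: leq_trans (uniq_leq_size uR sub) _; rewrite size_allpairs size_iota leq_mul2l.
  by rewrite (leq_trans sL) ?orbT // size_cat sl.
(* There are at least [l] roots of height one, so none of the [l] degrees is zero. *)
have e1 i : (0 < e i)%N.
  have := ce 1%N isT; have -> : count (fun b => ht b == 1%N) pos = count (mem sim) pos.
    apply: eq_in_count => x xp /=; apply/eqP/idP => [h1|/sim1 x1].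
      case: (boolP (x \in sim)) => // ns; have [y ys sp] := pos_sub_sim hG rsP reg xp ns.
      have := ht_gt0 rsP sim1 sp; have := htE rsP sim1 xp; have := htE rsP sim1 sp.
      move=> q1 q2 q3; move: q1; rewrite dotBl (sim1 ys) q2 h1 subrr => /eqP.
      by rewrite eq_sym pnatr_eq0 => /eqP q4; rewrite q4 in q3.
    by apply/eqP; rewrite -(eqr_nat R) -(htE rsP sim1 xp) x1.
  have ls : (l <= count (mem sim) pos)%N.
    have sz : size (codom (fun i : 'I_l => delta_mx 0 i : V)) = l by rewrite size_codom card_ord.
    rewrite -size_filter -[X in (X <= _)%N]sz.
    apply: uniq_leq_size; last by move=> x /codomP[j ->]; rewrite mem_filter /= simd (sim_pos (simd j)).
    apply/injectiveP => i' j /rowP/(_ i'); rewrite !mxE !eqxx /=; case: (i' =P j) => // _ /eqP.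
    by rewrite oner_eq0.
  move=> cE; have hc : (#|[set: 'I_l]| <= #|[set i | (1 <= e i)%N]|)%N by rewrite cardsT card_ord cE.
  have /eqP/setP/(_ i) : [set i | (1 <= e i)%N] == setT by rewrite eqEcard subsetT hc.
  by rewrite !inE.
case: cb => _ _ _ se.
have ged i : (d <= e i + e (s i))%N by rewrite dvdn_leq ?dmin // addn_gt0 e1.
have se2 : (\sum_i (e i + e (s i)) = 2 * size pos)%N.
  have e4 : (\sum_i e i = size pos)%N by exact: se.
  have e3 : (\sum_i e (s i) = size pos)%N by rewrite -e4; apply/esym; exact: (reindex_inj (@perm_inj _ s)).
  by rewrite big_split /= e3 e4 addnn mul2n.
have eqd : (2 * size pos = d * l)%N.
  apply/eqP; rewrite eqn_leq N2 -se2 -[X in (d * X)%N](card_ord l) -sum1_card big_distrr /=.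
  by apply: leq_sum => i _; rewrite muln1.
have l0 : l%:R != 0 :> R by rewrite pnatr_eq0 -lt0n.
exists d, e, s; split=> //.
  by apply: (mulIf l0); rewrite -hN eqd natrM.
have : (\sum_i (e i + e (s i) - d) = 0)%N.
  rewrite sumnB // se2 eqd big_const_ord iter_addn_0 /= mulnC subnn //.
by move=> /eqP; rewrite sum_nat_eq0 => /forallP hd i; split=> //; apply/eqP; rewrite eqn_leq ged andbT -subn_eq0; exact: hd.
Qed.

End Spectrum.
End Spectrum.

(** * Counting monomials *)

Section Monomials.
Variables (n B : nat).

Definition mons d : {set 'X_{1..n < B}} := [set m : 'X_{1..n < B} | mdeg m == d].
Definition mons0 (i0 : 'I_n) d : {set 'X_{1..n < B}} := [set m : 'X_{1..n < B} | (mdeg m == d) && (m i0 == 0%N)].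
(** The Hilbert function of a polynomial ring in [n - 1] variables, that is, of the ring modulo a
    linear form. The bound [B] only serves to make the sets of monomials finite. *)
Definition hilb0 d := if d is d'.+1 then (#|mons d| - #|mons d'|)%N else 1%N.

Definition mshift (i : 'I_n) (m : 'X_{1..n < B}) : 'X_{1..n < B} := insubd m (m + U_(i))%MM.
Lemma mshiftE i (m : 'X_{1..n < B}) : ((mdeg m).+1 < B)%N -> (mshift i m : 'X_{1..n}) = (m + U_(i))%MM.
Proof. by move=> h; rewrite /mshift val_insubd mdegD mdeg1 addn1 h. Qed.
Lemma mshift_inj i d : (d.+1 < B)%N -> {in mons d &, injective (mshift i)}.
Proof.
move=> dB m m'; rewrite !inE => /eqP hm /eqP hm' /(congr1 (fun x : 'X_{1..n < B} => x : 'X_{1..n})).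
by rewrite !mshiftE ?hm ?hm' // => /addIm e; apply: val_inj.
Qed.

Lemma card_mons (i0 : 'I_n) d : (d.+1 < B)%N -> (#|mons d.+1| = #|mons d| + #|mons0 i0 d.+1|)%N.
Proof.
move=> dB; pose up := mshift i0.
have upE m : m \in mons d -> (up m : 'X_{1..n}) = (m + U_(i0))%MM.
  by rewrite inE => /eqP md; rewrite /up mshiftE // md.
rewrite -(card_in_imset (mshift_inj (i := i0) dB)).
rewrite -cardsUI.
have -> : up @: mons d :&: mons0 i0 d.+1 = set0.
  apply/setP => m; rewrite !inE; apply/negbTE/negP => /andP[/imsetP[m' hm' ->]].
  by rewrite upE // mnmDE mnm1E eqxx addn1 andbF.
rewrite cards0 addn0; congr #|pred_of_set _|; apply/setP => m; rewrite !inE.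
case: (eqVneq (m i0) 0%N) => [m0|m0]; rewrite ?andbT ?andbF ?orbF.
  case: (mdeg m =P d.+1) => md; rewrite ?orbT // orbF; apply/esym/negbTE/negP => /imsetP[m' hm' e].
  by move: m0; rewrite e upE // mnmDE mnm1E eqxx addn1.
apply/idP/imsetP => [/eqP md|[m' hm' ->]]; last first.
  by rewrite upE // mdegD mdeg1 addn1; move: hm'; rewrite inE => /eqP ->.
have le : (U_(i0) <= m)%MM by apply/mnm_lepP => j; rewrite mnm1E; case: eqP => // <-; rewrite lt0n.
have dm : mdeg (m - U_(i0))%MM = d.
  by apply/eqP; rewrite -eqSS -addn1 -(mdeg1 i0) -mdegD submK // md.
have mB : (mdeg (m - U_(i0))%MM < B)%N by rewrite dm ltnW.
exists (BMultinom mB); first by rewrite inE /= dm.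
by apply: val_inj; rewrite /= upE ?inE /= ?dm // submK.
Qed.

Lemma mons_0 : (0 < B)%N -> #|mons 0| = 1%N.
Proof.
move=> B0; have B0' : (mdeg (0%MM : 'X_{1..n}) < B)%N by rewrite mdeg0.
rewrite -(cards1 (BMultinom B0')); congr #|pred_of_set _|; apply/setP => m.
by rewrite !inE mdeg_eq0 -(inj_eq val_inj).
Qed.

Lemma card_mons0 (i0 : 'I_n) d : (d < B)%N -> #|mons0 i0 d| = hilb0 d.
Proof.
case: d => [|d] dB; last by rewrite /hilb0 (card_mons i0 dB) addKn.
rewrite /hilb0 -(mons_0 dB); congr #|pred_of_set _|; apply/setP => m; rewrite !inE.
by case: (mdeg m =P 0%N) => // /eqP; rewrite mdeg_eq0 => /eqP ->; rewrite mnm0E.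
Qed.

Lemma card_mons_sum d : (0 < n)%N -> (d < B)%N -> #|mons d| = (\sum_(p < d.+1) hilb0 p)%N.
Proof.
move=> n0; elim: d => [|d IH] dB; first by rewrite big_ord1 mons_0.
rewrite big_ord_recr /= -IH; last exact: ltnW.
by rewrite subnKC // (card_mons (Ordinal n0) dB) leq_addr.
Qed.

(** Multiplication by a second variable [i1] is injective on monomials free of [i0]. *)
Lemma hilb0_le d d' : (1 < n)%N -> (d <= d' < B)%N -> (hilb0 d <= hilb0 d')%N.
Proof.
move=> n1 /andP[dd' dB]; have n0 : (0 < n)%N by apply: ltnW.
pose i0 := Ordinal n0; pose i1 := Ordinal n1.
have step t : (t.+1 < B)%N -> (hilb0 t <= hilb0 t.+1)%N.
  move=> tB; rewrite -!(card_mons0 i0) //; last exact: ltnW.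
  have inj : {in mons0 i0 t &, injective (mshift i1)}.
    move=> m m'; rewrite !inE => /andP[hm _] /andP[hm' _].
    by apply: (mshift_inj tB); rewrite inE.
  rewrite -(card_in_imset inj); apply: subset_leq_card; apply/subsetP => _ /imsetP[m + ->].
  rewrite !inE => /andP[/eqP hm /eqP m0].
  by rewrite mshiftE ?hm // mdegD mdeg1 hm addn1 eqxx mnmDE m0 mnm1E.
elim: d' dd' dB => [|d' IH]; first by rewrite leqn0 => /eqP ->.
rewrite leq_eqVlt => /orP[/eqP -> //|]; rewrite ltnS => dd' dB.
by apply: leq_trans (IH dd' (ltnW dB)) (step _ dB).
Qed.
End Monomials.

Section NoVar.
Variables (F : fieldType) (n : nat) (i0 : 'I_n).
Definition novar (p : {mpoly F[n]}) := forall m : 'X_{1..n}, m i0 != 0%N -> p@_m = 0.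

Lemma novarM p q : novar p -> novar q -> novar (p * q).
Proof.
move=> hp hq m m0; rewrite mcoeffM big1 // => k /eqP e.
case: (eqVneq ((k.1 : 'X_{1..n}) i0) 0%N) => [k1|k1]; last by rewrite hp // mul0r.
have em : m i0 = (k.1 i0 + k.2 i0)%N by rewrite -mnmDE -e.
by rewrite [X in _ * X]hq ?mulr0 //; move: m0; rewrite em k1.
Qed.
Lemma novar_elim (a : 'rV[F]_n) (p : {mpoly F[n]}) : a 0 i0 != 0 -> novar (p \mPo elim_tuple a i0).
Proof.
move=> ai; have nS q (c : F) : novar q -> novar (c *: q) by move=> hq m m0; rewrite mcoeffZ hq ?mulr0.
have n1 : novar 1.
  move=> m m0; rewrite mcoeff1; case: (m =P 0%MM) => // e; by move: m0; rewrite e mnm0E.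
have nX j : novar (tnth (elim_tuple a i0) j).
  rewrite tnth_mktuple; case: (j =P i0) => [_|ji] m m0; last first.
    rewrite mcoeffX; case: (U_(j)%MM =P m) => // e; move: m0; rewrite -e mnm1E.
    by move/eqP/negbTE: ji => ->.
  rewrite mcoeffB mcoeffZ mcoeffX; case: (eqVneq U_(i0)%MM m) => [<-|ne].
    by rewrite lf_coef mulVf // subrr.
  rewrite /lf raddf_sum /= big1 ?mulr0 ?subr0 // => t _; rewrite mcoeffZ mcoeffX.
  case: (U_(t)%MM =P m) => e; last by rewrite mulr0.
  by move: m0 ne; rewrite -e mnm1E; case: (t =P i0) => [->|//] _; rewrite eqxx.
rewrite comp_mpolyE; apply: (big_ind novar); first by move=> m _; rewrite mcoeff0.
  by move=> x y hx hy m m0; rewrite mcoeffD hx // hy // addr0.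
move=> m _; apply: nS; apply: (big_ind novar) => //; first exact: novarM.
move=> j _; elim: (m j) => [|t IH]; first by rewrite expr0.
by rewrite exprS; apply: novarM.
Qed.
End NoVar.

(** * Linear conditions on families of derivations *)

Section Families.
Variables (R : realType) (l n : nat).
Local Notation V := 'rV[R]_l.
Local Notation S := {mpoly R[n]}.
Definition comb m (y : 'I_m -> R) (F : 'I_m -> 'rV[S]_l) := \sum_j (y j)%:MP *: F j.
Definition findep m (F : 'I_m -> 'rV[S]_l) := forall y, comb y F = 0 -> forall j, y j = 0.

Lemma comb_comb m m' (K : 'M[R]_(m', m)) y (F : 'I_m -> 'rV[S]_l) :
  comb y (fun i => comb (K i) F) = comb (fun j => \sum_i y i * K i j) F.
Proof.
rewrite /comb; under eq_bigr do rewrite scaler_sumr.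
rewrite exchange_big /=; apply: eq_bigr => j _; rewrite rmorph_sum scaler_suml.
by apply: eq_bigr => i _; rewrite scalerA -rmorphM.
Qed.

(** The left kernel of [M] has codimension at most the number [s] of columns. *)
Lemma family_cut m s (F : 'I_m -> 'rV[S]_l) (M : 'M[R]_(m, s)) : findep F ->
  exists (m' : nat) (K : 'M[R]_(m', m)), [/\ (m <= m' + s)%N, findep (fun i => comb (K i) F) & K *m M = 0].
Proof.
move=> hF; exists (\rank (kermx M)), (row_base (kermx M)); split.
- by rewrite mxrank_ker; have := rank_leq_col M; have := rank_leq_row M; lia.
- move=> y; rewrite comb_comb => /hF hy; pose yr : 'rV[R]_(\rank (kermx M)) := \row_i y i.
  have y0 : yr *m row_base (kermx M) = 0.
    by apply/rowP => j; rewrite !mxE -[RHS](hy j); apply: eq_bigr => i _; rewrite mxE.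
  have /row_free_inj inj := row_base_free (kermx M).
  have e0 : yr = 0 by apply: inj; rewrite y0 mul0mx.
  by move=> j; have := congr1 (fun x : 'rV_ _ => x 0 j) e0; rewrite !mxE.
by apply/sub_kermxP; rewrite eq_row_base.
Qed.

Lemma dap_comb m y (F : 'I_m -> 'rV[S]_l) (a : V) : dap (comb y F) a = \sum_j y j *: dap (F j) a.
Proof.
rewrite /comb; elim: (index_enum _) => [|j r IH].
  by rewrite !big_nil -(scale0r (0 : 'rV[S]_l)) dap_scale mul0r.
by rewrite !big_cons dap_add dap_scale mul_mpolyC IH.
Qed.

(* One divisibility condition modulo the linear form [g], imposed on an element
   known modulo [g] up to a multiple of [Q], costs at most as many dimensions as
   there are monomials of the complementary degree without one variable. *)
Lemma family_step m B p ht (F : 'I_m -> 'rV[S]_l) (al : V) (g : 'rV[R]_n) (Q : S) d :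
  findep F -> g != 0 -> (p < B)%N -> (forall i j, F i 0 j \is p.-homog) ->
  Q \is d.-homog -> mcop (lf g) Q -> (p <= d + ht)%N -> (ht < B)%N ->
  (forall i, exists q, mdvd (lf g) (dap (F i) al - Q * q)) ->
  exists (m' : nat) (K : 'M[R]_(m', m)) x, [/\ (x <= ht)%N, (m <= m' + hilb0 n B x)%N,
    findep (fun i => comb (K i) F) & forall i, mdvd (lf g) (dap (comb (K i) F) al)].
Proof.
move=> hF g0 pB hh hQ cQ pd hB hq; have [i0 gi0] := rV_neq0 g0.
have hd i : dap (F i) al \is p.-homog by apply: dap_homog.
case: (ltnP p d) => [lt|ge].
  exists m, 1%:M, 0%N; have e i : comb ((1%:M : 'M[R]_m) i) F = F i.
    rewrite /comb (bigD1 i) //= big1 ?addr0; first by rewrite mxE eqxx scale1r.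
    by move=> j ji; rewrite mxE eq_sym (negbTE ji) scale0r.
  split=> // [|y|i]; first by rewrite leq_addr.
  - have -> : comb y (fun i => comb ((1%:M : 'M[R]_m) i) F) = comb y F by apply: eq_bigr => i _; rewrite e.
    exact: hF.
  by rewrite e; have [h _] := mod_homog g0 hQ (hd i) (hq i); apply: h.
pose x := (p - d)%N; have px : p = (d + x)%N by rewrite subnKC.
have /fin_all_exists2[q qh qd] i := (mod_homog g0 hQ (hd i) (hq i)).2 x px.
pose qe i := q i \mPo elim_tuple g i0.
have xB : (x < B)%N by rewrite (leq_ltn_trans _ pB) // leq_subr.
(* The conditions are the coefficients of the reduced quotients [qe i]. These are homogeneous of
   degree [x] and free of the variable [i0], so the monomials of [Ms] suffice. *)
pose Ms := mons0 B i0 x; pose M : 'M[R]_(m, #|Ms|) := \matrix_(i, t) (qe i)@_((enum_val (t : 'I_#|Ms|)) : 'X_{1..n < B}).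
have [m' [K [mm hK KM]]] := family_cut M hF.
exists m', K, x; split=> //; first by rewrite leq_subLR.
  by rewrite -(card_mons0 i0 xB).
move=> i; rewrite dap_comb.
have e0 : \sum_j K i j *: qe j = 0.
  apply/mpolyP => mm'; rewrite mcoeff0 raddf_sum /=.
  have hom : \sum_j K i j *: qe j \is x.-homog.
    apply: rpred_sum => j _; apply: rpredZ; rewrite -[x]muln1; apply: homog_comp => // t.
    rewrite tnth_mktuple; case: eqP => _; rewrite -?lf_delta ?lf_homog //.
    by apply: rpredB; rewrite ?lf_homog //; apply: rpredZ; rewrite lf_homog.
  have [mB|mB] := boolP ((mdeg mm' == x) && (mm' i0 == 0%N)); last first.
    rewrite big1 // => j _; rewrite mcoeffZ.
    case: (eqVneq (mm' i0) 0%N) mB => [_|m0 _]; last by rewrite novar_elim ?mulr0.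
    rewrite andbT => mx; rewrite (dhomog_nemf_coeff (d := x) (mf := mdeg)) ?mulr0 //.
    rewrite -[x]muln1; apply: homog_comp => // t.
    rewrite tnth_mktuple; case: eqP => _; rewrite -?lf_delta ?lf_homog //.
    by apply: rpredB; rewrite ?lf_homog //; apply: rpredZ; rewrite lf_homog.
  have mB' : (mdeg mm' < B)%N by case/andP: mB => /eqP ->.
  have mMs : BMultinom mB' \in Ms by rewrite inE.
  have /matrixP/(_ i (enum_rank_in mMs (BMultinom mB'))) := KM.
  rewrite [RHS]mxE [LHS]mxE => {2}<-; apply: eq_bigr => j _.
  by rewrite mcoeffZ [M _ _]mxE enum_rankK_in.
have : mdvd (lf g) (\sum_j K i j *: (dap (F j) al - Q * q j)).
  by apply: mdvd_sum => j _; apply: mdvdZ.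
under eq_bigr do rewrite scalerBr; rewrite sumrB.
have : mdvd (lf g) (\sum_j K i j *: (Q * q j)).
  under eq_bigr do rewrite scalerAr; rewrite -mulr_sumr; apply: mdvdMl.
  have : mdvd (lf g) (\sum_j K i j *: (q j - qe j)).
    by apply: mdvd_sum => j _; apply: mdvdZ; apply: lf_mod.
  by under eq_bigr do rewrite scalerBr; rewrite sumrB e0 subr0.
by move=> h1 h2; have := mdvdD h2 h1; rewrite subrK.
Qed.

End Families.

Lemma rowZ_eq0 (S : idomainType) l (p : S) (th : 'rV[S]_l) :
  (p *: th == 0) = (p == 0) || (th == 0).
Proof.
apply/eqP/orP => [h|[/eqP ->|/eqP ->]]; rewrite ?scale0r ?scaler0 //.
case: (eqVneq p 0) => [|p0]; [by left | right; apply/eqP/rowP => j].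
by have /rowP/(_ j)/eqP := h; rewrite !mxE mulf_eq0 (negbTE p0) => /eqP.
Qed.

(** * Standard coordinates and reduction modulo z *)

Section Standard.
Variables (R : realType) (l : nat).
Local Notation V := 'rV[R]_l.
Local Notation S := {mpoly R[l + 1]}.

Definition stdE : 'M[R]_(l, l + 1) := row_mx 1%:M 0.
Definition stdz : 'rV[R]_(l + 1) := row_mx 0 1%:M.
Local Notation aff := (aff stdE stdz).

Lemma std_inj v t : v *m stdE = t *: stdz -> v = 0 /\ t = 0.
Proof.
rewrite mul_mx_row mulmx1 mulmx0 scale_row_mx scaler0 => /eq_row_mx[-> /matrixP/(_ 0 0)].
by rewrite !mxE mulr1 => <-.
Qed.

Definition redt : (l + 1).-tuple {mpoly R[l]} :=
  [tuple (match split i with inl j => 'X_j | inr _ => 0 end) | i < l + 1].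
Definition red (p : S) : {mpoly R[l]} := p \mPo redt.

Lemma redD p q : red (p + q) = red p + red q. Proof. exact: rmorphD. Qed.
Lemma redM p q : red (p * q) = red p * red q. Proof. exact: rmorphM. Qed.
Lemma red_aff b j : red (lf (aff (b, j))) = lf b.
Proof.
rewrite /red comp_lf big_split_ord /= [X in _ + X]big1 ?addr0 => [|i _].
  apply: eq_bigr => i _; rewrite tnth_mktuple (unsplitK (inl i)); congr (_ *: _).
  rewrite /Submission.aff /= mul_mx_row scale_row_mx mulmx1 scaler0 mxE row_mxEl [X in _ + X]mxE row_mxEl.
  by rewrite [X in _ - X]mxE subr0.
by rewrite tnth_mktuple (unsplitK (inr i)) scaler0.
Qed.
Lemma red_homog d p : p \is d.-homog -> red p \is d.-homog.
Proof.
move=> hp; rewrite -[d]muln1; apply: homog_comp => // i; rewrite tnth_mktuple.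
by case: (split i) => j; [rewrite -lf_delta lf_homog | apply: rpred0].
Qed.

Let i0 : 'I_(l + 1) := rshift l ord0.
Let z0 : stdz 0 i0 != 0. Proof. by rewrite row_mxEr mxE oner_neq0. Qed.
Lemma stdz_neq0 : stdz != 0.
Proof. by apply: contraNneq z0 => ->; rewrite mxE. Qed.
Lemma stdzE : stdz = delta_mx 0 i0.
Proof.
apply/rowP => i; case: (split_ordP i) => j ->; rewrite ?row_mxEl ?row_mxEr !mxE ?eq_lrshift //.
by rewrite (ord1 j) /i0 !eqxx.
Qed.

Lemma red0_dvd p : red p = 0 -> mdvd (lf stdz) p.
Proof.
move=> p0; apply/(lf_dvdP _ z0).
pose incl := [tuple 'X_(lshift 1 i) : S | i < l].
suff -> : p \mPo elim_tuple stdz i0 = red p \mPo incl by rewrite p0 rmorph0.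
apply: (@mpoly_ext _ _ S (comp_mpoly (elim_tuple stdz i0)) (fun p => red p \mPo incl)).
- by move=> x y; rewrite rmorphD.
- by move=> x y; rewrite redD rmorphD.
- by move=> x y; rewrite rmorphM.
- by move=> x y; rewrite redM rmorphM.
- by move=> c; rewrite /red !comp_mpolyC.
move=> i; rewrite -lf_delta /red !comp_lf.
have lfd (T : 'I_(l + 1) -> S) : \sum_j delta_mx 0 i 0 j *: T j = T i.
  rewrite (bigD1 i) //= big1 ?addr0 => [|j ji]; first by rewrite mxE !eqxx scale1r.
  by rewrite mxE (negbTE ji) andbF scale0r.
rewrite lfd rmorph_sum /=; under [RHS]eq_bigr do rewrite comp_mpolyZ.
rewrite lfd !tnth_mktuple; case: (split_ordP i) => j ->.
  rewrite /i0 eq_lrshift ?(unsplitK (inl j)) -[in RHS]lf_delta comp_lf (bigD1 j) //= big1 ?addr0 => [|t tj].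
    by rewrite mxE !eqxx scale1r tnth_mktuple.
  by rewrite mxE (negbTE tj) andbF scale0r.
rewrite (ord1 j) ?(unsplitK (inr ord0)) /i0 eqxx rmorph0 stdzE !mxE !eqxx invr1 scale1r.
by rewrite lf_delta subrr.
Qed.

Definition redm m (th : 'M[S]_(m, l)) := map_mx red th.

Lemma dap_red th a : dap (redm th) a = red (dap th a) :> {mpoly R[l]}.
Proof.
rewrite /dap /red rmorph_sum /=; apply: eq_bigr => j _.
by rewrite comp_mpolyZ !mxE.
Qed.

(** Each division by [z] lowers the degree, so the process ends with a derivation that is nonzero
    modulo [z]. *)
Lemma z_removal p (th : 'rV[S]_l) : (forall j, th 0 j \is p.-homog) -> th != 0 ->
  exists t (th' : 'rV[S]_l), [/\ th = lf stdz ^+ t *: th', (t <= p)%N,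
    forall j, th' 0 j \is (p - t).-homog & redm th' != 0].
Proof.
elim: p th => [|p IH] th hh n0; (case: (eqVneq (redm th) 0) => [r0|]; last by
  exists 0%N, th; rewrite expr0 scale1r subn0).
  have hd j : mdvd (lf stdz) (th 0 j).
    by apply: red0_dvd; have /rowP/(_ j) := r0; rewrite !mxE.
  case/eqP: n0; apply/rowP => j; rewrite mxE.
  exact: (homog_dvd_small (lf_homog stdz) (hh j) _ (hd j)).
have hd j : mdvd (lf stdz) (th 0 j).
  by apply: red0_dvd; have /rowP/(_ j) := r0; rewrite !mxE.
have /fin_all_exists[g hg] := hd.
have eg : th = lf stdz *: \row_j g j by apply/rowP => j; rewrite !mxE.
have gh j : (\row_j g j) 0 j \is p.-homog.
  rewrite mxE; apply: (@homog_quot_eq _ _ 1 p (lf stdz) 0).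
  - by rewrite lf_eq0 stdz_neq0.
  - exact: lf_homog.
  by rewrite -hg add1n hh.
have g0 : \row_j g j != 0 by apply: contraNneq n0 => g0; rewrite eg g0 scaler0.
have [t [th' [e1 e2 e3 e4]]] := IH _ gh g0.
by exists t.+1, th'; split=> //; rewrite eg e1 scalerA exprS.
Qed.

(** No affine root with nonzero linear part divides [z], so a power of [z] can be cancelled. *)
Lemma logd_z A t (th : 'rV[S]_l) : {in A, forall b : V * R, b.1 != 0} ->
  logd stdE stdz A (lf stdz ^+ t *: th) -> logd stdE stdz A th.
Proof.
move=> hA h b bA; have b0 := hA b bA.
have a0 : aff b != 0 by apply: (aff_eq0 (@std_inj)).
have cop : mcop (lf (aff b)) (lf stdz ^+ t).
  apply/mcop_expr/lf_cop_lf => // c; apply/eqP => e; move: b0; apply/negP; rewrite negbK.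
  have [] := @std_inj (c *: b.1) (1 + c * b.2).
    by rewrite -scalemxAl scalerDl scale1r {1}e /Submission.aff scalerBr scalerA subrK.
  move=> /eqP; rewrite scaler_eq0 => /orP[/eqP c0|//] _.
  by move: stdz_neq0; rewrite e c0 scale0r eqxx.
by apply: cop; rewrite -dap_scale; apply: h.
Qed.

End Standard.

(** * Sums over equal multisets of degrees *)

Section Sums.
Lemma card_ge_split l (f : 'I_l -> nat) v :
  #|[set i | (v <= f i)%N]| = (#|[set i | f i == v]| + #|[set i | (v.+1 <= f i)%N]|)%N.
Proof.
rewrite -cardsUI [X in (_ + #|pred_of_set X|)%N](_ : _ = set0) ?cards0 ?addn0.
  congr #|pred_of_set _|; apply/setP => i; rewrite !inE; by rewrite leq_eqVlt eq_sym.
by apply/setP => i; rewrite !inE; case: eqP => // ->; rewrite ltnn.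
Qed.

Lemma sum_levels l (f : 'I_l -> nat) (F : nat -> nat) M : (forall i, f i < M)%N ->
  (\sum_i F (f i) = \sum_(v < M) F v * #|[set i | f i == v]|)%N.
Proof.
move=> hM; rewrite (partition_big (fun i => Ordinal (hM i)) xpredT) //=.
apply: eq_bigr => v _; rewrite (eq_bigr (fun=> F v)); last by move=> i /eqP <-.
by rewrite sum_nat_cond_const mulnC; congr (_ * _)%N; apply: eq_card => i; rewrite !inE -(inj_eq val_inj).
Qed.

(** The numbers of values at least [r] determine the multiset of values; for [r = 0] both are
    [l]. *)
Lemma sum_same_levels l (f g : 'I_l -> nat) (F : nat -> nat) :
  (forall r, (0 < r)%N -> #|[set i | (r <= f i)%N]| = #|[set i | (r <= g i)%N]|) ->
  (\sum_i F (f i) = \sum_i F (g i))%N.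
Proof.
move=> h; pose M := (\max_i (f i + g i)).+1.
have hf i : (f i < M)%N by rewrite ltnS (leq_trans (leq_addr (g i) _)) // (leq_bigmax i).
have hg i : (g i < M)%N by rewrite ltnS (leq_trans (leq_addl (f i) _)) // (leq_bigmax i).
rewrite (sum_levels _ hf) (sum_levels _ hg); apply: eq_bigr => v _; congr (_ * _)%N.
have hv r : #|[set i | (r <= f i)%N]| = #|[set i | (r <= g i)%N]|.
  case: r => [|r]; last exact: h.
  by congr #|pred_of_set _|; apply/setP => i; rewrite !inE.
by apply/eqP; rewrite -(eqn_add2r #|[set i | (v.+1 <= f i)%N]|) -card_ge_split hv card_ge_split hv.
Qed.
End Sums.

(** * Bases for extended Shi arrangements, irreducible case *)

Section Irreducible.
Variables (R : realType) (l : nat) (G : 'M[R]_l).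
Hypothesis hG : inner_product G.
Local Notation V := 'rV[R]_l.
Local Notation S := {mpoly R[l + 1]}.
Local Notation "u '*d' v" := (dot G u v) (at level 40).
Local Notation cart := (cart G).
Variables (Phi : seq V) (xi : V).
Hypotheses (rsP : root_system G Phi) (reg : regular G Phi xi).
Local Notation pos := (posr G Phi xi).
Local Notation sim := (simr G Phi xi).
Local Notation ht := (ht G xi).
Local Notation arr := (arr G Phi xi).
Local Notation aff := (aff (stdE R l) (stdz R l)).
Local Notation logd := (logd (stdE R l) (stdz R l)).
Local Notation sbasis := (sbasis (stdE R l) (stdz R l)).
Local Notation al i := (delta_mx 0 i : V).
Hypothesis simd : forall i, al i \in sim.
Hypothesis sims : forall a, a \in sim -> exists i, a = al i.
Hypothesis sim1 : {in sim, forall a, a *d xi = 1}.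
Hypothesis irr : forall P : V -> Prop,
  (forall a b, a \in Phi -> b \in Phi -> P a -> ~ P b -> a *d b = 0) ->
  (forall a, a \in Phi -> P a) \/ (forall a, a \in Phi -> ~ P a).
Hypothesis l_gt0 : (0 < l)%N.
Variables (hn : nat) (e0 : 'I_l -> nat) (s0 : 'S_l).
Hypotheses (hcox : {in Phi, forall a, \sum_(b <- pos) cart b a * cart a b = 2 * hn%:R})
  (hn_gt0 : (0 < hn)%N) (hN : (2 * size pos = hn * l)%N)
  (e0cnt : forall r, (0 < r)%N -> #|[set i | (r <= e0 i)%N]| = count (fun b => ht b == r) pos)
  (e0dual : forall i, (0 < e0 i)%N /\ (e0 i + e0 (s0 i) = hn)%N).

Let einj := @std_inj R l.
Let alp i : al i \in pos. Proof. exact: sim_pos (simd i). Qed.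

Lemma arr_pos_neq0 u w c : c \in arr u w -> c.1 != 0.
Proof.
case/mem_arr => -[cp _]; first exact: (pos_neq0 rsP cp).
by rewrite -oppr_eq0 (pos_neq0 rsP cp).
Qed.

Lemma affN (b : V) x : aff (- b, - x) = - aff (b, x).
Proof. by rewrite /Submission.aff /= mulNmx scaleNr opprB opprK addrC. Qed.

Lemma indep_std (r : 'I_l -> R) : indep [set: 'I_l] (fun i => (al i, r i)).
Proof.
move=> w _ /= hw i; have := congr1 (fun x : V => x 0 i) hw; rewrite summxE mxE (bigD1 i) //= !mxE !eqxx mulr1.
by rewrite big1 ?addr0 // => j ji; rewrite !mxE eq_sym (negbTE ji) andbF mulr0.
Qed.

(** Apart from [z = 0], [arr] with the constants [k] and [k] is the extended Shi arrangement, and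
    with [k + 1] and [k] the extended Catalan one; the ladder with all positive roots leads from one
    to the other. *)
Lemma cat_of_shi k Th0 : sbasis (arr (fun=> k) (fun=> k)) Th0 (fun=> k * hn)%N ->
  exists (Th : 'M[S]_l) e, sbasis (arr (fun=> k.+1) (fun=> k)) Th e /\ cntJ G xi (k * hn) pos e.
Proof.
move=> sb.
have [] := @ladder R l (l + 1) G hG _ _ einj Phi xi rsP reg sim1 hn%:R hcox k (k * hn)%N pos _
   (pos_uniq xi rsP) _ _ (fun _ _ => True) (fun _ => True) _ _ _ _ _ _ Th0 (fun i => (al i, 0)) sb (indep_std (r := fun=> 0)) _ _ 0 => //.
  by rewrite natrM.
move=> Th [e [_ [_ [sbT ce _ _ _]]]]; exists Th, e; split=> //.
by rewrite (arr_ext (u' := fun b => (k + (b \in pos))%N) (w' := fun=> k)) // => b bp; rewrite bp addn1.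
Qed.

Lemma mem_arr_low k (J : pred V) c : c \in arr (fun=> k.+1) (fun b => (k + (b \in J))%N) ->
  c \in arr (fun=> k.+1) (fun=> k) \/ exists2 b, b \in pos & b \in J /\ c = (- b, - k.+1%:R).
Proof.
case/mem_arr => -[cp [i hi e2]]; first by left; apply/mem_arr; left; split=> //; exists i.
case: (leqP i k) => ik.
  by left; apply/mem_arr; right; split=> //; exists i => //; case/andP: hi => ->.
right; exists (- c.1) => //; case: (boolP (- c.1 \in J)) hi => bJ /andP[_]; last by rewrite addn0 leqNgt ik.
rewrite addn1 => ik'; have ei : i = k.+1 by apply/eqP; rewrite eqn_leq ik' ik.
by split=> //; rewrite opprK -ei -e2 -surjective_pairing.
Qed.

Lemma logd_low k (J : pred V) (th : 'rV[S]_l) : logd (arr (fun=> k.+1) (fun=> k)) th ->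
  (forall b, b \in pos -> b \in J -> mdvd (lf (aff (b, k.+1%:R))) (dap th b)) ->
  logd (arr (fun=> k.+1) (fun b => (k + (b \in J))%N)) th.
Proof.
move=> h1 h2 c /mem_arr_low[/h1 //|[b bp [bJ ->]]] /=.
have -> : lf (aff (- b, - k.+1%:R)) = (-1) *: lf (aff (b, k.+1%:R)) :> S.
  by rewrite affN linearN scaleN1r.
by rewrite dapN; apply/mdvdN/mdvd_Zl; [rewrite oppr_eq0 oner_neq0 | apply: h2].
Qed.
Lemma logd_low_inv k (J : pred V) (th : 'rV[S]_l) b : b \in pos -> b \in J ->
  logd (arr (fun=> k.+1) (fun b => (k + (b \in J))%N)) th -> mdvd (lf (aff (b, k.+1%:R))) (dap th b).
Proof.
move=> bp bJ h; have := h (- b, - k.+1%:R); rewrite dapN => H.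
have -> : lf (aff (b, k.+1%:R)) = (-1) *: lf (aff (- b, - k.+1%:R)) :> S.
  by rewrite affN linearN scaleN1r opprK.
rewrite -[dap th b]opprK; apply/mdvdN/mdvd_Zl; first by rewrite oppr_eq0 oner_neq0.
apply: H; apply/mem_arr; right; rewrite opprK; split=> //.
by exists k.+1; rewrite //= bJ addn1 ltnS leqnn.
Qed.

Section Eta.
Variables (k : nat) (Th : 'M[S]_l) (e : 'I_l -> nat).
Hypotheses (sbT : sbasis (arr (fun=> k.+1) (fun=> k)) Th e) (ce : cntJ G xi (k * hn) pos e).
Let p := (k.+1 * hn).-1.
Let B := p.+2.
Let n_gt1 : (1 < l + 1)%N. Proof. by rewrite addn1 ltnS. Qed.
Let n_gt0 : (0 < l + 1)%N. Proof. by rewrite addn1. Qed.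
Let pE : p.+1 = (k.+1 * hn)%N. Proof. by rewrite prednK // muln_gt0. Qed.

Let e0lt i : (e0 i < hn)%N.
Proof. by have [_ <-] := e0dual i; rewrite -[X in (X < _)%N]addn0 ltn_add2l; case: (e0dual (s0 i)). Qed.

Let e_lev r : (0 < r)%N -> #|[set i | (r <= e i - k * hn)%N]| = #|[set i | (r <= e0 i)%N]|.
Proof.
move=> r0; case: ce => lo hi; rewrite e0cnt // -hi //; congr #|pred_of_set _|; apply/setP => i.
by rewrite !inE leq_subRL // lo.
Qed.

Let e_le i : (e i <= p)%N.
Proof.
have : #|[set i | (hn <= e i - k * hn)%N]| = 0%N.
  by rewrite e_lev //; apply/eqP; rewrite cards_eq0; apply/eqP/setP => j; rewrite !inE leqNgt e0lt.
move/eqP; rewrite cards_eq0 => /eqP/setP/(_ i); rewrite !inE => /negbT; rewrite -ltnNge.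
by case: ce => /(_ i) lo _; rewrite ltn_subLR // -mulSnr => h; rewrite -ltnS pE.
Qed.

Let ht_le b : b \in pos -> (ht b < hn)%N.
Proof.
move=> bp; have : (0 < #|[set i | (ht b <= e0 i)%N]|)%N.
  by rewrite e0cnt ?(ht_gt0 rsP sim1) // -has_count; apply/hasP; exists b.
by case/card_gt0P => i; rewrite inE => h; apply: leq_ltn_trans h (e0lt i).
Qed.

(** By duality the numbers [p - e i] are the exponents of the root system minus one. There are
    [\sum_(q < m) hilb0 q] monomials of degree [m - 1], and as many exponents above [q] as roots of
    height [q + 1]; exchanging the sums gives the right side. *)
Let total : (\sum_i #|mons (l + 1) B (p - e i)| = \sum_(b <- pos) hilb0 (l + 1) B (ht b).-1)%N.
Proof.
have hnB : (hn <= p.+1)%N by rewrite pE leq_pmull.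
transitivity (\sum_i #|mons (l + 1) B (hn.-1 - (e i - k * hn))%N|)%N.
  apply: eq_bigr => i _; congr #|pred_of_set (mons _ _ _)|.
  case: ce => /(_ i) lo _; have := e_le i; move: pE; rewrite mulSn.
  clear -hn_gt0 lo; move: lo; set q := (k * hn)%N; clearbody q; move: (e i); clearbody p; clear; lia.
rewrite (sum_same_levels (fun x => #|mons (l + 1) B (hn.-1 - x)%N|) e_lev).
transitivity (\sum_i #|mons (l + 1) B (e0 (s0 i)).-1|)%N.
  apply: eq_bigr => i _; congr #|pred_of_set (mons _ _ _)|.
  by have [] := e0dual i; have [] := e0dual (s0 i); clear; lia.
rewrite -(reindex_inj (h := s0) (P := xpredT) (F := fun i => #|mons (l + 1) B (e0 i).-1|)) /=; last exact: perm_inj.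
transitivity (\sum_i \sum_(q < B | (q < e0 i)%N) hilb0 (l + 1) B q)%N.
  apply: eq_bigr => i _; have [ei _] := e0dual i; have lt := e0lt i.
  have eB : (e0 i <= B)%N by rewrite (leq_trans (ltnW lt)) // (leq_trans hnB).
  rewrite card_mons_sum //; last by rewrite prednK.
  by rewrite prednK // (big_ord_widen B (fun q => hilb0 (l + 1) B q) eB).
rewrite (exchange_big_dep xpredT) //=.
transitivity (\sum_(q < B) \sum_(b <- pos | ht b == q.+1) hilb0 (l + 1) B q)%N.
  apply: eq_bigr => q _; rewrite (eq_bigl (fun i => i \in [set i | (q < e0 i)%N])); last by move=> i; rewrite inE.
  by rewrite sum_nat_const e0cnt // big_const_seq iter_addn_0 mulnC.
rewrite (exchange_big_dep xpredT) //= big_seq [RHS]big_seq; apply: eq_bigr => b bp.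
have h1 := ht_gt0 rsP sim1 bp; have h2 := ht_le bp.
have hB : ((ht b).-1 < B)%N by rewrite prednK // (leq_trans (ltnW h2)) // (leq_trans hnB).
rewrite (bigD1 (Ordinal hB)) /= ?prednK ?eqxx // big1 ?addn0 // => q /andP[/eqP hq /eqP nq].
by case: nq; apply: val_inj; rewrite /= hq.
Qed.

(** The monomial multiples of the rows of [Th] in degree [p]; they are independent because [\det Th]
    is nonzero. *)
Let start : exists m (F : 'I_m -> 'rV[S]_l), [/\ findep F,
  m = (\sum_i #|mons (l + 1) B (p - e i)|)%N, forall j t, F j 0 t \is p.-homog &
  forall j, logd (arr (fun=> k.+1) (fun=> k)) (F j)].
Proof.
case: sbT => hl hh hd _.
pose T : finType := {x : 'I_l * bmultinom (l + 1) B | mdeg x.2 == (p - e x.1)%N}.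
pose F (j : 'I_#|{: T}|) : 'rV[S]_l := 'X_[(val (enum_val j)).2] *: row (val (enum_val j)).1 Th.
exists #|{: T}|, F; split.
- move=> y hy j; pose r : 'rV[S]_l := \row_i \sum_(j | (val (enum_val j)).1 == i) y j *: 'X_[(val (enum_val j)).2].
  have er : r *m Th = 0.
    rewrite -[RHS]hy /comb mulmx_sum_row (partition_big (fun j => (val (enum_val j)).1) xpredT) //=.
    apply: eq_bigr => i _; rewrite mxE scaler_suml; apply: eq_bigr => t /eqP <-.
    by rewrite /F scalerA mul_mpolyC.
  have r0 : r = 0.
    have : r *m Th *m \adj Th = 0 by rewrite er mul0mx.
    rewrite -mulmxA mul_mx_adj mul_mx_scalar => /rowP h; apply/rowP => i.
    by have := h i; rewrite !mxE => /eqP; rewrite mulf_eq0 (negbTE hd) => /eqP.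
  have /rowP/(_ (val (enum_val j)).1)/(congr1 (mcoeff (val (enum_val j)).2)) := r0.
  rewrite !mxE mcoeff0 raddf_sum (bigD1 j) //= mcoeffZ mcoeffX eqxx mulr1 big1 ?addr0 //.
  move=> t /andP[/eqP ti tj]; rewrite mcoeffZ mcoeffX; case: eqP => [e1|]; last by rewrite mulr0.
  case/eqP: tj; apply: enum_val_inj; apply: val_inj => /=.
  by rewrite [LHS]surjective_pairing [RHS]surjective_pairing ti; congr (_, _); apply: val_inj.
- rewrite card_sig -sum1_card.
  under [RHS]eq_bigr do rewrite -sum1_card.
  rewrite pair_big_dep /=; apply: eq_bigl => x; by rewrite !inE.
- move=> j t; rewrite !mxE; have /eqP md := valP (enum_val j).
  have hx : 'X_[(val (enum_val j)).2] * Th (val (enum_val j)).1 t \is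
      ((p - e (val (enum_val j)).1) + e (val (enum_val j)).1)%N.-homog.
    by apply: dhomogM; [rewrite -md dhomogX | exact: hh].
  by move: hx; rewrite (subnK (e_le _)).
move=> j c cA; rewrite dap_scale; apply: mdvdMl; exact: hl.
Qed.

Lemma eta_exists i : exists eta : 'rV[S]_l, [/\ eta != 0, forall j, eta 0 j \is p.-homog &
  logd (arr (fun=> k.+1) (fun b => (k + (b != al i))%N)) eta].
Proof.
pose rl := [rel a b : V | (ht b <= ht a)%N].
pose L := sort rl [seq b <- pos | b != al i].
have LP b : (b \in L) = (b \in pos) && (b != al i) by rewrite mem_sort mem_filter andbC.
have uL : uniq L by rewrite sort_uniq filter_uniq // (pos_uniq xi rsP).
have sL : sorted rl L by apply: sort_sorted => x y; exact: leq_total.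
have rlT : transitive rl by move=> y x z /= h1 h2; apply: leq_trans h2 h1.
suff key s1 s2 : L = s1 ++ s2 -> exists m (F : 'I_m -> 'rV[S]_l), [/\ findep F,
    (\sum_(b <- pos) hilb0 (l + 1) B (ht b).-1 <= m + \sum_(b <- s1) hilb0 (l + 1) B (ht b).-1)%N,
    forall j t, F j 0 t \is p.-homog & forall j, logd (arr (fun=> k.+1) (fun b => (k + (b \in s1))%N)) (F j)].
  have [m [F [hF mF hh hl]]] := key L [::] (esym (cats0 _)).
  have m0 : (0 < m)%N.
    move: mF; rewrite (perm_big _ (permEl (perm_sort rl _))) big_filter /= (bigID (fun b => b != al i)) /=.
    rewrite addnC leq_add2r; apply: leq_trans; rewrite big_mkcond (big_rem (al i)) //= eqxx /=.
    have -> : ht (al i) = 1%N.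
      by apply/eqP; rewrite -(eqr_nat R) -(htE rsP sim1 (alp i)) (sim1 (simd i)).
    by rewrite ltn_addr.
  exists (F (Ordinal m0)); split=> //.
    apply/eqP => F0; have := hF (fun j => (j == Ordinal m0)%:R).
    have -> : comb (fun j => (j == Ordinal m0)%:R) F = 0.
      rewrite /comb (bigD1 (Ordinal m0)) //= F0 scaler0 add0r big1 // => j /negbTE ->.
      by rewrite scale0r.
    by move=> /(_ erefl (Ordinal m0)) /eqP; rewrite eqxx oner_eq0.
  rewrite (arr_ext (u' := fun=> k.+1) (w' := fun b => (k + (b \in L))%N)) // => b bp.
  by rewrite LP bp.
elim/last_ind: s1 s2 => [|s1 a IH] s2 eL.
  have [m [F [hF em hh hl]]] := start; exists m, F; split=> //.
    by rewrite big_nil addn0 em total.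
  by move=> j; apply: logd_low => //; exact: hl.
rewrite cat_rcons in eL; have [m [F [hF mF hh hl]]] := IH _ eL.
have aL : a \in L by rewrite eL mem_cat mem_head orbT.
have [ap ai] : a \in pos /\ a != al i by move: aL; rewrite LP => /andP[].
have as1 : a \notin s1.
  by move: uL; rewrite eL cat_uniq => /and3P[_ /hasPn/(_ a)]; rewrite mem_head => /(_ isT).
have hig g : g \in pos -> a *d xi < g *d xi -> g \in s1.
  rewrite (htE rsP sim1 ap) => gp; rewrite (htE rsP sim1 gp) ltr_nat => lt.
  have gi : g != al i.
    apply: contraTneq lt => ->; rewrite -leqNgt.
    have -> : ht (al i) = 1%N.
      by apply/eqP; rewrite -(eqr_nat R) -(htE rsP sim1 (alp i)) (sim1 (simd i)).
    exact: (ht_gt0 rsP sim1 ap).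
  have : g \in L by rewrite LP gp gi.
  rewrite eL mem_cat in_cons => /or3P[//|/eqP ge|gs2]; first by move: lt; rewrite ge ltnn.
  move: sL; rewrite eL (sorted_pairwise rlT) pairwise_cat => /and3P[_ _] /= /andP[/allP/(_ g gs2) /= + _].
  by rewrite leqNgt lt.
have [Q [d [hQ cQ dQ dvQ]]] := divisor_down hG einj rsP reg sim1 hcox k ap as1 hig.
have a0 : aff (a, k.+1%:R) != 0 by apply: (aff_eq0 einj); exact: (pos_neq0 rsP ap).
have h1 := ht_gt0 rsP sim1 ap; have h2 := ht_le ap.
(* The divisor has degree at least [p + 1 - ht a], so the quotient has degree at most [ht a - 1]. *)
have pd : (p <= d + (ht a).-1)%N.
  have : (k.+1 * hn <= d + ht a)%N.
    by rewrite -(ler_nat R) natrD natrM -lerBlDr.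
  by rewrite -pE; clear -h1; lia.
have hnB : (hn <= p.+1)%N by rewrite pE leq_pmull.
have hB : ((ht a).-1 < B)%N by rewrite prednK // (leq_trans (ltnW h2)) // (leq_trans hnB).
have pB : (p < B)%N by rewrite ltnW.
have hq j : exists q, mdvd (lf (aff (a, k.+1%:R))) (dap (F j) a - Q * q) by apply: dvQ; exact: hl.
have [m' [K [x [xh mm hK hKd]]]] := family_step hF a0 pB hh hQ cQ pd hB hq.
exists m', (fun j => comb (K j) F); split=> //.
- apply: leq_trans mF _; rewrite big_rcons /= addnA; rewrite addnAC leq_add2r.
  apply: leq_trans mm _; rewrite leq_add2l; apply: hilb0_le => //.
  by rewrite xh.
- move=> j t; rewrite /comb summxE; apply: rpred_sum => u _; rewrite mxE mul_mpolyC.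
  by apply: rpredZ; exact: hh.
move=> j; have hlj : logd (arr (fun=> k.+1) (fun b => (k + (b \in s1))%N)) (comb (K j) F).
  move=> c cA; rewrite dap_comb; apply: mdvd_sum => u _; apply: mdvdZ; exact: hl.
apply: (@logd_low k (mem (rcons s1 a))).
  move=> c cA; apply: hlj; apply/mem_arr; case/mem_arr: cA => -[cp [u hu e2]]; [left|right]; split=> //; exists u => //.
  by case/andP: hu => -> /= hu; rewrite (leq_trans hu) // leq_addr.
move=> b bp; rewrite inE mem_rcons in_cons => /orP[/eqP ->|bs]; first exact: hKd.
exact: (@logd_low_inv k (mem s1)).
Qed.

End Eta.

(** Modulo [z] the [2 (k + 1)] hyperplanes parallel to [b = 0] coincide with it. *)
Lemma red_quasi k (th : 'rV[S]_l) : logd (arr (fun=> k.+1) (fun=> k.+1)) th ->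
  quasi G Phi xi k (redm th).
Proof.
move=> h b bp; have b0 := pos_neq0 rsP bp.
pose Lc : seq R := [seq - i%:R | i <- iota 0 k.+1] ++ [seq i%:R | i <- iota 1 k.+1].
have uL : uniq Lc.
  rewrite cat_uniq !map_inj_uniq ?iota_uniq; first last.
  - by move=> i j /oppr_inj/eqP; rewrite eqr_nat => /eqP.
  - by move=> i j /eqP; rewrite eqr_nat => /eqP.
  rewrite andTb andbT; apply/hasPn => x /mapP[i]; rewrite mem_iota => /andP[i1 _] ->.
  apply/negP => /mapP[j _] /eqP; rewrite -subr_eq0 opprK -natrD pnatr_eq0 addn_eq0.
  by case: (i) i1.
have a0 c : aff (b, c) != 0 by apply: (aff_eq0 einj).
have dv c : c \in Lc -> mdvd (lf (aff (b, c))) (dap th b).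
  rewrite mem_cat => /orP[] /mapP[i]; rewrite mem_iota => hi ->.
    by apply: (h (b, - i%:R)); apply/mem_arr; left; split=> //; exists i.
  have -> : lf (aff (b, i%:R)) = (-1) *: lf (aff (- b, - i%:R)) :> S.
    by rewrite affN linearN scaleN1r opprK.
  rewrite -[dap th b]opprK; apply/mdvdN/mdvd_Zl; first by rewrite oppr_eq0 oner_neq0.
  rewrite -dapN; apply: (h (- b, - i%:R)); apply/mem_arr; right; rewrite opprK; split=> //.
  by exists i => //; rewrite -ltnS -add1n.
have [|q eq] := @mdvd_prod R _ R Lc (fun c => lf (aff (b, c))) (dap th b) uL dv _.
  move=> c c' _ _ ne; apply: lf_cop_lf => // t; apply/eqP => e1.
  have [e2 e3] := aff_prop einj e1; move/eqP: ne; apply.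
  have t1 : t = 1.
    have /eqP : (t - 1) *: b = 0 by rewrite scalerBl scale1r -e2 subrr.
    by rewrite scaler_eq0 (negbTE b0) orbF subr_eq0 => /eqP.
  by move: e3; rewrite /= t1 mul1r => ->.
rewrite dap_red eq redM; apply: mdvdMr.
have -> : red (\prod_(c <- Lc) lf (aff (b, c))) = lf b ^+ (2 * k.+1).
  rewrite /red rmorph_prod /=; under eq_bigr do rewrite -/(red _) red_aff.
  rewrite big_const_seq count_predT iter_mulr_1; congr (_ ^+ _).
  by rewrite size_cat !size_map !size_iota; lia.
exact: mdvd_refl.
Qed.

(** Multiplying [eta i] by the missing form gives a derivation for the whole arrangement. Modulo [z]
    these products are nonzero multiples of the simple roots in the lowest degree, where
    [simple_basis] makes them independent; their degrees already add up to the number of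
    hyperplanes. *)
Lemma shi_of_cat k (Th : 'M[S]_l) e : sbasis (arr (fun=> k.+1) (fun=> k)) Th e ->
  cntJ G xi (k * hn) pos e -> exists (Th0 : 'M[S]_l),
  sbasis (arr (fun=> k.+1) (fun=> k.+1)) Th0 (fun=> k.+1 * hn)%N /\
  forall i, exists eta : 'rV[S]_l, row i Th0 = lf (aff (al i, k.+1%:R)) *: eta.
Proof.
move=> sbT ce; have /fin_all_exists[eta heta] := eta_exists sbT ce.
have kh0 : (0 < k.+1 * hn)%N by rewrite muln_gt0.
pose f i := lf (aff (al i, k.+1%:R)) : S.
have lift i (x : 'rV[S]_l) : logd (arr (fun=> k.+1) (fun b => (k + (b != al i))%N)) x ->
    logd (arr (fun=> k.+1) (fun=> k.+1)) (f i *: x).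
  move=> hx; rewrite (arr_ext (u' := fun=> k.+1) (w' := fun b => (k + (b \in pos))%N)) //; last first.
    by move=> b bp; rewrite bp addn1.
  apply: (@logd_low k (mem pos)) => [c cA|b bp _].
    rewrite dap_scale; apply/mdvdMl/hx; apply/mem_arr; case/mem_arr: cA => -[cp [u hu e2]]; [left|right]; split=> //; exists u => //.
    by case/andP: hu => -> /= hu; rewrite (leq_trans hu) // leq_addr.
  rewrite dap_scale; case: (eqVneq b (al i)) => [->|bi]; first exact/mdvdMr/mdvd_refl.
  apply: mdvdMl; exact: (@logd_low_inv k [pred b | b != al i]).
have psi0 i (x : 'rV[S]_l) : redm (f i *: x) = lf (al i) *: redm x.
  by apply/rowP => j; rewrite !mxE redM red_aff.
(* If [eta i] had a factor [z], dividing it out would produce a nonzero element below the lowest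
   degree. *)
have red0 i : redm (eta i) != 0.
  have [n0 hh hl] := heta i; have [t [x [ex tp hx rx]]] := z_removal hh n0.
  have hlx : logd (arr (fun=> k.+1) (fun b => (k + (b != al i))%N)) x.
    by apply: (logd_z (t := t)); [move=> b; apply: arr_pos_neq0 | rewrite -ex].
  case: t ex tp hx => [|t] ex tp hx; first by rewrite ex expr0 scale1r.
  have : redm (f i *: x) = 0.
    have dlt : (k.+1 * hn - t.+1 < k.+1 * hn)%N by rewrite ltn_subrL kh0.
    apply: (quasi_min hG rsP reg simd irr l_gt0 hn_gt0 hN dlt); split; first exact: red_quasi (lift _ _ hlx).
    move=> j; rewrite psi0 mxE mxE.
    have -> : (k.+1 * hn - t.+1 = 1 + ((k.+1 * hn).-1 - t.+1))%N.
      by rewrite add1n -subSn // prednK.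
    by apply: dhomogM; [exact: lf_homog | exact: red_homog (hx j)].
  by rewrite psi0 => /eqP; rewrite rowZ_eq0 (negbTE rx) lf_eq0 (negbTE (pos_neq0 rsP (alp i))).
pose Th0 : 'M[S]_l := \matrix_i (f i *: eta i).
have hh0 i j : (f i *: eta i) 0 j \is (k.+1 * hn)%N.-homog.
  have hx : f i * eta i 0 j \is (1 + (k.+1 * hn).-1)%N.-homog.
    by apply: dhomogM; [exact: lf_homog | have [_ hh _] := heta i].
  by move: hx; rewrite mxE add1n prednK.
exists Th0; split; last by move=> i; exists (eta i); rewrite rowK.
split.
- by move=> i; rewrite rowK; apply: lift; have [] := heta i.
- by move=> i j; have := hh0 i j; rewrite [Th0 i j]mxE.
- have hd : \det (\matrix_i redm (f i *: eta i)) != 0.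
    apply: (simple_basis hG rsP reg simd sims irr (k' := k) l_gt0 hn_gt0 hN).
    + move=> i; split; first by apply/red_quasi/lift; have [] := heta i.
      by move=> j; rewrite mxE; apply/red_homog/hh0.
    + by move=> i; rewrite psi0 rowZ_eq0 negb_or lf_eq0 (pos_neq0 rsP (alp i)) red0.
    by move=> i; exists (redm (eta i)); rewrite psi0.
  apply: contraNneq hd => d0; have -> : \matrix_i redm (f i *: eta i) = map_mx (comp_mpoly (redt R l)) Th0.
    by apply/matrixP => i j; rewrite !mxE.
  by rewrite det_map_mx d0 rmorph0.
rewrite size_arr big_const_seq count_predT iter_addn_0 big_const_ord iter_addn_0 addnn.
by rewrite -mul2n -(mulnA _ hn l) -hN mulnCA mulnA.
Qed.

Lemma shi_basis k : exists (Th0 : 'M[S]_l),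
  sbasis (arr (fun=> k.+1) (fun=> k.+1)) Th0 (fun=> k.+1 * hn)%N /\
  forall i, exists eta : 'rV[S]_l, row i Th0 = lf (aff (al i, k.+1%:R)) *: eta.
Proof.
elim: k => [|k [Th0 [sb0 _]]]; last first.
  by have [Th [e [sb ce]]] := cat_of_shi sb0; apply: shi_of_cat sb ce.
have A0 c : c \in arr (fun=> 0%N) (fun=> 0%N) = false.
  by apply/negP => /mem_arr[[_ [i]]|[_ [i]]] //; case: i.
have sb0 : sbasis (arr (fun=> 0%N) (fun=> 0%N)) (1%:M : 'M[S]_l) (fun=> 0 * hn)%N.
  split=> [i c| | |].
  - by rewrite A0.
  - by move=> i j; rewrite mxE; case: (_ == _); rewrite ?dhomog1 ?dhomog0 ?rpred0.
  - by rewrite det1 oner_eq0.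
  by rewrite (size_arr G Phi xi) !big1_eq.
by have [Th [e [sb ce]]] := cat_of_shi sb0; apply: shi_of_cat sb ce.
Qed.

(* Vanishing on a flat, tested on points with polynomial coordinates. *)
Definition vanish (X : seq (V * R)) (th : 'rV[S]_l) := forall m (x : (l + 1).-tuple {mpoly R[m]}),
  {in X, forall c, lf (aff c) \mPo x = 0} -> forall j, th 0 j \mPo x = 0.

(** The sign [s] accounts for [arr] storing the hyperplane [a = j z] with [j > 0] as
    [(- a, - j)]. *)
Lemma irreducible_ladder k (J : seq V) : uniq J -> {subset J <= pos} ->
  (forall b g s, b \in J -> g \in pos -> {subset s <= pos} -> b - g = \sum_(x <- s) x -> g \in J) ->
  forall t, (t <= l)%N ->
  exists (Th : 'M[S]_l) (e : 'I_l -> nat) (Q : {set 'I_l}) (c : 'I_l -> V * R),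
  [/\ sbasis (arr (fun b => (k.+1 + (b \in J))%N) (fun=> k.+1)) Th e,
    cntJ G xi (k.+1 * hn) J e, #|Q| = t, topset Q e &
    [/\ indep Q c, forall i, i \in Q -> exists s : bool, let A := arr (fun b => (k.+1 + (b \in J))%N) (fun=> k.+1) in
          ((-1) ^+ s *: (c i).1, (-1) ^+ s * (c i).2) \in A &
       forall i, i \in Q -> vanish [seq c i | i in Q] (row i Th)]].
Proof.
move=> uJ Jp Jl t tl; have [Th0 [sb0 hTh0]] := shi_basis k.
have khE : (k.+1 * hn)%:R = k.+1%:R * hn%:R :> R by rewrite natrM.
apply: (ladder hG einj rsP reg sim1 hcox khE uJ Jp Jl (vn := vanish)
  (good := fun c => exists s : bool, let A := arr (fun b => (k.+1 + (b \in J))%N) (fun=> k.+1) in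
    ((-1) ^+ s *: c.1, (-1) ^+ s * c.2) \in A) (c0 := fun i => (al i, k.+1%:R)) _ _ _ _ _ _ sb0) => //.
- by move=> X m x _ j; rewrite mxE rmorph0.
- by move=> X a b ha hb m x hx j; rewrite mxE rmorphD /= ha ?hb ?addr0.
- by move=> X r a ha m x hx j; rewrite mxE rmorphM /= ha ?mulr0.
- by move=> X c th cX m x hx j; rewrite mxE rmorphM /= hx ?mul0r.
- by move=> X Y th XY hX m x hx; apply: hX => c cX; apply: hx; apply: XY.
- move=> b bJ; exists false; rewrite /= expr0 scale1r mul1r; apply/mem_arr; left.
  by split; [exact: Jp | exists k.+1; rewrite //= bJ addn1].
- exact: indep_std.
- move=> i; exists true; rewrite /= expr1 scaleN1r mulN1r; apply/mem_arr; right.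
  by rewrite /= opprK; split=> //; exists k.+1; rewrite /= ?leqnn.
move=> i; have [eta ->] := hTh0 i; move=> m x hx j; rewrite mxE rmorphM /=.
by rewrite (hx (al i, k.+1%:R)) ?mem_head // mul0r.
Qed.

End Irreducible.

(** * Degrees left after removing the largest ones *)

Section Topset.
Variables (l : nat) (C : {set 'I_l}).

(** Either some element of [Q] is at most [v], and then so is everything outside [Q], or all of [Q]
    lies above [v]. *)
Lemma topset_low (f : 'I_l -> nat) (Q : {set 'I_l}) v : Q \subset C ->
  (forall i j, i \in Q -> j \in C -> j \notin Q -> (f j <= f i)%N) ->
  #|[set i in C :\: Q | (f i <= v)%N]| = minn #|[set i in C | (f i <= v)%N]| (#|C| - #|Q|).
Proof.
move=> QC top; have cD : (#|C :\: Q| = #|C| - #|Q|)%N by rewrite cardsD (setIidPr QC).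
have le1 : (#|[set i in C :\: Q | (f i <= v)%N]| <= #|[set i in C | (f i <= v)%N]|)%N.
  by apply: subset_leq_card; apply/subsetP => i; rewrite !inE => /andP[/andP[_ ->] ->].
have le2 : (#|[set i in C :\: Q | (f i <= v)%N]| <= #|C| - #|Q|)%N.
  by rewrite -cD; apply: subset_leq_card; apply/subsetP => i; rewrite !inE => /andP[].
case: (pickP (fun i => (i \in Q) && (f i <= v)%N)) => [i /andP[iQ fi]|none].
  have e1 : [set i in C :\: Q | (f i <= v)%N] = C :\: Q.
    apply/setP => j; rewrite !inE; case: (boolP (j \in Q)) => //= jQ; case: (boolP (j \in C)) => //= jC.
    by rewrite (leq_trans (top i j iQ jC jQ) fi).
  by rewrite e1 cD in le1 *; rewrite (minn_idPr le1).
have e1 : [set i in C :\: Q | (f i <= v)%N] = [set i in C | (f i <= v)%N].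
  apply/setP => j; rewrite !inE; case: (boolP (j \in Q)) => //= jQ.
  by have := none j; rewrite jQ /= => ->; rewrite andbF.
by rewrite e1 in le2 *; rewrite (minn_idPl le2).
Qed.

Lemma card_eq_low (D : {set 'I_l}) (f : 'I_l -> nat) v : (#|[set i in D | (f i <= v)%N]| =
  #|[set i in D | f i == v]| + (if v is v'.+1 then #|[set i in D | (f i <= v')%N]| else 0))%N.
Proof.
case: v => [|v]; first by rewrite addn0; congr #|pred_of_set _|; apply/setP => i; rewrite !inE leqn0.
rewrite -cardsUI [X in (_ + #|pred_of_set X|)%N](_ : _ = set0) ?cards0 ?addn0.
  by congr #|pred_of_set _|; apply/setP => i; rewrite !inE leq_eqVlt ltnS; case: (i \in D).
by apply/setP => i; rewrite !inE; case: eqP => [->|]; rewrite ?ltnn ?andbF.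
Qed.

(** By [topset_low] the degrees outside a top set depend only on its size and on the multiset of all
    degrees. *)
Lemma topset_counts (f f' : 'I_l -> nat) (Q Q' : {set 'I_l}) : Q \subset C -> Q' \subset C ->
  #|Q| = #|Q'| ->
  (forall i j, i \in Q -> j \in C -> j \notin Q -> (f j <= f i)%N) ->
  (forall i j, i \in Q' -> j \in C -> j \notin Q' -> (f' j <= f' i)%N) ->
  (forall v, #|[set i in C | f i == v]| = #|[set i in C | f' i == v]|) ->
  forall v, #|[set i in C :\: Q | f i == v]| = #|[set i in C :\: Q' | f' i == v]|.
Proof.
move=> QC QC' cQ top top' cnt.
have low v : #|[set i in C | (f i <= v)%N]| = #|[set i in C | (f' i <= v)%N]|.
  by elim: v => [|v IH]; rewrite (card_eq_low C f) (card_eq_low C f') cnt ?IH.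
have low' v : #|[set i in C :\: Q | (f i <= v)%N]| = #|[set i in C :\: Q' | (f' i <= v)%N]|.
  by rewrite (topset_low v QC top) (topset_low v QC' top') cQ low.
move=> v; apply/eqP; have := card_eq_low (C :\: Q) f v; have := card_eq_low (C :\: Q') f' v.
rewrite low' => -> /eqP; case: v => [|v]; first by rewrite !addn0 eq_sym.
by rewrite low' eqn_add2r eq_sym.
Qed.

End Topset.

Lemma comp_X (F : fieldType) n k (i : 'I_n) (t : n.-tuple {mpoly F[k]}) : 'X_i \mPo t = tnth t i.
Proof.
rewrite -lf_delta comp_lf (bigD1 i) //= big1 ?addr0 => [|j ji]; first by rewrite mxE !eqxx scale1r.
by rewrite mxE (negbTE ji) andbF scale0r.
Qed.

Lemma std_affl (R : realType) l (b : 'rV[R]_l) r j :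
  aff (stdE R l) (stdz R l) (b, r) 0 (lshift 1 j) = b 0 j.
Proof.
rewrite /aff /= !mul_mx_row scale_row_mx mulmx1 mulmx0 scaler0 opp_row_mx add_row_mx.
by rewrite oppr0 addr0 row_mxEl.
Qed.
Lemma std_affr (R : realType) l (b : 'rV[R]_l) r j :
  aff (stdE R l) (stdz R l) (b, r) 0 (rshift l j) = - r.
Proof.
rewrite /aff /= !mul_mx_row scale_row_mx mulmx1 mulmx0 scaler0 opp_row_mx add_row_mx.
by rewrite sub0r row_mxEr !mxE (ord1 j) eqxx mulr1.
Qed.

(** * Components of the Dynkin graph and their assembly *)

Section Component.
Variables (R : realType) (l : nat) (G : 'M[R]_l).
Hypothesis hG : inner_product G.
Local Notation V := 'rV[R]_l.
Local Notation S := {mpoly R[l + 1]}.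
Local Notation "u '*d' v" := (dot G u v) (at level 40).
Local Notation cart := (cart G).
Variables (Phi : seq V) (xi : V).
Hypotheses (rsP : root_system G Phi) (reg : regular G Phi xi).
Local Notation pos := (posr G Phi xi).
Local Notation sim := (simr G Phi xi).
Local Notation ht := (ht G xi).
Local Notation arr := (arr G Phi xi).
Local Notation aff := (aff (stdE R l) (stdz R l)).
Local Notation logd := (logd (stdE R l) (stdz R l)).
Local Notation al i := (delta_mx 0 i : V).
Hypothesis simd : forall i, al i \in sim.
Hypothesis sims : forall a, a \in sim -> exists i, a = al i.
Hypothesis sim1 : {in sim, forall a, a *d xi = 1}.
Variables (k' : nat) (J : seq V).
Local Notation k := k'.+1.
Hypotheses (uJ : uniq J) (Jpos : {subset J <= pos}).
Hypothesis Jlow : forall b g s, b \in J -> g \in pos -> {subset s <= pos} ->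
  b - g = \sum_(x <- s) x -> g \in J.
Local Notation A := (arr (fun b => (k + (b \in J))%N) (fun=> k)).

Definition edge : rel 'I_l := [rel i j | G i j != 0].
Definition compo (i : 'I_l) : {set 'I_l} := [set j | connect edge i j].

Let GC i j : G i j = G j i.
Proof. by case: hG => sG _; rewrite -{1}sG mxE. Qed.
Let edge_sym : connect_sym edge.
Proof. by apply: sym_connect_sym => i j; rewrite /edge /= GC. Qed.

Lemma compo_self i : i \in compo i. Proof. by rewrite inE connect0. Qed.

Section OneComponent.
Variable i0 : 'I_l.
Let C := compo i0.
Let L := #|C|.
Let iota_ (a : 'I_L) : 'I_l := enum_val a.
Let rk (j : 'I_l) : 'I_L := enum_rank_in (compo_self i0) j.

Let rkK j : j \in C -> iota_ (rk j) = j.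
Proof. exact: enum_rankK_in. Qed.
Let iotaK a : rk (iota_ a) = a.
Proof. exact: enum_valK_in. Qed.
Let iotaC a : iota_ a \in C. Proof. exact: enum_valP. Qed.
Let L_gt0 : (0 < L)%N. Proof. by apply/card_gt0P; exists i0; apply: compo_self. Qed.

Let GZ j t : j \in C -> t \notin C -> G j t = 0.
Proof.
move=> jC tC; apply/eqP; apply: contraNT tC => ne; rewrite inE; move: jC; rewrite inE => h.
exact: connect_trans h (connect1 ne).
Qed.

Let GZr j t : j \in C -> t \notin C -> G t j = 0.
Proof. by move=> jC tC; rewrite GC GZ. Qed.

Let Ei : 'M[R]_(L, l) := \matrix_(a, j) (iota_ a == j)%:R.
Let emb (x : 'rV[R]_L) : V := x *m Ei.
Let prj (b : V) : 'rV[R]_L := \row_a b 0 (iota_ a).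
Let GL : 'M[R]_L := Ei *m G *m Ei^T.

Let embE x j : emb x 0 j = if j \in C then x 0 (rk j) else 0.
Proof.
rewrite mxE; case: ifP => jC.
  rewrite (bigD1 (rk j)) //= mxE rkK // eqxx mulr1 big1 ?addr0 // => a aj.
  by rewrite mxE; case: eqP => [e|_]; rewrite ?mulr0 //; case/eqP: aj; rewrite -e iotaK.
apply: big1 => a _; rewrite mxE; case: eqP => [e|_]; last by rewrite mulr0.
by rewrite -e iotaC in jC.
Qed.
Let embK x : prj (emb x) = x.
Proof. by apply/rowP => a; rewrite mxE embE iotaC iotaK. Qed.
Let supp (b : V) := [forall j, (j \notin C) ==> (b 0 j == 0)].
Let suppP b : reflect (supp_in (fun j => j \in C) b) (supp b).
Proof.
apply: (iffP forallP) => [h j jC|h j]; first by apply/eqP; exact: implyP (h j) jC.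
by apply/implyP => jC; rewrite h.
Qed.
Let prjK b : supp b -> emb (prj b) = b.
Proof.
move=> /suppP h; apply/rowP => j; rewrite embE; case: ifP => jC; first by rewrite mxE rkK.
by rewrite h // jC.
Qed.
Let emb_supp x : supp (emb x).
Proof. by apply/suppP => j jC; rewrite embE (negbTE jC). Qed.
Let embB x y : emb (x - y) = emb x - emb y. Proof. exact: mulmxBl. Qed.
Let embZ t x : emb (t *: x) = t *: emb x. Proof. by rewrite /emb -scalemxAl. Qed.
Let emb_inj : injective emb. Proof. exact: can_inj embK. Qed.
Let emb0 : emb 0 = 0. Proof. exact: mul0mx. Qed.
Let dotE x y : dot GL x y = emb x *d emb y.
Proof. by rewrite /dot /GL /emb trmx_mul !mulmxA. Qed.

Let hGL : inner_product GL.
Proof.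
case: hG => sG pG; split; first by rewrite /GL !trmx_mul trmxK sG mulmxA.
by move=> u u0; rewrite dotE; apply: pG; apply: contraNneq u0 => e; rewrite -(embK u) e; apply/eqP/rowP => a; rewrite !mxE.
Qed.
Let cartE x y : Submission.cart GL x y = cart (emb x) (emb y).
Proof. by rewrite /Submission.cart !dotE. Qed.
Let reflE x y : emb (refl GL x y) = refl G (emb x) (emb y).
Proof. by rewrite /refl embB embZ cartE. Qed.

Let PhiL : seq 'rV[R]_L := [seq prj b | b <- Phi & supp b].
Let memPhi x : (x \in PhiL) = (emb x \in Phi).
Proof.
apply/mapP/idP => [[b]|h]; first by rewrite mem_filter => /andP[sb bP] ->; rewrite prjK.
by exists (emb x); rewrite ?embK // mem_filter emb_supp.
Qed.
Let rsL : root_system GL PhiL.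
Proof.
split.
- rewrite map_inj_in_uniq ?filter_uniq ?(rs_uniq rsP) // => b b'.
  by rewrite !mem_filter => /andP[sb _] /andP[sb' _] e; rewrite -(prjK sb) e prjK.
- by rewrite memPhi emb0 (rs_neq0 rsP).
- by move=> a b; rewrite !memPhi reflE; apply: (rs_refl rsP).
- by move=> a b; rewrite !memPhi cartE; apply: (rs_int rsP).
by move=> a; rewrite memPhi => aP t; rewrite memPhi embZ; apply: (rs_red rsP aP).
Qed.
Let xiL := prj xi.
Let dot_xi x : dot GL x xiL = emb x *d xi.
Proof.
rewrite dotE; apply/eqP; rewrite -subr_eq0 -(dotBr hG); apply/eqP.
have supZ := @support_orth R l G hG (fun j => j \in C) (fun i t iC tC => GZr iC tC).
apply: supZ; first exact/suppP.
by move=> j jC; rewrite mxE embE jC !mxE rkK // subrr.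
Qed.
Let regL : regular GL PhiL xiL.
Proof. by move=> a; rewrite memPhi dot_xi; apply: reg. Qed.
Let memPos x : (x \in posr GL PhiL xiL) = (emb x \in pos).
Proof. by rewrite !mem_posr memPhi dot_xi. Qed.
Let emb_delta a : emb (delta_mx 0 a) = al (iota_ a).
Proof.
apply/rowP => j; rewrite embE !mxE !eqxx /=; case: ifP => jC.
  by rewrite -(inj_eq (can_inj iotaK)) rkK.
by case: eqP => // e; rewrite e iotaC in jC.
Qed.
Let simdL a : delta_mx 0 a \in simr GL PhiL xiL.
Proof.
apply/simP; rewrite memPos emb_delta (sim_pos (simd _)); split=> // b; rewrite !memPos embB emb_delta => bp.
by case: (simP _ _ _ _ (simd (iota_ a))) => _; apply.
Qed.
Let simsL x : x \in simr GL PhiL xiL -> exists a, x = delta_mx 0 a.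
Proof.
move=> /simP[]; rewrite memPos => xp hx.
case: (boolP (emb x \in sim)) => [/sims[j ej]|ns].
  have jC : j \in C.
    apply/negPn/negP => jC; have := congr1 (fun y : V => y 0 j) ej.
    by rewrite embE (negbTE jC) mxE !eqxx => /esym/eqP; rewrite oner_eq0.
  by exists (rk j); apply: emb_inj; rewrite emb_delta rkK.
have [s /sims[j ->] sp] := pos_sub_sim hG rsP reg xp ns.
have jC : j \in C.
  apply/negPn/negP => jC; have := pos_coord rsP sims j sp.
  by rewrite mxE embE (negbTE jC) !mxE !eqxx add0r oppr_ge0 ler10.
exfalso; have := hx (delta_mx 0 (rk j)); rewrite !memPos embB emb_delta rkK // (sim_pos (simd _)) sp.
by move=> /(_ isT).
Qed.
Let sim1L : {in simr GL PhiL xiL, forall a, dot GL a xiL = 1}.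
Proof. by move=> x /simsL[a ->]; rewrite dot_xi emb_delta (sim1 (simd _)). Qed.

(** Roots that are not orthogonal agree on [P]. The simple roots of the component are connected, and
    no root is orthogonal to all of them. *)
Let irrL (P : 'rV[R]_L -> Prop) :
  (forall a b, a \in PhiL -> b \in PhiL -> P a -> ~ P b -> dot GL a b = 0) ->
  (forall a, a \in PhiL -> P a) \/ (forall a, a \in PhiL -> ~ P a).
Proof.
move=> hP; have dP a : delta_mx 0 a \in PhiL by exact: (pos_root (sim_pos (simdL a))).
have adj a b : a \in PhiL -> b \in PhiL -> dot GL a b != 0 -> P a -> P b.
  by move=> aP bP ne pa; apply: boolp.contrapT => nb; case/eqP: ne; apply: hP.
have gram i j : al i *d al j = G i j.
  by rewrite /dot -rowE trmx_delta -colE !mxE.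
have key (i j : 'I_l) : i \in C -> connect edge i j -> P (delta_mx 0 (rk i)) -> P (delta_mx 0 (rk j)).
  move=> iC /connectP[p hp ->]; elim: p i iC hp => [|t p IH] i iC //= /andP[it hp] pi.
  have tC : t \in C by apply: contraTT it => tC; rewrite /edge /= (GZ iC tC) eqxx.
  apply: (IH t tC hp); apply: adj pi => //.
  by rewrite dotE !emb_delta !rkK // gram.
have all_same a b : P (delta_mx 0 a) -> P (delta_mx 0 b).
  have := key (iota_ a) (iota_ b) (iotaC a) _; rewrite !iotaK; apply.
  have h1 := iotaC a; have h2 := iotaC b; rewrite !inE in h1 h2.
  by rewrite edge_sym in h1; apply: connect_trans h1 h2.
have some x : x \in PhiL -> exists a, dot GL x (delta_mx 0 a) != 0.
  move=> xP; have x0 := root_neq0 rsL xP; apply: boolp.contrapT => none.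
  case/eqP: x0; apply/eqP; rewrite -(dot_eq0 hGL); apply/eqP.
  rewrite {2}(row_sum_delta x) (dot_sumr hGL) big1 // => a _; rewrite (dotZr hGL).
  case: (eqVneq (dot GL x (delta_mx 0 a)) 0) => [->|ne]; first by rewrite mulr0.
  by case: none; exists a.
have [p0|n0] := boolp.pselect (P (delta_mx 0 (rk i0))); [left|right] => x xP.
  have [a ne] := some x xP; apply: (adj (delta_mx 0 a)) => //; first by rewrite (dotcomm hGL).
  exact: all_same p0.
move=> px; have [a ne] := some x xP; apply: n0; apply: (all_same a).
exact: (adj x).
Qed.

Let JL := [seq prj b | b <- J & supp b].
Let memJ x : (x \in JL) = (emb x \in J).
Proof.
apply/mapP/idP => [[b]|h]; first by rewrite mem_filter => /andP[sb bP] ->; rewrite prjK.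
by exists (emb x); rewrite ?embK // mem_filter emb_supp.
Qed.
Let uJL : uniq JL.
Proof.
rewrite map_inj_in_uniq ?filter_uniq // => b b'.
by rewrite !mem_filter => /andP[sb _] /andP[sb' _] e; rewrite -(prjK sb) e prjK.
Qed.
Let JposL : {subset JL <= posr GL PhiL xiL}.
Proof. by move=> x; rewrite memJ memPos; apply: Jpos. Qed.
Let JlowL b g s : b \in JL -> g \in posr GL PhiL xiL -> {subset s <= posr GL PhiL xiL} ->
  b - g = \sum_(x <- s) x -> g \in JL.
Proof.
rewrite !memJ memPos => bJ gp sp e; apply: (Jlow (s := [seq emb x | x <- s]) bJ gp).
  by move=> y /mapP[x /sp]; rewrite memPos => h ->.
by rewrite -embB e /emb mulmx_suml big_map.
Qed.

Let emT : (L + 1).-tuple S :=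
  [tuple (match split i with inl a => 'X_(lshift 1 (iota_ a)) | inr _ => 'X_(rshift l ord0) end) | i < L + 1].
Let up (p : {mpoly R[L + 1]}) : S := p \mPo emT.
Let up_aff x r : up (lf (Submission.aff (stdE R L) (stdz R L) (x, r))) = lf (aff (emb x, r)).
Proof.
rewrite /up comp_lf [in RHS]/lf !big_split_ord /=; congr (_ + _); last first.
  by apply: eq_bigr => j _; rewrite tnth_mktuple (unsplitK (inr j)) !std_affr (ord1 j).
rewrite [RHS](bigID (fun j => j \in C)) /= [X in _ = _ + X]big1 ?addr0; last first.
  by move=> j jC; rewrite std_affl embE (negbTE jC) scale0r.
rewrite [RHS](reindex_onto (fun a : 'I_L => iota_ a) rk) /=; last by move=> j jC; rewrite rkK.
apply: eq_big => [a|a _]; first by rewrite iotaC iotaK eqxx.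
by rewrite tnth_mktuple (unsplitK (inl a)) !std_affl embE iotaC iotaK.
Qed.
Let up_homog d p : p \is d.-homog -> up p \is d.-homog.
Proof.
move=> hp; rewrite -[d]muln1; apply: homog_comp => // i; rewrite tnth_mktuple.
by case: (split i) => j; rewrite -lf_delta lf_homog.
Qed.
Let up_comp m p (x : (l + 1).-tuple {mpoly R[m]}) :
  up p \mPo x = p \mPo [tuple tnth emT i \mPo x | i < L + 1].
Proof.
apply: (@mpoly_ext _ _ {mpoly R[m]} (fun p => up p \mPo x)).
- by move=> a b; rewrite /up !rmorphD.
- by move=> a b; rewrite !rmorphD.
- by move=> a b; rewrite /up !rmorphM.
- by move=> a b; rewrite !rmorphM.
- by move=> c; rewrite /up !comp_mpolyC.
by move=> i; rewrite [RHS]comp_X [RHS]tnth_mktuple /up comp_X.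
Qed.

(** Data of one component inside matrices of full size. [Psi] and [dl] keep the adjugate and the
    determinant of the block, so that nonsingularity survives the assembly: the assembled matrix
    times the assembled [Psi] is diagonal. [est] fixes the multiset of degrees independently of
    [t]. *)
Definition comp_data (est : 'I_l -> nat) t (Th : 'M[S]_l) (e : 'I_l -> nat) (Q : {set 'I_l})
    (c : 'I_l -> V * R) (Psi : 'M[S]_l) (dl : S) :=
  [/\ (forall i, i \in C -> logd A (row i Th)) /\ (forall i j, i \in C -> Th i j \is (e i).-homog),
   (forall i j, j \notin C -> Th i j = 0) /\ (forall j i, j \notin C -> Psi j i = 0),
   dl != 0 /\ (forall i j, i \in C -> j \in C -> (Th *m Psi) i j = if i == j then dl else 0),
   (\sum_(i in C) e i = \sum_(b <- pos | supp b) (k + (b \in J) + k))%N /\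
   (forall i, i \in C -> 0 < e i)%N &
   [/\ Q \subset C /\ #|Q| = t, forall i j, i \in Q -> j \in C -> j \notin Q -> (e j <= e i)%N,
     forall v, #|[set i in C | e i == v]| = #|[set i in C | est i == v]|,
     (forall w : 'I_l -> R, (forall i, i \notin Q -> w i = 0) ->
        \sum_(i in C) w i *: (c i).1 = 0 -> forall i, w i = 0) /\
     (forall i, i \in Q -> supp (c i).1) &
     (forall i, i \in Q -> exists s : bool, ((-1) ^+ s *: (c i).1, (-1) ^+ s * (c i).2) \in A) /\
     forall i, i \in Q -> vanish [seq c j | j in Q] (row i Th)]].

(** The roots supported on the component form an irreducible system in [L] coordinates, to which
    everything is transported. The remaining roots vanish on these coordinates and impose
    nothing. *)
Lemma component_ladder : exists est : 'I_l -> nat, forall t, (t <= #|C|)%N ->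
  exists Th e Q c Psi dl, comp_data est t Th e Q c Psi dl.
Proof.
have [h [hcox hN0]] := coxeter_number hGL rsL regL simdL irrL L_gt0.
have [hn [e0 [s0 [eh hn0 ec es ed]]]] := Spectrum.exponent_duality hGL rsL regL simdL simsL sim1L irrL L_gt0 hcox hN0.
have hcox' : {in PhiL, forall a, \sum_(b <- posr GL PhiL xiL) Submission.cart GL b a * Submission.cart GL a b = 2 * hn%:R}.
  by move=> a aP; rewrite hcox // eh.
have hN : (2 * size (posr GL PhiL xiL) = hn * L)%N.
  by apply/eqP; rewrite -(eqr_nat R) hN0 eh natrM.
have lad := irreducible_ladder hGL rsL regL simdL simsL sim1L irrL L_gt0 hcox' hn0 hN ec ed k' uJL JposL JlowL.
have [_ [est [_ [_ [_ cest _ _ _]]]]] := lad 0%N (leq0n _).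
exists (fun i => est (rk i)) => t tL; have [Th [e [Q [c [sb ce cQ top [ind gd van]]]]]] := lad t tL.
have [hl hh hd hs] := sb.
set affL := Submission.aff (stdE R L) (stdz R L) in hl.
pose Th' : 'M[S]_l := \matrix_(i, j) if (i \in C) && (j \in C) then up (Th (rk i) (rk j)) else 0.
pose Psi : 'M[S]_l := \matrix_(i, j) if (i \in C) && (j \in C) then up (\adj Th (rk i) (rk j)) else 0.
pose Q' := [set i in C | rk i \in Q].
have sumC (T : nmodType) (F : 'I_l -> T) : \sum_(i in C) F i = \sum_a F (iota_ a).
  rewrite (reindex_onto (fun a : 'I_L => iota_ a) rk) /=; last by move=> j jC; rewrite rkK.
  by apply: eq_bigl => a; rewrite iotaC iotaK eqxx.
have sumCall (T : nmodType) (F : 'I_l -> T) : (forall i, i \notin C -> F i = 0) ->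
    \sum_i F i = \sum_a F (iota_ a).
  by move=> h0; rewrite -sumC (bigID (fun i => i \in C)) /= [X in _ + X]big1 ?addr0.
have cardC (p : pred 'I_L) : #|[set i in C | p (rk i)]| = #|[set a | p a]|.
  rewrite -(card_imset _ (can_inj iotaK)); congr #|pred_of_set _|; apply/setP => i.
  rewrite in_set; apply/andP/imsetP => [[iC pi]|[a]].
    by exists (rk i); rewrite ?in_set ?rkK.
  by rewrite in_set => pa ->; rewrite iotaK iotaC.
have dapE i b : i \in C -> dap (row i Th') b = up (dap (row (rk i) Th) (prj b)).
  move=> iC; rewrite /dap sumCall => [|j jC]; last by rewrite !mxE iC (negbTE jC) scaler0.
  rewrite /up rmorph_sum /=; apply: eq_bigr => a _; rewrite comp_mpolyZ !mxE iC.
  by rewrite iotaC iotaK.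
have memA (b : V * R) : supp b.1 -> b \in A -> (prj b.1, b.2) \in
    Submission.arr GL PhiL xiL (fun b => (k + (b \in JL))%N) (fun=> k).
  move=> sb1 /mem_arr[[bp [i hi e2]]|[bp [i hi e2]]]; apply/mem_arr; [left|right]; split=> /=.
  - by rewrite memPos prjK.
  - by exists i => //; rewrite memJ prjK.
  - by rewrite memPos /emb mulNmx -/(emb _) prjK.
  by exists i.
have memA' (x : 'rV[R]_L) r : (x, r) \in Submission.arr GL PhiL xiL (fun b => (k + (b \in JL))%N) (fun=> k) -> (emb x, r) \in A.
  case/mem_arr => /= -[bp [i hi e2]]; apply/mem_arr; [left|right]; split=> /=.
  - by rewrite -memPos.
  - by exists i => //; rewrite -memJ.
  - by move: bp; rewrite memPos /emb mulNmx.
  by exists i.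
have arr_supp (b : V * R) : b \in A -> supp_in (fun j => j \in C) b.1 \/ supp_off (fun j => j \in C) b.1.
  move=> bA; apply: (root_support hG rsP reg simd sims); first by move=> i u iC uC; exact: (GZr iC uC).
  case/mem_arr: bA => -[bp _]; first exact: pos_root bp.
  by rewrite -[b.1]opprK; apply: (rootN hG rsP); exact: pos_root bp.
exists Th', (fun i => e (rk i)), Q', (fun i => (emb (c (rk i)).1, (c (rk i)).2)), Psi, (up (\det Th)); split.
- split=> [i iC b bA|i j iC]; last first.
    by rewrite mxE iC; case: ifP => _; [apply: up_homog; apply: hh | apply: rpred0].
  rewrite dapE //; case: (arr_supp b bA) => [/suppP sb1|ob].
    have [q eq] := hl (rk i) _ (memA b sb1 bA); rewrite /= in eq; rewrite eq.
    rewrite /up rmorphM /= -/(up _) up_aff prjK // -surjective_pairing; exact/mdvdMr/mdvd_refl.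
  have -> : prj b.1 = 0 by apply/rowP => a; rewrite !mxE ob.
  rewrite /dap /up rmorph_sum /= big1 => [|a _]; first exact: mdvd0.
  by rewrite mxE scale0r rmorph0.
- split=> i j jC; first by rewrite mxE (negbTE jC) andbF.
  by rewrite mxE (negbTE jC).
- split.
    have fc := fcop_arr hGL (@std_inj R L) rsL regL (fun b => (k + (b \in JL))%N) (fun=> k).
    have [|u eu] := saito_det fc (fun a => proj1 (logd_lsub _ _ _ _) (hl a)) hh _ hs.
      by rewrite big_map -[size _]sum1_size; apply: homog_prod => b; exact: lf_homog.
    have u0 : u != 0 by apply: contraNneq hd => u0; rewrite eu u0 scale0r.
    rewrite eu /up comp_mpolyZ -mul_mpolyC mulf_neq0 ?mpolyC_eq0 // rmorph_prod /= prodf_seq_neq0.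
    apply/allP => x /mapP[b bA ->] /=; rewrite [b]surjective_pairing -/(up _) up_aff lf_eq0.
    apply: (aff_eq0 (@std_inj R l)) => /=; apply: contraNneq (arr_pos_neq0 rsL bA) => eb.
    by rewrite -(embK b.1) eb; apply/eqP/rowP => a; rewrite !mxE.
  move=> i j iC jC; rewrite mxE sumCall => [|u uC]; last by rewrite [Th' _ _]mxE (negbTE uC) andbF mul0r.
  have := congr1 (fun M : 'M_L => up (M (rk i) (rk j))) (mul_mx_adj Th).
  rewrite [X in up X = _]mxE [X in _ = up X]mxE {1}/up rmorph_sum /= => e1.
  transitivity (up (\det Th *+ (rk i == rk j))).
    rewrite -e1; apply: eq_bigr => a _; rewrite !mxE iC jC iotaK iotaC.
    by rewrite /= /up -rmorphM.
  rewrite -{1}(inj_eq (can_inj iotaK)) !rkK //; case: eqP => _ //.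
  by rewrite mulr0n /up rmorph0.
- split.
    transitivity (\sum_a e a)%N.
      by rewrite [LHS](sumC _ (fun i => e (rk i))); apply: eq_bigr => a _; rewrite iotaK.
    transitivity (\sum_(x <- posr GL PhiL xiL) (k + (x \in JL) + k))%N; first by rewrite -size_arr -hs.
    have pp : perm_eq [seq emb x | x <- posr GL PhiL xiL] [seq b <- pos | supp b].
      apply: uniq_perm; first by rewrite (map_inj_uniq emb_inj) (pos_uniq xiL rsL).
        by rewrite filter_uniq // (pos_uniq xi rsP).
      move=> b; rewrite mem_filter; apply/mapP/andP => [[x xp ->]|[sb1 bp]].
        by rewrite emb_supp -memPos.
      by exists (prj b); rewrite ?memPos prjK.
    have e2 : (\sum_(b <- [seq b <- pos | supp b]) (k + (b \in J) + k) = \sum_(b <- pos | supp b) (k + (b \in J) + k))%N by rewrite big_filter.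
    rewrite -e2 -(perm_big _ pp) /= big_map; apply: eq_bigr => x _.
    by rewrite memJ.
  move=> i _; case: ce => /(_ (rk i)) le _; apply: leq_trans le.
  by rewrite muln_gt0.
split.
- split; first by apply/subsetP => i; rewrite in_set => /andP[].
  by rewrite /Q' (cardC (mem Q)) -cQ; congr #|pred_of_set _|; apply/setP => a; rewrite inE.
- move=> i j; rewrite !in_set => /andP[iC iQ] jC; rewrite jC /= => jQ; exact: top.
- move=> v; rewrite (cardC (fun a => e a == v)) (cardC (fun a => est a == v)).
  have lev r : #|[set a | (r <= e a)%N]| = #|[set a | (r <= est a)%N]|.
    case: ce cest => lo hi [lo' hi']; case: (leqP r (k * hn)) => rk'.
      by congr #|pred_of_set _|; apply/setP => a; rewrite !inE !(leq_trans rk').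
    rewrite -(subnKC (ltnW rk')); have r0 : (0 < r - k * hn)%N by rewrite subn_gt0.
    by rewrite hi // hi'.
  by apply/eqP; rewrite -(eqn_add2r #|[set a | (v.+1 <= e a)%N]|) -card_ge_split lev card_ge_split lev.
- split=> [w hw|i iQ]; last exact: emb_supp.
  rewrite sumC /= => e1 i; have [iC|iC] := boolP (i \in C); last by rewrite hw // in_set (negbTE iC).
  rewrite -(rkK iC); apply: (ind (fun a => w (iota_ a))).
    by move=> a aQ; apply: hw; rewrite in_set iotaK (negbTE aQ) andbF.
  apply: emb_inj; rewrite emb0 -e1 /emb mulmx_suml; apply: eq_bigr => a _.
  by rewrite iotaK scalemxAl.
split=> i iQ.
  have iQ2 : rk i \in Q by move: iQ; rewrite in_set => /andP[].
  have [s hsg] := gd _ iQ2; exists s; rewrite /= -embZ; exact: memA'.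
move=> m x hx j; rewrite [row _ _ _ _]mxE [Th' _ _]mxE; case: ifP => [/andP[iC jC]|_]; last by rewrite rmorph0.
have iQ2 : rk i \in Q by move: iQ; rewrite in_set => /andP[].
rewrite up_comp; have := van _ iQ2 m [tuple tnth emT i \mPo x | i < L + 1] _ (rk j); rewrite [row _ _ _ _]mxE; apply.
move=> d /mapP[a]; rewrite mem_enum => aQ ->; rewrite -up_comp [c a]surjective_pairing up_aff.
apply: hx; apply/mapP; exists (iota_ a); last by rewrite iotaK.
by rewrite mem_enum in_set iotaK aQ iotaC.
Qed.

End OneComponent.

Let rep i := fingraph.root edge i.
Let rep_in i : i \in compo (rep i).
Proof. by rewrite in_set edge_sym connect_root. Qed.
Let rep_eq i r : rep r = r -> i \in compo r -> rep i = r.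
Proof. by rewrite in_set -(root_connect edge_sym) => e /eqP h; rewrite -[RHS]e /rep h. Qed.
Let rep_idem i : rep (rep i) = rep i. Proof. exact: root_root. Qed.
Let rep_compo r i : rep r = r -> (rep i == r) = (i \in compo r).
Proof. by move=> e; apply/eqP/idP => [<-|]; [exact: rep_in | exact: rep_eq]. Qed.
Let sum_rep (P : pred 'I_l) (F : 'I_l -> nat) :
  (\sum_(i | P i) F i = \sum_(r | rep r == r) \sum_(i in compo r | P i) F i)%N.
Proof.
rewrite (partition_big rep (fun r => rep r == r)) /=; last by move=> i _; rewrite rep_idem.
apply: eq_bigr => r /eqP er; apply: eq_bigl => i; by rewrite rep_compo // andbC.
Qed.
Let card_rep (D : {set 'I_l}) : (#|D| = \sum_(r | rep r == r) #|[set i in compo r | i \in D]|)%N.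
Proof.
transitivity (\sum_(i in D) 1)%N; first by rewrite sum1_card.
rewrite (sum_rep (mem D) (fun=> 1%N)); apply: eq_bigr => r _.
by rewrite -sum1_card; apply: eq_bigl => i; rewrite in_set.
Qed.

(** A top set of the whole meets each component in a top set, of size [tq r]. Each component
    supplies its basis for that size, and these are put together. *)
Theorem ladder_basis : exists est : 'I_l -> nat, (forall i, 0 < est i)%N /\ forall Qs : {set 'I_l}, topset Qs est ->
  exists (Th : 'M[S]_l) (e : 'I_l -> nat) (Q : {set 'I_l}) (c : 'I_l -> V * R),
  [/\ sbasis (stdE R l) (stdz R l) A Th e, #|Q| = #|Qs|,
    forall v, #|[set i in ~: Q | e i == v]| = #|[set i in ~: Qs | est i == v]|,
    indep Q c &
    (forall i, i \in Q -> exists s : bool, ((-1) ^+ s *: (c i).1, (-1) ^+ s * (c i).2) \in A) /\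
    forall i, i \in Q -> vanish [seq c j | j in Q] (row i Th)].
Proof.
have /fin_all_exists[es hes] := component_ladder.
exists (fun i => es (rep i) i); split=> [i|Qs top].
  have [Th [e [Q [c [Psi [dl]]]]]] := hes (rep i) 0%N (leq0n _).
  case=> _ _ _ [_ ep] [_ _ cnt _ _]; rewrite lt0n; apply/negP => /eqP e0.
  have : (0 < #|[set j in compo (rep i) | es (rep i) j == 0%N]|)%N.
    by apply/card_gt0P; exists i; rewrite in_set rep_in e0 eqxx.
  rewrite -cnt => /card_gt0P[j]; rewrite in_set => /andP[jC /eqP ej].
  by have := ep j jC; rewrite ej.
pose tq r := #|[set i in compo r | i \in Qs]|.
have ht r : (tq r <= #|compo r|)%N by apply: subset_leq_card; apply/subsetP => i; rewrite in_set => /andP[].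
have /fin_all_exists[Tf] := fun r => hes r (tq r) (ht r).
move=> /fin_all_exists[ef] /fin_all_exists[Qf] /fin_all_exists[cf] /fin_all_exists[Pf] /fin_all_exists[df hD].
pose Th : 'M[S]_l := \matrix_(i, j) Tf (rep i) i j.
pose Psi : 'M[S]_l := \matrix_(j, i) Pf (rep i) j i.
pose Q := [set i | i \in Qf (rep i)].
pose e i := ef (rep i) i; pose c i := cf (rep i) i.
have rowTh i : row i Th = row i (Tf (rep i)) by apply/rowP => j; rewrite !mxE.
have QfC r : Qf r \subset compo r by case: (hD r) => _ _ _ _ [[]].
have QE r : rep r = r -> forall i, i \in compo r -> (i \in Q) = (i \in Qf r).
  by move=> er i iC; rewrite in_set (rep_eq er iC).
have cQ : #|Q| = #|Qs|.
  rewrite (card_rep Q) (card_rep Qs); apply: eq_bigr => r /eqP er.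
  case: (hD r) => _ _ _ _ [[_ cqr] _ _ _ _]; rewrite -[RHS]/(tq r) -cqr; congr #|pred_of_set _|; apply/setP => i.
  rewrite in_set; case: (boolP (i \in compo r)) => iC /=; first exact: QE.
  by apply/esym/negbTE; apply: contra iC; apply: (subsetP (QfC r)).
have suppD b : b \in pos -> exists2 r, rep r = r & forall r', rep r' = r' ->
    [forall j, (j \notin compo r') ==> (b 0 j == 0)] = (r' == r).
  move=> bp; have /rV0Pn[j bj] := pos_neq0 rsP bp; exists (rep j); first exact: rep_idem.
  move=> r' er'; apply/forallP/eqP => [hs|->].
    by apply/esym/rep_eq => //; apply: contraR bj => jC; exact: implyP (hs j) jC.
  have [|h|h] := root_support hG rsP reg simd sims (Z := fun i => i \in compo (rep j)) _ (pos_root bp).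
  - move=> u t uC tC; rewrite GC; apply/eqP; apply: contraNT tC => ne; rewrite in_set; move: uC; rewrite in_set => hu.
    exact: connect_trans hu (connect1 ne).
  - by move=> t; apply/implyP => tC; rewrite h.
  by move: bj; rewrite h ?eqxx // rep_in.
exists Th, e, Q, c; split=> //.
- split.
  + by move=> i; rewrite rowTh; case: (hD (rep i)) => -[hl _] _ _ _ _; apply: hl; exact: rep_in.
  + by move=> i j; rewrite mxE; case: (hD (rep i)) => -[_ hh] _ _ _ _; apply: hh; exact: rep_in.
  + have TP : Th *m Psi = diag_mx (\row_i df (rep i)).
      apply/matrixP => i t; rewrite mxE [RHS]mxE [X in X *+ _]mxE.
      case: (eqVneq (rep i) (rep t)) => [eit|nit].
        case: (hD (rep i)) => _ _ [_ hTP] _ _.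
        have := hTP i t (rep_in i); rewrite {1}eit => /(_ (rep_in t)); rewrite mxE => e1.
        transitivity (\sum_j Tf (rep i) i j * Pf (rep i) j t).
          by apply: eq_bigr => j _; rewrite !mxE eit.
        by rewrite e1; case: (i == t).
      have -> : (i == t) = false by apply/negbTE; apply: contraNneq nit => ->.
      rewrite mulr0n big1 // => j _; rewrite !mxE.
      case: (boolP (j \in compo (rep i))) => jC.
        have jC' : j \notin compo (rep t).
          apply: contra nit => jC'; rewrite -(rep_eq (rep_idem i) jC) -(rep_eq (rep_idem t) jC').
          by [].
        by case: (hD (rep t)) => _ [_ h0] _ _ _; rewrite h0 // mulr0.
      by case: (hD (rep i)) => _ [h0 _] _ _ _; rewrite h0 // mul0r.
    apply/eqP => d0; have := congr1 (fun M : 'M_l => \det M) TP.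
    rewrite det_mulmx d0 mul0r det_diag => /esym/eqP; rewrite prodf_seq_eq0 => /hasP[i _] /=.
    by rewrite mxE; case: (hD (rep i)) => _ _ [/negbTE -> _] _ _.
  transitivity (\sum_(r | rep r == r) \sum_(i in compo r) ef r i)%N.
    rewrite -[LHS]/(\sum_(i | xpredT i) e i)%N sum_rep; apply: eq_bigr => r /eqP er.
    by apply: eq_big => [i|i /andP[iC _]]; rewrite ?andbT // /e (rep_eq er).
  rewrite size_arr; under eq_bigr => r _ do case: (hD r) => _ _ _ [-> _] _.
  rewrite (exchange_big_dep xpredT) //= big_seq [RHS]big_seq; apply: eq_bigr => b bp.
  have [r er hr] := suppD b bp.
  rewrite (bigD1 r) /=; last by rewrite er hr ?eqxx.
  by rewrite big1 ?addn0 // => r' /andP[/andP[/eqP er' sr'] /negP[]]; rewrite -hr.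
- have inC (P : pred 'I_l) r i : (i \in [set i in compo r | P i]) = (i \in compo r) && P i by rewrite in_set.
  have inD (P : pred 'I_l) (D : {set 'I_l}) i : (i \in [set i in ~: D | P i]) = (i \notin D) && P i by rewrite in_set in_setC.
  have inE' (P : pred 'I_l) (D D' : {set 'I_l}) i : (i \in [set i in D :\: D' | P i]) = [&& i \notin D', i \in D & P i].
    by rewrite in_set in_setD andbA.
  move=> v; rewrite (card_rep [set i in ~: Q | e i == v]) (card_rep [set i in ~: Qs | es (rep i) i == v]); apply: eq_bigr => r /eqP er.
  case: (hD r) => _ _ _ _ [[_ cq] topr cnt _ _].
  have estE i : i \in compo r -> es (rep i) i = es r i by move=> iC; rewrite (rep_eq er iC).
  have := @topset_counts _ (compo r) (ef r) (es r) (Qf r) [set i in compo r | i \in Qs] (QfC r) _ cq topr _ cnt v.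
  have -> : [set i in compo r | i \in [set i in ~: Q | e i == v]] = [set i in compo r :\: Qf r | ef r i == v].
    apply/setP => i; rewrite inC inD inE'.
    case: (boolP (i \in compo r)) => iC; rewrite ?andbF //=.
    by rewrite (QE r er i iC) /e (rep_eq er iC).
  have -> : [set i in compo r | i \in [set i in ~: Qs | es (rep i) i == v]] =
      [set i in compo r :\: [set i in compo r | i \in Qs] | es r i == v].
    apply/setP => i; rewrite inC inD inE' inC.
    by case: (boolP (i \in compo r)) => iC; rewrite ?andbF //= (rep_eq er iC).
  apply; first by apply/subsetP => i; rewrite in_set => /andP[].
  move=> i j; rewrite inC => /andP[iC iQ] jC; rewrite inC jC /= => jQ.
  by rewrite -!estE //; apply: top.
- move=> w w0 hw i; pose r := rep i; have er : rep r = r by exact: rep_idem.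
  case: (hD r) => _ _ _ _ [_ _ _ [ind sp] _].
  pose w' j := if j \in compo r then w j else 0.
  have -> : w i = w' i by rewrite /w' rep_in.
  apply: ind => [j jQ|].
    by rewrite /w'; case: ifP => // jC; apply: w0; rewrite (QE r er).
  have E : \sum_(j in compo r) w' j *: (cf r j).1 = \sum_(j in compo r) w j *: (c j).1.
    by apply: eq_bigr => j jC; rewrite /w' jC /c (rep_eq er jC).
  rewrite E; apply/rowP => t; rewrite mxE summxE.
  have wz j : rep j = r \/ w j * (c j).1 0 t = 0 \/ t \notin compo r.
    case: (eqVneq (rep j) r) => [->|ne]; first by left.
    right; case: (boolP (t \in compo r)) => tC; last by right.
    left; case: (boolP (j \in Q)) => [jQ|jQ]; last by rewrite w0 ?mul0r.
    case: (hD (rep j)) => _ _ _ _ [_ _ _ [_ spj] _].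
    have jQ' : j \in Qf (rep j) by move: jQ; rewrite in_set.
    have /forallP/(_ t)/implyP hz := spj j jQ'; rewrite /c (eqP (hz _)) ?mulr0 //.
    by apply: contra ne => tC'; rewrite -(rep_eq er tC) -(rep_eq (rep_idem j) tC').
  case: (boolP (t \in compo r)) => tC.
    have hz := congr1 (fun y : V => y 0 t) hw; rewrite summxE mxE in hz; rewrite -[RHS]hz.
    rewrite [RHS](bigID (fun j => j \in compo r)) /= [X in _ = _ + X]big1 ?addr0 // => j jC.
    case: (wz j) => [ej|[h0|]]; [|by rewrite mxE|by rewrite tC].
    by case/negP: jC; rewrite -rep_compo // ej.
  rewrite big1 // => j jC; case: (boolP (j \in Q)) => [jQ|jQ]; last by rewrite w0 // scale0r mxE.
  have jQ' : j \in Qf r by rewrite -(QE r er).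
  have /forallP/(_ t)/implyP hz := sp j jQ'.
  by rewrite /c (rep_eq er jC) mxE (eqP (hz tC)) mulr0.
split=> i; rewrite in_set => iQ.
  by case: (hD (rep i)) => _ _ _ _ [_ _ _ _ [gd _]]; apply: gd.
rewrite rowTh; case: (hD (rep i)) => _ _ _ _ [_ _ _ _ [_ van]].
move=> m x hx; apply: (van i iQ) => d /mapP[j]; rewrite mem_enum => jQ ->.
have jC := subsetP (QfC _) j jQ; apply: hx; apply/mapP; exists j.
  by rewrite mem_enum in_set (rep_eq (rep_idem i) jC).
by rewrite /c (rep_eq (rep_idem i) jC).
Qed.

End Component.

(** * Restriction of a basis to a flat *)

Section Restrict.
Variable R : realType.

Definition npar n (fs : seq 'rV[R]_n) := [/\ uniq fs, {in fs, forall v, v != 0} &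
  {in fs &, forall v w, v != w -> forall t, w <> t *: v}].
Definition lfs n (fs : seq 'rV[R]_n) := [seq (v, lf v) | v <- fs].

Lemma npar_fcop n (fs : seq 'rV[R]_n) : npar fs -> fcop (lfs fs).
Proof.
move=> [u n0 np]; split.
- by rewrite map_inj_uniq // => x y [].
- by move=> c /mapP[v vs ->]; apply: n0.
move=> c d /mapP[v vs ->] /mapP[w ws ->] /= ne.
by apply: lf_cop_lf => [|t]; [apply: n0 | apply/eqP; apply: np => //; apply: contraNneq ne => ->].
Qed.

Lemma npar_reps n (s : seq 'rV[R]_n) : exists2 fs, npar fs & {subset fs <= s} /\
  forall v, v \in s -> v != 0 -> exists w t, [/\ w \in fs, t != 0 & v = t *: w].
Proof.
elim: s => [|v s [fs [u n0 np] [sub cov]]]; first by exists [::].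
have sub' : {subset fs <= v :: s} by move=> w /sub; rewrite in_cons => ->; rewrite orbT.
have [bad|good] := boolp.pselect (v == 0 \/ exists w t, [/\ w \in fs, t != 0 & v = t *: w]).
  exists fs => //; split=> // w; rewrite in_cons => /orP[/eqP ->|/cov //].
  by case: bad => [->|].
have v0 : v != 0 by apply/negP => h; apply: good; left.
have ng w : w \in fs -> forall t, v <> t *: w.
  move=> wf t e; apply: good; right; exists w, t; split=> //.
  by apply: contraNneq v0 => t0; rewrite e t0 scale0r.
exists (v :: fs); split.
- by rewrite /= u andbT; apply/negP => vf; apply: (ng v vf 1); rewrite scale1r.
- by move=> w; rewrite in_cons => /orP[/eqP -> //|/n0].
- move=> a b; rewrite !in_cons => /orP[/eqP ->|af] /orP[/eqP ->|bf] ne t.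
  + by rewrite eqxx in ne.
  + move=> e; have t0 : t != 0 by apply: contraTneq (n0 b bf) => t0; rewrite e t0 scale0r eqxx.
    by apply: (ng b bf t^-1); rewrite e scalerA mulVf // scale1r.
  + exact: ng.
  exact: np.
- by move=> w; rewrite !in_cons => /orP[->//|/sub ->]; rewrite orbT.
move=> w; rewrite in_cons => /orP[/eqP ->|/cov h] w0; first by exists v, 1; rewrite mem_head oner_neq0 scale1r.
by have [x [t [xf t0 ->]]] := h w0; exists x, t; rewrite in_cons xf orbT.
Qed.

(** Linear forms coprime to [g] divide the cofactor, so they can be cancelled one after another. *)
Lemma lf_prod_unit n (g : {mpoly R[n]}) (s : seq 'rV[R]_n) : {in s, forall v, v != 0} ->
  {in s, forall v, mcop (lf v) g} -> mdvd g (\prod_(v <- s) lf v) -> mdvd g 1.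
Proof.
elim: s => [|v s IH] n0 cop; first by rewrite big_nil.
rewrite big_cons => -[q eq]; have v0 : v != 0 by apply: n0; rewrite mem_head.
apply: IH => [w ws|w ws|]; [by apply: n0; rewrite in_cons ws orbT | by apply: cop; rewrite in_cons ws orbT|].
have [r er] : mdvd (lf v) q.
  by apply: (cop v (mem_head _ _)); rewrite -eq; exact/mdvdMr/mdvd_refl.
exists r; apply: (mulfI (x := lf v)); first by rewrite lf_eq0.
by rewrite eq er mulrCA.
Qed.

Section Flat.
Variables (n d q : nat) (fs : seq 'rV[R]_n) (Th : 'M[{mpoly R[n]}]_n) (e : 'I_n -> nat).
Local Notation S := {mpoly R[n]}.
Local Notation T := {mpoly R[d]}.
Local Notation Fs := (lfs fs).
Hypotheses (hnp : npar fs) (hlog : forall i, lsub Fs (row i Th))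
  (hhom : forall i j, Th i j \is (e i).-homog)
  (hspan : forall th, lsub Fs th -> exists c : 'rV[S]_n, th = c *m Th).
(** [N] holds equations of the flat, the rows of [J] parametrize it and [K] reads off its
    coordinates. *)
Variables (N : 'M[R]_(q, n)) (J : 'M[R]_(d, n)) (K : 'M[R]_(n, d)).
Hypotheses (JK : J *m K = 1%:M) (NJ : N *m J^T = 0)
  (hN : forall v : 'rV[R]_n, v *m J^T = 0 -> (v <= N)%MS)
  (Nfs : forall a, exists v t, [/\ v \in fs, t != 0 & row a N = t *: v]).
Definition rho (p : S) : T := p \mPo [tuple lf (col i J)^T | i < n].
Variable g : 'I_d -> 'I_n.
Hypotheses (ginj : injective g)
  (hvan : forall i, i \notin codom g -> forall j, rho (Th i j) = 0).

Let mC m k (M : 'M[R]_(m, k)) : 'M[T]_(m, k) := map_mx (@mpolyC d R) M.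

Lemma rho_lf v : rho (lf v) = lf (v *m J^T).
Proof.
rewrite /rho comp_lf; under eq_bigr do rewrite tnth_mktuple -linearZ /=.
rewrite -linear_sum; congr lf; apply/rowP => j; rewrite summxE mxE.
by apply: eq_bigr => i _; rewrite !mxE.
Qed.
Lemma rho_homog x p : p \is x.-homog -> rho p \is x.-homog.
Proof.
by move=> hp; rewrite -[x]muln1; apply: homog_comp => // i; rewrite tnth_mktuple lf_homog.
Qed.

(** The equations of the flat are forms of the arrangement up to scalars, and theta of such a form
    is a multiple of it. *)
Lemma tangent th u : lsub Fs th -> u *m J^T = 0 -> rho (dap th u) = 0.
Proof.
move=> ht /hN/submxP[c ->]; rewrite mulmx_sum_row dap_sum /rho rmorph_sum big1 //= => a _.
rewrite comp_mpolyZ; have [v [t [vf t0 ea]]] := Nfs a.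
have vJ : v *m J^T = 0.
  by apply: (scalerI t0); rewrite scalemxAl -ea -row_mul NJ scaler0 row0.
have [r er] := ht (v, lf v) (map_f _ vf); rewrite ea dapZ comp_mpolyZ -/(rho _) er /rho rmorphM /=.
by rewrite -/(rho _) rho_lf vJ linear0 mul0r !scaler0.
Qed.

Definition resx m (M : 'M[S]_(m, n)) : 'M[T]_(m, d) := map_mx rho M *m mC K.

Lemma dap_resx m (M : 'M[S]_(m, n)) i v : lsub Fs (row i M) ->
  dap (row i (resx M)) (v *m J^T) = rho (dap (row i M) v).
Proof.
move=> ht; have h0 := tangent ht (u := v - v *m J^T *m K^T).
have -> : rho (dap (row i M) v) = rho (dap (row i M) (v *m J^T *m K^T)).
  apply/eqP; rewrite -subr_eq0 /rho -comp_mpolyB -/(rho _).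
  have -> : dap (row i M) v - dap (row i M) (v *m J^T *m K^T) = dap (row i M) (v - v *m J^T *m K^T).
    by rewrite dapD dapN.
  by rewrite h0 // mulmxBl -(mulmxA (v *m J^T) K^T J^T) -trmx_mul JK trmx1 mulmx1 subrr.
rewrite dap_col /resx row_mul -mulmxA.
have -> : mC K *m (map_mx (@mpolyC d R) (v *m J^T))^T = (map_mx (@mpolyC d R) (v *m J^T *m K^T))^T.
  by rewrite [in RHS]map_mxM /= trmx_mul -map_trmx trmxK.
rewrite -[LHS]/((row i (map_mx rho M) *m _) 0 0) mxE /dap /rho rmorph_sum /=.
by apply: eq_bigr => j _; rewrite comp_mpolyZ !mxE -mul_mpolyC mulrC.
Qed.

Let ThX : 'M[T]_d := \matrix_a row (g a) (resx Th).

(** Rows outside [codom g] vanish on the flat, so the kept rows generate all restrictions. *)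
Lemma resx_span m (M : 'M[S]_(m, n)) : (forall i, lsub Fs (row i M)) ->
  exists C : 'M[T]_(m, d), resx M = C *m ThX.
Proof.
move=> hM; have /fin_all_exists[c hc] := fun i => hspan (hM i).
exists (\matrix_(i, a) rho (c i 0 (g a))).
have -> : M = (\matrix_i c i) *m Th.
  by apply/row_matrixP => i; rewrite row_mul rowK hc.
have -> : resx ((\matrix_i c i) *m Th) = map_mx rho (\matrix_i c i) *m resx Th.
  by rewrite /resx [map_mx rho _]map_mxM mulmxA.
have h0 t j : t \notin codom g -> resx Th t j = 0.
  by move=> tg; rewrite mxE big1 // => u _; rewrite mxE hvan // mul0r.
apply/matrixP => i j; rewrite [LHS]mxE [RHS]mxE (bigID (fun t => t \in g @: setT)) /= [X in _ + X]big1 ?addr0.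
  rewrite big_imset /=; last by move=> x y _ _; apply: ginj.
  by apply: eq_big => [a|a _]; rewrite ?in_setT // !mxE.
move=> t tg; rewrite h0 ?mulr0 //; apply: contra tg => /codomP[a ->].
by rewrite imset_f ?in_setT.
Qed.

Lemma det_dvd_resx (M : 'M[S]_(d, n)) : (forall i, lsub Fs (row i M)) ->
  mdvd (\det ThX) (\det (resx M)).
Proof.
by move=> /resx_span[C ->]; rewrite det_mulmx mulrC; exact/mdvdMr/mdvd_refl.
Qed.

(** Multiplication by this product makes a derivation logarithmic as soon as it respects the forms
    that restrict to multiples of [w]. *)
Definition offprod (w : 'rV[R]_d) : S := \prod_(v <- fs | ~~ (v *m J^T <= w)%MS) lf v.
Local Notation cS x := (map_mx (@mpolyC n R) x).

Lemma dap_const (x : 'rV[R]_n) v : dap (cS x) v = ((x *m v^T) 0 0)%:MP.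
Proof.
rewrite /dap mxE rmorph_sum /=; apply: eq_bigr => i _.
by rewrite !mxE -mul_mpolyC -mpolyCM mulrC.
Qed.

Lemma lsub_off w (th : 'rV[S]_n) : (forall v, v \in fs -> (v *m J^T <= w)%MS -> mdvd (lf v) (dap th v)) ->
  lsub Fs (offprod w *: th).
Proof.
move=> h c /mapP[v vf ->] /=; rewrite dap_scale; case: (boolP (v *m J^T <= w)%MS) => hv.
  by apply/mdvdMl/h.
apply: mdvdMr; rewrite /offprod (big_rem v vf) hv; exact/mdvdMr/mdvd_refl.
Qed.

Lemma lsub_const w (u : 'rV[R]_d) : u *m w^T = 0 -> lsub Fs (offprod w *: cS (u *m J)).
Proof.
move=> uw; apply: lsub_off => v vf /sub_rVP[c hc]; rewrite dap_const.
have -> : u *m J *m v^T = u *m (v *m J^T)^T by rewrite trmx_mul trmxK mulmxA.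
by rewrite hc linearZ /= -scalemxAr uw scaler0 mxE; apply: mdvd0.
Qed.

Lemma resx_const p (u : 'rV[R]_d) : resx (p *: cS (u *m J)) = rho p *: mC u.
Proof.
rewrite /resx; have -> : map_mx rho (p *: cS (u *m J)) = rho p *: mC (u *m J).
  by apply/matrixP => i j; rewrite !mxE /rho rmorphM /= comp_mpolyC.
by rewrite -scalemxAl /mC -map_mxM /= -mulmxA JK mulmx1.
Qed.

Section Euler.
Variables (w u0 : 'rV[R]_d).
Hypothesis wu0 : u0 *m w^T = 1%:M.
(** The linear field [eul] maps every form restricting to a multiple of [w] to itself, and induces
    [w] times the constant field [u0] on the flat. Several forms may have proportional restrictions,
    so the lift has to be right for all of them at once. *)
Let E' : 'M[R]_n := 1%:M - K *m (1%:M - w^T *m u0) *m J.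
Let eul : 'rV[S]_n := \row_i lf (col i E')^T.

Let dap_eul v : dap eul v = lf (v *m E'^T).
Proof.
rewrite /dap; under eq_bigr do rewrite mxE -linearZ /=.
rewrite -linear_sum; congr lf; apply/rowP => j; rewrite summxE mxE.
by apply: eq_bigr => i _; rewrite !mxE.
Qed.
Lemma lsub_eul : lsub Fs (offprod w *: eul).
Proof.
apply: lsub_off => v vf /sub_rVP[c hc]; rewrite dap_eul.
have Jv : J *m v^T = c *: w^T by rewrite -[J]trmxK -trmx_mul hc linearZ.
have -> : v *m E'^T = v; last exact: mdvd_refl.
apply: (can_inj (@trmxK _ _ _)); rewrite trmx_mul trmxK /E' mulmxBl mul1mx -!mulmxA Jv -scalemxAr.
by rewrite mulmxBl mul1mx -mulmxA wu0 mulmx1 subrr !(scaler0, mulmx0) subr0.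
Qed.
Lemma resx_eul : resx (offprod w *: eul) = (rho (offprod w) * lf w) *: mC u0.
Proof.
have JE : J *m E' = w^T *m u0 *m J.
  by rewrite /E' mulmxBr mulmx1 !mulmxA JK mul1mx mulmxBl mul1mx subKr.
rewrite /resx; have -> : map_mx rho (offprod w *: eul) = (rho (offprod w) * lf w) *: mC (u0 *m J).
  apply/matrixP => i j; rewrite (ord1 i) !mxE /rho rmorphM /= -!/(rho _) -mulrA; congr (_ * _).
  rewrite -/(rho _) rho_lf tr_col -row_mul -trmx_mul JE [RHS]mulrC mul_mpolyC -linearZ /=.
  congr lf; apply/rowP => t.
  by rewrite 2!mxE -mulmxA mxE big_ord1 [(u0 *m J) _ _]mxE [w^T _ _]mxE [RHS]mxE mulrC.
by rewrite -scalemxAl /mC -map_mxM /= -mulmxA JK mulmx1.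
Qed.
End Euler.

Lemma det_dvd_off : mdvd (\det ThX) (rho (offprod 0) ^+ d).
Proof.
pose M : 'M[S]_(d, n) := \matrix_j (offprod 0 *: cS (delta_mx 0 j *m J)).
have hM i : lsub Fs (row i M) by rewrite rowK; apply: lsub_const; rewrite trmx0 mulmx0.
have := det_dvd_resx hM; have -> : resx M = (rho (offprod 0))%:M; last by rewrite det_scalar.
apply/row_matrixP => i; have -> : row i (resx M) = resx (row i M) by rewrite /resx row_mul map_row.
rewrite rowK resx_const; apply/rowP => j; rewrite [LHS]mxE [mC _ _ _]mxE [delta_mx _ _ _ _]mxE.
rewrite [RHS]mxE [RHS]mxE eqxx /= eq_sym; case: (i == j); first by rewrite mpolyC1 mulr1.
by rewrite mpolyC0 mulr0.
Qed.

(** The test derivations are the constant fields along [w = 0] and one linear field transversal to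
    it, all multiplied by [offprod w]. Their determinant on the flat has a single factor [w] besides
    forms not proportional to [w]. *)
Lemma det_dvd_flat (w : 'rV[R]_d) : w != 0 -> mdvd (\det ThX) (rho (offprod w) ^+ d * lf w).
Proof.
move=> /rV_neq0[j0 wj0].
pose u0 : 'rV[R]_d := (w 0 j0)^-1 *: delta_mx 0 j0.
have dw j : delta_mx 0 j *m w^T = (w 0 j)%:M :> 'M_1.
  by apply/matrixP => a b; rewrite !ord1 -rowE !mxE mulr1n.
have wu0 : u0 *m w^T = 1%:M.
  by rewrite -scalemxAl dw scale_scalar_mx mulVf.
pose b j : 'rV[R]_d := delta_mx 0 j - (w 0 j / w 0 j0) *: delta_mx 0 j0.
have bw j : b j *m w^T = 0.
  by rewrite mulmxBl -scalemxAl !dw scale_scalar_mx divfK // subrr.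
pose eul : 'rV[S]_n := \row_i lf (col i (1%:M - K *m (1%:M - w^T *m u0) *m J))^T.
pose M : 'M[S]_(d, n) := \matrix_j (if j == j0 then offprod w *: eul else offprod w *: cS (b j *m J)).
pose B : 'M[R]_d := \matrix_j (if j == j0 then u0 else b j).
have hM i : lsub Fs (row i M).
  by rewrite rowK; case: eqP => _; [apply: lsub_eul | apply: lsub_const].
have uB : \det B != 0.
  pose I' : 'M[R]_d := \matrix_(i, j) ((i == j)%:R * (i != j0)%:R + w 0 i * (j == j0)%:R).
  have IB : I' *m B = 1%:M.
    apply/row_matrixP => i; rewrite row_mul mulmx_sum_row row1.
    have -> : \sum_j row i I' 0 j *: row j B = (i != j0)%:R *: row i B + w 0 i *: u0.
      have -> : w 0 i *: u0 = \sum_j (w 0 i * (j == j0)%:R) *: row j B.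
        rewrite (bigD1 j0) //= big1 ?addr0 => [|j /negbTE ->]; last by rewrite mulr0 scale0r.
        by rewrite eqxx mulr1 rowK eqxx.
      have -> : (i != j0)%:R *: row i B = \sum_j ((i == j)%:R * (i != j0)%:R) *: row j B.
        rewrite (bigD1 i) //= big1 ?addr0 => [|j ji]; first by rewrite eqxx mul1r.
        by rewrite eq_sym (negbTE ji) mul0r scale0r.
      by rewrite -big_split; apply: eq_bigr => j _; rewrite !mxE scalerDl.
    rewrite rowK; case: (eqVneq i j0) => [->|ij] /=; first by rewrite scale0r add0r scalerA mulfV // scale1r.
    by rewrite scale1r /b /u0 scalerA subrK.
  by apply/eqP => d0; have := congr1 (fun X : 'M_d => \det X) IB; rewrite /= det_mulmx d0 mulr0 det1 => /eqP; rewrite eq_sym oner_eq0.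
have := det_dvd_resx hM.
have -> : resx M = diag_mx (\row_j (rho (offprod w) * (if j == j0 then lf w else 1))) *m mC B.
  apply/row_matrixP => i; have -> : row i (resx M) = resx (row i M) by rewrite /resx row_mul map_row.
  rewrite row_mul row_diag_mx -scalemxAl -rowE mxE rowK -[row i (mC B)]map_row rowK; case: eqP => _; first exact: resx_eul.
  by rewrite resx_const mulr1.
rewrite det_mulmx det_diag det_map_mx => -[r er]; exists ((\det B)^-1 *: r).
have er' : \prod_i (\row_j (rho (offprod w) * (if j == j0 then lf w else 1))) 0 i * (\det B)%:MP = \det ThX * r by exact: er.
rewrite -scalerAr -er' [X in _ *: X]mulrC mul_mpolyC scalerA mulVf // scale1r.
under eq_bigr do rewrite mxE.
rewrite big_split /= prodr_const card_ord; congr (_ * _).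
by rewrite (bigD1 j0) //= eqxx big1 ?mulr1 // => j /negbTE ->.
Qed.

(** The determinant of the kept rows is divisible by all restricted forms. It also divides the test
    determinants: [det_dvd_off] shows that it has no other factors, and [det_dvd_flat] that each
    occurs only once. So the degrees of the kept rows need not be known to add up. *)
Lemma restrict_basis : exists fsX : seq 'rV[R]_d, [/\ npar fsX,
  forall w, w \in fsX -> exists2 v, v \in fs & w = v *m J^T,
  forall v, v \in fs -> v *m J^T != 0 -> exists w t, [/\ w \in fsX, t != 0 & v *m J^T = t *: w] &
  exists ThX' : 'M[T]_d, [/\ forall a, lsub (lfs fsX) (row a ThX'),
    forall a j, ThX' a j \is (e (g a)).-homog &
    exists2 u : R, u != 0 & \det ThX' = u *: \prod_(w <- fsX) lf w]].
Proof.
have [fsX np [sub cov]] := npar_reps [seq v *m J^T | v <- fs].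
have fsXP w : w \in fsX -> exists2 v, v \in fs & w = v *m J^T.
  by move=> /sub/mapP[v vf ->]; exists v.
have covX v : v \in fs -> v *m J^T != 0 -> exists w t, [/\ w \in fsX, t != 0 & v *m J^T = t *: w].
  by move=> vf; apply: cov; apply: map_f.
have hl a : lsub (lfs fsX) (row a ThX).
  move=> c /mapP[w /fsXP[v vf ->] ->] /=; rewrite rowK dap_resx //.
  have hx := hlog (g a); have [r er] := hx (v, lf v) (map_f _ vf); rewrite /= in er.
  by rewrite er /rho rmorphM /= -/(rho (lf v)) rho_lf; exact/mdvdMr/mdvd_refl.
have hh a j : ThX a j \is (e (g a)).-homog.
  rewrite mxE [row _ _ _ _]mxE /resx [(_ *m _) _ _]mxE; apply: rpred_sum => t _.
  rewrite [mC K t j]mxE mulrC mul_mpolyC; apply: rpredZ; rewrite mxE; exact/rho_homog/hhom.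
exists fsX; split=> //; exists ThX; split=> //.
have [[r er] [n0 npw]] := (det_dvd_prod (npar_fcop np) hl, (let: And3 _ a b := np in conj a b)).
rewrite big_map /= in er.
have rP w : rho (offprod w) = \prod_(v <- fs | ~~ (v *m J^T <= w)%MS) lf (v *m J^T).
  by rewrite /rho /offprod rmorph_prod /=; apply: eq_bigr => v _; rewrite -/(rho _) rho_lf.
have r1 : mdvd r 1.
  pose s := flatten (nseq d [seq v *m J^T | v <- fs & ~~ (v *m J^T <= (0 : 'rV[R]_d))%MS]).
  have sP u : u \in s -> exists v, [/\ v \in fs, u = v *m J^T & u != 0].
    move=> /flattenP[x /nseqP[-> _] /mapP[v]]; rewrite mem_filter => /andP[nz vf] ->.
    by exists v; split=> //; apply: contraNneq nz => ->; rewrite sub0mx.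
  apply: (@lf_prod_unit d r s).
  - by move=> u /sP[v [_ _ nz]].
  - move=> u /sP[v [vf eu nz]]; have [w [t [wf t0 ew]]] := covX v vf (etrans (congr1 (fun x => x != 0) (esym eu)) nz).
    have w0 := n0 w wf; have cw : mcop (lf w) r.
      apply: lf_cop => // dv.
      have [x ex] := det_dvd_flat w0; rewrite er in ex.
      have : mdvd (lf w) (rho (offprod w) ^+ d).
        have [y ey] := dv; rewrite (big_rem w wf) /= ey in ex.
        exists ((\prod_(v0 <- rem w fsX) lf v0) * y * x); apply: (mulIf (x := lf w)); first by rewrite lf_eq0.
        by rewrite ex; ring.
      rewrite -[_ ^+ d]mulr1 => h1.
      have cP : mcop (lf w) (rho (offprod w) ^+ d).
        apply: mcop_expr; rewrite rP -big_filter; apply: mcop_prodr => v'; rewrite mem_filter => /andP[nv _].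
        apply: lf_cop_lf => // c; apply/eqP => e1; case/negP: nv; apply/sub_rVP.
        by exists c.
      by case: (lf_ndvd1 w0); apply: cP; exact: h1.
    rewrite eu ew linearZ /=; move=> p [y ey].
    have h1 : mdvd (lf w) p by apply: cw; rewrite ey -scalerAl; apply/mdvdZ/mdvdMr/mdvd_refl.
    exact: mdvd_Zl.
  have [x ex] := det_dvd_off.
  have es : \prod_(v <- s) lf v = rho (offprod 0) ^+ d.
    rewrite /s big_flatten big_nseq rP iter_mulr_1 big_map big_filter; congr (_ ^+ _).
  by exists (\prod_(w <- fsX) lf w * x); rewrite es ex er; ring.
have D0 : \prod_(w <- fsX) lf w != 0 :> T.
  by rewrite prodf_seq_neq0; apply/allP => w /n0; rewrite lf_eq0.
have [r' er'] := r1.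
have rhom : exists x, r \is x.-homog.
  have hdet := det_homog hh; have hP : (\prod_(w <- fsX) lf w : T) \is (size fsX).-homog.
    by rewrite -[size _]sum1_size; apply: homog_prod => w; exact: lf_homog.
  case: (leqP (size fsX) (\sum_a e (g a))) => le.
    exists (\sum_a e (g a) - size fsX)%N; apply: (@homog_quot_eq _ _ (size fsX) _ (\prod_(w <- fsX) lf w) 0) => //.
    by rewrite subnKC // -er.
  have d0 : \det ThX = 0.
    by apply: (homog_dvd_small hP hdet le); rewrite er; exact/mdvdMr/mdvd_refl.
  exists 0%N; move: d0; rewrite er => /eqP; rewrite mulf_eq0 (negbTE D0) => /eqP ->; exact: rpred0.
have [x rx] := rhom.
have x0 : x = 0%N.
  case: x rx => // x rx; have : (1 : T) = 0.
    by apply: (homog_dvd_small rx (dhomog1 _ _) _ r1).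
  by move/eqP; rewrite oner_eq0.
rewrite x0 in rx; have [u eu] := homog0C rx.
exists u; last by rewrite er eu mulrC mul_mpolyC.
apply/eqP => u0; move: er'; rewrite eu u0 mpolyC0 mul0r => /eqP; by rewrite oner_eq0.
Qed.

End Flat.
End Restrict.

(** * From coordinates to abstract vector spaces *)

Section Coordinates.
Variables (R : realType) (U : vectType R).
Local Notation form := ('Hom(U, R^o)).

Definition fform n (phi : 'I_n -> form) (v : 'rV[R]_n) : form := \sum_i v 0 i *: phi i.
Lemma fformE n (phi : 'I_n -> form) v u : fform phi v u = \sum_i v 0 i * (phi i u : R) :> R.
Proof. by rewrite /fform sum_lfunE; apply: eq_bigr => i _; rewrite scale_lfunE. Qed.

Definition coords n (phi : 'I_n -> form) :=
  n = \dim {:U} /\ forall u, (forall i, (phi i u : R) = 0) -> u = 0.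
Definition represents n (phi : 'I_n -> form) (fs : seq 'rV[R]_n) (A : {fset {vspace U}}) :=
  forall H, H \in A <-> exists2 v, v \in fs & H = lker (fform phi v).

Lemma proportional (a f : form) : f != 0 -> lker a = lker f -> exists2 t : R, t != 0 & a = t *: f.
Proof.
move=> f0 e; have [u fu] : exists u, (f u : R) != 0.
  apply: contrapT => h; case/eqP: f0; apply/lfunP => u; rewrite lfunE /=.
  by apply/eqP; rewrite -[_ == _]negbK; apply/negP => hu; apply: h; exists u.
exists ((a u : R) / (f u : R)).
  rewrite mulf_neq0 ?invr_eq0 //; apply: contra fu => /eqP au.
  by have : u \in lker a; [rewrite memv_ker; apply/eqP | rewrite e memv_ker].
apply/lfunP => x; rewrite scale_lfunE.
have : x - ((f x : R) / (f u : R)) *: u \in lker a.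
  rewrite e memv_ker linearB linearZ /= subr_eq0; apply/eqP.
  by rewrite -[RHS]/((f x : R) / (f u : R) * (f u : R)) divfK.
rewrite memv_ker linearB linearZ /= subr_eq0 => /eqP ->.
by rewrite -[LHS]/((f x : R) / (f u : R) * (a u : R)) -[RHS]/((a u : R) / (f u : R) * (f x : R)); ring.
Qed.

Local Notation m := (\dim {:U}).
Local Notation S := {mpoly R[m]}.

Lemma mderiv_lf n i (w : 'rV[R]_n) : mderiv i (lf w) = (w 0 i)%:MP.
Proof.
rewrite /lf raddf_sum (bigD1 i) //= big1 ?addr0 => [|j ji].
  rewrite mderivZ mderivX mnm1E eqxx scale1r (_ : (U_(i) - U_(i))%MM = 0%MM) ?mpolyX0 -?mul_mpolyC ?mulr1 //.
  by apply/mnmP => t; rewrite mnmBE subnn mnm0E.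
by rewrite mderivZ mderivX mnm1E (negbTE ji) scale0r scaler0.
Qed.
Lemma der_apply_lf (th : 'rV[S]_m) w : der_apply (U := U) th (lf w) = dap th w.
Proof.
by rewrite /der_apply /dap; apply: eq_bigr => i _; rewrite mderiv_lf mulrC mul_mpolyC.
Qed.

Definition co (a : form) : 'rV[R]_m := \row_j (a (vbasis {:U})`_j : R).
Lemma form_polyE a : form_poly a = lf (co a).
Proof. by apply: eq_bigr => i _; rewrite mxE. Qed.
Lemma coZ t a : co (t *: a) = t *: co a.
Proof. by apply/rowP => j; rewrite !mxE scale_lfunE. Qed.

(** [Mx] relates the coordinates [phi] to the basis fixed in [symalg]: polynomials are substituted
    along it and the values are transformed by its inverse. *)
Lemma free_coords n (phi : 'I_n -> form) (A : {fset {vspace U}}) fs (Th : 'M[{mpoly R[n]}]_n) e u es :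
  coords phi -> represents phi fs A -> npar fs -> (forall i, lsub (lfs fs) (row i Th)) ->
  (forall i j, Th i j \is (e i).-homog) -> u != 0 -> \det Th = u *: \prod_(v <- fs) lf v ->
  perm_eq es [seq e i | i <- enum 'I_n] -> free_with_exponents A es.
Proof.
move=> [hn inj] hrep; subst n; move=> hnp hl hh u0 hdet pes.
pose Mx : 'M[R]_m := \matrix_(i, j) (phi i (vbasis {:U})`_j : R).
have coM v : co (fform phi v) = v *m Mx.
  by apply/rowP => j; rewrite !mxE fformE; apply: eq_bigr => i _; rewrite mxE.
have uM : Mx \in unitmx.
  rewrite -unitmx_tr -row_free_unit -kermx_eq0; apply/rowV0P => c /sub_kermxP hc.
  pose x := \sum_j c 0 j *: (vbasis {:U})`_j.
  have x0 : x = 0.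
    apply: inj => i; rewrite /x linear_sum /=.
    have /rowP/(_ i) := hc; rewrite !mxE => h0; rewrite -[RHS]h0; apply: eq_bigr => j _.
    by rewrite linearZ /= !mxE.
  have /freeP fr : free (vbasis {:U}) by case/andP: (vbasisP {:U}).
  by apply/rowP => j; rewrite mxE; apply: (fr (fun j => c 0 j)).
have Minj v : v *m Mx = 0 -> v = 0 by move=> e0; rewrite -(mulmxK uM v) e0 mul0mx.
pose fs' := [seq v *m Mx | v <- fs].
have np' : npar fs'.
  case: hnp => us n0 np; split.
  - by rewrite map_inj_uniq // => x y e0; apply/eqP; rewrite -subr_eq0; apply/eqP/Minj; rewrite mulmxBl e0 subrr.
  - by move=> _ /mapP[v vs ->]; apply/eqP => /Minj v0; move: (n0 v vs); rewrite v0 eqxx.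
  move=> _ _ /mapP[v vs ->] /mapP[w ws ->] ne t e0.
  apply: (np v w vs ws _ t); first by apply: contraNneq ne => ->.
  by apply/eqP; rewrite -subr_eq0; apply/eqP/Minj; rewrite mulmxBl -scalemxAl e0 subrr.
have fnz v : v \in fs -> fform phi v != 0.
  move=> vs; apply/eqP => f0; case: hnp => _ n0 _.
  have /Minj v0 : v *m Mx = 0 by rewrite -coM f0; apply/rowP => j; rewrite !mxE lfunE.
  by move: (n0 v vs); rewrite v0 eqxx.
have logF (th : 'rV[S]_m) : logder A th <-> lsub (lfs fs') th.
  split=> [h c /mapP[_ /mapP[v vs ->] ->] /=|h H a /hrep[v vs ->] ea].
    have [|gg eg] := h (lker (fform phi v)) (fform phi v) _ erefl; first by apply/hrep; exists v.
    by exists gg; move: eg; rewrite form_polyE der_apply_lf coM.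
  have [t t0 ->] := proportional (fnz v vs) ea.
  rewrite form_polyE der_apply_lf coZ coM dapZ linearZ /=.
  have [r er] := h (v *m Mx, lf (v *m Mx)) (map_f _ (map_f _ vs)); rewrite /= in er.
  by exists r; rewrite er scalerAl.
pose tau := [tuple lf (row i Mx) | i < m].
have tau_lf v : lf v \mPo tau = lf (v *m Mx).
  rewrite comp_lf; under eq_bigr do rewrite tnth_mktuple -linearZ /=.
  rewrite -linear_sum; congr lf; apply/rowP => j; rewrite summxE mxE.
  by apply: eq_bigr => i _; rewrite !mxE.
pose iM : 'M[S]_m := map_mx (@mpolyC m R) (invmx Mx)^T.
pose Th' : 'M[S]_m := map_mx (comp_mpoly tau) Th *m iM.
have dap' i v : dap (row i Th') (v *m Mx) = dap (row i Th) v \mPo tau.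
  rewrite dap_col row_mul -mulmxA.
  have -> : iM *m (map_mx (@mpolyC m R) (v *m Mx))^T = (map_mx (@mpolyC m R) v)^T.
    rewrite /iM map_trmx -[LHS](map_mxM (@mpolyC m R)) /= trmx_mul mulmxA -trmx_mul mulmxV // trmx1 mul1mx.
    by rewrite map_trmx.
  rewrite mxE /dap rmorph_sum /=; apply: eq_bigr => j _.
  by rewrite comp_mpolyZ !mxE mulrC mul_mpolyC.
have hl' i : lsub (lfs fs') (row i Th').
  move=> c /mapP[_ /mapP[v vs ->] ->] /=; rewrite dap'.
  have hx := hl i; have [r er] := hx (v, lf v) (map_f _ vs); rewrite /= in er.
  by rewrite er rmorphM /= tau_lf; exact/mdvdMr/mdvd_refl.
have hh' i j : Th' i j \is (e i).-homog.
  rewrite mxE; apply: rpred_sum => t _; rewrite [iM _ _]mxE mulrC mul_mpolyC; apply: rpredZ.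
  by rewrite mxE -[e i]muln1; apply: homog_comp => // s; rewrite tnth_mktuple lf_homog.
pose u' := u * \det (invmx Mx).
have u'0 : u' != 0 by rewrite mulf_neq0 // -unitfE -unitmxE unitmx_inv.
have hdet' : \det Th' = u' *: \prod_(c <- lfs fs') c.2.
  rewrite det_mulmx !det_map_mx det_tr hdet /= comp_mpolyZ rmorph_prod /= mulrC mul_mpolyC scalerA mulrC.
  by rewrite !big_map /=; congr (_ *: _); apply: eq_bigr => v _; rewrite tau_lf.
have P0 : \prod_(c <- lfs fs') c.2 != 0 :> S.
  by rewrite big_map prodf_seq_neq0; apply/allP => v vs; rewrite /= lf_eq0; case: np' => _ n0 _; apply: n0.
have d0 : \det Th' != 0 by rewrite hdet' -mul_mpolyC mulf_neq0 // mpolyC_eq0.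
(* The list [es] may order the degrees differently from the rows. *)
have /tuple_permP[p ep] : perm_eq es [tuple e i | i < m] by rewrite /= map_comp in pes *; exact: pes.
subst es; set es := [tuple _ | i < m].
pose f (i : 'I_(size es)) : 'I_m := p (cast_ord (size_tuple es) i).
pose fi (j : 'I_m) : 'I_(size es) := cast_ord (esym (size_tuple es)) ((p^-1)%g j).
have fK : cancel f fi by move=> i; rewrite /f /fi permK cast_ordK.
have fiK : cancel fi f by move=> i; rewrite /f /fi cast_ordKV permKV.
have fbij : bijective fi by exists f.
exists (fun i => row (f i) Th'); last first.
  move=> i j; rewrite mxE (_ : nth 0%N es i = e (f i)) //.
  by apply: etrans (esym (tnth_nth 0%N es (cast_ord (size_tuple es) i))) _; rewrite /es !tnth_mktuple.
have sumE (c : 'I_(size es) -> S) : \sum_i c i *: row (f i) Th' = (\row_j c (fi j)) *m Th'.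
  rewrite mulmx_sum_row (reindex fi) /=; last exact: onW_bij.
  by apply: eq_bigr => j _; rewrite mxE fiK.
split=> [i|th /logF ht|c].
- by apply/logF.
- have [c ec] := saito (npar_fcop np') hl' u'0 P0 hdet' ht.
  exists (fun i => c 0 (f i)); rewrite sumE ec; congr (_ *m _); apply/rowP => j.
  by rewrite mxE fiK.
rewrite sumE => c0 i; have : (\row_j c (fi j)) *m Th' *m \adj Th' = 0 by rewrite c0 mul0mx.
rewrite -mulmxA mul_mx_adj mul_mx_scalar => /rowP/(_ (f i)); rewrite !mxE fK => /eqP.
by rewrite mulf_eq0 (negbTE d0) => /eqP.
Qed.

End Coordinates.

Lemma memv_bigcap (R : fieldType) (U : vectType R) (s : seq {vspace U}) (u : U) :
  (u \in (\bigcap_(H <- s) H)%VS) = all (fun H : {vspace U} => u \in H) s.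
Proof. by elim: s => [|H s IH]; rewrite ?big_nil ?memvf // big_cons memv_cap IH. Qed.

(** * Accuracy from one adapted basis per dimension *)

Section Accurate.
Variables (R : realType) (U : vectType R) (n : nat).
Local Notation form := ('Hom(U, R^o)).
Variables (phi : 'I_n -> form) (A : {fset {vspace U}}) (fs : seq 'rV[R]_n) (es : seq nat).
Hypotheses (hco : coords phi) (hrep : represents phi fs A) (hnp : npar fs).
Hypotheses (n_gt0 : (0 < n)%N) (ses : size es = n) (sorted_es : sorted leq es).

(** What accuracy needs in dimension [d], in coordinates. The basis and the flat may depend on [d],
    whereas the sorted list [es] of degrees is common to all. *)
Definition flat_data d (Th : 'M[{mpoly R[n]}]_n) (e : 'I_n -> nat) (Q : {set 'I_n}) (c : 'I_n -> 'rV[R]_n) (u : R) :=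
  [/\ (forall i, lsub (lfs fs) (row i Th)) /\ (forall i j, Th i j \is (e i).-homog),
    u != 0 /\ \det Th = u *: \prod_(v <- fs) lf v,
    #|~: Q| = d /\ perm_eq (take d es) [seq e i | i <- enum (~: Q)],
    (forall w : 'I_n -> R, (forall i, i \notin Q -> w i = 0) -> \sum_i w i *: c i = 0 -> forall i, w i = 0) /\
    (forall i, i \in Q -> exists v t, [/\ v \in fs, t != 0 & c i = t *: v]) &
    forall i, i \in Q -> forall m (x : n.-tuple {mpoly R[m]}),
      (forall j, j \in Q -> lf (c j) \mPo x = 0) -> forall j, Th i j \mPo x = 0].

Let xU (u : U) : 'rV[R]_n := \row_i (phi i u : R).
Let xl : linear xU.
Proof. by move=> t u v; apply/rowP => i; rewrite !mxE linearP. Qed.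
Let xL : {linear U -> 'rV[R]_n} := HB.pack xU (GRing.isLinear.Build _ _ _ _ _ xl).
Let fformX v u : fform phi v u = (v *m (xU u)^T) 0 0 :> R.
Proof. by rewrite fformE mxE; apply: eq_bigr => i _; rewrite !mxE. Qed.
Let xinj u : xU u = 0 -> u = 0.
Proof. by move=> h; apply: hco.2 => i; have /rowP/(_ i) := h; rewrite !mxE. Qed.
Let xsurj x : exists u, xU u = x.
Proof.
pose xh := linfun xL; have xhE u : xh u = xU u by rewrite lfunE.
have k0 : lker xh = 0%VS.
  by apply/eqP; rewrite -subv0; apply/subvP => u; rewrite memv_ker xhE => /eqP/xinj ->; rewrite mem0v.
have := limg_ker_dim xh fullv; rewrite k0 capv0 dimv0 add0n => dm.
have : x \in limg xh.
  have -> : limg xh = fullv.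
    apply/eqP; rewrite -(dimv_leqif_eq (subvf _)).2 dm -hco.1 dimvf /=.
    by rewrite /dim /= mul1n.
  exact: memvf.
by case/memv_imgP => u _ ->; exists u; rewrite xhE.
Qed.

Section OneFlat.
Variables (d : nat) (Th : 'M[{mpoly R[n]}]_n) (e : 'I_n -> nat) (Q : {set 'I_n}) (c : 'I_n -> 'rV[R]_n) (u0 : R).
Hypothesis hD : flat_data d Th e Q c u0.
Let q := #|Q|.
Let N : 'M[R]_(q, n) := \matrix_a c (enum_val a).
Let r := \rank (kermx N^T).
Let J : 'M[R]_(r, n) := row_base (kermx N^T).
Let K : 'M[R]_(n, r) := pinvmx J.
Let X : {vspace U} := (\bigcap_(H <- [fset lker (fform phi (c i)) | i in enum Q]%fset) H)%VS.

Let JK : J *m K = 1%:M. Proof. by rewrite mulmxVp ?row_base_free. Qed.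
Let JN : J *m N^T = 0. Proof. by apply/sub_kermxP; rewrite eq_row_base. Qed.
Let NJ : N *m J^T = 0. Proof. by apply: (can_inj (@trmxK _ _ _)); rewrite trmx_mul trmxK JN trmx0. Qed.
Let rN : \rank N = q.
Proof.
apply/eqP; rewrite -/(row_free N) -kermx_eq0; apply/rowV0P => y /sub_kermxP yN.
case: hD => _ _ _ [ind _] _.
pose w i := \sum_a y 0 a * (enum_val a == i)%:R.
have w0 : forall i, w i = 0.
  apply: ind => [i iQ|].
    rewrite /w big1 // => a _; case: eqP => [e1|_]; last by rewrite mulr0.
    by move: iQ; rewrite -e1 enum_valP.
  rewrite -[RHS]yN mulmx_sum_row /w; under eq_bigr do rewrite scaler_suml.
  rewrite exchange_big; apply: eq_bigr => a _ /=.
  rewrite (bigD1 (enum_val a)) //= big1 ?addr0 => [|i /negbTE ia]; first by rewrite eqxx mulr1 rowK.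
  by rewrite eq_sym ia mulr0 scale0r.
apply/rowP => a; rewrite mxE -(w0 (enum_val a)) /w (bigD1 a) //= eqxx mulr1 big1 ?addr0 //.
by move=> b ba; rewrite (inj_eq enum_val_inj) (negbTE ba) mulr0.
Qed.
Let rd : r = d.
Proof.
case: hD => _ _ [<- _] _ _; rewrite /r mxrank_ker mxrank_tr rN.
by have := cardsC Q; rewrite card_ord => /(canRL (addKn _)) ->.
Qed.
Let hN (v : 'rV[R]_n) : v *m J^T = 0 -> (v <= N)%MS.
Proof.
move=> h; have sN : (N <= kermx J^T)%MS by apply/sub_kermxP.
have : (kermx J^T <= N)%MS.
  rewrite -(geq_leqif (mxrank_leqif_sup sN)) mxrank_ker mxrank_tr rN.
  have -> : \rank J = (n - q)%N.
    by rewrite /J (eqP (row_base_free _)) /r mxrank_ker mxrank_tr rN.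
  by rewrite subKn // -rN rank_leq_col.
by apply: submx_trans; apply/sub_kermxP.
Qed.
Let inX u : (u \in X) = (xU u <= J)%MS.
Proof.
rewrite /X memv_bigcap; apply/allP/idP => [h|/submxP[z ez] H /imfsetP[i /=]].
  rewrite /J eq_row_base; apply/sub_kermxP; apply/rowP => a; rewrite [RHS]mxE.
  have aQ := enum_valP a.
  have : u \in lker (fform phi (c (enum_val a))).
    by apply: h; apply/imfsetP; exists (enum_val a) => //=; rewrite mem_enum.
  rewrite memv_ker => /eqP; rewrite fformX => h0; rewrite -[RHS]h0 !mxE.
  by apply: eq_bigr => i _; rewrite !mxE mulrC.
rewrite mem_enum => iQ ->; rewrite memv_ker; apply/eqP.
rewrite -[LHS]/(fform phi (c i) u : R) fformX ez trmx_mul mulmxA.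
have -> : c i = row (enum_rank_in iQ i) N by rewrite rowK enum_rankK_in.
by rewrite -row_mul NJ row0 mul0mx mxE.
Qed.
Let surjX (z : 'rV[R]_r) : exists2 y : subvs_of X, True & xU (vsval y) = z *m J.
Proof.
have [u hu] := xsurj (z *m J); have uX : u \in X by rewrite inX hu submxMl.
by exists (vsproj X u) => //; rewrite vsprojK.
Qed.
Let iX : 'Hom(subvs_of X, U) := linfun (vsval : subvs_of X -> U).
Let psi (j : 'I_r) : 'Hom(subvs_of X, R^o) := \sum_i K i j *: (phi i \o iX)%VF.
Let psiE j y : psi j y = (xU (vsval y) *m K) 0 j :> R.
Proof.
rewrite /psi sum_lfunE mxE; apply: eq_bigr => i _.
by rewrite scale_lfunE comp_lfunE lfunE [xU _ _ _]mxE [RHS]mulrC.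
Qed.
Let xXK y : xU (vsval (y : subvs_of X)) *m K *m J = xU (vsval y).
Proof.
have : xU (vsval y) \in [pred x : 'rV_n | (x <= J)%MS] by rewrite inE -inX subvsP.
by rewrite inE => /submxP[z ->]; rewrite -(mulmxA z) JK mulmx1.
Qed.
Let psi_form v y : fform psi (v *m J^T) y = fform phi v (vsval y) :> R.
Proof.
rewrite fformE; under eq_bigr do rewrite psiE.
have ev : v *m (xU (vsval y))^T = (v *m J^T) *m (xU (vsval y) *m K)^T.
  by rewrite -[in LHS](xXK y) (trmx_mul (xU (vsval y) *m K) J) (mulmxA v).
rewrite [RHS]fformX ev [RHS]mxE.
by apply: eq_bigr => j _; rewrite [X in _ = _ * X]mxE.
Qed.
Let psi_coords : coords psi.
Proof.
have inj y : (forall j, (psi j y : R) = 0) -> y = 0.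
  move=> h; apply: val_inj; apply: xinj; rewrite -(xXK y).
  have -> : xU (vsval y) *m K = 0 by apply/rowP => j; rewrite -psiE h mxE.
  by rewrite mul0mx.
split=> //; pose f : subvs_of X -> 'rV[R]_r := fun y => \row_j (psi j y : R).
have fl : linear f by move=> t a b; apply/rowP => j; rewrite !mxE linearP.
pose fL : {linear subvs_of X -> 'rV[R]_r} := HB.pack f (GRing.isLinear.Build _ _ _ _ _ fl).
pose fh := linfun fL; have fhE y : fh y = f y by rewrite lfunE.
have k0 : lker fh = 0%VS.
  apply/eqP; rewrite -subv0; apply/subvP => y; rewrite memv_ker fhE => /eqP h.
  by rewrite (inj y) ?mem0v // => j; have /rowP/(_ j) := h; rewrite !mxE.
have := limg_ker_dim fh fullv; rewrite k0 capv0 dimv0 add0n => <-.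
have -> : limg fh = fullv.
  apply/eqP; rewrite eqEsubv subvf /=; apply/subvP => z _; apply/memv_imgP.
  have [y _ hy] := surjX z; exists y; rewrite ?memvf // fhE; apply/rowP => j.
  by rewrite mxE psiE hy -mulmxA JK mulmx1.
by rewrite dimvf /dim /= mul1n.
Qed.

Let kerZ (W : vectType R) t (f : 'Hom(W, R^o)) : t != 0 -> lker (t *: f) = lker f.
Proof.
move=> t0; apply/vspaceP => y; rewrite !memv_ker scale_lfunE.
by rewrite scaler_eq0 (negbTE t0).
Qed.
Let fformZ k (W : vectType R) (ph : 'I_k -> 'Hom(W, R^o)) t v : fform ph (t *: v) = t *: fform ph v.
Proof. by rewrite /fform scaler_sumr; apply: eq_bigr => i _; rewrite mxE scalerA. Qed.

Let g (a : 'I_r) : 'I_n := enum_val (cast_ord (etrans rd (esym (proj1 (let: And5 _ _ x _ _ := hD in x)))) a).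
Let ginj : injective g.
Proof. by move=> a b /enum_val_inj/cast_ord_inj. Qed.
Let gQ a : g a \notin Q. Proof. by have := enum_valP (cast_ord (etrans rd (esym (proj1 (let: And5 _ _ x _ _ := hD in x)))) a); rewrite in_setC. Qed.
Let gsurj i : i \notin Q -> i \in codom g.
Proof.
move=> iQ; have iC : i \in ~: Q by rewrite in_setC.
apply/codomP; exists (cast_ord (esym (etrans rd (esym (proj1 (let: And5 _ _ x _ _ := hD in x))))) (enum_rank_in iC i)).
by rewrite /g cast_ordKV enum_rankK_in.
Qed.

(** This is [restrict_basis] for the flat parametrized by [J]. The coordinates [psi] of [X] are
    chosen such that restricting a form means multiplying its row by [J^T]. *)
Lemma flat_free : exists X : {vspace U}, [/\ intersection A X, \dim X = d &
  free_with_exponents (restriction A X) (take d es)].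
Proof.
have dX : \dim X = d by have [h _] := psi_coords; rewrite -rd h dimvf.
case: (hD) => [[hl hh] [u00 hdet] [cQ pes] [ind cfs] van].
have cker i : i \in Q -> exists2 v, v \in fs & lker (fform phi (c i)) = lker (fform phi v).
  by move=> iQ; have [v [t [vf t0 ->]]] := cfs i iQ; exists v; rewrite // fformZ kerZ.
exists X; split=> //.
  exists [fset lker (fform phi (c i)) | i in enum Q]%fset => //.
  apply/fsubsetP => H /imfsetP[i /=]; rewrite mem_enum => iQ ->.
  by have [v vf ->] := cker i iQ; apply/hrep; exists v.
have P0 : \prod_(x <- lfs fs) x.2 != 0 :> {mpoly R[n]}.
  by rewrite big_map prodf_seq_neq0; apply/allP => v vs; rewrite /= lf_eq0; case: hnp => _ n0 _; apply: n0.
have hdet' : \det Th = u0 *: \prod_(x <- lfs fs) x.2 by rewrite hdet big_map.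
have hspan th := saito (th := th) (npar_fcop hnp) hl u00 P0 hdet'.
have Nfs a : exists v t, [/\ v \in fs, t != 0 & row a N = t *: v].
  by rewrite rowK; apply: cfs; exact: enum_valP.
have hvan i : i \notin codom g -> forall j, rho J (Th i j) = 0.
  move=> ig; have iQ : i \in Q by apply: contraR ig; apply: gsurj.
  apply: (van i iQ) => j jQ; rewrite -/(rho J _) rho_lf.
  have -> : c j = row (enum_rank_in jQ j) N by rewrite rowK enum_rankK_in.
  by rewrite -row_mul NJ row0 linear0.
have [fsX [np fsXP covX [ThX [hlX hhX [u u1 detX]]]]] := restrict_basis hl hh hspan JK NJ hN Nfs ginj hvan.
apply: (free_coords psi_coords _ np hlX hhX u1 detX).
  move=> H; split.
    case/imfsetP => H0 /= /andP[/hrep[v vf ->] nX] ->.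
    have vJ : v *m J^T != 0.
      apply: contra nX => /eqP vJ0; apply/subvP => y yX; rewrite memv_ker; apply/eqP.
      rewrite -[LHS]/(fform phi v y : R) -[y](vsprojK yX) -psi_form vJ0 fformE big1 // => j _.
      by rewrite mxE mul0r.
    have [w [t [wf t0 ew]]] := covX v vf vJ; exists w => //.
    have -> : lker (fform psi w) = lker (fform psi (v *m J^T)) by rewrite ew fformZ kerZ.
    apply/vspaceP => y; rewrite mem_restriction !memv_ker.
    by rewrite -[X in _ = (X == _)]/(fform psi (v *m J^T) y : R) psi_form.
  case=> w /[dup] wf /fsXP[v vf ew] ->; apply/imfsetP; exists (lker (fform phi v)).
    rewrite /= ; apply/andP; split; first by apply/hrep; exists v.
    case: np => _ n0 _; have := n0 w wf; apply: contra => /subvP sX; rewrite ew.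
    apply/eqP/rowP => j; rewrite [RHS]mxE; have [y _ hy] := surjX (delta_mx 0 j).
    have := sX (vsval y) (subvsP y); rewrite memv_ker => /eqP; rewrite fformX hy => h0.
    by rewrite -[RHS]h0 (trmx_mul (delta_mx 0 j) J) (mulmxA v) trmx_delta -colE [RHS]mxE.
  apply/vspaceP => y; rewrite mem_restriction !memv_ker ew.
  by rewrite -[X in (X == _) = _]/(fform psi (v *m J^T) y : R) psi_form.
apply: perm_trans pes _; rewrite (map_comp e g); apply: perm_map.
apply: uniq_perm; rewrite ?enum_uniq ?(map_inj_uniq ginj) ?enum_uniq // => i.
rewrite mem_enum in_setC; apply/idP/mapP => [/gsurj/codomP[a ->]|[a _ ->]]; last exact: gQ.
by exists a; rewrite ?mem_enum.
Qed.
End OneFlat.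

Lemma accurate_coords : (forall d, (0 < d <= n)%N -> exists Th e Q c u, flat_data d Th e Q c u) ->
  accurate A.
Proof.
move=> hall; exists es; have dimU := hco.1; split=> //; rewrite -?dimU //.
  have [|Th [e [Q [c [u [[hl hh] [u0 hdet] [cQ pes] _ _]]]]]] := hall n; first by rewrite n_gt0 leqnn.
  apply: (free_coords hco hrep hnp hl hh u0 hdet); rewrite take_oversize ?ses // in pes.
  apply: perm_trans pes _; apply: perm_map; apply: uniq_perm; rewrite ?enum_uniq // => i.
  rewrite !mem_enum; have /eqP/setP/(_ i) : ~: Q == setT by rewrite eqEcard subsetT cardsT card_ord cQ leqnn.
  by rewrite in_setT.
by move=> d hd; have [Th [e [Q [c [u hD]]]]] := hall d hd; apply: flat_free hD.
Qed.

End Accurate.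

(** * Adjoining z and the Euler derivation *)

Section Cone.
Variables (R : realType) (l : nat) (G : 'M[R]_l).
Hypothesis hG : inner_product G.
Local Notation V := 'rV[R]_l.
Local Notation S := {mpoly R[l + 1]}.
Variables (Phi : seq V) (xi : V).
Hypotheses (rsP : root_system G Phi) (reg : regular G Phi xi).
Local Notation aff := (aff (stdE R l) (stdz R l)).
Let einj := @std_inj R l.

Lemma std_affE b : aff b = row_mx b.1 (- b.2)%:M.
Proof.
rewrite /Submission.aff /stdE /stdz mul_mx_row mulmx1 mulmx0 scale_row_mx scaler0.
by rewrite opp_row_mx add_row_mx subr0 sub0r -scaleNr scalemx1.
Qed.

Lemma arr_root u w b : b \in arr G Phi xi u w -> b.1 \in Phi.
Proof.
case/mem_arr => -[bp _]; first exact: pos_root bp.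
by rewrite -[b.1]opprK; apply: (rootN hG rsP); exact: pos_root bp.
Qed.

(** Opposite affine roots cannot both occur: the multiples of [z] in [arr] have one sign, so both
    would be zero, and the half with negative roots starts at [i = 1]. *)
Lemma arr_prop u w b c t : b \in arr G Phi xi u w -> c \in arr G Phi xi u w ->
  aff b = t *: aff c -> b = c.
Proof.
move=> bA cA /(aff_prop einj)[e1 e2]; have bP := arr_root bA; have cP := arr_root cA.
have [t1|t1] : t = 1 \/ t = -1 by apply: (rs_red rsP cP); rewrite -e1.
  by rewrite [b]surjective_pairing e1 e2 t1 scale1r mul1r -surjective_pairing.
move: e1 e2; rewrite t1 scaleN1r mulN1r => e1 e2.
have neg i j : - i%:R = - (- j%:R) :> R -> j = 0%N.
  move=> h; have : (i + j)%:R == 0 :> R by rewrite natrD addrC addr_eq0 h opprK.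
  by rewrite pnatr_eq0 addn_eq0 => /andP[_ /eqP].
case/mem_arr: bA => -[bp [i hi ei]]; case/mem_arr: cA => -[cp [j hj ej]].
- by move: bp; rewrite e1 (pos_negF hG rsP reg cp).
- have j0 : j = 0%N by apply: (neg i); rewrite -ei e2 ej.
  by rewrite j0 in hj.
- have i0 : i = 0%N by apply: (neg j); rewrite -ej -ei e2 opprK.
  by rewrite i0 in hi.
by move: bp; rewrite e1 opprK => bp; rewrite (pos_negF hG rsP reg bp) in cp.
Qed.

Lemma arr_npar u w : npar (stdz R l :: [seq aff b | b <- arr G Phi xi u w]).
Proof.
set A := arr _ _ _ _ _.
have nz b t : b \in A -> aff b <> t *: stdz R l.
  move=> bA e; have [|b0 _] := @einj b.1 (t + b.2).
    by rewrite scalerDl -e /Submission.aff subrK.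
  by move: (root_neq0 rsP (arr_root bA)); rewrite b0 eqxx.
have z0 : stdz R l != 0.
  by apply/eqP => /rowP/(_ (rshift l ord0))/eqP; rewrite row_mxEr !mxE oner_eq0.
split.
- rewrite /= map_inj_in_uniq => [|b c bA cA e]; last by apply: (@arr_prop u w b c 1) => //; rewrite scale1r.
  apply/andP; split; last exact: arr_uniq.
  by apply/mapP => -[b bA e]; apply: (nz b 1 bA); rewrite scale1r.
- move=> v; rewrite in_cons => /orP[/eqP -> //|/mapP[b bA ->]].
  by apply/eqP => e; apply: (nz b 0 bA); rewrite e scale0r.
move=> v v'; rewrite !in_cons => /orP[/eqP ->|/mapP[b bA ->]] /orP[/eqP ->|/mapP[c cA ->]] ne t e.
- by rewrite eqxx in ne.
- exact: (nz c t cA e).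
- have t0 : t != 0 by apply: contraNneq z0 => t0; rewrite e t0 scale0r.
  by apply: (nz b t^-1 bA); rewrite [X in _ *: X]e scalerA mulVf // scale1r.
by move: ne; rewrite (arr_prop cA bA e) eqxx.
Qed.

Hypothesis simd : forall i, (delta_mx 0 i : V) \in simr G Phi xi.
Hypothesis sims : forall a, a \in simr G Phi xi -> exists i, a = delta_mx 0 i.
Hypothesis sim1 : {in simr G Phi xi, forall a, dot G a xi = 1}.
Variables (k' : nat) (J : seq V).
Hypotheses (uJ : uniq J) (Jpos : {subset J <= posr G Phi xi}).
Hypothesis Jlow : forall (b g : V) (s : seq V), b \in J -> g \in posr G Phi xi ->
  {subset s <= posr G Phi xi} -> b - g = \sum_(x <- s) x -> g \in J.
Local Notation A := (arr G Phi xi (fun b => (k'.+1 + (b \in J))%N) (fun=> k'.+1)).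
Variables (U : vectType R) (phi : 'I_(l + 1) -> 'Hom(U, R^o)) (Ar : {fset {vspace U}}).
Local Notation fs := (stdz R l :: [seq aff b | b <- A]).
Hypotheses (hco : coords phi) (hrep : represents phi fs Ar).

(** The Euler derivation, of degree 1, is the last row of [Th'] and never belongs to the vanishing
    rows. In dimension [d + 1] it is kept with the [d] smallest of the other degrees; [est_gt0]
    makes 1 the smallest degree of all. *)
Theorem cone_accurate : accurate Ar.
Proof.
have [est [est_gt0 hest]] := ladder_basis hG rsP reg simd sims sim1 k' uJ Jpos Jlow.
pose r : rel 'I_l := relpre est leq.
pose s := sort r (enum 'I_l).
have ps : perm_eq s (enum 'I_l) by rewrite /s perm_sort.
have us : uniq s by rewrite (perm_uniq ps) enum_uniq.
have ss : size s = l by rewrite (perm_size ps) size_enum_ord.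
have sorts : sorted r s by apply: sort_sorted => i j; exact: leq_total.
have rtr : transitive r by move=> b a c; exact: leq_trans.
have np := arr_npar (fun b => (k'.+1 + (b \in J))%N) (fun=> k'.+1).
apply: (@accurate_coords R U (l + 1) phi Ar fs (1%N :: map est s) hco hrep np).
- by rewrite addn1.
- by rewrite /= size_map ss addn1.
- rewrite /= (path_sortedE leq_trans) sorted_map sorts andbT.
  by apply/allP => _ /mapP[i _ ->]; exact: est_gt0.
move=> d /andP[d0 dl]; case: d d0 dl => // d _ dl.
have dl' : (d <= l)%N by rewrite addn1 ltnS in dl.
pose lo := take d s; pose hi := drop d s.
pose Qs := [set i in hi].
have loC : perm_eq (enum (~: Qs)) lo.
  apply: uniq_perm; rewrite ?enum_uniq ?take_uniq // => i.
  rewrite mem_enum in_setC in_set.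
  have : uniq (lo ++ hi) by rewrite cat_take_drop.
  rewrite cat_uniq => /and3P[_ /hasPn hd _].
  have : (i \in lo) || (i \in hi) by rewrite -mem_cat cat_take_drop (perm_mem ps) mem_enum.
  case: (boolP (i \in hi)) => [ih _|_]; last by rewrite orbF => ->.
  by have := hd i ih; rewrite /= => /negbTE ->.
have top : topset Qs est.
  move=> i j iQ jQ; rewrite in_set in iQ.
  have jl : j \in lo by rewrite -(perm_mem loC) mem_enum in_setC.
  have : pairwise r (lo ++ hi) by rewrite cat_take_drop -sorted_pairwise.
  by rewrite pairwise_cat => /and3P[/allrelP h _ _]; exact: h.
have [Th [e [Q [c [sb cQ cnt ind [mem van]]]]]] := hest Qs top.
case: sb => hl hh hd hs.
have cC : #|~: Q| = d.
  have h1 : #|~: Qs| = d by rewrite cardE (perm_size loC) size_takel ?ss.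
  by apply: (@addnI #|Q|); rewrite cardsC cQ -h1 cardsC.
have pe : perm_eq [seq est i | i <- lo] [seq e i | i <- enum (~: Q)].
  rewrite perm_sym in loC; apply: (perm_trans (perm_map est loC)).
  apply/allP => v _ /=; rewrite !count_map.
  have cE (D : {set 'I_l}) (f : 'I_l -> nat) : count (fun i => f i == v) (enum D) = #|[set i in D | f i == v]|.
    by rewrite -sum1_count big_enum_cond -sum1_card; apply: eq_bigl => i; rewrite in_set.
  by apply/eqP; exact: (etrans (cE _ est) (etrans (esym (cnt v)) (esym (cE _ e)))).
pose Th' : 'M[S]_(l + 1) := block_mx Th 0 (\row_j 'X_(lshift 1 j)) ('X_(rshift l ord0))%:M.
pose e' (i : 'I_(l + 1)) := match split i with inl i' => e i' | inr _ => 1%N end.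
pose c' (i : 'I_(l + 1)) : 'rV[R]_(l + 1) := match split i with inl i' => aff (c i') | inr _ => 0 end.
have spl (i : 'I_l) : split (lshift 1 i) = inl i := unsplitK (inl i).
have spr (i : 'I_1) : split (rshift l i) = inr i := unsplitK (inr i).
have e'l i : e' (lshift 1 i) = e i by rewrite /e' spl.
have e'r i : e' (rshift l i) = 1%N by rewrite /e' spr.
have c'l i : c' (lshift 1 i) = aff (c i) by rewrite /c' spl.
have c'r i : c' (rshift l i) = 0 by rewrite /c' spr.
have dapl i v : dap (row (lshift 1 i) Th') v = dap (row i Th) (lsubmx v).
  rewrite /Submission.dap big_split_ord /= [X in _ + X]big1 ?addr0 => [|j _].
    by apply: eq_bigr => j _; rewrite [row _ Th' _ _]mxE block_mxEul [row _ Th _ _]mxE [lsubmx v _ _]mxE.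
  by rewrite [row _ Th' _ _]mxE block_mxEur mxE scaler0.
have dapr v : dap (row (rshift l ord0) Th') v = lf v.
  rewrite /Submission.dap /lf; apply: eq_bigr => j _; congr (_ *: _); rewrite mxE.
  case: (split_ordP j) => j' ->; first by rewrite block_mxEdl mxE.
  by rewrite block_mxEdr (ord1 j') mxE eqxx.
have hl' i : lsub (lfs fs) (row i Th').
  move=> x /mapP[v vf ->] /=.
  case: (split_ordP i) => i' ->; last by rewrite (ord1 i') dapr; exact: mdvd_refl.
  rewrite dapl; move: vf; rewrite in_cons => /orP[/eqP ->|/mapP[b bA ->]].
    have -> : lsubmx (stdz R l) = 0 by rewrite /stdz row_mxKl.
    have -> : dap (row i' Th) 0 = 0 by rewrite /Submission.dap big1 // => j _; rewrite mxE scale0r.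
    exact: mdvd0.
  by rewrite [X in lsubmx X]std_affE row_mxKl; exact: hl.
have hh' i j : Th' i j \is (e' i).-homog.
  case: (split_ordP i) => i' ->; case: (split_ordP j) => j' ->.
  - by rewrite block_mxEul e'l.
  - by rewrite block_mxEur mxE rpred0.
  - by rewrite block_mxEdl mxE e'r dhomogX; apply/eqP; exact: mdeg1.
  by rewrite block_mxEdr (ord1 i') (ord1 j') mxE eqxx e'r dhomogX; apply/eqP; exact: mdeg1.
have hP : \prod_(x <- lfs fs) x.2 \is (size fs).-homog.
  by rewrite big_map -[size _]sum1_size; apply: homog_prod => v; exact: lf_homog.
have sumE : (\sum_i e' i = size fs)%N.
  rewrite big_split_ord big_ord1 /= e'r (eq_bigr e) => [|i _]; last exact: e'l.
  by rewrite hs size_map addn1.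
have [u eu] := Submission.saito_det (npar_fcop np) hl' hh' hP sumE.
have u0 : u != 0.
  apply/eqP => u0; have : \det Th' != 0.
    rewrite det_lblock det_scalar1 mulf_neq0 //.
    apply/eqP => /(congr1 (mcoeff U_(rshift l ord0))); rewrite mcoeffX eqxx mcoeff0 => /eqP.
    by rewrite oner_eq0.
  by rewrite eu u0 scale0r eqxx.
have enumC : perm_eq (enum (~: (lshift 1 @: Q))) (rshift l ord0 :: [seq lshift 1 i | i <- enum (~: Q)]).
  apply: uniq_perm; rewrite ?enum_uniq //.
    rewrite /= (map_inj_uniq (@lshift_inj _ _)) enum_uniq andbT.
    by apply/mapP => -[i _ /eqP]; rewrite eq_rlshift.
  move=> i; rewrite mem_enum in_setC in_cons; case: (split_ordP i) => i' ->.
    by rewrite (mem_imset _ _ (@lshift_inj _ _)) eq_lrshift (mem_map (@lshift_inj _ _)) mem_enum in_setC.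
  rewrite (ord1 i') eqxx /=; apply/imsetP => -[j _ /eqP]; by rewrite eq_rlshift.
exists Th', e', (lshift 1 @: Q), c', u; split.
- by split.
- by split=> //; rewrite eu big_map.
- split; first by rewrite cardE (perm_size enumC) /= size_map -cardE cC.
  rewrite perm_sym; apply: (perm_trans (perm_map e' enumC)).
  rewrite /= e'r perm_cons -map_take -map_comp (eq_map (g := e)) 1?perm_sym //.
- split=> [w hw h0|i /imsetP[i' i'Q ->]].
    have wr : w (rshift l ord0) = 0.
      by apply: hw; apply/imsetP => -[j _ /eqP]; rewrite eq_rlshift.
    have ha : (\sum_i w (lshift 1 i) *: (c i).1) *m stdE R l = (\sum_i w (lshift 1 i) * (c i).2) *: stdz R l.
      move: h0; rewrite big_split_ord big_ord1 /= c'r scaler0 addr0 => h0; apply/eqP.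
      rewrite -subr_eq0 -[X in _ == X]h0; apply/eqP; rewrite mulmx_suml scaler_suml -sumrB.
      by apply: eq_bigr => j _; rewrite c'l /Submission.aff scalerBr scalemxAl scalerA.
    have [hs0 _] := einj ha.
    have hw' : forall i, w (lshift 1 i) = 0.
      apply: (ind (fun i => w (lshift 1 i))) => // i iQ; apply: hw.
      by rewrite (mem_imset _ _ (@lshift_inj _ _)).
    by move=> i; case: (split_ordP i) => i' -> //; rewrite (ord1 i').
  have [b bA] := mem i' i'Q.
  exists (aff ((-1) ^+ b *: (c i').1, (-1) ^+ b * (c i').2)), ((-1) ^+ b); split.
  - by rewrite in_cons (map_f _ bA) orbT.
  - by rewrite signr_eq0.
  rewrite c'l /Submission.aff /= -scalemxAl -scalerA -scalerBr scalerA -signr_addb addbb.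
  by rewrite expr0 scale1r.
move=> _ /imsetP[i iQ ->] m x hx j; case: (split_ordP j) => j' ->; last first.
  by rewrite block_mxEur mxE rmorph0.
have hX : {in [seq c j | j in Q], forall b, lf (aff b) \mPo x = 0}.
  by move=> _ /imageP[t tQ ->]; have := hx (lshift 1 t) (imset_f _ tQ); rewrite c'l.
by have := van i iQ m x hX j'; rewrite mxE block_mxEul.
Qed.

End Cone.

(** * Coordinates in which the simple roots are unit vectors *)

Section SimpleCoordinates.
Variables (R : realType) (l : nat).

Lemma inner_unit (G : 'M[R]_l) : inner_product G -> G \in unitmx.
Proof.
move=> [_ pd]; rewrite -row_free_unit -kermx_eq0; apply/rowV0P => x /sub_kermxP h.
by apply/eqP; apply: contraPT (pd x) => x0 /(_ x0); rewrite /dot h mul0mx mxE ltxx.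
Qed.

Variable G : 'M[R]_l.
Hypothesis hG : inner_product G.
Local Notation V := 'rV[R]_l.
Variables (Phi : seq V) (xi : V).
Hypotheses (rsP : root_system G Phi) (reg : regular G Phi xi).
Hypothesis span : forall x, {in Phi, forall a, dot G a x = 0} -> x = 0.
Local Notation sim := (simr G Phi xi).
Local Notation pos := (posr G Phi xi).
Let simM m : 'M[R]_(m, l) := \matrix_i nth 0 sim i.

Let simM_free m : (m <= size sim)%N -> row_free (simM m).
Proof.
move=> hm; rewrite -kermx_eq0; apply/rowV0P => w /sub_kermxP hw.
have us : uniq sim by exact: sim_uniq rsP.
have mem (i : 'I_m) : nth 0 sim i \in sim by apply: mem_nth; apply: leq_trans (ltn_ord i) hm.
pose c a := \sum_(i < m) w 0 i * (nth 0 sim i == a)%:R.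
have c0 : \sum_(a <- sim) c a *: a = 0.
  rewrite -[RHS]hw mulmx_sum_row; under eq_bigr do rewrite scaler_suml.
  rewrite exchange_big /=; apply: eq_bigr => i _.
  rewrite rowK (bigD1_seq (nth 0 sim i)) //= eqxx mulr1 big1 ?addr0 // => a /negbTE na.
  by rewrite eq_sym na mulr0 scale0r.
apply/rowP => i; rewrite mxE -[RHS](sim_free hG rsP reg c0 (mem i)) /c (bigD1 i) //=.
rewrite eqxx mulr1 big1 ?addr0 // => j /negbTE ji.
by rewrite nth_uniq ?(leq_trans (ltn_ord _) hm) // -[(j == i :> nat)]/(j == i) ji mulr0.
Qed.

Let ssim : size sim = l.
Proof.
apply/eqP; rewrite eqn_leq; apply/andP; split.
  apply: leq_trans (rank_leq_col (simM (size sim))).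
  by have /eqP h := simM_free (leqnn _); rewrite h.
have rf : row_free (simM (size sim) *m G)^T.
  rewrite -kermx_eq0; apply/rowV0P => x /sub_kermxP hx; apply: span => a aP.
  have e0 : simM (size sim) *m G *m x^T = 0.
    by apply: trmx_inj; rewrite trmx_mul trmxK trmx0.
  have hs s : s \in sim -> dot G s x = 0.
    move=> ss; have hi : (index s sim < size sim)%N by rewrite index_mem.
    have -> : s = row (Ordinal hi) (simM (size sim)) by rewrite rowK nth_index.
    by rewrite /dot -!row_mul e0 row0 mxE.
  have hp b : b \in pos -> dot G b x = 0.
    case/(pos_ncone rsP) => n ->; rewrite dot_suml big_seq big1 // => s ss.
    by rewrite dotZl hs // mulr0.
  case: (boolP (a \in pos)) => [/hp //|np]; have := hp (- a).
  by rewrite (posN hG rsP reg aP) np dotNl => /(_ isT)/eqP; rewrite oppr_eq0 => /eqP.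
apply: leq_trans (leq_trans (mxrankM_maxl (simM (size sim)) G) (rank_leq_row _)).
by move/eqP: rf; rewrite mxrank_tr => h; rewrite h.
Qed.

Let M := simM l.
Let uM : M \in unitmx. Proof. by rewrite -row_free_unit simM_free // ssim. Qed.
Let G1 := M *m G *m M^T.
(** The vector with inner product 1 with every unit vector, so that values at it are heights. *)
Let xi1 : V := const_mx 1 *m invmx G1.
Let Phi1 := [seq a *m invmx M | a <- Phi].
Let dot1 x y : dot G1 x y = dot G (x *m M) (y *m M).
Proof. by rewrite /dot /G1 trmx_mul !mulmxA. Qed.
Let minj (x : V) : x *m M = 0 -> x = 0.
Proof. by move=> h; rewrite -(mulmxK uM x) h mul0mx. Qed.
Let hG1 : inner_product G1.
Proof.
split=> [|x x0]; first by rewrite /G1 !trmx_mul trmxK hG.1 mulmxA.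
by rewrite dot1; apply: hG.2; apply: contra x0 => /eqP/minj ->.
Qed.
Let mem1 x : (x \in Phi1) = (x *m M \in Phi).
Proof.
apply/mapP/idP => [[a aP ->]|h]; first by rewrite mulmxKV.
by exists (x *m M); rewrite ?mulmxK.
Qed.
Let cart1 x y : cart G1 x y = cart G (x *m M) (y *m M).
Proof. by rewrite /cart !dot1. Qed.
Let refl1 x y : refl G1 x y *m M = refl G (x *m M) (y *m M).
Proof. by rewrite /refl mulmxBl -scalemxAl cart1. Qed.
Let rs1 : root_system G1 Phi1.
Proof.
split.
- by rewrite map_inj_uniq ?(rs_uniq rsP) //; exact: can_inj (mulmxKV uM).
- by rewrite mem1 mul0mx; exact: rs_neq0 rsP.
- by move=> a b; rewrite !mem1 refl1; exact: (rs_refl rsP).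
- by move=> a b; rewrite !mem1 cart1; exact: (rs_int rsP).
by move=> a; rewrite mem1 => aP t; rewrite mem1 -scalemxAl; exact: (rs_red rsP).
Qed.
Let hx1 x : dot G1 x xi1 = \sum_i x 0 i.
Proof.
rewrite /dot /xi1 trmx_mul trmx_inv hG1.1 mulmxA mulmxK ?inner_unit //.
by rewrite mxE; apply: eq_bigr => i _; rewrite !mxE mulr1.
Qed.
Let ps x : x *m M \in pos -> 0 < dot G1 x xi1.
Proof.
move=> xp; have [n en] := pos_ncone rsP xp.
have ex : x = \row_i (n (nth 0 sim i))%:R.
  apply/eqP; rewrite -subr_eq0; apply/eqP/minj; rewrite mulmxBl en (big_nth 0) ssim big_mkord mulmx_sum_row.
  by apply/eqP; rewrite subr_eq0; apply/eqP; apply: eq_bigr => i _; rewrite mxE rowK.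
have ge i : true -> 0 <= x 0 i by rewrite ex mxE ler0n.
rewrite hx1 lt0r sumr_ge0 // andbT; apply/negP => /eqP h.
have x0 : x = 0 by apply/rowP => i; rewrite mxE; exact: (psumr_eq0P ge h).
by move: (pos_neq0 rsP xp); rewrite x0 mul0mx eqxx.
Qed.
Let psN x : x *m M \in Phi -> x *m M \notin pos -> dot G1 x xi1 < 0.
Proof.
move=> xP np; have /ps : (- x) *m M \in pos by rewrite mulNmx (posN hG rsP reg xP).
by rewrite dotNl oppr_gt0.
Qed.
Let hpos x : (x \in posr G1 Phi1 xi1) = (x *m M \in pos).
Proof.
rewrite [LHS]mem_posr mem1; apply/andP/idP => [[xP h]|xp]; last by rewrite (pos_root xp) ps.
by apply/negPn/negP => np; have := lt_trans h (psN xP np); rewrite ltxx.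
Qed.
Let reg1 : regular G1 Phi1 xi1.
Proof.
move=> x; rewrite mem1 => xP; case: (boolP (x *m M \in pos)) => [/ps|/(psN xP)].
  by move=> h; rewrite gt_eqF.
by move=> h; rewrite lt_eqF.
Qed.
Let hsim x : (x \in simr G1 Phi1 xi1) = (x *m M \in sim).
Proof.
apply/simP/simP => -[xp h].
  split=> [|b bp]; first by rewrite -hpos.
  by have := h (b *m invmx M); rewrite !hpos mulmxBl mulmxKV // => /(_ bp).
split=> [|b bp]; first by rewrite hpos.
by rewrite hpos mulmxBl; apply: h; rewrite -hpos.
Qed.

Lemma simple_coordinates : exists (M G1 : 'M[R]_l) (Phi1 : seq V) (xi1 : V),
  [/\ M \in unitmx, [/\ inner_product G1, root_system G1 Phi1 & regular G1 Phi1 xi1],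
    forall x, (x \in posr G1 Phi1 xi1) = (x *m M \in pos),
    (forall i, (delta_mx 0 i : V) \in simr G1 Phi1 xi1) /\
      (forall a, a \in simr G1 Phi1 xi1 -> exists i, a = delta_mx 0 i) &
    {in simr G1 Phi1 xi1, forall a, dot G1 a xi1 = 1}].
Proof.
have dM i : (delta_mx 0 i : V) *m M = nth 0 sim i by rewrite -rowE rowK.
have sims a : a \in simr G1 Phi1 xi1 -> exists i, a = delta_mx 0 i.
  rewrite hsim => aM; have hi : (index (a *m M) sim < l)%N by apply: leq_trans (eq_leq ssim); rewrite index_mem.
  exists (Ordinal hi); apply/eqP; rewrite -subr_eq0; apply/eqP/minj.
  by rewrite mulmxBl dM /= nth_index // subrr.
exists M, G1, Phi1, xi1; split=> //.
  by split=> // i; rewrite hsim dM mem_nth // ssim.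
move=> a /sims[i ->]; rewrite hx1 (bigD1 i) //= mxE !eqxx big1 ?addr0 // => j /negbTE ji.
by rewrite mxE ji andbF.
Qed.

End SimpleCoordinates.

(** * The invariant inner product of a system given by coroots *)

Section FrozenRoots.
Variables (R : realType) (l : nat).
Local Notation V := 'rV[R]_l.
Local Notation form := ('Hom(V, R^o)).
Implicit Types (a b : form) (u w c : V).

Definition rowf a : V := \row_j (a (delta_mx 0 j) : R).

Lemma rowfE a u : (a u : R) = (rowf a *m u^T) 0 0.
Proof.
rewrite {1}[u]row_sum_delta linear_sum mxE; apply: eq_bigr => j _.
by rewrite linearZ !mxE; exact: mulrC.
Qed.
Lemma rowf_inj : injective rowf.
Proof. by move=> a b h; apply/lfunP => u; rewrite -[LHS]/(a u : R) -[RHS]/(b u : R) !rowfE h. Qed.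
Lemma rowfB a b : rowf (a - b) = rowf a - rowf b.
Proof. by apply/rowP => j; rewrite !mxE add_lfunE opp_lfunE. Qed.
Lemma rowfZ t a : rowf (t *: a) = t *: rowf a.
Proof. by apply/rowP => j; rewrite !mxE scale_lfunE. Qed.
Lemma rowf_sum (T : Type) (s : seq T) (f : T -> form) : rowf (\sum_(x <- s) f x) = \sum_(x <- s) rowf (f x).
Proof. by apply/rowP => j; rewrite mxE summxE sum_lfunE; apply: eq_bigr => x _; rewrite mxE. Qed.

Variables (Phi P : {fset form}) (v0 : V).
Hypothesis hPhi : reduced_root_system Phi.
Hypothesis reg0 : {in Phi, forall a, (a v0 : R) != 0}.
Hypothesis eP : P = [fset a in Phi | 0 < (a v0 : R)]%fset.

Lemma roots_separate u : {in Phi, forall a, (a u : R) = 0} -> u = 0.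
Proof.
move=> h; apply/rowP => j; rewrite mxE.
have fl : linear (fun v : V => v 0 j : R^o) by move=> x y z; rewrite !mxE.
pose f : {linear V -> R^o} := HB.pack (fun v : V => v 0 j : R^o) (GRing.isLinear.Build _ _ _ _ _ fl).
have -> : u 0 j = (linfun f u : R) by rewrite lfunE.
have fs : linfun f \in <<in_tuple (enum_fset Phi)>>%VS by case: hPhi => -> _ _ _; exact: memvf.
rewrite (coord_span fs) sum_lfunE big1 // => i _.
by rewrite scale_lfunE; have -> := h _ (mem_nth 0 (ltn_ord i)); exact: mulr0.
Qed.

(** The canonical invariant form on the space where the roots are linear forms, [\sum a(u) a(w)]
    over all roots. The roots themselves live in the dual and use its inverse. *)
Definition normal_form : 'M[R]_l := \sum_(a <- Phi) (rowf a)^T *m rowf a.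
Local Notation N := normal_form.

Lemma dot_normal u w : dot N u w = \sum_(a <- Phi) (a u : R) * (a w : R).
Proof.
rewrite /dot /normal_form mulmx_sumr mulmx_suml summxE; apply: eq_bigr => a _.
have -> : u *m ((rowf a)^T *m rowf a) *m w^T = (rowf a *m u^T)^T *m (rowf a *m w^T).
  by rewrite trmx_mul trmxK !mulmxA.
by rewrite mxE big_ord1 mxE !rowfE.
Qed.

Lemma normal_inner : inner_product N.
Proof.
split=> [|u u0].
  by rewrite /normal_form [LHS]linear_sum; apply: eq_bigr => a _; rewrite /= trmx_mul trmxK.
rewrite dot_normal lt0r sumr_ge0 ?andbT => [|a _]; last by rewrite -expr2 sqr_ge0.
rewrite psumr_eq0 => [|a _]; last by rewrite -expr2 sqr_ge0.
apply: contra u0 => /allP h; apply/eqP/roots_separate => a aP.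
by have := h a aP; rewrite /= mulf_eq0 orbb => /eqP.
Qed.

(** The reflection permutes the roots, so it preserves [N]. Applied to [c] and an arbitrary [w],
    this makes [dot N c w] proportional to [a w], and [a c = 2] fixes the factor. *)
Lemma coroot_form a c : a \in Phi -> coroot Phi a c ->
  forall b, (b c : R) = cart (invmx N) (rowf b) (rowf a).
Proof.
move=> aP [ac2 hc]; pose sg (b : form) : form := b - (b c : R) *: a.
have sgE b u : (sg b u : R) = b (u - (a u : R) *: c).
  transitivity ((b u : R) - (b c : R) * (a u : R)); first by rewrite add_lfunE opp_lfunE scale_lfunE.
  by rewrite mulrC linearB linearZ.
have sgc b : (sg b c : R) = - (b c : R).
  by rewrite add_lfunE opp_lfunE scale_lfunE -[(b c : R) *: _]/((b c : R) * (a c : R)) ac2; ring.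
have sgK : involutive sg by move=> b; rewrite {1}/sg sgc scaleNr opprK /sg subrK.
have pm : perm_eq [seq sg b | b <- enum_fset Phi] (enum_fset Phi).
  apply: uniq_perm; rewrite ?(map_inj_uniq (can_inj sgK)) ?fset_uniq // => b.
  apply/mapP/idP => [[b' b'P ->]|bP]; first exact: hc.
  by exists (sg b); [exact: hc | rewrite sgK].
have inv u w : dot N (u - (a u : R) *: c) (w - (a w : R) *: c) = dot N u w.
  rewrite !dot_normal -[in RHS](perm_big _ pm) big_map; apply: eq_bigr => b _.
  by rewrite !sgE.
have hN := normal_inner; pose t := dot N c c.
have cN w : dot N c w = t / 2 * (a w : R).
  have := inv c w; rewrite ac2 (_ : c - 2 *: c = - c); last by rewrite scaler_nat mulr2n opprD addNKr.
  rewrite dotNl dotBr // dotZr // -/t => h.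
  by move: h; set x := dot N c w; set y := (a w : R) => h; lra.
have ec : c = (t / 2) *: (rowf a *m invmx N).
  rewrite -[LHS](mulmxK (inner_unit hN)) scalemxAl; congr (_ *m _); apply/rowP => j.
  have := cN (delta_mx 0 j); rewrite /dot trmx_delta -colE mxE => ->.
  by rewrite [RHS]mxE [rowf _ _ _]mxE.
have GT : (invmx N)^T = invmx N by rewrite trmx_inv hN.1.
have bc b : (b c : R) = t / 2 * dot (invmx N) (rowf b) (rowf a).
  by rewrite rowfE {1}ec linearZ /= -scalemxAr mxE trmx_mul GT mulmxA.
have h2 := ac2; rewrite bc in h2.
move=> b; rewrite bc /cart; set x := dot _ (rowf b) _; set y := dot _ _ _ in h2 *.
have y0 : y != 0 by apply: contra_eqN h2 => /eqP ->; rewrite mulr0 eq_sym pnatr_eq0.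
by apply: (mulIf y0); rewrite divfK // mulrAC h2.
Qed.

Lemma inv_inner : inner_product (invmx N).
Proof.
have hN := normal_inner; have GT : (invmx N)^T = invmx N by rewrite trmx_inv hN.1.
split=> // u u0; have -> : dot (invmx N) u u = dot N (u *m invmx N) (u *m invmx N).
  by rewrite /dot mulmxKV ?inner_unit // trmx_mul GT mulmxA.
apply: hN.2; apply: contra u0 => /eqP h.
by rewrite -(mulmxKV (inner_unit hN) u) h mul0mx.
Qed.

Lemma mem_rowf a : (rowf a \in [seq rowf b | b <- enum_fset Phi]) = (a \in Phi).
Proof. by rewrite mem_map //; exact: rowf_inj. Qed.

Lemma frozen_root_system : root_system (invmx N) [seq rowf a | a <- enum_fset Phi].
Proof.
case: hPhi => _ Phi0 hc hr; split.
- by rewrite map_inj_uniq ?fset_uniq //; exact: rowf_inj.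
- apply: contra Phi0 => /mapP[a aP e]; suff <- : a = 0 by [].
  by apply: rowf_inj; rewrite -e; apply/rowP => j; rewrite !mxE lfunE.
- move=> _ _ /mapP[a aP ->] /mapP[b bP ->]; have [c ac _] := hc a aP.
  rewrite /refl -(coroot_form aP ac) -rowfZ -rowfB mem_rowf.
  by case: ac => _; exact.
- move=> _ _ /mapP[a aP ->] /mapP[b bP ->]; have [c ac hi] := hc a aP.
  by rewrite -(coroot_form aP ac); exact: hi.
by move=> _ /mapP[a aP ->] t; rewrite -rowfZ mem_rowf; exact: hr.
Qed.

Let xi0 := v0 *m N.
Let hx0 a : dot (invmx N) (rowf a) xi0 = (a v0 : R).
Proof.
have hN := normal_inner.
have e : rowf a *m invmx N *m (v0 *m N)^T = rowf a *m v0^T.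
  by rewrite trmx_mul hN.1 mulmxA mulmxKV ?inner_unit.
by rewrite /dot /xi0 e -rowfE.
Qed.

Lemma frozen_coordinates : exists (M G1 : 'M[R]_l) (Phi1 : seq V) (xi1 : V),
  [/\ M \in unitmx, [/\ inner_product G1, root_system G1 Phi1 & regular G1 Phi1 xi1],
    (forall x a, rowf a = x *m M -> (x \in posr G1 Phi1 xi1) = (a \in P)) /\
    (forall x, x \in posr G1 Phi1 xi1 -> exists a, rowf a = x *m M),
    (forall i, (delta_mx 0 i : V) \in simr G1 Phi1 xi1) /\
      (forall y : V, y \in simr G1 Phi1 xi1 -> exists i, y = delta_mx 0 i) &
    {in simr G1 Phi1 xi1, forall y, dot G1 y xi1 = 1}].
Proof.
have hN := normal_inner.
have reg1 : regular (invmx N) [seq rowf a | a <- enum_fset Phi] xi0.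
  by move=> _ /mapP[a aP ->]; rewrite hx0; exact: reg0.
have span x : {in [seq rowf a | a <- enum_fset Phi], forall y, dot (invmx N) y x = 0} -> x = 0.
  move=> h; have e0 : x *m invmx N = 0.
    apply: roots_separate => a aP; have := h _ (map_f _ aP).
    by rewrite rowfE trmx_mul trmx_inv hN.1 /dot mulmxA.
  by rewrite -(mulmxKV (inner_unit hN) x) e0 mul0mx.
have [M [G1 [Phi1 [xi1 [uM h1 hpos h2 h3]]]]] := simple_coordinates inv_inner frozen_root_system reg1 span.
exists M, G1, Phi1, xi1; split=> //; split=> [x a ea|x].
  by rewrite hpos -ea mem_posr mem_rowf hx0 eP !inE.
by rewrite hpos => /pos_root/mapP[a _ ->]; exists a.
Qed.

End FrozenRoots.

(** * Ideal-Shi arrangements in the given coordinates *)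

Section Main.
Variables (R : realType) (l : nat).
Local Notation V := 'rV[R]_l.
Local Notation V' := 'rV[R]_(l + 1).
Local Notation form := ('Hom(V, R^o)).
Variables (Phi P I : {fset form}) (k : nat).
Hypotheses (hPhi : reduced_root_system Phi) (hP : positive_system Phi P).
Hypotheses (k_gt0 : (0 < k)%N) (hI : root_ideal P I).

Let lkerN (f g : 'Hom(V', R^o)) : f = - g -> lker f = lker g.
Proof. by move=> ->; apply/vspaceP => w; rewrite !memv_ker opp_lfunE oppr_eq0. Qed.

Theorem idealShi_accurate : accurate (idealShi k P I).
Proof.
case: hP => v0 reg0 eP; case: hI => /fsubsetP IP Ilow.
have [M [G [Ph [xi [uM [hG rsP reg] [hpos hex] [simd sims] sim1]]]]] := frozen_coordinates hPhi reg0 eP.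
have xP a : a \in P -> rowf a *m invmx M \in posr G Ph xi.
  by move=> aP; rewrite (hpos _ a) // mulmxKV.
pose J := [seq rowf a *m invmx M | a <- enum_fset I].
have memJ x a : rowf a = x *m M -> (x \in J) = (a \in I).
  move=> ea; apply/mapP/idP => [[b bI ex]|aI]; last by exists a; rewrite // ea mulmxK.
  by suff -> : a = b by []; apply: rowf_inj; rewrite ea ex mulmxKV.
have uJ : uniq J.
  rewrite map_inj_uniq ?fset_uniq // => a b h; apply: rowf_inj.
  by rewrite -(mulmxKV uM (rowf a)) h mulmxKV.
have Jpos : {subset J <= posr G Ph xi}.
  by move=> _ /mapP[a aI ->]; apply/xP/IP.
have simP' (a : form) : (a \in simple_roots P) = (rowf a *m invmx M \in simr G Ph xi).
  apply/idP/simP.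
    rewrite !inE /= => /andP[aP nb]; split=> [|x xp]; first exact: xP.
    have [b eb] := hex x xp; apply: contra nb => yp.
    apply/imfset2P; exists b; first by rewrite /= -(hpos x b).
    have ez : rowf (a - b) = (rowf a *m invmx M - x) *m M by rewrite rowfB eb mulmxBl mulmxKV.
    exists (a - b); last by rewrite addrC subrK.
    by have := hpos _ _ ez; rewrite yp => /esym h1; exact: h1.
  case=> ap h; have aP : a \in P by rewrite -(hpos (rowf a *m invmx M) a) // mulmxKV.
  rewrite !inE /= aP; apply/negP => /imfset2P[b /= bP [c /= cP e]].
  have := h _ (xP b bP); by rewrite -mulmxBl -rowfB e addrC addKr xP.
(* The order on roots uses sums of simple roots, the ladder sums of positive roots; the latter are
   expanded by [pos_ncone]. *)
have Jlow (b g : V) (s : seq V) : b \in J -> g \in posr G Ph xi ->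
    {subset s <= posr G Ph xi} -> b - g = \sum_(x <- s) x -> g \in J.
  move=> /mapP[bf bI eb] gp sp es; have [gf eg] := hex g gp.
  rewrite (memJ g gf eg); apply: (Ilow bf gf bI); first by rewrite -(hpos g gf eg).
  have [n en] : ncone G Ph xi (\sum_(x <- s) x).
    elim: s sp {es} => [|x s IH] sp; first by rewrite big_nil; exact: ncone0.
    rewrite big_cons; apply: nconeD; last by apply: IH => y ys; apply: sp; rewrite in_cons ys orbT.
    by apply: (pos_ncone rsP); apply: sp; rewrite mem_head.
  exists (fun a => n (rowf a *m invmx M)); apply: rowf_inj.
  have -> : rowf (bf - gf) = (b - g) *m M by rewrite rowfB eg mulmxBl eb mulmxKV.
  rewrite es en mulmx_suml rowf_sum.
  have pm : perm_eq [seq rowf a *m invmx M | a <- enum_fset (simple_roots P)] (simr G Ph xi).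
    apply: uniq_perm; last first.
    - move=> x; apply/mapP/idP => [[a aS ->]|xs]; first by rewrite -simP'.
      have [a ea] := hex x (sim_pos xs); exists a; last by rewrite ea mulmxK.
      by rewrite simP' ea mulmxK.
    - exact: sim_uniq rsP.
    rewrite map_inj_uniq ?fset_uniq // => a a' h; apply: rowf_inj.
    by rewrite -(mulmxKV uM (rowf a)) h mulmxKV.
  rewrite -(perm_big _ pm) big_map; apply: eq_bigr => a _.
  by rewrite -scalemxAl mulmxKV // -scaler_nat rowfZ.
have /fin_all_exists[al hal] (i : 'I_l) : exists a : form, rowf a = row i M.
  by have [a ea] := hex _ (sim_pos (simd i)); exists a; rewrite ea -rowE.
pose phi (i : 'I_(l + 1)) : 'Hom(V', R^o) :=
  match split i with inl j => lift_form (al j) | inr _ => zform R l end.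
have phil j : phi (lshift 1 j) = lift_form (al j) by rewrite /phi (unsplitK (inl j)).
have phir j : phi (rshift l j) = zform R l by rewrite /phi (unsplitK (inr j)).
have liftE (a : form) (w : V') : (lift_form a w : R) = a (lsubmx w) by rewrite comp_lfunE lfunE.
have hco : coords phi.
  split=> [|w hw]; first by rewrite dimvf /dim /= mul1n.
  have u0 : lsubmx w = 0.
    apply: (@trmx_inj _ _ _); rewrite trmx0 -[LHS](mulKmx uM); apply/eqP.
    suff -> : M *m (lsubmx w)^T = 0 by rewrite mulmx0.
    apply/colP => i; have := hw (lshift 1 i); rewrite phil liftE rowfE hal -row_mul !mxE => h.
    by rewrite -[RHS]h.
  have z0 : rsubmx w = 0.
    by apply/rowP => i; have := hw (rshift l i); rewrite phir zformE !mxE (ord1 i).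
  by rewrite -[w]hsubmxK u0 z0 row_mx0.
pose aff := aff (stdE R l) (stdz R l).
have affE (a : form) x t : rowf a = x *m M -> fform phi (aff (x, t)) = lift_form a - t *: zform R l.
  move=> ea; apply/lfunP => w; rewrite add_lfunE opp_lfunE scale_lfunE.
  rewrite -[LHS]/(fform phi (aff (x, t)) w : R) fformE big_split_ord big_ord1 /= phir.
  rewrite -[RHS]/((lift_form a w : R) - t * (zform R l w : R)) liftE rowfE ea /aff std_affE.
  rewrite row_mxEr [(_%:M) _ _]mxE mulr1n mulNr; congr (_ - _).
  rewrite -mulmxA mxE; apply: eq_bigr => i _; rewrite row_mxEl phil liftE rowfE hal.
  by rewrite -row_mul [row _ _ _ _]mxE.
have zE : fform phi (stdz R l) = zform R l.
  apply/lfunP => w; rewrite -[LHS]/(fform phi (stdz R l) w : R) fformE big_split_ord big_ord1 /=.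
  rewrite big1 => [|i _]; last by rewrite /stdz row_mxEl mxE mul0r.
  by rewrite add0r /stdz row_mxEr mxE mul1r phir.
have kE : k.-1.+1 = k by rewrite prednK.
pose A := arr G Ph xi (fun b => (k.-1.+1 + (b \in J))%N) (fun=> k.-1.+1).
have HypE (a : form) (x : V) (i : int) : rowf a = x *m M -> lker (fform phi (aff (x, i%:~R))) = Hyp a i.
  by move=> ea; rewrite (affE a).
have HypN (a : form) (x : V) (i : int) : rowf a = x *m M -> lker (fform phi (aff (- x, - i%:~R))) = Hyp a i.
  move=> ea; apply: lkerN; rewrite (affE (- a)); last by rewrite -scaleN1r rowfZ ea scaleN1r mulNmx.
  rewrite scaleNr opprK opprB addrC; congr (_ + _); apply/lfunP => w.
  by rewrite opp_lfunE -[LHS]/(lift_form (- a) w : R) liftE opp_lfunE -liftE.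
have posI a : a \in P -> exists2 x, x \in posr G Ph xi & rowf a = x *m M.
  by move=> aP; exists (rowf a *m invmx M); [exact: xP | rewrite mulmxKV].
have natN i : - i%:R = (- i%:Z)%:~R :> R by rewrite rmorphN.
have hrep : represents phi (stdz R l :: [seq aff b | b <- A]) (idealShi k P I).
  move=> H; split.
    rewrite in_fsetU => /orP[/mem_Shi[[a [j [aP j1 j2 ->]]]|->]|/imfsetP[a /= aI ->]].
    (* For [j <= 0] the hyperplane is stored with the positive root, for [j > 0] with its
       negative. *)
    - have [x xp ea] := posI a aP; have [j0|j0] := lerP j 0.
        exists (aff (x, - `|j|%N%:R)); last by rewrite natN -(HypE a x _ ea); congr (lker (fform _ (aff (_, _%:~R)))); lia.
        rewrite in_cons; apply/orP; right; apply: map_f; apply/mem_arr; left; split=> //.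
        by exists `|j|%N => //=; rewrite kE; lia.
      have [n ej] : exists n : nat, j = n%:Z by exists `|j|%N; lia.
      rewrite ej in j0 j2 *; exists (aff (- x, - n%:R)); last by rewrite -(HypN a x n%:Z ea).
      rewrite in_cons; apply/orP; right; apply: map_f; apply/mem_arr; right; rewrite /= opprK; split=> //.
      by exists n => //=; rewrite kE; lia.
    - by exists (stdz R l); rewrite ?mem_head // zE.
    have [x xp ea] := posI a (IP a aI).
    exists (aff (x, - k%:R)); last by rewrite natN -(HypE a x _ ea).
    rewrite in_cons; apply/orP; right; apply: map_f; apply/mem_arr; left; split=> //.
    by exists k => //=; rewrite kE (memJ x a ea) aI addn1.
  case=> v; rewrite in_cons => /orP[/eqP -> ->|/mapP[b bA ->] ->].
    by rewrite zE in_fsetU; apply/orP; left; apply/mem_Shi; right.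
  rewrite [b]surjective_pairing; case/mem_arr: bA => -[xp [i hi ->]]; have [a ea] := hex _ xp.
    have aP : a \in P by rewrite -(hpos _ a ea).
    rewrite natN (HypE a _ _ ea) in_fsetU; rewrite kE (memJ _ a ea) in hi.
    have [ik|ik] := ltnP i k.
      by apply/orP; left; apply/mem_Shi; left; exists a, (- i%:Z); split=> //; lia.
    case: (boolP (a \in I)) hi => aI hi; last by rewrite addn0 ltnNge ik in hi.
    have -> : i = k by lia.
    by apply/orP; right; apply/imfsetP; exists a.
  have aP : a \in P by rewrite -(hpos _ a ea).
  rewrite -[b.1]opprK -[i%:R]/(i%:Z%:~R) (HypN a _ _ ea) in_fsetU; rewrite kE in hi.
  by apply/orP; left; apply/mem_Shi; left; exists a, (i%:Z); split=> //; lia.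
exact: (cone_accurate hG rsP reg simd sims sim1 uJ Jpos Jlow hco hrep).
Qed.

End Main.

Theorem theorem1p8 (R : realType) (l : nat)
  (W : {fset 'End('rV[R]_l)})
  (Phi P I : {fset 'Hom('rV[R]_l, R^o)}) (k : nat)
  (hPhi : reduced_root_system Phi)
  (hW : forall w, w \in W <-> weyl_group Phi w)
  (hP : positive_system Phi P)
  (hk : (0 < k)%N)
  (hI : root_ideal P I) :
  [/\ accurate (Shi k P), accurate (idealShi k P I) & accurate (Cat k P)].
Proof.
split; last 2 first.
- exact: idealShi_accurate hPhi hP hk hI.
- by apply: idealShi_accurate hPhi hP hk _; split; rewrite ?fsubset_refl.
have -> : Shi k P = idealShi k P fset0.
  apply/fsetP => H; rewrite [RHS]in_fsetU; case: (boolP (H \in Shi k P)) => //= _.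
  by apply/esym/negbTE/negP => /imfsetP[b /=]; rewrite in_fset0.
by apply: idealShi_accurate hPhi hP hk _; split=> [|b g]; rewrite ?fsub0set // in_fset0.
Qed.
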